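(* Let $V$ be a compact connected algebraic submanifold of $\mathbb{R}^n$. Then there is a constant $C(V)$ such that for every integer $k\ge 0$ and every real polynomial $p\in\mathcal{P}_{k,n}(\mathbb{R})$ with $p|_V\not\equiv 0$, the function $(\log|p|)|_V$ belongs to $\mathrm{BMO}(V)$ and its BMO-norm satisfies $|\log|p||_V|_*\le C(V)\,k$.
   Context: $\mathcal{P}_{k,n}(\mathbb{R})$ is the space of real polynomials in $n$ variables of degree at most $k$. $V$ is endowed with the metric induced from the Euclidean metric of $\mathbb{R}^n$ and with the measure $\lambda_V$ induced from Lebesgue measure of $\mathbb{R}^n$. For $f\in L_1(V,d\lambda_V)$ the BMO-norm is $$|f|_*:=\sup_B\frac{1}{\lambda_V(B)}\int_B|f-f_B|\,d\lambda_V,\qquad f_B:=\frac{1}{\lambda_V(B)}\int_B f\,d\lambda_V,$$ the supremum being over all metric balls $B\subset V$ for the induced metric; $\mathrm{BMO}(V)$ consists of those $f$ with $|f|_*<\infty$. *)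

(* Defs.v *)
From HB Require Import structures.
From mathcomp Require Import all_boot all_order all_algebra.
From mathcomp Require Import all_classical all_reals all_analysis.
From mathcomp Require mpoly.
Import (canonicals, coercions) mpoly.

Set Implicit Arguments.
Unset Strict Implicit.
Unset Printing Implicit Defensive.

Import Order.TTheory GRing.Theory Num.Theory.
Import numFieldNormedType.Exports.
Local Open Scope classical_set_scope.
Local Open Scope ring_scope.

Section Defs.
Variables (R : realType) (n : nat).

(* R^n is 'rV[R]_n. Euclidean norm (the library norm on 'rV is the sup norm,
   which induces the same topology but a different metric). *)
Definition eucl (x : 'rV[R]_n) : R := Num.sqrt (\sum_(i < n) x ord0 i ^+ 2).

Definition peval (p : mpoly.mpoly n R) (x : 'rV[R]_n) : R :=
  mpoly.meval (fun i => x ord0 i) p.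

(* p in P_{k,n}(R): total degree <= k, i.e. msize p <= k+1
   (msize p = 1 + deg p, and msize 0 = 0) *)
Definition in_Pkn (k : nat) (p : mpoly.mpoly n R) : Prop :=
  (mpoly.mmeasure mpoly.mdeg p <= k.+1)%N.

Definition algebraic_set (V : set 'rV[R]_n) : Prop :=
  exists s : seq (mpoly.mpoly n R),
    V = [set x | forall q, q \in s -> peval q x = 0].

Fixpoint iter_derive (m : nat) (vs : seq 'rV[R]_n) (F : 'rV[R]_n -> 'rV[R]_m)
  : 'rV[R]_n -> 'rV[R]_m :=
  match vs with
  | [::] => F
  | v :: vs' => fun x => 'D_v (iter_derive vs' F) x
  end.

Definition smooth_on (m : nat) (U : set 'rV[R]_n) (F : 'rV[R]_n -> 'rV[R]_m)
  : Prop :=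
  forall vs : seq 'rV[R]_n, forall x, U x ->
    {for x, continuous (iter_derive vs F)} /\
    (forall v, derivable (iter_derive vs F) x v).

Definition submanifold (d : nat) (V : set 'rV[R]_n) : Prop :=
  (d <= n)%N /\
  forall x, V x -> exists (U : set 'rV[R]_n) (F : 'rV[R]_n -> 'rV[R]_(n - d)),
    [/\ open U, U x, smooth_on U F,
        (forall y, U y -> forall w : 'rV[R]_(n - d),
            exists v : 'rV[R]_n, 'D_v F y = w) &
        V `&` U = U `&` [set y | F y = 0]].

(* Euclidean diameter (in \bar R; -oo for the empty set) *)
Definition ediam (A : set 'rV[R]_n) : \bar R :=
  ereal_sup [set (eucl (x - y))%:E | x in A & y in A].

Definition hterm (d : nat) (A : set 'rV[R]_n) : \bar R :=
  if pselect (A = set0) then 0%E else ((fine (ediam A)) ^+ d)%:E.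

Definition hausdorff_delta (d : nat) (delta : R) (A : set 'rV[R]_n) : \bar R :=
  ereal_inf [set (\sum_(0 <= j <oo) hterm d (G j))%E
            | G in [set G : (set 'rV[R]_n)^nat |
                    A `<=` \bigcup_j G j /\ forall j, (ediam (G j) <= delta%:E)%E]].

(* d-dimensional Hausdorff (outer) measure in R^n w.r.t. the Euclidean metric,
   without the normalising constant omega_d / 2^d *)
Definition hausdorff (d : nat) (A : set 'rV[R]_n) : \bar R :=
  ereal_sup [set hausdorff_delta d delta A | delta in [set delta : R | 0 < delta]].

Definition Rn := g_sigma_algebraType (@open 'rV[R]_n).

Definition Vball (V : set 'rV[R]_n) (c : 'rV[R]_n) (r : R) : set Rn :=
  [set y | V y /\ eucl (y - c) < r].

Definition is_Vball (V : set 'rV[R]_n) (B : set Rn) : Prop :=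
  exists c r, V c /\ 0 < r /\ B = Vball V c r.

Definition mean (mu : {measure set Rn -> \bar R}) (B : set Rn) (f : Rn -> R) : R :=
  fine (\int[mu]_(x in B) (f x)%:E)%E / fine (mu B).

Definition mean_osc (mu : {measure set Rn -> \bar R}) (B : set Rn) (f : Rn -> R)
  : \bar R :=
  ((fine (mu B))^-1%:E * \int[mu]_(x in B) (`|f x - mean mu B f|)%:E)%E.

Definition bmo_norm (V : set 'rV[R]_n) (mu : {measure set Rn -> \bar R})
  (f : Rn -> R) : \bar R :=
  ereal_sup [set mean_osc mu B f | B in is_Vball V].

End Defs.

(* Main.v *)
(* Near each of its points V is the graph, over a ball of R^d, of functions x_l(u) that are smooth and algebraic:
   a nonzero polynomial in (u, x_l) vanishes on the projection of V to R^(d+1), which is semialgebraic (quantifier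
   elimination) and has empty interior (box counting).  Smooth algebraic functions are analytic, so on lines p o x is
   a limit of polynomials in the l^1 norm of coefficients, and it satisfies a relation sum_j b_j(t) F^j = 0 whose
   degree in F does not depend on p and whose coefficients have degree O(k).  On a circle where one of the b_j is not
   small such an F cannot take a value of modulus W^(mq), with m = O(k), so that a bound for F on an interval
   propagates to the circle; Cauchy's estimates then give Bernstein inequalities with constants e^O(k), hence doubling
   on cubes and a discrete Remez inequality on lines.  A stopping cube argument converts these into sublevel
   estimates: with M the maximum of |p| on a ball of V, the part of the ball where |p| <= e^(-Ckj) M is covered by a
   fraction O(2^-j) of small cubes.  Summing over j bounds the mean of |log |p| - log M| by O(k).  For balls that are
   not small, doubling is propagated along V, which is connected and compact. *)

Require Import Defs.
From HB Require Import structures.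
From mathcomp Require Import all_boot all_order all_algebra.
From mathcomp Require Import cyclotomic separable cyclic complex ordered_qelim qe_rcf.
From mathcomp Require Import all_classical all_reals all_analysis measurable_realfun.
From mathcomp Require mpoly.
Import (canonicals, coercions) mpoly.
From mathcomp Require Import zify ring lra.

Set Implicit Arguments.
Unset Strict Implicit.
Unset Printing Implicit Defensive.

Import Order.TTheory GRing.Theory Num.Theory.
Import numFieldNormedType.Exports.
Local Open Scope classical_set_scope.
Local Open Scope ring_scope.

(** * Coefficient norms and the Bernstein inequality for algebraic functions *)

(** The norm [pnorm] is submultiplicative and bounds values on complex discs. Complex analysis is
    therefore only needed for polynomials: Cauchy's estimate becomes a finite Fourier sum, and the
    identity principle a statement on limits of coefficients, [approximates_flat]. All bounds have
    to be of the form [K ^+ k] with [K] depending on [V] alone, because only then is their logarithm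
    linear in [k]; hence the insistence on a relation whose degree in F is fixed, since the
    exponents [gap J] depend on it, while the degree of its coefficients only enters linearly in the
    exponent. Two degeneracies have to be met. The Taylor series of a coordinate may be a multiple
    root of its relation; the relation is then differentiated until the series is a simple root in
    the formal sense, which bounds the Taylor coefficients, and equality of the function with the
    sum of its series is a separate argument. And all coefficients of a relation may vanish along a
    line; the inequalities on such lines are limits of those on nearby lines, with the same
    constants. *)

Definition pnormby (R : realType) (K : nzRingType) (N : K -> R) (s : R) (p : {poly K}) : R :=
  \sum_(i < size p) N p`_i * s ^+ i.

Section PnormBy.
Variables (R : realType) (K : nzRingType) (N : K -> R).
Implicit Types (s t : R) (p q : {poly K}).
Hypotheses (N0 : N 0 = 0) (NN : forall x, N (- x) = N x).
Hypothesis ND : forall x y, N (x + y) <= N x + N y.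
Hypothesis NM : forall x y, N (x * y) = N x * N y.

Lemma Nge0 x : 0 <= N x.
Proof. by have := ND x (- x); rewrite subrr N0 NN; lra. Qed.

Lemma pnormby_widen n s (p : {poly K}) : (size p <= n)%N ->
  pnormby N s p = \sum_(i < n) N p`_i * s ^+ i.
Proof.
move=> le_pn; rewrite /pnormby (big_ord_widen n (fun i => N p`_i * s ^+ i)) //.
rewrite [RHS](bigID (fun i : 'I_n => (i < size p)%N)) /=.
rewrite [X in _ = _ + X]big1 ?addr0 // => i.
by rewrite -leqNgt => /(nth_default 0) ->; rewrite N0 mul0r.
Qed.

Lemma pnormby_ge0 s p : 0 <= s -> 0 <= pnormby N s p.
Proof. by move=> s0; apply: sumr_ge0 => i _; rewrite mulr_ge0 ?Nge0 ?exprn_ge0. Qed.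

Lemma pnormby0 s : pnormby N s 0 = 0.
Proof. by rewrite /pnormby size_poly0 big_ord0. Qed.

Lemma pnormbyMXaddC s p c : pnormby N s (p * 'X + c%:P) = N c + s * pnormby N s p.
Proof.
rewrite (@pnormby_widen (size p).+1); last first.
  by rewrite size_MXaddC; case: ifP.
rewrite big_ord_recl /= expr0 mulr1 coefD coefMX coefC /= add0r; congr (_ + _).
rewrite /pnormby big_distrr; apply: eq_bigr => i _ /=.
by rewrite coefD coefMX coefC /= addr0 exprS; ring.
Qed.

Lemma pnormbyC s c : pnormby N s c%:P = N c.
Proof.
by have := pnormbyMXaddC s 0 c; rewrite mul0r add0r pnormby0 mulr0 addr0.
Qed.

Lemma pnormbyD s p q : 0 <= s -> pnormby N s (p + q) <= pnormby N s p + pnormby N s q.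
Proof.
move=> s0; pose n := maxn (size p) (size q).
rewrite (@pnormby_widen n _ (p + q)) ?size_polyD //.
rewrite (@pnormby_widen n _ p) ?leq_maxl // (@pnormby_widen n _ q) ?leq_maxr //.
rewrite -big_split ler_sum // => i _ /=.
by rewrite coefD -mulrDl ler_wpM2r ?exprn_ge0.
Qed.

Lemma pnormbyN s p : pnormby N s (- p) = pnormby N s p.
Proof. by rewrite /pnormby size_polyN; apply: eq_bigr => i _; rewrite coefN NN. Qed.

Lemma pnormby_sum s (I : Type) (r : seq I) (P : pred I) (F : I -> {poly K}) : 0 <= s ->
  pnormby N s (\sum_(i <- r | P i) F i) <= \sum_(i <- r | P i) pnormby N s (F i).
Proof.
move=> s0; elim/big_rec2: _ => [|i y x _ IH]; first by rewrite pnormby0.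
by apply: le_trans (pnormbyD _ _ s0) _; rewrite lerD2l.
Qed.

Lemma pnormbyCM s c p : pnormby N s (c%:P * p) = N c * pnormby N s p.
Proof.
rewrite (@pnormby_widen (size p)); last by rewrite mul_polyC size_scale_leq.
rewrite /pnormby big_distrr; apply: eq_bigr => i _ /=.
by rewrite coefCM NM mulrA.
Qed.

Lemma pnormbyMX s p : pnormby N s (p * 'X) = s * pnormby N s p.
Proof. by have := pnormbyMXaddC s p 0; rewrite polyC0 addr0 N0 add0r. Qed.

Lemma pnormbyM s p q : 0 <= s -> pnormby N s (p * q) <= pnormby N s p * pnormby N s q.
Proof.
move=> s0; elim/poly_ind: p => [|p c IH]; first by rewrite mul0r !pnormby0 mul0r.
rewrite mulrDl -mulrA -(commr_polyX q) mulrA.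
apply: le_trans (pnormbyD _ _ s0) _.
rewrite pnormbyMX pnormbyCM pnormbyMXaddC mulrDl addrC lerD2l -mulrA.
by rewrite ler_wpM2l.
Qed.

Lemma pnormby_horner p z : N p.[z] <= pnormby N (N z) p.
Proof.
elim/poly_ind: p => [|p c IH]; first by rewrite horner0 N0 pnormby0.
rewrite hornerMXaddC pnormbyMXaddC; apply: le_trans (ND _ _) _.
by rewrite NM addrC lerD2l mulrC ler_wpM2l ?Nge0.
Qed.

Lemma pnormby_le s t p : 0 <= s -> s <= t -> pnormby N s p <= pnormby N t p.
Proof.
move=> s0 st; apply: ler_sum => i _; rewrite ler_wpM2l ?Nge0 //.
by rewrite lerXn2r // nnegrE (le_trans s0).
Qed.

Lemma pnormby_coef s p i : 0 <= s -> N p`_i * s ^+ i <= pnormby N s p.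
Proof.
move=> s0; have [ip|pi] := ltnP i (size p).
  rewrite /pnormby (bigD1 (Ordinal ip)) //= lerDl.
  by apply: sumr_ge0 => j _; rewrite mulr_ge0 ?Nge0 ?exprn_ge0.
by rewrite nth_default // N0 mul0r pnormby_ge0.
Qed.

Lemma pnormby_dilate s t k m p : (size p <= m.+1)%N -> 0 <= t -> 1 <= k -> 0 <= s ->
  s <= k * t -> pnormby N s p <= k ^+ m * pnormby N t p.
Proof.
move=> sp t0 k1 s0 skt; rewrite !(@pnormby_widen m.+1) // big_distrr.
apply: ler_sum => i _ /=; rewrite mulrCA ler_wpM2l ?Nge0 //.
have k0 : 0 <= k by lra.
apply: le_trans (_ : (k * t) ^+ i <= _).
  by rewrite lerXn2r // nnegrE mulr_ge0.
rewrite exprMn ler_wpM2r ?exprn_ge0 //.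
by rewrite ler_weXn2l // -ltnS.
Qed.

End PnormBy.

Lemma pnormby_prod (R : realType) (K : nzRingType) (N : K -> R) (N0 : N 0 = 0) (N1 : N 1 = 1)
  (NN : forall x, N (- x) = N x)
  (ND : forall x y, N (x + y) <= N x + N y) (NM : forall x y, N (x * y) = N x * N y)
  (s : R) (I : Type) (r : seq I) (P : pred I) (F : I -> {poly K}) : 0 <= s ->
  pnormby N s (\prod_(i <- r | P i) F i) <= \prod_(i <- r | P i) pnormby N s (F i).
Proof.
move=> s0; elim/big_rec2: _ => [|i y x _ IH].
  by rewrite -polyC1 pnormbyC // N1.
apply: le_trans (pnormbyM N0 ND NM _ _ s0) _.
by rewrite ler_wpM2l // pnormby_ge0.
Qed.

(** The version for a general [N] also serves for polynomials over [R[i]], with the complex modulus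
    [normc]. *)
Definition pnorm (R : realType) (s : R) (p : {poly R}) : R := pnormby (fun x => `|x|) s p.

Section Pnorm.
Variable R : realType.
Implicit Types (s t : R) (p q : {poly R}).
Let N (x : R) := `|x|.
Let N0 : N 0 = 0. Proof. exact: normr0. Qed.
Let N1 : N 1 = 1. Proof. exact: normr1. Qed.
Let NN x : N (- x) = N x. Proof. exact: normrN. Qed.
Let ND x y : N (x + y) <= N x + N y. Proof. exact: ler_normD. Qed.
Let NM x y : N (x * y) = N x * N y. Proof. exact: normrM. Qed.

Lemma pnorm_widen n s p : (size p <= n)%N -> pnorm s p = \sum_(i < n) `|p`_i| * s ^+ i.
Proof. exact: pnormby_widen. Qed.
Lemma pnorm_ge0 s p : 0 <= s -> 0 <= pnorm s p.
Proof. by apply: pnormby_ge0. Qed.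
Lemma pnorm0 s : pnorm s 0 = 0.
Proof. exact: pnormby0. Qed.
Lemma pnormC s c : pnorm s c%:P = `|c|.
Proof. by apply: pnormbyC. Qed.
Lemma pnormMXaddC s p c : pnorm s (p * 'X + c%:P) = `|c| + s * pnorm s p.
Proof. by apply: pnormbyMXaddC. Qed.
Lemma pnormD s p q : 0 <= s -> pnorm s (p + q) <= pnorm s p + pnorm s q.
Proof. by apply: pnormbyD. Qed.
Lemma pnormN s p : pnorm s (- p) = pnorm s p.
Proof. by apply: pnormbyN. Qed.
Lemma pnorm_sum s (I : Type) (r : seq I) (P : pred I) (F : I -> {poly R}) : 0 <= s ->
  pnorm s (\sum_(i <- r | P i) F i) <= \sum_(i <- r | P i) pnorm s (F i).
Proof. by apply: pnormby_sum. Qed.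
Lemma pnormCM s c p : pnorm s (c%:P * p) = `|c| * pnorm s p.
Proof. by apply: pnormbyCM. Qed.
Lemma pnormMX s p : pnorm s (p * 'X) = s * pnorm s p.
Proof. by apply: pnormbyMX. Qed.
Lemma pnormM s p q : 0 <= s -> pnorm s (p * q) <= pnorm s p * pnorm s q.
Proof. by apply: pnormbyM. Qed.
Lemma pnorm_prod s (I : Type) (r : seq I) (P : pred I) (F : I -> {poly R}) : 0 <= s ->
  pnorm s (\prod_(i <- r | P i) F i) <= \prod_(i <- r | P i) pnorm s (F i).
Proof. by apply: pnormby_prod. Qed.
Lemma pnorm_horner p z : `|p.[z]| <= pnorm `|z| p.
Proof. by apply: pnormby_horner. Qed.
Lemma pnorm_le s t p : 0 <= s -> s <= t -> pnorm s p <= pnorm t p.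
Proof. by apply: pnormby_le. Qed.
Lemma pnorm_horner_le p z s : `|z| <= s -> `|p.[z]| <= pnorm s p.
Proof. by move=> zs; apply: le_trans (pnorm_horner p z) (pnorm_le _ _ zs). Qed.
Lemma pnorm_coef s p i : 0 <= s -> `|p`_i| * s ^+ i <= pnorm s p.
Proof. by apply: pnormby_coef. Qed.
Lemma pnorm_dilate s t k m p : (size p <= m.+1)%N -> 0 <= t -> 1 <= k -> 0 <= s ->
  s <= k * t -> pnorm s p <= k ^+ m * pnorm t p.
Proof. by apply: pnormby_dilate. Qed.

Lemma pnormXn s n : pnorm s 'X^n = s ^+ n.
Proof.
elim: n => [|n IH]; first by rewrite expr0 -polyC1 pnormC normr1.
by rewrite exprSr pnormMX IH exprS.
Qed.

Lemma pnormX_le s p n : 0 <= s -> pnorm s (p ^+ n) <= pnorm s p ^+ n.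
Proof.
move=> s0; rewrite -[n in p ^+ n]card_ord -[n in leRHS]card_ord -!prodr_const.
exact: pnorm_prod.
Qed.

Lemma pnorm_eq0 s p : 0 < s -> pnorm s p = 0 -> p = 0.
Proof.
move=> s0 p0; apply/polyP => i; rewrite coef0; apply/eqP.
have := pnorm_coef p i (ltW s0); rewrite p0 => h.
rewrite -normr_eq0; have : `|p`_i| * s ^+ i = 0.
  by apply/eqP; rewrite eq_le h mulr_ge0 // exprn_ge0 // ltW.
by move/eqP; rewrite mulf_eq0 expf_eq0 (gt_eqF s0) andbF orbF.
Qed.

Lemma pnorm_gt0 s p : 0 < s -> p != 0 -> 0 < pnorm s p.
Proof.
move=> s0 p0; rewrite lt_neqAle pnorm_ge0 ?ltW // andbT eq_sym.
by apply/eqP => /(pnorm_eq0 s0) /eqP; rewrite (negbTE p0).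
Qed.

Lemma pnormXsubC s x : pnorm s ('X - x%:P) = `|x| + s.
Proof.
have -> : 'X - x%:P = 1 * 'X + (- x)%:P :> {poly R} by rewrite mul1r polyCN.
by rewrite pnormMXaddC -polyC1 pnormC normr1 mulr1 normrN.
Qed.

End Pnorm.

(** Each factor of the falling factorial $(2m)(2m-1)\cdots(m+1)$ is at least $m$, and this product
    is $m!$ times a binomial coefficient that is at most $4^m$. The bound absorbs the $m^m$ produced
    by nodes at distance $h/m$. *)
Lemma expnn_le_fact m : (m ^ m <= 4 ^ m * m`!)%N.
Proof.
apply: (@leq_trans ((m + m) ^_ m)).
  rewrite ffact_prod; rewrite -[X in (_ ^ X <= _)%N]card_ord -prod_nat_const.
  by apply: leq_prod => i _; have := ltn_ord i; lia.
rewrite -bin_ffact leq_mul2r; apply/orP; right.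
have -> : (4 ^ m = 2 ^ (m + m))%N by rewrite addnn -mul2n expnM.
rewrite -[2%N]/(1 + 1)%N expnDn; have hm : (m < (m + m).+1)%N by lia.
rewrite (bigD1 (Ordinal hm)) //= !exp1n !muln1; exact: leq_addr.
Qed.

(** * Lagrange interpolation and polynomial inequalities of Remez type *)

Section Lagrange.
Variable R : realType.

(** [maxn i j - minn i j] is the distance of two naturals. The indices below [i] contribute $i!$,
    those above contribute $(m-i)!$. *)
Lemma prod_dist_fact m (i : 'I_m.+1) :
  (\prod_(j < m.+1 | j != i) (maxn i j - minn i j) = i`! * (m - i)`!)%N.
Proof.
rewrite (bigID (fun j : 'I_m.+1 => (j < i)%N)) /=; congr (_ * _)%N.
  rewrite fact_prod.
  transitivity (\prod_(0 <= j < m.+1 | (j < i)%N) (i - j))%N.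
    rewrite big_mkord; apply: eq_big => [j|j]; last first.
      by move=> /andP[_ ji]; rewrite (maxn_idPl (ltnW ji)) (minn_idPr (ltnW ji)).
    by case: (eqVneq j i) => [->|//]; rewrite ltnn.
  rewrite (big_cat_nat _ (n := i)) //=; last by have := ltn_ord i; lia.
  rewrite [X in (_ * X)%N]big_nat_cond [X in (_ * X)%N]big_pred0 ?muln1; last by move=> j; lia.
  rewrite big_add1 /= [RHS]big_nat_rev /= add0n big_nat_cond [RHS]big_nat_cond.
  by apply: eq_big => [j|j]; lia.
rewrite fact_prod.
transitivity (\prod_(0 <= j < m.+1 | (i < j)%N) (j - i))%N.
  rewrite big_mkord; apply: eq_big => [j|j]; last first.
    rewrite -leqNgt => /andP[_ ij].
    by rewrite (maxn_idPr ij) (minn_idPl ij).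
  by rewrite -leqNgt ltn_neqAle; congr (_ && _); rewrite eq_sym.
rewrite (big_cat_nat _ (n := i.+1)) ?ltn_ord //=.
rewrite [X in (X * _)%N]big_nat_cond [X in (X * _)%N]big_pred0 ?mul1n; last by move=> j; lia.
rewrite -{1}[i.+1]add0n big_addn.
have -> : (m.+1 - i.+1 = m - i)%N by [].
rewrite [RHS]big_add1 /= big_nat_cond [RHS]big_nat_cond.
by apply: eq_big => [j|j]; lia.
Qed.

Lemma lagrange_interp m (p : {poly R}) (x : 'I_m.+1 -> R) : (size p <= m.+1)%N -> injective x ->
  p = \sum_(i < m.+1) (p.[x i] / \prod_(j < m.+1 | j != i) (x i - x j))%:P *
        \prod_(j < m.+1 | j != i) ('X - (x j)%:P).
Proof.
move=> sp xinj.
have xneq i j : j != i -> x i - x j != 0.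
  by move=> ji; rewrite subr_eq0; apply: contra ji => /eqP /xinj ->.
pose c i := p.[x i] / \prod_(j < m.+1 | j != i) (x i - x j).
pose l i := \prod_(j < m.+1 | j != i) ('X - (x j)%:P).
have sl i : size (l i) = m.+1.
  rewrite /l -big_filter size_prod_XsubC size_filter; congr _.+1.
  by rewrite -sum1_count (eq_bigl (mem (predC1 i))) // sum1_card cardC1 card_ord.
apply/eqP; rewrite -subr_eq0; apply/eqP.
apply: (@roots_geq_poly_eq0 _ _ [seq x i | i <- enum 'I_m.+1]).
- apply/allP => y /mapP[i _ ->]; rewrite /root hornerD hornerN horner_sum.
  rewrite (bigD1 i) //= [X in _ - (_ + X)]big1 => [|j ji]; last first.
    rewrite hornerM horner_prod [X in _ * X](bigD1 i) 1?eq_sym //= hornerXsubC subrr.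
    by rewrite mul0r mulr0.
  rewrite hornerM hornerC horner_prod addr0.
  under [X in _ * X]eq_bigr do rewrite hornerXsubC.
  rewrite mulfVK ?subrr //.
  by rewrite prodf_seq_neq0; apply/allP => j _; apply/implyP => /xneq.
- by rewrite map_inj_uniq ?enum_uniq.
- rewrite size_map size_enum_ord.
  apply: leq_trans (size_polyD _ _) _; rewrite geq_max sp size_polyN.
  apply: leq_trans (size_sum _ _ _) _; apply/bigmax_leqP => i _.
  by rewrite mul_polyC (leq_trans (size_scale_leq _ _)) ?sl.
Qed.

(** Coefficients are fixed linear combinations of values at integers. This will show that the
    coefficients with respect to one variable are polynomial functions of the other variables. *)
Lemma coef_interp D : exists w : nat -> 'I_D.+1 -> R,
  forall (q : {poly R}) i, (size q <= D.+1)%N -> q`_i = \sum_k w i k * q.[k%:R].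
Proof.
pose x (k : 'I_D.+1) : R := k%:R.
have xinj : injective x by move=> k l /eqP; rewrite eqr_nat => /eqP /val_inj.
exists (fun i k => (\prod_(j < D.+1 | j != k) (x k - x j))^-1 *
  (\prod_(j < D.+1 | j != k) ('X - (x j)%:P))`_i) => q i sq.
rewrite {1}(lagrange_interp sq xinj) coef_sum; apply: eq_bigr => k _.
by rewrite coefCM -mulrA mulrC.
Qed.

(** In Lagrange's formula the numerator of index $i$ has norm at most $(s+X)^m$, its denominator is
    at least $\delta^m\, i!\,(m-i)!$, and $\sum_i 1/(i!(m-i)!) = 2^m/m!$. *)
Lemma lagrange_pnorm m (p : {poly R}) (x : 'I_m.+1 -> R) (X s M delta : R) :
  (size p <= m.+1)%N -> 0 < delta -> 0 <= s ->
  (forall i j : 'I_m.+1, delta * (maxn i j - minn i j)%:R <= `|x i - x j|) ->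
  (forall i, `|x i| <= X) -> (forall i, `|p.[x i]| <= M) ->
  pnorm s p <= M * (2 * (s + X) / delta) ^+ m / m`!%:R.
Proof.
move=> sp d0 s0 sep xX pM.
have X0 : 0 <= X by apply: le_trans (xX ord0).
have M0 : 0 <= M by apply: le_trans (pM ord0).
have xneq i j : j != i -> x i - x j != 0.
  move=> ji; rewrite -normr_gt0; apply: lt_le_trans (sep i j).
  rewrite mulr_gt0 // ltr0n.
  have : (j != i :> nat) by [].
  by lia.
have xinj : injective x.
  move=> i j xij; apply/eqP; rewrite eq_sym; apply: contraT => /xneq.
  by rewrite xij subrr eqxx.
pose c i := p.[x i] / \prod_(j < m.+1 | j != i) (x i - x j).
pose l i := \prod_(j < m.+1 | j != i) ('X - (x j)%:P).
rewrite (lagrange_interp sp xinj).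
apply: le_trans (pnorm_sum _ _ _ s0) _.
have dm0 : 0 < delta ^+ m by rewrite exprn_gt0.
apply: le_trans (_ : \sum_(i < m.+1) (M * ((s + X) / delta) ^+ m) * ('C(m, i)%:R / m`!%:R) <= _).
  apply: ler_sum => i _; rewrite pnormCM normrM normfV -!mulrA.
  apply: ler_pM => //; first by rewrite mulr_ge0 ?invr_ge0 // pnorm_ge0.
  have cardi : #|[pred j : 'I_m.+1 | j != i]| = m.
    by rewrite cardC1 card_ord.
  have plow : delta ^+ m * (i`! * (m - i)`!)%:R <= `|\prod_(j < m.+1 | j != i) (x i - x j)|.
    have -> : delta ^+ m = \prod_(j < m.+1 | j != i) delta by rewrite prodr_const cardi.
    rewrite -prod_dist_fact normr_prod natr_prod -big_split /=.
    apply: ler_prod => j ji; rewrite sep andbT mulr_ge0 //; exact: ltW.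
  have lup : pnorm s (l i) <= (s + X) ^+ m.
    apply: le_trans (pnorm_prod _ _ _ s0) _.
    have -> : (s + X) ^+ m = \prod_(j < m.+1 | j != i) (s + X) by rewrite prodr_const cardi.
    apply: ler_prod => j ji; rewrite pnorm_ge0 //= pnormXsubC addrC lerD2l //.
  have f0 : 0 < (i`! * (m - i)`!)%:R :> R by rewrite ltr0n muln_gt0 !fact_gt0.
  have le_im : (i <= m)%N by rewrite -ltnS.
  have -> : 'C(m, i)%:R / m`!%:R = ((i`! * (m - i)`!)%:R)^-1 :> R.
    rewrite -(bin_fact le_im) natrM invfM mulrA mulfV ?mul1r //.
    by rewrite pnatr_eq0 -lt0n bin_gt0.
  rewrite mulrC expr_div_n -mulrA -invfM.
  apply: ler_pM => //; rewrite ?pnorm_ge0 ?invr_ge0 //.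
  by rewrite lef_pV2 // ?posrE ?mulr_gt0 //; apply: lt_le_trans plow; rewrite mulr_gt0.
rewrite -big_distrr /= -big_distrl /= -natr_sum.
have -> : (\sum_(i < m.+1) 'C(m, i) = 2 ^ m)%N.
  by rewrite -[2%N]/(1 + 1)%N expnDn; apply: eq_bigr => i _; rewrite !exp1n !muln1.
rewrite natrX !mulrA ler_pM2r ?invr_gt0 ?ltr0n ?fact_gt0 //.
by rewrite -!mulrA ler_wpM2l // -exprMn [_ * 2]mulrC !mulrA.
Qed.

(** Equidistant nodes at distance $h/m$; as $m^m/m! \le 4^m$, the constant is $8 = 2\cdot 4$. *)
Lemma pnorm_le_of_interval m (p : {poly R}) (a h s M : R) : (0 < m)%N ->
  (size p <= m.+1)%N -> 0 < h -> 0 <= s ->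
  (forall t, a <= t <= a + h -> `|p.[t]| <= M) ->
  pnorm s p <= M * (8 * (s + `|a| + h) / h) ^+ m.
Proof.
move=> m0 sp h0 s0 pM.
have m0' : 0 < m%:R :> R by rewrite ltr0n.
pose x (i : 'I_m.+1) := a + h * (i%:R / m%:R).
have xr i : a <= x i <= a + h.
  rewrite /x lerDl lerD2l mulr_ge0 ?divr_ge0 ?(ltW h0) //=.
  by rewrite ger_pMr // ler_pdivrMr // mul1r ler_nat -ltnS.
have M0 : 0 <= M by apply: le_trans (pM _ (xr ord0)).
have := @lagrange_pnorm m p x (`|a| + h) s M (h / m%:R) sp (divr_gt0 h0 m0') s0.
move=> H; have {H} := H _ _ _.
have xx : forall i j : 'I_m.+1, h / m%:R * (maxn i j - minn i j)%:R <= `|x i - x j|.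
  move=> i j; have -> : x i - x j = h / m%:R * (i%:R - j%:R).
    by rewrite /x; field; apply/negP => /eqP; lra.
  rewrite normrM ger0_norm ?divr_ge0 ?(ltW h0) //.
  rewrite ler_pM2l ?divr_gt0 //.
  case: (leqP i j) => ij.
    by rewrite natrB // distrC ger0_norm // subr_ge0 ler_nat.
  by rewrite natrB ?(ltnW ij) // ger0_norm // subr_ge0 ler_nat ltnW.
move/(_ xx); move=> H; apply: le_trans (H _ _) _ => [i|i|].
- have /andP[x1 x2] := xr i; rewrite ler_norml; have := ler_norm a; have := ler_norm (- a).
  rewrite normrN; lra.
- exact/pM/xr.
set A := s + _ + _; have -> : s + (`|a| + h) = A by rewrite addrA.
have A0 : 0 <= A by rewrite !addr_ge0 ?normr_ge0 ?(ltW h0).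
rewrite -mulrA ler_wpM2l // ler_pdivrMr ?ltr0n ?fact_gt0 //.
have -> : 2 * A / (h / m%:R) = (2 * A / h) * m%:R.
  by rewrite invfM invrK !mulrA.
have -> : 8 * A / h = (2 * A / h) * 4 by ring.
rewrite !exprMn -!mulrA ler_wpM2l ?exprn_ge0 // ler_wpM2l ?exprn_ge0 //.
apply: ler_wpM2l; first by rewrite exprn_ge0 // invr_ge0 ltW.
by rewrite -!natrX -natrM ler_nat expnn_le_fact.
Qed.

(* If [|p|] is small on more than [m * g] of the [N] grid points, then [m + 1]
   of these are at mutual distance at least [g h / N]. *)
Lemma discrete_remez m g N (S : {set 'I_N}) (p : {poly R}) (a h s eps : R) :
  (0 < g)%N -> (size p <= m.+1)%N -> 0 < h -> 0 <= s ->
  (m * g < #|S|)%N -> (forall i, i \in S -> `|p.[a + h * (i%:R / N%:R)]| <= eps) ->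
  pnorm s p <= eps * (2 * (s + `|a| + h) / h * (N%:R / g%:R)) ^+ m / m`!%:R.
Proof.
move=> g0 sp h0 s0 cS pe.
have N0 : (0 < N)%N by case: N S cS pe => // S; rewrite [#|S|]eq_card0 ?ltn0 // => -[].
have N0' : 0 < N%:R :> R by rewrite ltr0n.
have g0' : 0 < g%:R :> R by rewrite ltr0n.
have sz : size (enum S) = #|S| by rewrite cardE.
pose s_ := [seq val i | i <- enum S].
have srt : sorted ltn s_.
  rewrite /s_ /enum_mem -enumT sorted_map; apply: sorted_filter.
    by move=> y x z /=; apply: ltn_trans.
  by have := iota_ltn_sorted 0 N; rewrite -val_enum_ord sorted_map.
have step1 i k : (i + k < #|S|)%N -> (nth 0%N s_ i + k <= nth 0%N s_ (i + k))%N.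
  elim: k => [|k IH] ik; first by rewrite !addn0.
  have H1 : (nth 0 s_ i + k <= nth 0 s_ (i + k))%N by apply: IH; lia.
  have H2 : (nth 0 s_ (i + k) < nth 0 s_ (i + k.+1))%N.
    apply: (sorted_ltn_nth ltn_trans) => //; rewrite ?inE ?size_map ?sz; lia.
  by lia.
have step i j : (i <= j)%N -> (j < #|S|)%N -> (nth 0%N s_ i + (j - i) <= nth 0%N s_ j)%N.
  by move=> ij jS; have := step1 i (j - i)%N; rewrite subnKC //; apply.
(* Every [g]-th element of [S] in increasing order. The indices are distinct integers, so two
   successive choices differ by at least [g]. *)
pose o (i : 'I_m.+1) := nth (Ordinal N0) (enum S) (i * g).
have ilt (i : 'I_m.+1) : (i * g < #|S|)%N.
  by apply: leq_ltn_trans cS; rewrite leq_mul2r -ltnS ltn_ord orbT.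
have oE i : val (o i) = nth 0%N s_ (i * g) by rewrite (nth_map (Ordinal N0)) // sz ilt.
have oS i : o i \in S by rewrite -mem_enum mem_nth // sz ilt.
pose x i := a + h * ((o i)%:R / N%:R).
have hN0 : 0 < h / N%:R by rewrite divr_gt0.
have xx : forall i j : 'I_m.+1, (h / N%:R * g%:R) * (maxn i j - minn i j)%:R <= `|x i - x j|.
  have W (i j : 'I_m.+1) : (i <= j)%N ->
      (h / N%:R * g%:R) * (j - i)%:R <= x j - x i.
    move=> ij; have -> : x j - x i = h / N%:R * ((o j)%:R - (o i)%:R).
      by rewrite /x; field; apply/negP => /eqP; lra.
    rewrite -mulrA ler_pM2l // lerBrDr -natrM -natrD ler_nat.
    rewrite [val (o i)]oE [val (o j)]oE addnC.
    rewrite [(g * _)%N]mulnC mulnBl; apply: step => //.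
    by rewrite leq_mul2r ij orbT.
  move=> i j; case: (leqP i j) => ij; last first.
    by apply: le_trans (W _ _ (ltnW ij)) (ler_norm _).
  by apply: le_trans (W _ _ ij) _; rewrite distrC ler_norm.
have := @lagrange_pnorm m p x (`|a| + h) s eps _ sp _ s0 xx.
have -> : s + (`|a| + h) = s + `|a| + h by rewrite addrA.
have -> : 2 * (s + `|a| + h) / (h / N%:R * g%:R) = 2 * (s + `|a| + h) / h * (N%:R / g%:R).
  by rewrite !invfM invrK !mulrA.
apply; first by rewrite mulr_gt0.
- move=> i; rewrite /x; apply: le_trans (ler_normD _ _) _; rewrite lerD2l.
  rewrite ger0_norm ?mulr_ge0 ?divr_ge0 ?(ltW h0) // ger_pMr //.
  by rewrite ler_pdivrMr // mul1r ler_nat ltnW.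
- by move=> i; apply: pe.
Qed.

End Lagrange.

(** * Polynomials on complex circles *)

Section ComplexCircle.
Import ComplexField.Normc.
Variable R : realType.
Local Notation C := R[i].
Local Notation toC := (map_poly (real_complex R)).
Implicit Types (T b : {poly R}) (z : C) (s Y B : R).

Lemma normc_real (x : R) : normc x%:C%C = `|x|.
Proof. by rewrite /normc /= expr0n /= addr0 sqrtr_sqr. Qed.

Lemma normcD z1 z2 : normc (z1 + z2) <= normc z1 + normc z2.
Proof. exact: le_normcD. Qed.

Lemma normc_ge0 z : 0 <= normc z.
Proof. by case: z => a b /=; rewrite sqrtr_ge0. Qed.

Lemma normcX z n : normc (z ^+ n) = normc z ^+ n.
Proof. by elim: n => [|n IH]; rewrite ?expr0 ?normc1 // !exprS normcM IH. Qed.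

Lemma normc_prod I (r : seq I) (F : I -> C) :
  normc (\prod_(i <- r) F i) = \prod_(i <- r) normc (F i).
Proof. by elim/big_rec2: _ => [|i y x _ IH]; rewrite ?normc1 // normcM IH. Qed.

Lemma normc_sum I (r : seq I) (P : pred I) (F : I -> C) :
  normc (\sum_(i <- r | P i) F i) <= \sum_(i <- r | P i) normc (F i).
Proof.
elim/big_rec2: _ => [|i y x _ IH]; rewrite ?normc0 //.
by apply: le_trans (normcD _ _) _; rewrite lerD2l.
Qed.

Lemma normc_distl z1 z2 : `|normc z1 - normc z2| <= normc (z1 - z2).
Proof.
have h1 := normcD (z1 - z2) z2; have h2 := normcD (z2 - z1) z1.
rewrite !subrK in h1 h2.
by rewrite -[z2 - z1]opprB normcN in h2; rewrite ler_norml; lra.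
Qed.

Lemma pnormby_toC s T : pnormby (@normc R) s (toC T) = pnorm s T.
Proof.
rewrite /pnorm /pnormby size_map_poly; apply: eq_bigr => i _.
by rewrite coef_map; congr (_ * _); exact: normc_real.
Qed.

Lemma normc_horner_le T z s : normc z <= s -> normc (toC T).[z] <= pnorm s T.
Proof.
move=> zs; rewrite -pnormby_toC.
apply: (@le_trans _ _ (pnormby (@normc R) (normc z) (toC T))).
  by apply: pnormby_horner; [exact: normc0|exact: normcN|exact: normcD|exact: normcM].
apply: pnormby_le => //; [exact: normc0|exact: normcN|exact: normcD|exact: normc_ge0].
Qed.

(** Replacing each root by its modulus gives a real polynomial [q] with $|b(z)| \ge |c|\,|q(|z|)|$,
    so it suffices to find a radius where [q] is not small. If there were none,
    [pnorm_le_of_interval] on [5/4, 7/4] would bound the norm of [q] by $(44/50)^m$ times itself.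
    The norms of [b] and [q] are compared through $|q(-1)| = \prod_w (1+|w|)$. *)
Lemma good_circle m b : (0 < m)%N -> (size b <= m.+1)%N ->
  exists2 s, 5 / 4 <= s <= 7 / 4 &
    forall z, normc z = s -> (50 ^+ m)^-1 * pnorm 1 b <= normc (toC b).[z].
Proof.
move=> m0 sb; have [-> |b0] := eqVneq b 0.
  exists (5 / 4); first by lra.
  by move=> z _; rewrite pnorm0 mulr0 normc_ge0.
have [rs rsE] := closed_field_poly_normal (toC b).
set c := lead_coef _ in rsE.
pose q : {poly R} := \prod_(z <- rs) ('X - (normc z)%:P).
have srs : (size rs <= m)%N.
  have : (size (toC b) <= m.+1)%N by rewrite size_map_poly.
  rewrite rsE size_scale ?size_prod_XsubC //.
  by rewrite lead_coef_eq0 map_poly_eq0.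
have sq : (size q <= m.+1)%N by rewrite size_prod_XsubC ltnS.
have q0 : q != 0 by rewrite monic_neq0 // monic_prod_XsubC.
have P0 : 0 < pnorm 1 q by exact: pnorm_gt0.
have [s sr sP] : exists2 s, 5 / 4 <= s <= 7 / 4 & (50 ^+ m)^-1 * pnorm 1 q <= `|q.[s]|.
  apply: contrapT => nex.
  have : pnorm 1 q <= (50 ^+ m)^-1 * pnorm 1 q * (8 * (1 + `|5 / 4| + 1 / 2) / (1 / 2)) ^+ m.
    apply: pnorm_le_of_interval => // t tr; rewrite leNgt; apply/negP => lt; apply: nex; exists t; last exact: ltW.
    by lra.
  have -> : 8 * (1 + `|5 / 4| + 1 / 2) / (1 / 2) = 44 :> R.
    by rewrite ger0_norm; lra.
  rewrite mulrAC => h.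
  have : (50 ^+ m)^-1 * 44 ^+ m < 1 :> R.
    rewrite mulrC -expr_div_n exprn_ilt1 ?lt0n_neq0 //; lra.
  by nra.
exists s => // z zs.
have E : normc (toC b).[z] = normc c * \prod_(w <- rs) normc (z - w).
  rewrite rsE hornerZ normcM horner_prod normc_prod; congr (_ * _).
  by apply: eq_bigr => w _; rewrite hornerXsubC.
rewrite E; have L : `|q.[s]| <= \prod_(w <- rs) normc (z - w).
  rewrite horner_prod normr_prod; apply: ler_prod => w _; rewrite normr_ge0 /=.
  by rewrite hornerXsubC -zs normc_distl.
have U : pnorm 1 b <= normc c * pnorm 1 q.
  rewrite -pnormby_toC rsE -mul_polyC.
  rewrite (pnormbyCM (normc0 _) (@normcM R)) ler_wpM2l ?normc_ge0 //.
  apply: (@le_trans _ _ `|q.[-1]|); last by apply: pnorm_horner_le; rewrite normrN1.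
  have pp := @pnormby_prod R _ (@normc R) (normc0 R) (normc1 R) (@normcN R) normcD (@normcM R).
  apply: le_trans (pp _ _ _ _ _ ler01) _.
  rewrite horner_prod normr_prod; apply: ler_prod => w _; rewrite pnormby_ge0 //=;
    [|exact: normc0|exact: normcN|exact: normcD].
  have -> : 'X - w%:P = 1 * 'X + (- w)%:P :> {poly C} by rewrite mul1r polyCN.
  rewrite (pnormbyMXaddC (normc0 _)) -polyC1 (pnormbyC (normc0 _)) normc1 mulr1 normcN.
  by rewrite hornerXsubC -opprD normrN ger0_norm ?addr_ge0 ?normc_ge0 // addrC.
apply: le_trans (_ : normc c * ((50 ^+ m)^-1 * pnorm 1 q) <= _).
  by rewrite mulrCA ler_wpM2l // invr_ge0 exprn_ge0.
by rewrite ler_wpM2l ?normc_ge0 // (le_trans sP).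
Qed.

(** Real and imaginary parts are carried along separately, so that only continuity of real functions
    is involved. *)
Lemma horner_path_continuous T (x y : R -> R) : continuous x -> continuous y ->
  exists u v : R -> R, [/\ continuous u, continuous v &
    forall t, (toC T).[(x t +i* y t)%C] = (u t +i* v t)%C].
Proof.
move=> cx cy; elim/poly_ind: T => [|T c [u [v [cu cv E]]]].
  exists (cst 0), (cst 0); split; [exact: cst_continuous|exact: cst_continuous|].
  by move=> t; rewrite rmorph0 horner0.
exists (fun t => u t * x t - v t * y t + c), (fun t => u t * y t + v t * x t); split.
- move=> t; apply: cvgD; last exact: cvg_cst.
  by apply: cvgB; apply: cvgM; [exact: cu|exact: cx|exact: cv|exact: cy].
- by move=> t; apply: cvgD; apply: cvgM; [exact: cu|exact: cy|exact: cv|exact: cx].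
- move=> t; rewrite rmorphD rmorphM /= map_polyX map_polyC /= hornerMXaddC E.
  by simpc.
Qed.

Lemma sqrt_comp_continuous (f : R -> R) : continuous f ->
  continuous (fun t => Num.sqrt (f t)).
Proof.
move=> cf t; apply: (@continuous_comp R R R f Num.sqrt); first exact: cf.
exact: sqrt_continuous.
Qed.

(** A point of the circle is joined to [- s] by an arc on its side of the real axis, parametrized by
    the real part; the sign [e] selects the side. The intermediate value theorem applies to the
    modulus of [T] along this arc. *)
Lemma circle_ivt T s Y : 0 < s -> normc (toC T).[(- s)%:C%C] < Y ->
  (forall z, normc z = s -> normc (toC T).[z] != Y) ->
  forall z, normc z = s -> normc (toC T).[z] < Y.
Proof.
move=> s0 start avoid [a b] zs; rewrite ltNge; apply/negP => ge.
have ab : a ^+ 2 + b ^+ 2 = s ^+ 2.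
  by rewrite -zs /= sqr_sqrtr // addr_ge0 ?sqr_ge0.
pose e : R := if 0 <= b then 1 else -1.
have e2 : e ^+ 2 = 1 by rewrite /e; case: ifP => _; rewrite ?sqrrN expr1n.
pose y (t : R) := e * Num.sqrt (s ^+ 2 - t ^+ 2).
have yc : continuous y.
  move=> t; apply: cvgM; first exact: cvg_cst.
  have cs : continuous (fun t : R => Num.sqrt (s ^+ 2 - t ^+ 2)).
    apply: sqrt_comp_continuous => {}t.
    by apply: cvgB; [exact: cvg_cst|exact: exprn_continuous].
  exact: cs.
have [u [v [cu cv E]]] := @horner_path_continuous T id y (fun t => cvg_id) yc.
pose psi t := normc (toC T).[(t +i* y t)%C].
have cpsi : continuous psi.
  have -> : psi = (fun t => Num.sqrt (u t ^+ 2 + v t ^+ 2)).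
    by apply/funext => t; rewrite /psi E.
  apply: sqrt_comp_continuous => t.
  by apply: cvgD; rewrite !expr2; apply: cvgM; [exact: cu|exact: cu|exact: cv|exact: cv].
have as_ : - s <= a <= s.
  rewrite -ler_norml -(@ler_pXn2r _ 2) ?nnegrE ?normr_ge0 //; last exact: ltW.
  by rewrite real_normK ?num_real //; nra.
have ya : y a = b.
  rewrite /y; have -> : s ^+ 2 - a ^+ 2 = b ^+ 2 by rewrite -ab; ring.
  rewrite sqrtr_sqr /e; case: ifPn => b0; first by rewrite mul1r ger0_norm.
  by rewrite -ltNge in b0; rewrite ltr0_norm //; ring.
have ys : y (- s) = 0 by rewrite /y sqrrN subrr sqrtr0 mulr0.
have [|||c cr cY] := @IVT R psi (- s) a Y.
- by case/andP: as_.
- exact/continuous_subspaceT.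
- have h1 : psi (- s) <= Y by rewrite /psi ys ltW.
  have h2 : Y <= psi a by rewrite /psi ya.
  by rewrite ge_min le_max h1 h2 orbT.
have /avoid /eqP : normc (c +i* y c)%C = s.
  have cs : c ^+ 2 <= s ^+ 2.
    move: cr as_; rewrite in_itv /= => /andP[c1 c2] /andP[_ a2]; nra.
  rewrite /= /y exprMn e2 mul1r sqr_sqrtr; last by rewrite subr_ge0.
  have -> : c ^+ 2 + (s ^+ 2 - c ^+ 2) = s ^+ 2 by ring.
  by rewrite sqrtr_sqr gtr0_norm.
by apply.
Qed.

Lemma prim_root_complex n : (0 < n)%N -> exists w : C, n.-primitive_root w.
Proof.
move=> n0; pose p : {poly C} := 'X^n - 1.
have [r Dp] := closed_field_poly_normal p.
move: Dp; rewrite (monicP _) ?monicXnsubC // scale1r => Dp.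
have rn1 : all n.-unity_root r by apply/allP => z; rewrite -root_prod_XsubC -Dp.
have sz_r : (n < (size r).+1)%N.
  by rewrite -(size_prod_XsubC r id) -Dp size_XnsubC.
have [|z] := hasP (has_prim_root n0 rn1 _ sz_r); last by exists z.
by rewrite -separable_prod_XsubC -Dp separable_Xn_sub_1 // pnatr_eq0 -lt0n.
Qed.

(** Cauchy's estimate without an integral: with [n] the number of coefficients of [T] and [w] a
    primitive [n]-th root of unity, the average of $T(s w^j)\,w^{-ij}$ over [j] isolates the
    coefficient of index [i]. *)
Lemma coef_le_circle T s B i : 0 < s ->
  (forall z, normc z = s -> normc (toC T).[z] <= B) -> `|T`_i| * s ^+ i <= B.
Proof.
move=> s0 TB; have B0 : 0 <= B.
  apply: le_trans (normc_ge0 _) (TB s%:C%C _).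
  by rewrite normc_real gtr0_norm.
have [ni|iT] := leqP (size T) i; first by rewrite nth_default // normr0 mul0r.
set n := size T in iT; have n0 : (0 < n)%N by case: (n) iT.
have [w wP] := prim_root_complex n0.
have w1 : normc w = 1.
  apply/eqP; rewrite -(@pexpr_eq1 _ _ n) ?normc_ge0 //.
  by rewrite -normcX (prim_expr_order wP) normc1.
have key : \sum_(j < n) (toC T).[s%:C%C * w ^+ j] * w ^+ (j * (n - i)) =
    (T`_i * s ^+ i * n%:R)%:C%C.
  under eq_bigr => j _ do rewrite horner_coef size_map_poly -/n big_distrl /=.
  rewrite exchange_big /= (bigD1 (Ordinal iT)) //= [X in _ + X]big1 => [|l li].
    rewrite addr0; under eq_bigr => j _.
      rewrite coef_map /= exprMn -!mulrA -[(w ^+ j) ^+ i]exprM -[_ ^+ (j * i) * _]exprD -mulnDr.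
      rewrite subnKC ?(ltnW iT) // mulnC exprM (prim_expr_order wP) expr1n mulr1.
      over.
    by rewrite sumr_const card_ord mulr_natr rmorphMn rmorphM rmorphXn.
  under eq_bigr => j _.
    rewrite coef_map /= exprMn -!mulrA -[(w ^+ j) ^+ l]exprM -[_ ^+ (j * l) * _]exprD -mulnDr.
    rewrite mulnC exprM mulrA.
    over.
  rewrite -big_distrr /=; set x := w ^+ _.
  (* The exponent $l + n - i$ lies strictly between $0$ and $2n$, and it equals $n$ only if $l =
     i$. *)
  have x1 : x != 1.
    rewrite /x -(prim_order_dvd wP); apply/negP => /dvdnP[k kE].
    have ll := ltn_ord l; have : (l : nat) <> i by move/eqP: li => + e; apply; apply/val_inj.
    case: k kE => [|[|k]] kE; [lia|lia|].
    by rewrite mulSn mulSn in kE; lia.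
  have : (x - 1) * \sum_(j < n) x ^+ j = 0.
    by rewrite -subrX1 /x -exprM mulnC exprM (prim_expr_order wP) expr1n subrr.
  by move/eqP; rewrite mulf_eq0 subr_eq0 (negbTE x1) /= => /eqP ->; rewrite mulr0.
have : normc (T`_i * s ^+ i * n%:R)%:C%C <= \sum_(j < n) B.
  rewrite -key; apply: le_trans (normc_sum _ _ _) _; apply: ler_sum => j _.
  rewrite normcM normcX w1 expr1n mulr1; apply: TB.
  by rewrite normcM normcX w1 expr1n mulr1 normc_real gtr0_norm.
rewrite normc_real sumr_const card_ord -[B *+ n]mulr_natr normrM [`|n%:R|]ger0_norm // normrM.
rewrite [`|s ^+ i|]ger0_norm ?exprn_ge0 ?(ltW s0) //.
by rewrite ler_pM2r // ltr0n.
Qed.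

End ComplexCircle.

(** The coefficient of index [j] of a relation has the threshold [W ^- (m * gap J j)]. For
    [Y = W ^+ (m * (gap J j).+1)], a coefficient reaching this threshold is at least [W ^+ m] after
    multiplication by [Y], whereas [Y ^+ J] times the threshold of index [j.+1] is at most 1. The
    recursion is dictated by this second requirement. *)
Fixpoint gap (J j : nat) : nat := if j is j'.+1 then (J.+1 * (gap J j').+1)%N else 0%N.

(** * Growth of approximate roots of a polynomial relation *)

Section KeyLemma.
Variables (R : realType) (J : nat).
Import ComplexField.Normc.
Local Notation toC := (map_poly (real_complex R)).

Lemma gapS j : gap J j.+1 = (J.+1 * (gap J j).+1)%N. Proof. by []. Qed.

Lemma gap_lt j : (gap J j < gap J j.+1)%N.
Proof. by rewrite gapS mulSn; lia. Qed.

Lemma gap_le i j : (i <= j)%N -> (gap J i <= gap J j)%N.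
Proof.
move=> /subnKC <-; elim: (j - i)%N => [|k IH]; rewrite ?addn0 // addnS.
by apply: leq_trans IH _; apply: ltnW; apply: gap_lt.
Qed.

(** $10^3 = 20\cdot 50$: a factor 50 per degree is lost in [good_circle], and 20 per degree beats
    the factor 2 of the dilation from radius 1 to radius 2. The other factor accounts for the number
    of terms of a relation and for the powers of values that are at most 2. *)
Definition Wbase : R := 10 ^+ 3 * (J.+1 * 2 ^ J)%:R.

Lemma Wbase_ge1 : 1 <= Wbase.
Proof. have : 1 <= (J.+1 * 2 ^ J)%:R :> R by rewrite ler1n muln_gt0 expn_gt0.
by rewrite /Wbase; lra. Qed.

Lemma Wbase_pow m : (0 < m)%N -> ((10 ^+ 3) ^+ m) * (J.+1 * 2 ^ J)%:R <= Wbase ^+ m :> R.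
Proof.
move=> m0; have -> : Wbase ^+ m = (10 ^+ 3) ^+ m * (J.+1 * 2 ^ J)%:R ^+ m.
  exact: exprMn.
apply: ler_wpM2l; first by rewrite !exprn_ge0.
by rewrite -{1}[_%:R]expr1 ler_weXn2l // ler1n muln_gt0 expn_gt0.
Qed.

Definition Wconst : R := Wbase ^+ (gap J J).+1.

(* On a circle where [b j*] is not small, [j*] being the last index whose
   coefficient polynomial exceeds its threshold, [|T|] cannot equal
   [Wbase ^ (m (gap j* + 1))]: the [j*]-th term would dominate all others. *)
Lemma algebraic_gap m (T : {poly R}) (b : 'I_J.+1 -> {poly R}) (eta : R) :
  (0 < m)%N ->
  (forall j, (size (b j) <= m.+1)%N) -> (forall j, pnorm 1 (b j) <= 1) ->
  (exists j, pnorm 1 (b j) = 1) ->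
  pnorm 2 (\sum_j b j * T ^+ j) <= eta -> eta <= Wbase ^- m ->
  (forall t, -2 <= t <= -1 -> `|T.[t]| <= 2) ->
  forall i, `|T`_i| * (5 / 4) ^+ i <= Wconst ^+ m.
Proof.
move=> m0 sb b1 [j1 bj1] Eeta eta1 T2.
set W := Wbase; have W1 : 1 <= W by exact: Wbase_ge1.
have W0 : 0 < W by lra.
have Wm := Wbase_pow m0; rewrite -/W in Wm.
set K : R := (J.+1 * 2 ^ J)%:R in Wm.
have J1K : J.+1%:R <= K by rewrite /K ler_nat leq_pmulr // expn_gt0.
have J1 : 1 <= J.+1%:R :> R by rewrite ler1n.
pose tau j := W ^- (m * gap J j).
have tau0 j : 0 < tau j by rewrite invr_gt0 exprn_gt0.
have bz j s (z : R[i]) : 0 <= s <= 2 -> normc z = s ->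
    normc (toC (b j)).[z] <= 2 ^+ m * pnorm 1 (b j).
  move=> /andP[s0 s2] zs; apply: (le_trans (@normc_horner_le R (b j) z 2 _)); first by rewrite zs.
  by apply: pnorm_dilate => //; lra.
have ex_j : exists j, (j <= J)%N && (tau j <= pnorm 1 (b (inord j))).
  exists (val j1); rewrite -ltnS ltn_ord inord_val bj1 invf_le1 ?exprn_gt0 //.
  by rewrite exprn_ege1.
have [js /andP[jsJ bjs] jsmax] := ex_maxnP ex_j (fun j h => proj1 (andP h)).
have bgt j : (js < val j)%N -> pnorm 1 (b j) <= tau js.+1.
  move=> jsj; have : ~~ (tau j <= pnorm 1 (b j)).
    apply/negP => h; have := jsmax (val j); rewrite inord_val h andbT -ltnS ltn_ord.
    by move=> /(_ isT) /leq_ltn_trans /(_ jsj); rewrite ltnn.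
  rewrite -ltNge => /ltW /le_trans; apply.
  rewrite lef_pV2 ?posrE ?exprn_gt0 // ler_weXn2l // leq_mul2l; apply/orP; right.
  exact: gap_le.
have eval_sum (z : R[i]) s : 0 <= s <= 2 -> normc z = s ->
    normc (\sum_j (toC (b j)).[z] * (toC T).[z] ^+ j) <= eta.
  move=> /andP[s0 s2] zs.
  have -> : \sum_j (toC (b j)).[z] * (toC T).[z] ^+ j = (toC (\sum_j b j * T ^+ j)).[z].
    rewrite rmorph_sum horner_sum; apply: eq_bigr => j _.
    by rewrite rmorphM rmorphXn hornerM horner_exp.
  by apply: le_trans Eeta; apply: normc_horner_le; rewrite zs.
have m2 : 1 <= 2 ^+ m :> R by rewrite exprn_ege1 //; lra.
(* If all coefficients of positive index were below their thresholds, the relation on [-2, -1],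
   where [T] is at most 2, would make [b ord0] small there. Its norm would be less than 1, which is
   the threshold of index 0. *)
have js0 : (0 < js)%N.
  rewrite lt0n; apply/eqP => js0; move: bjs; rewrite js0 /tau /= muln0 expr0 invr1 => b0.
  have : pnorm 1 (b ord0) <= (W ^- m * (2 ^+ m * K)) * (8 * (1 + `|-2| + 1) / 1) ^+ m.
    apply: pnorm_le_of_interval => // t tr.
    have tr' : -2 <= t <= -1 by lra.
    have := eval_sum t%:C%C `|t| _ (normc_real _).
    have tn : 0 <= `|t| <= 2 by rewrite normr_ge0 ler_norml; lra.
    move=> /(_ tn).
    have -> : \sum_j (toC (b j)).[t%:C%C] * (toC T).[t%:C%C] ^+ j = (\sum_j (b j).[t] * T.[t] ^+ j)%:C%C.
      rewrite rmorph_sum; apply: eq_bigr => j _.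
      by rewrite rmorphM rmorphXn -!horner_map.
    rewrite normc_real big_ord_recl /= expr0 mulr1 => h.
    have h2 : `|\sum_(i < J) (b (lift ord0 i)).[t] * T.[t] ^+ lift ord0 i| <= W ^- m * (2 ^+ m * (J%:R * 2 ^+ J)).
      apply: le_trans (ler_norm_sum _ _ _) _.
      have -> : W ^- m * (2 ^+ m * (J%:R * 2 ^+ J)) = \sum_(i < J) W ^- m * (2 ^+ m * 2 ^+ J).
        by rewrite sumr_const card_ord -mulr_natr; ring.
      apply: ler_sum => i _; rewrite normrM mulrA.
      apply: ler_pM => //; last first.
        rewrite normrX; apply: le_trans (_ : 2 ^+ (lift ord0 i) <= _).
          by rewrite lerXn2r ?nnegrE //; apply: T2.
        by rewrite ler_weXn2l ?ler1n // -ltnS ltn_ord.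
      apply: le_trans (_ : pnorm 2 (b (lift ord0 i)) <= _).
        by apply: pnorm_horner_le; case/andP: tn.
      apply: le_trans (_ : 2 ^+ m * pnorm 1 (b (lift ord0 i)) <= _).
        by apply: pnorm_dilate => //; lra.
      rewrite mulrC ler_wpM2r ?exprn_ge0 //.
      have := bgt (lift ord0 i); rewrite js0 => /(_ isT) /le_trans; apply.
      rewrite /tau /= muln1 lef_pV2 ?posrE ?exprn_gt0 // ler_weXn2l //.
      by rewrite leq_pmulr.
    have := ler_normB ((b ord0).[t] + \sum_(i < J) (b (lift ord0 i)).[t] * T.[t] ^+ lift ord0 i)
      (\sum_(i < J) (b (lift ord0 i)).[t] * T.[t] ^+ lift ord0 i).
    rewrite addrK => /le_trans; apply; apply: le_trans (lerD h h2) _.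
    apply: le_trans (lerD eta1 (lexx _)) _.
    rewrite -[X in X + _]mulr1 -mulrDr.
    apply: ler_wpM2l; first by rewrite invr_ge0 exprn_ge0 // ltW.
    have J2 : 1 <= 2 ^+ J :> R by rewrite exprn_ege1 //; lra.
    have -> : K = J%:R * 2 ^+ J + 2 ^+ J by rewrite /K natrM natrX -natr1 mulrDl mul1r.
    by nra.
  have -> : 8 * (1 + `|-2| + 1) / 1 = 32 :> R by rewrite normrN ger0_norm; lra.
  have b0' : 1 <= pnorm 1 (b ord0).
    by move: b0; congr (_ <= pnorm 1 (b _)); apply/val_inj; rewrite /= inordK.
  move=> h; have {h b0'} := le_trans b0' h.
  have -> : W ^- m * (2 ^+ m * K) * 32 ^+ m = (64 ^+ m * K) / W ^+ m.
    have -> : 64 ^+ m = 2 ^+ m * 32 ^+ m :> R by rewrite -exprMn; congr (_ ^+ _); lra.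
    by move: (2 ^+ m) (32 ^+ m) (W ^- m) => x y z; ring.
  rewrite leNgt ltr_pdivrMr ?exprn_gt0 // mul1r; apply/negP; rewrite negbK.
  apply: lt_le_trans Wm; rewrite ltr_pM2r; last by lra.
  by rewrite ltrXn2r // ?lt0n_neq0 //; lra.
set bs := b (inord js) in bjs.
have [s sr scirc] := @good_circle R m bs m0 (sb _).
pose Y := W ^+ (m * (gap J js).+1).
have Y1 : 1 <= Y by rewrite exprn_ege1.
have s2 : 0 <= s <= 2 by lra.
have avoid z : normc z = s -> normc (toC T).[z] != Y.
  move=> zs; apply/eqP => TY.
  have := eval_sum z s s2 zs.
  rewrite (bigD1 (inord js)) //= -/bs inordK // => h.
  set rest := \sum_(i < J.+1 | _) _ in h.
  have hrest : normc rest <= 2 ^+ m * J%:R * Y ^+ js.-1.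
    apply: le_trans (normc_sum _ _ _) _.
    have -> : 2 ^+ m * J%:R * Y ^+ js.-1 =
        \sum_(i < J.+1 | i != inord js) 2 ^+ m * Y ^+ js.-1.
      rewrite sumr_const cardC1 card_ord -mulr_natr; ring.
    apply: ler_sum => j jj; rewrite normcM normcX TY.
    have jnjs : val j <> js.
      by move=> jE; move/eqP: jj; apply; apply/val_inj; rewrite /= inordK.
    have [jlt|jge] := ltnP (val j) js.
      apply: ler_pM; rewrite ?normc_ge0 ?exprn_ge0 ?(le_trans ler01) //.
        apply: le_trans (bz j s z s2 zs) _.
        by rewrite -[leRHS]mulr1 ler_wpM2l ?exprn_ge0.
      by rewrite ler_weXn2l // -ltnS prednK.
    have jgt : (js < val j)%N by rewrite ltn_neqAle jge andbT; apply/eqP => jE; apply: jnjs.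
    apply: le_trans (_ : (2 ^+ m * tau js.+1) * Y ^+ J <= _).
      apply: ler_pM; rewrite ?normc_ge0 ?exprn_ge0 ?(le_trans ler01) //.
        by apply: le_trans (bz j s z s2 zs) _; rewrite ler_wpM2l ?exprn_ge0 // bgt.
      by rewrite ler_weXn2l // -ltnS.
    rewrite -mulrA ler_wpM2l ?exprn_ge0 //.
    apply: le_trans (_ : 1 <= _); last by rewrite exprn_ege1.
    rewrite /tau mulrC ler_pdivrMr ?exprn_gt0 // mul1r /Y -exprM ler_weXn2l //.
    by rewrite gapS -mulnA leq_mul2l [(_ * J)%N]mulnC mulSn leq_addl orbT.
  have hmain : (50 ^+ m)^-1 * W ^+ m * Y ^+ js.-1 <= normc ((toC bs).[z] * (toC T).[z] ^+ js).
    rewrite normcM normcX TY -[in Y ^+ js](prednK js0) exprS mulrA.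
    rewrite ler_wpM2r ?exprn_ge0 ?(le_trans ler01) //.
    apply: le_trans (_ : ((50 ^+ m)^-1 * tau js) * Y <= _); last first.
      rewrite ler_wpM2r ?(le_trans ler01) //; apply: le_trans (scirc z zs).
      by rewrite ler_wpM2l // invr_ge0 exprn_ge0.
    rewrite -mulrA ler_wpM2l ?invr_ge0 ?exprn_ge0 // /tau /Y mulnS exprD.
    by rewrite mulrCA mulVf ?mulr1 // expf_neq0 // gt_eqF.
  have h3 := normcD ((toC bs).[z] * (toC T).[z] ^+ js + rest) (- rest).
  rewrite addrK normcN in h3.
  have h4 : (50 ^+ m)^-1 * W ^+ m * Y ^+ js.-1 <= eta + 2 ^+ m * J%:R * Y ^+ js.-1.
    by apply: le_trans hmain _; apply: le_trans h3 _; apply: lerD.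
  have Yp : 1 <= Y ^+ js.-1 by rewrite exprn_ege1.
  have eta1' : eta <= 1.
    by apply: le_trans eta1 _; rewrite invf_le1 ?exprn_gt0 // exprn_ege1.
  have h5 : (50 ^+ m)^-1 * W ^+ m <= 1 + 2 ^+ m * J%:R.
    rewrite -(ler_pM2r (lt_le_trans ltr01 Yp)); apply: le_trans h4 _.
    rewrite mulrDl mul1r lerD2r; lra.
  have h6 : 20 ^+ m * J.+1%:R <= (50 ^+ m)^-1 * W ^+ m.
    rewrite ler_pdivlMl ?exprn_gt0 // mulrA [50 ^+ m * _]mulrC -exprMn.
    have -> : 20 * 50 = 10 ^+ 3 :> R by lra.
    by apply: le_trans Wm; rewrite ler_wpM2l ?exprn_ge0.
  have h7 : 2 ^+ m < 20 ^+ m :> R by rewrite ltrXn2r // ?lt0n_neq0 //; lra.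
  have : J.+1%:R = J%:R + 1 :> R by rewrite -natr1.
  have J0 : 0 <= J%:R :> R by [].
  nra.
have sgt0 : 0 < s by lra.
have start : normc (toC T).[(- s)%:C%C] < Y.
  rewrite horner_map normc_real; apply: le_lt_trans (T2 _ _) _; first by lra.
  rewrite /Y; apply: lt_le_trans (_ : W ^+ m <= _); last first.
    by rewrite ler_weXn2l // leq_pmulr.
  apply: lt_le_trans Wm.
  have : 10 ^+ 3 <= (10 ^+ 3) ^+ m :> R by rewrite -{1}[10 ^+ 3]expr1 ler_weXn2l //; lra.
  by nra.
have below := circle_ivt sgt0 start avoid.
move=> i; apply: le_trans (_ : `|T`_i| * s ^+ i <= _).
  by rewrite ler_wpM2l // lerXn2r ?nnegrE //; lra.
apply: le_trans (coef_le_circle i sgt0 (fun z zs => ltW (below z zs))) _.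
rewrite /Y /Wconst -exprM ler_weXn2l // mulnC leq_mul2r; apply/orP; right.
by rewrite ltnS gap_le.
Qed.

(** Apply [algebraic_gap] to [T L] divided by [M]: the coefficient of index [j] is multiplied by
    [M ^+ j], and the relation is divided by the largest resulting norm [c j1]. As the residual of
    the relation tends to 0, it ends up below the required threshold. *)
Lemma bernstein_algebraic m (T : nat -> {poly R}) (b : 'I_J.+1 -> {poly R}) (M : R) :
  (0 < m)%N -> (forall j, (size (b j) <= m.+1)%N) -> (exists j, b j != 0) -> 0 < M ->
  (forall eps, 0 < eps -> \forall L \near \oo, pnorm 2 (\sum_j b j * T L ^+ j) <= eps) ->
  (\forall L \near \oo, forall t, -2 <= t <= -1 -> `|(T L).[t]| <= 2 * M) ->
  \forall L \near \oo, forall i, `|(T L)`_i| * (5 / 4) ^+ i <= M * Wconst ^+ m.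
Proof.
move=> m0 sb [j0 bj0] M0 rel small.
pose c (j : 'I_J.+1) := M ^+ j * pnorm 1 (b j).
have [j1 _ j1max] := @arg_maxP _ _ _ j0 xpredT c isT.
have c0 : 0 < c j1.
  by apply: lt_le_trans (j1max j0 isT); rewrite mulr_gt0 ?exprn_gt0 ?pnorm_gt0.
pose b' (j : 'I_J.+1) := (M ^+ j / c j1)%:P * b j.
have Mj (j : 'I_J.+1) : 0 < M ^+ j by rewrite exprn_gt0.
near=> L.
have H : forall i, `|((M^-1)%:P * T L)`_i| * (5 / 4) ^+ i <= Wconst ^+ m.
  apply: (@algebraic_gap m _ b' (Wbase ^- m)) => //.
  - by move=> j; rewrite /b' mul_polyC (leq_trans (size_scale_leq _ _)).
  - move=> j; rewrite /b' pnormCM gtr0_norm ?divr_gt0 // mulrAC ler_pdivrMr // mul1r.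
    exact: j1max.
  - exists j1; rewrite /b' pnormCM gtr0_norm ?divr_gt0 // mulrAC.
    by rewrite divff // gt_eqF.
  - have -> : \sum_j b' j * ((M^-1)%:P * T L) ^+ j = (c j1)^-1%:P * \sum_j b j * T L ^+ j.
      rewrite big_distrr; apply: eq_bigr => j _ /=.
      rewrite /b' exprMn -polyC_exp -mulrA [b j * _]mulrCA !mulrA -!polyCM; congr (_%:P * _ * _).
      by rewrite exprVn mulrAC divff ?mul1r // gt_eqF.
    rewrite pnormCM gtr0_norm ?invr_gt0 // mulrC ler_pdivrMr //.
    near: L; apply: rel; rewrite mulr_gt0 // invr_gt0 exprn_gt0 //.
    exact: lt_le_trans ltr01 Wbase_ge1.
  - move=> t tr; rewrite hornerM hornerC normrM gtr0_norm ?invr_gt0 // mulrC ler_pdivrMr //.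
    by move: t tr; near: L; exact: small.
move=> i; have := H i.
by rewrite coefCM normrM gtr0_norm ?invr_gt0 // -mulrA ler_pdivrMl.
Unshelve. all: by end_near.
Qed.

End KeyLemma.

(** * Doubling and Remez inequalities imply decay of sublevel sets *)

Definition box (R : realType) d (lo hi : 'rV[R]_d) : set 'rV[R]_d :=
  [set u | forall i, lo 0 i <= u 0 i <= hi 0 i].

Definition cube (R : realType) d (a : 'rV[R]_d) (h : R) : set 'rV[R]_d :=
  box a (a + const_mx h).

Definition axis (R : realType) d (i : 'I_d) : 'rV[R]_d := delta_mx 0 i.

Section Boxes.
Variables (R : realType) (d : nat).
Implicit Types (a u v lo hi : 'rV[R]_d) (h : R).

Lemma cubeP a h u : cube a h u <-> forall i, a 0 i <= u 0 i <= a 0 i + h.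
Proof. by split => H i; have := H i; rewrite /= !mxE. Qed.

Lemma box_compact lo hi : compact (box lo hi).
Proof.
have := @rV_compact R d (fun i => `[lo 0 i, hi 0 i]%classic) (fun i => @segment_compact R _ _).
congr compact; apply/seteqP; split => u /= H i; have := H i; rewrite ?in_itv //=.
Qed.

Lemma axis_line u (i : 'I_d) (t : R) j :
  (u + t *: axis R i) 0 j = if j == i then u 0 i + t else u 0 j.
Proof.
rewrite !mxE eqxx /=; case: eqP => [->|_]; first by rewrite mulr1.
by rewrite mulr0 addr0.
Qed.

End Boxes.

Section Coordinates.
Variables (R : realType) (d : nat).
Implicit Types (u v : 'rV[R]_d).

Lemma coord_le_norm u i : `|u 0 i| <= `|u|.
Proof.
rewrite [leRHS]mx_normrE.
exact: (@le_bigmax _ _ _ _ (fun ij : 'I_1 * 'I_d => `|u ij.1 ij.2|) (0, i)).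
Qed.

Lemma coord_diff_le_norm u v i : `|u 0 i - v 0 i| <= `|u - v|.
Proof. by have := coord_le_norm (u - v) i; rewrite !mxE. Qed.

Lemma norm_le_coord u r : 0 <= r -> (forall i, `|u 0 i| <= r) -> `|u| <= r.
Proof.
move=> r0 H; rewrite [leLHS]mx_normrE; apply/bigmax_leP; split => // -[i j] _ /=.
by rewrite (ord1 i).
Qed.

End Coordinates.

Lemma exists_half_pow (R : realType) (h delta : R) : 0 < delta ->
  exists n, h / 2 ^+ n <= delta.
Proof.
move=> d0; exists (Num.truncn (`|h| / delta)).+1; set n := (Num.truncn (`|h| / delta)).+1.
rewrite ler_pdivrMr ?exprn_gt0 // -ler_pdivrMl // mulrC.
apply: le_trans (_ : n%:R <= _).
  apply: le_trans (_ : `|h| / delta <= _); first by rewrite ler_pM2r ?invr_gt0 // ler_norm.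
  by apply/ltW/truncnS_gt.
by rewrite -natrX ler_nat ltnW // ltn_expl.
Qed.

Section Count.
Variables (R : realType) (d : nat).
Implicit Types (a : 'rV[R]_d) (h : R) (P : 'rV[R]_d -> R -> bool).

Definition corner a h (e : {ffun 'I_d -> bool}) : 'rV[R]_d :=
  a + \row_i (h / 2 * (e i)%:R).

(** Counting dyadic subcubes of generation [L] by recursion over the children, rather than over a
    grid, allows stopping arguments that treat each child separately. *)
Fixpoint count_sub (L : nat) P a h : nat :=
  if L is L'.+1 then (\sum_e count_sub L' P (corner a h e) (h / 2))%N
  else P a h.

Lemma corner_sub a h e : 0 <= h -> cube (corner a h e) (h / 2) `<=` cube a h.
Proof.
move=> h0 u /cubeP H; apply/cubeP => i; have := H i; rewrite !mxE.
by case: (e i); rewrite ?mulr1 ?mulr0; lra.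
Qed.

Lemma corner_cover a h u : cube a h u -> exists e, cube (corner a h e) (h / 2) u.
Proof.
move=> /cubeP H; exists [ffun i => a 0 i + h / 2 <= u 0 i]; apply/cubeP => i.
have := H i; rewrite !mxE ffunE; case: (leP (a 0 i + h / 2) (u 0 i)) => /=;
  rewrite ?mulr1 ?mulr0; lra.
Qed.

Lemma count_sub_le L P a h : (count_sub L P a h <= 2 ^ (L * d))%N.
Proof.
elim: L a h => [|L IH] a h /=; first by case: (P _ _).
apply: (@leq_trans (\sum_(e : {ffun 'I_d -> bool}) 2 ^ (L * d))%N); first exact: leq_sum.
by rewrite sum_nat_const card_ffun card_bool card_ord -expnD mulSn.
Qed.

Lemma count_sub_cover L P a h : 0 <= h ->
  exists2 s : seq 'rV[R]_d, size s = count_sub L P a h &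
  forall u, cube a h u ->
    (forall b, cube b (h / 2 ^+ L) u -> cube b (h / 2 ^+ L) `<=` cube a h -> P b (h / 2 ^+ L)) ->
    exists2 b, b \in s & cube b (h / 2 ^+ L) u.
Proof.
elim: L a h => [|L IH] a h h0 /=.
  exists (if P a h then [:: a] else [::]); first by case: (P a h).
  rewrite expr0 divr1 => u uQ HP; have -> : P a h by apply: HP.
  by exists a => //; rewrite inE.
have h20 : 0 <= h / 2 by lra.
have /choice [s sP] : forall e, exists s : seq 'rV[R]_d,
    size s = count_sub L P (corner a h e) (h / 2) /\
    forall u, cube (corner a h e) (h / 2) u ->
    (forall b, cube b (h / 2 / 2 ^+ L) u ->
      cube b (h / 2 / 2 ^+ L) `<=` cube (corner a h e) (h / 2) -> P b (h / 2 / 2 ^+ L)) ->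
    exists2 b, b \in s & cube b (h / 2 / 2 ^+ L) u.
  by move=> e; case: (IH (corner a h e) _ h20) => s s1 s2; exists s.
exists (flatten [seq s e | e <- enum {ffun 'I_d -> bool}]).
  rewrite size_flatten /shape -map_comp sumnE big_map big_enum /=.
  by apply: eq_bigr => e _; case: (sP e).
have hE : h / 2 ^+ L.+1 = h / 2 / 2 ^+ L by rewrite exprS invfM mulrA.
move=> u uQ; rewrite hE => HP; have [e ue] := corner_cover uQ.
have [_ /(_ u ue) sH] := sP e.
have [b bs bu] := sH (fun b bu bQ => HP b bu (subset_trans bQ (@corner_sub a h e h0))).
exists b => //; apply/flattenP; exists (s e) => //.
by apply/mapP; exists e => //; rewrite mem_enum.
Qed.

Definition grid_point a h N (k : {ffun 'I_d -> 'I_N}) : 'rV[R]_d :=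
  a + \row_i (h * ((k i)%:R / N%:R)).

(** Prepending the binary digit [e i] to [k i] identifies the lower corners of the subcubes of
    generation [L] with distinct points of the grid of mesh $h/2^L$. *)
Lemma count_sub_grid L (P : 'rV[R]_d -> bool) a h :
  (count_sub L (fun b _ => P b) a h <=
   #|[set k : {ffun 'I_d -> 'I_(2 ^ L)} | P (grid_point a h k)]%SET|)%N.
Proof.
elim: L a h => [|L IH] a h /=.
  case Pa : (P a) => //; apply/card_gt0P.
  exists [ffun=> ord0]; rewrite inE; congr (is_true (P _)): Pa.
  by apply/rowP => i; rewrite !mxE ffunE /= mul0r mulr0 addr0.
apply: leq_trans (leq_sum _ (fun e _ => IH (corner a h e) (h / 2))) _.
have lt2 (b : bool) (k : 'I_(2 ^ L)) : (b * 2 ^ L + k < 2 ^ L.+1)%N.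
  by rewrite expnS; have := ltn_ord k; case: b; lia.
pose f (x : {ffun 'I_d -> bool} * {ffun 'I_d -> 'I_(2 ^ L)}) : {ffun 'I_d -> 'I_(2 ^ L.+1)} :=
  [ffun i => Ordinal (lt2 (x.1 i) (x.2 i))].
have finj : injective f.
  move=> [e k] [e' k'] /ffunP E; have {}E i : (e i * 2 ^ L + k i = e' i * 2 ^ L + k' i)%N.
    by have := E i; rewrite !ffunE => /(congr1 val).
  have EE i : e i = e' i /\ k i = k' i.
    have := E i; have := ltn_ord (k i); have := ltn_ord (k' i).
    case: (e i) (e' i) => -[]; rewrite ?mul1n ?mul0n => h1 h2 h3; split => //; try lia;
    apply/val_inj => /=; lia.
  by congr pair; apply/ffunP => i; case: (EE i).
pose A := [set x : {ffun 'I_d -> bool} * {ffun 'I_d -> 'I_(2 ^ L)} |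
  P (grid_point (corner a h x.1) (h / 2) x.2)]%SET.
have -> : (\sum_e #|[set k : {ffun 'I_d -> 'I_(2 ^ L)} | P (grid_point (corner a h e) (h / 2) k)]%SET| = #|A|)%N.
  rewrite -[RHS]sum1_card (eq_bigl (fun x => P (grid_point (corner a h x.1) (h / 2) x.2))); last first.
    by move=> x; rewrite inE.
  rewrite -(pair_big_dep xpredT (fun e k => P (grid_point (corner a h e) (h / 2) k)) (fun _ _ => 1%N)) /=.
  by apply: eq_bigr => e _; rewrite -sum1_card; apply: eq_bigl => k; rewrite inE.
rewrite -(card_imset _ finj); apply/subset_leq_card/fintype.subsetP => y /imsetP[[e k]].
rewrite !inE /= => Pk ->; congr (is_true (P _)): Pk.
apply/rowP => i; rewrite !mxE !ffunE /= natrD natrM -addrA; congr (_ + _).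
rewrite expnS natrM natrX; field.
by rewrite expf_neq0 // pnatr_eq0.
Qed.

End Count.

Section CountUntil.
Variables (R : realType) (d : nat).
Implicit Types (a : 'rV[R]_d) (h : R) (P St : 'rV[R]_d -> R -> bool) (p : 'rV[R]_d -> bool).

Lemma count_sub_mono L P P' a h : (forall b r, P b r -> P' b r) ->
  (count_sub L P a h <= count_sub L P' a h)%N.
Proof.
move=> PP'; elim: L a h => [|L IH] a h /=.
  by case E : (P a h) => //; rewrite (PP' _ _ E).
by apply: leq_sum => e _; apply: IH.
Qed.

Lemma count_sub_none L P a h : 0 <= h -> (forall b r, cube b r `<=` cube a h -> ~ P b r) ->
  count_sub L P a h = 0%N.
Proof.
elim: L a h => [|L IH] a h h0 H /=.
  by apply/eqP; rewrite eqb0; apply/negP/H.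
rewrite big1 // => e _; apply: IH; first by rewrite divr_ge0.
by move=> b r bs; apply: H; apply: subset_trans bs (corner_sub h0).
Qed.

Lemma count_sub_all L p a h : 0 <= h -> (forall x, cube a h x -> p x) ->
  count_sub L (fun b _ => p b) a h = (2 ^ (L * d))%N.
Proof.
elim: L a h => [|L IH] a h h0 H /=.
  by rewrite H //; apply/cubeP => i; rewrite lexx lerDl.
rewrite (eq_bigr (fun=> 2 ^ (L * d))%N) => [|e _]; last first.
  apply: IH; first by rewrite divr_ge0.
  by move=> x xs; apply: H; apply: corner_sub h0 _ xs.
by rewrite sum_nat_const card_ffun card_bool card_ord -expnD mulSn.
Qed.

(** A cube satisfying [St] stops the recursion and counts for all of its descendants of generation
    [L]; cubes never stopped count for nothing. *)
Fixpoint count_until (L : nat) St a h : nat :=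
  if St a h then (2 ^ (L * d))%N else
  if L is L'.+1 then (\sum_e count_until L' St (corner a h e) (h / 2))%N else 0%N.

Lemma count_until_stop L St a h : St a h -> count_until L St a h = (2 ^ (L * d))%N.
Proof. by case: L => [|L] /= ->. Qed.

Lemma count_until_le (Om : set 'rV[R]_d) L St p a h : 0 <= h -> cube a h `<=` Om ->
  (forall b r, 0 <= r -> cube b r `<=` Om -> St b r -> forall x, cube b r x -> p x) ->
  (count_until L St a h <= count_sub L (fun b _ => p b) a h)%N.
Proof.
move=> h0 sub H; elim: L a h h0 sub => [|L IH] a h h0 sub /=.
  case: ifP => // Sta; by rewrite mul0n expn0 (H a h) //; apply/cubeP => i; rewrite lexx lerDl.
case: ifP => [Sta|_].
  by have := count_sub_all L.+1 h0 (H a h h0 sub Sta); rewrite /= => ->.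
apply: leq_sum => e _; apply: IH; first by rewrite divr_ge0.
by apply: subset_trans (corner_sub h0) sub.
Qed.

End CountUntil.

Section GridAverage.
Variables (d N : nat).
Local Notation G := {ffun 'I_d -> 'I_N}.

Definition upd (k : G) (l : 'I_d) (x : 'I_N) : G := [ffun i => if i == l then x else k i].

(** Fubini on a finite grid: the involution exchanging [k l] with [x] turns the sum of the counts
    over lines in direction [l] into [N] times the total count. The factors [c] and [q] express
    densities without division. *)
Lemma card_by_lines (l : 'I_d) (P : pred G) (c q : nat) :
  (forall k, c * #|[set x | P (upd k l x)]%SET| <= q)%N ->
  (N * (c * #|[set k | P k]%SET|) <= q * #|{: G}|)%N.
Proof.
move=> H; pose f (y : G * 'I_N) := (upd y.1 l y.2, y.1 l).
have ff : involutive f.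
  move=> [k x]; rewrite /f /=; congr pair; last by rewrite ffunE eqxx.
  by apply/ffunP => i; rewrite !ffunE; case: eqP => [->|].
have E : (N * #|[set k | P k]%SET| = \sum_(k : G) #|[set x | P (upd k l x)]%SET|)%N.
  have -> : (\sum_(k : G) #|[set x | P (upd k l x)]%SET| = \sum_(k : G) \sum_(x : 'I_N) P (upd k l x))%N.
    by apply: eq_bigr => k _; rewrite -sum1dep_card big_mkcond.
  rewrite pair_big /= (reindex_inj (inv_inj ff)) /=.
  have -> : (\sum_(y : G * 'I_N) P (upd (upd y.1 l y.2) l (y.1 l)) = \sum_(k : G) \sum_(x : 'I_N) P k)%N.
    rewrite pair_big /=; apply: eq_bigr => -[k x] _ /=; congr (nat_of_bool (P _)).
    by have /(congr1 fst) := ff (k, x).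
  under eq_bigr do rewrite sum_nat_const card_ord.
  by rewrite -big_distrr /= -sum1dep_card big_mkcond.
rewrite mulnCA E big_distrr /=.
apply: leq_trans (leq_sum _ (fun k _ => H k)) _.
by rewrite sum_nat_const mulnC.
Qed.

End GridAverage.

Section Tails.
Variables (R : realType) (d : nat) (F : 'rV[R]_d -> R) (Om : set 'rV[R]_d) (K : R) (N0 : nat).
Hypothesis K2 : 2 <= K.
Hypothesis Fuc : forall e : R, 0 < e -> exists2 r : R, 0 < r &
  forall u v, Om u -> Om v -> (forall i, `|u 0 i - v 0 i| <= r) -> `|F u - F v| <= e.

Definition boxsup lo hi := sup [set `|F u| | u in box lo hi].

Hypothesis doubling : forall a h e, 0 < h -> cube a h `<=` Om ->
  boxsup a (a + const_mx h) <= K * boxsup (corner a h e) (corner a h e + const_mx (h / 2)).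

Hypothesis remez : forall (u : 'rV[R]_d) (i : 'I_d) (h M : R), 0 < h -> 0 < M ->
  (forall t, 0 <= t <= h -> Om (u + t *: axis R i)) ->
  (exists2 t, 0 <= t <= h & M <= `|F (u + t *: axis R i)|) ->
  forall N, (N0 <= N)%N ->
  (2 * d * #|[set k : 'I_N | (`|F (u + (h * (k%:R / N%:R)) *: axis R i)| < K^-1 * M)%R]%SET| <= N)%N.

Lemma boxsup_max lo hi : box lo hi `<=` Om -> (forall i, lo 0 i <= hi 0 i) ->
  (exists2 u, box lo hi u & `|F u| = boxsup lo hi) /\
  (forall u, box lo hi u -> `|F u| <= boxsup lo hi).
Proof.
move=> sub le; have ne : box lo hi !=set0 by exists lo => i; rewrite lexx le.
have cF : {within box lo hi, continuous (fun u => `|F u|)}.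
  apply/subspace_continuousP => u uB.
  apply/cvgrPdist_le => e e0; have [r r0 rH] := Fuc e0.
  apply/nbhs_ballP; exists r => //= v vr vB; apply: le_trans (ler_dist_dist _ _) _.
  apply: rH; [exact: sub|exact: sub|move=> i].
  apply: le_trans (coord_diff_le_norm u v i) _.
  by move: vr; rewrite -ball_normE => /ltW.
have [c cB cmax] := EVT_max_rV ne (box_compact (lo := lo) (hi := hi)) cF.
rewrite inE in cB.
have ub : ubound [set `|F u| | u in box lo hi] `|F c|.
  by move=> _ [u uB <-]; apply: cmax; rewrite inE.
have E : boxsup lo hi = `|F c|.
  apply/eqP; rewrite eq_le; apply/andP; split.
    by apply: ge_sup => //; exists `|F c|; exists c.
  by apply: ub_le_sup; [exists (`|F c|) | exists c].
by split; [exists c|rewrite E => u uB; apply: cmax; rewrite inE].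
Qed.

Lemma cubesup_max a h : 0 <= h -> cube a h `<=` Om ->
  (exists2 u, cube a h u & `|F u| = boxsup a (a + const_mx h)) /\
  (forall u, cube a h u -> `|F u| <= boxsup a (a + const_mx h)).
Proof. by move=> h0 sub; apply: boxsup_max => // i; rewrite !mxE; lra. Qed.

Let K0 : 0 < K. Proof. by apply: lt_le_trans K2. Qed.

(** The coordinates are frozen one after the other at their grid values. If the value at the grid
    point is below $K^{-d}M$, then at some step [l] the supremum over the remaining slice drops by
    more than the factor $K$. By [remez] such a drop has density at most $1/(2d)$ on lines in
    direction [l], and there are $d$ directions. *)
Lemma grid_remez a h M N : 0 < h -> cube a h `<=` Om -> 0 < M ->
  M <= boxsup a (a + const_mx h) -> (N0 <= N)%N ->
  (2 * #|[set k : {ffun 'I_d -> 'I_N} | (`|F (grid_point a h k)| < K ^- d * M)%R]%SET| <= N ^ d)%N.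
Proof.
move=> h0 sub M0 MQ N0N.
have [/eqP d0|d0] := boolP (d == 0%N).
  rewrite [X in (2 * X)%N](_ : _ = 0%N) ?muln0 //; apply/eqP; rewrite cards_eq0.
  apply/set0Pn => -[k]; rewrite inE.
  have [[u uQ uM] _] := cubesup_max (ltW h0) sub.
  have -> : grid_point a h k = u.
    by apply/rowP => i; have := ltn_ord i; rewrite {2}d0.
  rewrite uM; have -> : K ^- d = 1 :> R by rewrite d0 expr0 invr1.
  by rewrite mul1r ltNge MQ.
have dpos : (0 < d)%N by rewrite lt0n.
have [N00|Npos] := posnP N.
  subst N; rewrite [X in (2 * X)%N](_ : _ = 0%N) ?muln0 //; apply/eqP; rewrite cards_eq0.
  by apply/set0Pn => -[k _]; case: (k (Ordinal dpos)).
have Nr : 0 < N%:R :> R by rewrite ltr0n.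
pose g (k : {ffun 'I_d -> 'I_N}) i : R := a 0 i + h * ((k i)%:R / N%:R).
have gr k i : a 0 i <= g k i <= a 0 i + h.
  rewrite /g lerDl lerD2l mulr_ge0 ?divr_ge0 ?(ltW h0) //=.
  by rewrite ger_pMr // ler_pdivrMr // mul1r ler_nat ltnW.
pose lo k (l : nat) : 'rV[R]_d := \row_i (if (i < l)%N then g k i else a 0 i).
pose hi k (l : nat) : 'rV[R]_d := \row_i (if (i < l)%N then g k i else a 0 i + h).
have slice k l : box (lo k l) (hi k l) `<=` cube a h.
  move=> u uB; apply/cubeP => i; have := uB i; rewrite !mxE.
  by case: ifP => // _; have := gr k i; lra.
have lohi k l i : lo k l 0 i <= hi k l 0 i by rewrite !mxE; case: ifP => // _; lra.
have mx k l := boxsup_max (subset_trans (@slice k l) sub) (lohi k l).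
pose S k l := boxsup (lo k l) (hi k l).
pose bad (l : 'I_d) k := (0 < S k l) && (S k l.+1 < K^-1 * S k l).
have badcard (l : 'I_d) : (N * (2 * d * #|[set k | bad l k]%SET|) <= N * #|{: {ffun 'I_d -> 'I_N}}|)%N.
  apply: (@card_by_lines d N l) => k.
  have Sl x : S (upd k l x) l = S k l.
    rewrite /S /lo /hi; congr boxsup; apply/rowP => i; rewrite !mxE /g ffunE;
    by case: ifP => // il; case: eqP => // E; rewrite E ltnn in il.
  have [S0|Sn0] := boolP (0 < S k l); last first.
    rewrite (_ : [set x | _]%SET = finset.set0) ?cards0 ?muln0 //; apply/setP => x.
    by rewrite !inE /bad Sl (negbTE Sn0).
  have [[u uB uS] _] := mx k l.
  (* The line in direction [l] through a point [u] where the supremum over the slice is attained,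
     started on the face of the cube. Freezing coordinate [l] leaves a slice that still meets this
     line. *)
  pose u' := u + (a 0 l - u 0 l) *: axis R l.
  have u't t : (u' + t *: axis R l) = \row_i (if i == l then a 0 l + t else u 0 i).
    apply/rowP => i; rewrite axis_line !axis_line eqxx [RHS]mxE.
    by case: eqP => [_|_]; ring.
  apply: leq_trans (@remez u' l h (S k l) h0 S0 _ _ N N0N).
  - rewrite leq_mul2l; apply/orP; right; apply/subset_leq_card/fintype.subsetP => x.
    rewrite !inE /bad Sl S0 /= => xlt; apply: le_lt_trans xlt.
    have [_] := mx (upd k l x) l.+1; apply => i.
    rewrite u't !mxE /g ffunE ltnS; have := uB i; rewrite !mxE /g.
    case: eqP => [-> _|/eqP il]; first by rewrite leqnn lexx.
    have -> : (i <= l)%N = (i < l)%N by rewrite [RHS]ltn_neqAle il.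
    by [].
  - move=> t tr; apply: sub; apply/cubeP => i; rewrite u't mxE.
    case: eqP => [->|_]; first by lra.
    by have /cubeP := slice _ _ _ uB; apply.
  - exists (u 0 l - a 0 l).
      have /cubeP/(_ l) := slice _ _ _ uB; lra.
    rewrite u't /S -uS; have -> : \row_i (if i == l then a 0 l + (u 0 l - a 0 l) else u 0 i) = u; last by [].
    by apply/rowP => i; rewrite mxE; case: eqP => [->|//]; ring.
have cover : [set k : {ffun 'I_d -> 'I_N} | `|F (grid_point a h k)| < K ^- d * M]%SET \subset
    (\bigcup_(l : 'I_d) [set k | bad l k])%SET.
  apply/fintype.subsetP => k; rewrite inE => klt; apply/bigcupP.
  suff [l bl] : exists l, bad l k by exists l; rewrite ?inE.
  apply: contrapT => nb.
  have step (l : nat) : (l <= d)%N -> K ^- l * M <= S k l.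
    elim: l => [_|l IH ld].
      rewrite expr0 invr1 mul1r; apply: le_trans MQ _.
      rewrite /S; have -> : lo k 0 = a by apply/rowP => i; rewrite mxE.
      by have -> : hi k 0 = a + const_mx h by apply/rowP => i; rewrite !mxE.
    have {}IH := IH (ltnW ld).
    have Spos : 0 < S k l by apply: lt_le_trans IH; rewrite mulr_gt0 // invr_gt0 exprn_gt0.
    rewrite leNgt; apply/negP => lt; apply: nb; exists (Ordinal ld).
    rewrite /bad Spos /=; apply: lt_le_trans lt _.
    by rewrite exprS invfM -mulrA ler_wpM2l // invr_ge0 ltW.
  have := step d (leqnn d); rewrite leNgt => /negP; apply.
  suff -> : S k d = `|F (grid_point a h k)| by [].
  have [[u uB uS] _] := mx k d; rewrite /S -uS; congr (`|F _|).
  apply/rowP => i; have := uB i; rewrite !mxE ltn_ord => /andP[h1 h2].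
  by apply/eqP; rewrite eq_le h1 h2.
have cG : #|{: {ffun 'I_d -> 'I_N}}| = (N ^ d)%N by rewrite card_ffun !card_ord.
rewrite -cG -(leq_pmul2l dpos) mulnA [(d * 2)%N]mulnC.
apply: (@leq_trans (\sum_(l < d) 2 * d * #|[set k | bad l k]%SET|)%N).
  rewrite -big_distrr /= leq_mul2l; apply/orP; right.
  apply: leq_trans (subset_leq_card cover) _.
  elim/big_rec2: _ => [|l A n _ IH]; first by rewrite cards0.
  by apply: leq_trans (leq_card_setU _ _) _; rewrite leq_add2l.
apply: (@leq_trans (\sum_(l < d) #|{: {ffun 'I_d -> 'I_N}}|)%N).
  by apply: leq_sum => l _; rewrite -(leq_pmul2l Npos) badcard.
by rewrite sum_nat_const card_ord.
Qed.

Definition meets (eps : R) b r : bool := `[< exists2 x, cube b r x & `|F x| <= eps >].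

(** A cube is stopped when its supremum is below $K^{-d}M$. The stopped cubes fill at most half of
    the whole cube by [grid_remez]. As their parents are not stopped, doubling keeps their supremum
    above $K^{-(d+1)}M$, so that the induction hypothesis inside each of them supplies the remaining
    factor $2^{-j}$. *)
Lemma tail_count (j : nat) a h : 0 < h -> cube a h `<=` Om -> 0 < boxsup a (a + const_mx h) ->
  exists L0, forall L, (L0 <= L)%N ->
  (2 ^ j * count_sub L (meets (K ^- (d.+1 * j) * boxsup a (a + const_mx h))) a h <= 2 ^ (L * d))%N.
Proof.
elim: j a h => [|j IHj] a h h0 sub M0.
  by exists 0%N => L _; rewrite expn0 mul1n count_sub_le.
set M := boxsup _ _ in M0 *.
pose P := meets (K ^- (d.+1 * j.+1) * M).
have K1 : 1 <= K by apply: le_trans K2; rewrite ler1n.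
have Kp n : 0 < K ^- n by rewrite invr_gt0 exprn_gt0.
pose St b r := boxsup b (b + const_mx r) < K ^- d * M.
(* By uniform continuity a cube of side at most [delta] that meets the sublevel set is stopped; this
   bounds the depth of the recursion in [main]. *)
have [delta d0 dH] := @Fuc (K ^- d * M / 4) ltac:(by rewrite divr_gt0 // mulr_gt0).
have fine b s : 0 < s -> s <= delta -> cube b s `<=` cube a h -> P b s -> St b s.
  move=> s0 sd bsub /asboolP[x xb xle].
  have [[y yb yM] _] := cubesup_max (ltW s0) (subset_trans bsub sub).
  rewrite /St -yM; have h1 : `|F y - F x| <= K ^- d * M / 4.
    apply: dH; [exact/sub/bsub|exact/sub/bsub|move=> i].
    have /cubeP/(_ i) := yb; have /cubeP/(_ i) := xb; rewrite ler_norml; lra.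
  have h2 : `|F x| <= K ^- d * M / 2.
    apply: le_trans xle _; rewrite -/M mulrAC ler_pM2r //.
    have : K ^- (d.+1 * j.+1) <= K ^- d.+1.
      by rewrite lef_pV2 ?posrE ?exprn_gt0 // ler_weXn2l // leq_pmulr.
    move/le_trans; apply; rewrite exprS invfM mulrC ler_pM2l //.
    by rewrite lef_pV2 ?posrE.
  have h3 : `|F y| <= `|F y - F x| + `|F x| by rewrite -{1}[F y](subrK (F x)) ler_normD.
  have : 0 < K ^- d * M by rewrite mulr_gt0.
  lra.
have stopcase b s : St b s -> 0 < s -> cube b s `<=` cube a h ->
    K ^- d.+1 * M <= boxsup b (b + const_mx s) ->
    exists L0, forall L, (L0 <= L)%N -> (2 ^ j * count_sub L P b s <= count_until L St b s)%N.
  move=> Stb s0 bsub Mb; have [|L0 L0P] := IHj b s s0 (subset_trans bsub sub).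
    by apply: lt_le_trans Mb; rewrite mulr_gt0.
  exists L0 => L /L0P; rewrite count_until_stop //; apply: leq_trans.
  rewrite leq_mul2l; apply/orP; right; apply: count_sub_mono => b' r' /asboolP[x xb xle].
  apply/asboolP; exists x => //; apply: le_trans xle _.
  have -> : K ^- (d.+1 * j.+1) * M = K ^- (d.+1 * j) * (K ^- d.+1 * M).
    by rewrite mulnS exprD invfM mulrA; congr (_ * _); apply: mulrC.
  by rewrite ler_pM2l.
have main : forall n b s, 0 < s -> cube b s `<=` cube a h -> s / 2 ^+ n <= delta ->
    K ^- d.+1 * M <= boxsup b (b + const_mx s) ->
    exists L0, forall L, (L0 <= L)%N -> (2 ^ j * count_sub L P b s <= count_until L St b s)%N.
  elim=> [|n IHn] b s s0 bsub sn Mb.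
    have [/stopcase|nStb] := boolP (St b s); first by apply.
    exists 0%N => L _; rewrite count_sub_none ?muln0 //.
      exact: ltW.
    move=> b' r' b'sub Pb'; move/negP: nStb; apply; apply: fine => //.
      by move: sn; rewrite expr0 divr1.
    by move: Pb' => /asboolP[x xb xle]; apply/asboolP; exists x => //; apply: b'sub.
  have [/stopcase|nStb] := boolP (St b s); first by apply.
  have s20 : 0 < s / 2 by rewrite divr_gt0.
  have child e : exists L0, forall L, (L0 <= L)%N ->
      (2 ^ j * count_sub L P (corner b s e) (s / 2) <= count_until L St (corner b s e) (s / 2))%N.
    apply: IHn => //.
    - by apply: subset_trans (corner_sub (ltW s0)) bsub.
    - by move: sn; rewrite exprS invfM mulrA.
    - move: nStb; rewrite -leNgt => nStb; rewrite exprS invfM -mulrA -(ler_pM2l K0) mulVKf ?gt_eqF //; apply: le_trans nStb _.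
      by apply: doubling => //; apply: subset_trans bsub sub.
  have [L0 L0P] := choice child.
  exists (\max_e L0 e).+1 => -[//|L] LL /=; rewrite (negbTE nStb) big_distrr /=.
  apply: leq_sum => e _; apply: L0P; apply: leq_trans (ltnSE LL).
  exact: leq_bigmax.
have [n nP] := exists_half_pow h d0.
have [L0 L0P] := main n a h h0 (fun _ x => x) nP ltac:(
  by rewrite ger_pMl // invf_le1 ?exprn_gt0 // exprn_ege1).
exists (maxn L0 N0) => L; rewrite geq_max => /andP[LL0 LN0].
rewrite expnS -mulnA; apply: leq_trans (_ : 2 * count_until L St a h <= _)%N.
  by rewrite leq_mul2l /= L0P.
apply: leq_trans (_ : 2 * count_sub L (fun b _ => `|F b| < K ^- d * M)%R a h <= _)%N.
  rewrite leq_mul2l /=; apply: (@count_until_le _ _ Om) => //; first exact: ltW.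
  move=> b r r0 bsub Stb x xb; apply: le_lt_trans Stb.
  by have [_] := cubesup_max r0 bsub; apply.
have -> : (2 ^ (L * d) = (2 ^ L) ^ d)%N by rewrite expnM.
apply: leq_trans (@grid_remez a h M (2 ^ L) h0 sub M0 (lexx _) _).
  by rewrite leq_mul2l /= count_sub_grid.
by apply: leq_trans LN0 _; rewrite ltnW // ltn_expl.
Qed.

Lemma tail_cover (j : nat) a h : 0 < h -> cube a h `<=` Om -> 0 < boxsup a (a + const_mx h) ->
  exists L0, forall L, (L0 <= L)%N -> exists2 s : seq 'rV[R]_d,
    (2 ^ j * size s <= 2 ^ (L * d))%N &
    forall u, cube a h u -> `|F u| <= K ^- (d.+1 * j) * boxsup a (a + const_mx h) ->
      exists2 b, b \in s & cube b (h / 2 ^+ L) u.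
Proof.
move=> h0 sub M0; have [L0 L0P] := tail_count j h0 sub M0.
exists L0 => L /L0P cP.
have [s sz sP] := count_sub_cover L (meets (K ^- (d.+1 * j) * boxsup a (a + const_mx h))) a (ltW h0).
exists s; first by rewrite sz.
by move=> u uQ uF; apply: sP => // b bu _; apply/asboolP; exists u.
Qed.

End Tails.

(** * Limits of polynomials in the coefficient norm *)

Section Tails.
Variable R : realType.
Implicit Types (p q : {poly R}) (s t : R).

(** Each term of order at least [k] gains a factor $(|t|/s)^k$ over its contribution to the norm. *)
Lemma horner_tail p k s t : 0 < s -> `|t| <= s ->
  `|p.[t] - \sum_(i < k) p`_i * t ^+ i| <= (`|t| / s) ^+ k * pnorm s p.
Proof.
move=> s0 ts; pose n := (k + size p)%N.
have sp : (size p <= n)%N by rewrite leq_addl.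
rewrite (horner_coef_wide t sp) (pnorm_widen s sp) /n !big_split_ord /=.
rewrite addrAC subrr add0r mulrDr.
apply: le_trans (ler_norm_sum _ _ _) _.
apply: le_trans (_ : \sum_(i < size p) (`|t| / s) ^+ k * (`|p`_(k + i)| * s ^+ (k + i)) <= _).
  apply: ler_sum => i _; rewrite normrM normrX mulrCA ler_wpM2l //.
  have -> : `|t| ^+ (k + i) = (`|t| / s) ^+ (k + i) * s ^+ (k + i).
    by rewrite -exprMn divfK // gt_eqF.
  rewrite ler_wpM2r ?exprn_ge0 ?(ltW s0) //.
  have ts1 : 0 <= `|t| / s <= 1 by rewrite divr_ge0 ?(ltW s0) //= ler_pdivrMr // mul1r.
  case/andP: ts1 => ts0 ts1.
  by rewrite exprD ler_piMr ?exprn_ge0 // exprn_ile1.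
rewrite -big_distrr /= lerDr mulr_ge0 ?exprn_ge0 ?divr_ge0 ?(ltW s0) //.
by apply: sumr_ge0 => i _; rewrite mulr_ge0 ?exprn_ge0 ?(ltW s0).
Qed.

End Tails.

Section AnalyticOn.
Variable R : realType.
Implicit Types (f g : R -> R) (s t : R) (T S : nat -> {poly R}).

(* [T] are polynomials converging to [f] on [-s, s] in the l^1 norm of the
   Taylor coefficients at [0], weighted by the powers of [s]. *)
Definition approximates T s f : Prop :=
  (forall e, 0 < e -> exists N, forall i j, (N <= i)%N -> (N <= j)%N ->
     pnorm s (T i - T j) <= e) /\
  (forall t, `|t| <= s -> forall e, 0 < e -> exists N, forall i, (N <= i)%N ->
     `|(T i).[t] - f t| <= e).

Definition analytic_on s f := exists T, approximates T s f.

Lemma approximates_bounded T s f : 0 <= s -> approximates T s f ->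
  exists2 B, 0 < B & exists N, forall i, (N <= i)%N -> pnorm s (T i) <= B.
Proof.
move=> s0 [TC _]; have [N NP] := TC 1 ltr01.
exists (1 + pnorm s (T N)); first by rewrite ltr_pwDl // pnorm_ge0.
exists N => i Ni; rewrite -[T i](subrK (T N)).
by apply: le_trans (pnormD _ _ s0) _; rewrite lerD2r NP.
Qed.

Lemma approximates_unif T s f : 0 <= s -> approximates T s f ->
  forall e, 0 < e -> exists N, forall i, (N <= i)%N -> forall t, `|t| <= s ->
    `|(T i).[t] - f t| <= e.
Proof.
move=> s0 [TC Tf] e e0; have e20 : 0 < e / 2 by lra.
have [N NP] := TC _ e20; exists N => i Ni t ts.
have [N' N'P] := Tf t ts _ e20; pose j := maxn N N'.
have h1 := NP i j Ni (leq_maxl _ _); have h2 := N'P j (leq_maxr _ _).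
have h3 := pnorm_horner_le (T i - T j) ts; rewrite hornerD hornerN in h3.
have -> : (T i).[t] - f t = ((T i).[t] - (T j).[t]) + ((T j).[t] - f t) by ring.
by apply: le_trans (ler_normD _ _) _; lra.
Qed.

Lemma approximatesD T S s f g : 0 <= s -> approximates T s f -> approximates S s g ->
  approximates (fun L => T L + S L) s (fun t => f t + g t).
Proof.
move=> s0 [TC Tf] [SC Sg]; split.
  move=> e e0; have e20 : 0 < e / 2 by lra.
  have [N NP] := TC _ e20; have [N' N'P] := SC _ e20.
  exists (maxn N N') => i j; rewrite !geq_max => /andP[i1 i2] /andP[j1 j2].
  have -> : T i + S i - (T j + S j) = (T i - T j) + (S i - S j) by ring.
  apply: le_trans (pnormD _ _ s0) _.
  by have := NP i j i1 j1; have := N'P i j i2 j2; lra.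
move=> t ts e e0; have e20 : 0 < e / 2 by lra.
have [N NP] := Tf t ts _ e20; have [N' N'P] := Sg t ts _ e20.
exists (maxn N N') => i; rewrite !geq_max => /andP[i1 i2].
have := NP i i1; have := N'P i i2; rewrite hornerD !ler_norml; lra.
Qed.

Lemma approximatesM T S s f g : 0 <= s -> approximates T s f -> approximates S s g ->
  approximates (fun L => T L * S L) s (fun t => f t * g t).
Proof.
move=> s0 Tf Sg.
have [B B0 [N1 N1P]] := approximates_bounded s0 Tf.
have [B' B'0 [N2 N2P]] := approximates_bounded s0 Sg.
have C e : 0 < e -> exists N, forall i j, (N <= i)%N -> (N <= j)%N ->
    pnorm s (T i * S i - T j * S j) <= e.
  move=> e0; have e1 : 0 < e / (2 * B') by rewrite divr_gt0 ?mulr_gt0.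
  have e2 : 0 < e / (2 * B) by rewrite divr_gt0 ?mulr_gt0.
  case: Tf Sg => [TC _] [SC _].
  have [N NP] := TC _ e1; have [N' N'P] := SC _ e2.
  exists (maxn (maxn N1 N2) (maxn N N')) => i j; rewrite !geq_max.
  move=> /andP[/andP[i1 i2] /andP[i3 i4]] /andP[/andP[j1 j2] /andP[j3 j4]].
  have -> : T i * S i - T j * S j = (T i - T j) * S i + T j * (S i - S j) by ring.
  apply: le_trans (pnormD _ _ s0) _.
  have h1 : pnorm s ((T i - T j) * S i) <= e / (2 * B') * B'.
    apply: le_trans (pnormM _ _ s0) _.
    by apply: ler_pM; rewrite ?pnorm_ge0 // ?NP // N2P.
  have h2 : pnorm s (T j * (S i - S j)) <= B * (e / (2 * B)).
    apply: le_trans (pnormM _ _ s0) _.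
    by apply: ler_pM; rewrite ?pnorm_ge0 // ?N'P // N1P.
  apply: le_trans (lerD h1 h2) _; rewrite le_eqVlt; apply/orP; left; apply/eqP.
  by field; rewrite !gt_eqF.
split=> // t ts e e0.
have Tb i : (N1 <= i)%N -> `|(T i).[t]| <= B.
  by move=> /N1P; apply: le_trans; apply: pnorm_horner_le.
have gb : `|g t| <= B' + 1.
  have [_ Sp] := Sg; have [N NP] := Sp t ts 1 ltr01.
  have h := NP _ (leq_maxl N N2); have h2 := N2P _ (leq_maxr N N2).
  have h3 := pnorm_horner_le (S (maxn N N2)) ts.
  have -> : g t = (S (maxn N N2)).[t] - ((S (maxn N N2)).[t] - g t) by ring.
  by apply: le_trans (ler_normB _ _) _; lra.
have B1 : 0 < B' + 1 by lra.
have e1 : 0 < e / (2 * (B' + 1)) by rewrite divr_gt0 ?mulr_gt0.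
have e2 : 0 < e / (2 * B) by rewrite divr_gt0 ?mulr_gt0.
case: Tf Sg => [_ Tp] [_ Sp].
have [N NP] := Tp t ts _ e1; have [N' N'P] := Sp t ts _ e2.
exists (maxn N1 (maxn N N')) => i; rewrite !geq_max => /andP[i1 /andP[i2 i3]].
have -> : (T i * S i).[t] - f t * g t =
    (T i).[t] * ((S i).[t] - g t) + ((T i).[t] - f t) * g t by rewrite hornerM; ring.
apply: le_trans (ler_normD _ _) _; rewrite !normrM.
have h1 : `|(T i).[t]| * `|(S i).[t] - g t| <= B * (e / (2 * B)).
  by apply: ler_pM => //; [exact: Tb|exact: N'P].
have h2 : `|(T i).[t] - f t| * `|g t| <= e / (2 * (B' + 1)) * (B' + 1).
  by apply: ler_pM => //; exact: NP.
apply: le_trans (lerD h1 h2) _; rewrite le_eqVlt; apply/orP; left; apply/eqP.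
by field; rewrite !gt_eqF.
Qed.

Lemma approximates_horner s (q : {poly R}) : approximates (fun=> q) s (fun t => q.[t]).
Proof.
split=> [e e0|t _ e e0]; exists 0%N => *; first by rewrite subrr pnorm0 ltW.
by rewrite subrr normr0 ltW.
Qed.

Lemma approximates_cst s c : approximates (fun=> c%:P) s (fun=> c).
Proof.
have := approximates_horner s c%:P; congr approximates.
by apply/funext => t; rewrite hornerC.
Qed.

Lemma approximatesX T s f n : 0 <= s -> approximates T s f ->
  approximates (fun L => T L ^+ n) s (fun t => f t ^+ n).
Proof.
move=> s0 Tf; elim: n => [|n IH].
  by under [X in approximates X]eq_fun do rewrite expr0 -polyC1; exact: approximates_cst.
have := approximatesM s0 Tf IH; congr approximates; apply/funext => x; rewrite exprS //.
Qed.

Lemma approximates_sum (I : Type) (r : seq I) (T : I -> nat -> {poly R}) s (f : I -> R -> R) :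
  0 <= s -> (forall i, approximates (T i) s (f i)) ->
  approximates (fun L => \sum_(i <- r) T i L) s (fun t => \sum_(i <- r) f i t).
Proof.
move=> s0 H; elim: r => [|i r IH].
  under [X in approximates X]eq_fun do rewrite big_nil.
  under [X in approximates _ _ X]eq_fun do rewrite big_nil.
  exact: approximates_cst.
have := approximatesD s0 (H i) IH; congr approximates; apply/funext => x; rewrite big_cons //.
Qed.

Lemma approximates_ext T s f g : (forall t, `|t| <= s -> f t = g t) ->
  approximates T s f -> approximates T s g.
Proof. by move=> fg [TC Tf]; split=> // t ts; rewrite -fg //; apply: Tf. Qed.

(** An identity principle. The coefficient of order [k] of [T L] tends to 0 by induction on [k]: at
    a single small [t] it is compared with the earlier coefficients, the tail of the polynomial and
    the value [f t]. Smallness of [f] is needed at arbitrarily small parameters only, not at all of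
    them. *)
Lemma approximates_flat T s f : 0 < s -> approximates T s f ->
  (forall n, exists C, forall eta, 0 < eta -> exists2 t, 0 < `|t| < eta & `|f t| <= C * `|t| ^+ n) ->
  (forall e, 0 < e -> exists N, forall i, (N <= i)%N -> pnorm s (T i) <= e) /\
  (forall t, `|t| <= s -> f t = 0).
Proof.
move=> s0 Tf flat; have s0' := ltW s0.
have coef0 k : forall e, 0 < e -> exists N, forall L, (N <= L)%N -> `|(T L)`_k| <= e.
  elim/ltn_ind: k => k IH e e0.
  have [C CP] := flat k.+1.
  have [B B0 [N0 N0P]] := approximates_bounded s0' Tf.
  pose C' := `|C| + 2 + B / s ^+ k.+1.
  have C'0 : 0 < C' by rewrite /C' ltr_wpDr ?divr_ge0 ?exprn_ge0 ?(ltW B0) // ltr_wpDl.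
  (* The parameter [t] is fixed before [L], because the earlier coefficients have to be small
     relative to a power of [t]. *)
  have [t /andP[t0 tlt] ft] := CP (Num.min s (e / C')) ltac:(by rewrite lt_min s0 divr_gt0).
  move: tlt; rewrite lt_min => /andP[ts te].
  have tk0 n : 0 < `|t| ^+ n by rewrite exprn_gt0.
  have [N1 N1P] := (proj2 Tf) t (ltW ts) _ (tk0 k.+1).
  have [N2 N2P] : exists N, forall L, (N <= L)%N -> forall i, (i < k)%N ->
      `|(T L)`_i| * `|t| ^+ i <= `|t| ^+ k.+1 / k.+1%:R.
    have : forall i : 'I_k, exists N, forall L, (N <= L)%N ->
        `|(T L)`_i| <= `|t| ^+ k.+1 / k.+1%:R / `|t| ^+ i.
      by move=> i; apply: IH => //; rewrite !divr_gt0.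
    move=> /choice[Nf NfP]; exists (\max_i Nf i) => L LL i ik.
    rewrite -ler_pdivlMr //; apply: (NfP (Ordinal ik)).
    by apply: leq_trans LL; apply: (leq_bigmax (Ordinal ik)).
  exists (maxn N0 (maxn N1 N2)) => L; rewrite !geq_max => /andP[L0 /andP[L1 L2]].
  have h1 := N1P L L1; have h2 := horner_tail (T L) k.+1 s0 (ltW ts).
  rewrite big_ord_recr /= in h2.
  have h3 : `|\sum_(i < k) (T L)`_i * t ^+ i| <= `|t| ^+ k.+1.
    apply: le_trans (ler_norm_sum _ _ _) _.
    apply: le_trans (_ : \sum_(i < k) `|t| ^+ k.+1 / k.+1%:R <= _).
      by apply: ler_sum => i _; rewrite normrM normrX N2P.
    rewrite sumr_const card_ord -[X in X <= _]mulr_natr -mulrA ler_piMr ?(ltW (tk0 _)) //.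
    by rewrite mulrC ler_pdivrMr ?ltr0n // mul1r ler_nat.
  have h4 : (`|t| / s) ^+ k.+1 * pnorm s (T L) <= `|t| ^+ k.+1 * (B / s ^+ k.+1).
    rewrite expr_div_n -mulrA ler_pM2l // [_^-1 * _]mulrC ler_pM2r ?invr_gt0 ?exprn_gt0 //.
    exact: N0P.
  have h5 : `|f t| <= `|C| * `|t| ^+ k.+1.
    by apply: le_trans ft _; rewrite ler_wpM2r ?exprn_ge0 // ler_norm.
  have key : `|(T L)`_k * t ^+ k| <= C' * `|t| ^+ k.+1.
    have -> : (T L)`_k * t ^+ k = f t + ((T L).[t] - f t) -
      ((T L).[t] - (\sum_(i < k) (T L)`_i * t ^+ i + (T L)`_k * t ^+ k)) -
      \sum_(i < k) (T L)`_i * t ^+ i by ring.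
    apply: le_trans (ler_normB _ _) _.
    have := ler_normB (f t + ((T L).[t] - f t)) ((T L).[t] - (\sum_(i < k) (T L)`_i * t ^+ i + (T L)`_k * t ^+ k)).
    have := ler_normD (f t) ((T L).[t] - f t).
    have -> : C' * `|t| ^+ k.+1 = `|C| * `|t| ^+ k.+1 + 2 * `|t| ^+ k.+1 + `|t| ^+ k.+1 * (B / s ^+ k.+1).
      by rewrite /C'; ring.
    lra.
  move: key; rewrite normrM normrX exprS mulrA ler_pM2r // => /le_trans; apply.
  by move: te; rewrite ltr_pdivlMr // mulrC => /ltW.
have norm0 : forall e, 0 < e -> exists N, forall i, (N <= i)%N -> pnorm s (T i) <= e.
  move=> e e0; have e40 : 0 < e / 4 by lra.
  have [N NP] := (proj1 Tf) _ e40.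
  have [N2 N2P] : exists N2, forall L, (N2 <= L)%N -> forall i, (i < size (T N))%N ->
      `|(T L)`_i| * s ^+ i <= e / 4 / (size (T N)).+1%:R.
    have : forall i : 'I_(size (T N)), exists M, forall L, (M <= L)%N ->
        `|(T L)`_i| <= e / 4 / (size (T N)).+1%:R / s ^+ i.
      by move=> i; apply: coef0; rewrite !divr_gt0 // exprn_gt0.
    move=> /choice[Nf NfP]; exists (\max_i Nf i) => L LL i ik.
    rewrite -ler_pdivlMr ?exprn_gt0 //; apply: (NfP (Ordinal ik)).
    by apply: leq_trans LL; apply: (leq_bigmax (Ordinal ik)).
  have TN : pnorm s (T N) <= e / 2.
    pose L := maxn N N2.
    apply: le_trans (_ : pnorm s (T N - T L) + e / 4 <= _); last first.
      by have := NP N L (leqnn _) (leq_maxl _ _); lra.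
    rewrite /pnorm /pnormby.
    apply: le_trans (_ : \sum_(i < size (T N)) (`|(T N - T L)`_i| * s ^+ i + `|(T L)`_i| * s ^+ i) <= _).
      apply: ler_sum => i _; rewrite -mulrDl ler_wpM2r ?exprn_ge0 //.
      by rewrite coefB -{1}[(T N)`_i](subrK (T L)`_i) ler_normD.
    rewrite big_split lerD //=.
      rewrite -/(pnormby _ s (T N - T L)) -/(pnorm s (T N - T L)).
      rewrite (@pnorm_widen _ (maxn (size (T N)) (size (T N - T L)))) ?leq_maxr //.
      rewrite (big_ord_widen _ (fun i => `|(T N - T L)`_i| * s ^+ i) (leq_maxl (size (T N)) (size (T N - T L)))).
      rewrite big_mkcond; apply: ler_sum => i _; case: ifP => // _.
      by rewrite mulr_ge0 ?exprn_ge0.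
    apply: le_trans (_ : \sum_(i < size (T N)) e / 4 / (size (T N)).+1%:R <= _).
      by apply: ler_sum => i _; rewrite N2P // leq_maxr.
    rewrite sumr_const card_ord -[X in X <= _]mulr_natr -mulrA ler_piMr ?(ltW e40) //.
    by rewrite mulrC ler_pdivrMr ?ltr0n // mul1r ler_nat.
  exists N => i Ni; rewrite -[T i](subrK (T N)).
  apply: le_trans (pnormD _ _ s0') _.
  by have := NP i N Ni (leqnn _); lra.
split=> // t ts; apply/eqP; rewrite -normr_le0; apply/ler_addgt0Pl => e e0; rewrite addr0.
have e20 : 0 < e / 2 by lra.
have [N NP] := norm0 _ e20; have [N' N'P] := (proj2 Tf) t ts _ e20.
have h1 := NP _ (leq_maxl N N'); have h2 := N'P _ (leq_maxr N N').
have h3 := pnorm_horner_le (T (maxn N N')) ts.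
have -> : f t = (T (maxn N N')).[t] - ((T (maxn N N')).[t] - f t) by ring.
by apply: le_trans (ler_normB _ _) _; lra.
Qed.

End AnalyticOn.

(** * Coefficients of formal power series roots *)

Section Hensel.
Variable R : realType.
Implicit Types (p q : {poly R}).

Lemma coefM_low p q M : (forall i, (i < M)%N -> p`_i = 0) -> q`_0 = 0 ->
  forall i, (i <= M)%N -> (p * q)`_i = 0.
Proof.
move=> p0 q0 i iM; rewrite coefM big1 // => j _.
have [jM|Mj] := ltnP j M; first by rewrite p0 // mul0r.
have -> : (i - j = 0)%N by have := ltn_ord j; lia.
by rewrite q0 mulr0.
Qed.

Lemma sum_le1 (V : nmodType) D (F : nat -> V) : (0 < D)%N ->
  \sum_(k < D.+1 | ~~ (1 < k)%N) F k = F 0%N + F 1%N.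
Proof.
case: D => // D _; rewrite big_mkcond !big_ord_recl /= big1 ?addr0 //.
Qed.

Lemma sum_coef_le_pnorm p s n : 0 <= s -> \sum_(i < n) `|p`_i| * s ^+ i <= pnorm s p.
Proof.
move=> s0; rewrite (@pnorm_widen _ (maxn n (size p))) ?leq_maxr //.
rewrite (big_ord_widen _ (fun i => `|p`_i| * s ^+ i) (leq_maxl n (size p))).
by rewrite big_mkcond; apply: ler_sum => i _; case: ifP => // _; rewrite mulr_ge0 ?exprn_ge0.
Qed.

(** A quantitative Newton-Hensel argument. Write the series as $\tau + X^N z$ with $z$ without
    constant term. The derivative of the relation has order exactly $N$ along the series, so after
    division by $X^{2N}$ the relation expresses a multiple of $z$, by a factor at least [delta] in
    modulus, through terms that are small for a small radius or at least quadratic in $z$. The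
    truncations of $z$ then stay bounded, with a bound depending only on [D], [N], [A] and
    [delta]. *)
Lemma hensel_bound (D N : nat) (A delta : R) : 0 <= A -> 0 < delta ->
  exists2 B, 1 <= B & forall (q : 'I_D.+1 -> {poly R}) (a : nat -> R),
  (forall e, pnorm 1 (q e) <= A) -> (forall i, (i <= N)%N -> `|a i| <= A) ->
  (forall m i, (i <= m)%N -> (\sum_e q e * (\poly_(j < m.+1) a j) ^+ e)`_i = 0) ->
  (forall i, (i < N)%N -> (\sum_e q e * (\poly_(j < N.+1) a j) ^+ e.-1 *+ e)`_i = 0) ->
  delta <= `|(\sum_e q e * (\poly_(j < N.+1) a j) ^+ e.-1 *+ e)`_N| ->
  forall i, `|a i| <= B ^+ i.+1.
Proof.
move=> A0 d0; pose A1 := N.+1%:R * A.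
have A10 : 0 <= A1 by rewrite mulr_ge0.
(* [E] bounds the Taylor coefficients [Q k] of the relation at [tau], and [eta] is the bound on [z]
   to be preserved. It is so small that the terms of degree at least 2 in [z] take up at most a
   third of [delta * eta]; the radius [s] is then chosen so that the constant and the linear term
   take up at most a third each. *)
pose E : R := D.+1%:R * (A * (2 ^+ D * (1 + A1) ^+ D)) + 1.
have E1 : 1 <= E by rewrite lerDr !mulr_ge0 ?exprn_ge0 // addr_ge0.
have E0 : 0 < E by lra.
have DE0 : 0 < D.+1%:R * E by rewrite mulr_gt0 // ltr0n.
pose eta := Num.min 1 (delta / 3 / (D.+1%:R * E)).
have eta0 : 0 < eta by rewrite lt_min ltr01 !divr_gt0.
have eta1 : eta <= 1 by rewrite ge_min lexx.
have etaE : D.+1%:R * E * eta <= delta / 3.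
  by rewrite mulrC -ler_pdivlMr // ge_min lexx orbT.
pose s := Num.min 1 (delta * eta / 3 / E).
have s0 : 0 < s by rewrite lt_min ltr01 !divr_gt0 // mulr_gt0.
have s1 : s <= 1 by rewrite ge_min lexx.
have sE : s * E <= delta * eta / 3 by rewrite -ler_pdivlMr // ge_min lexx orbT.
have s0' := ltW s0.
exists (Num.max 1 (Num.max A s^-1)); first by rewrite le_max lexx.
set Bd := Num.max 1 _.
have B1 : 1 <= Bd by rewrite le_max lexx.
have BA : A <= Bd by rewrite !le_max lexx orbT.
have Bs : s^-1 <= Bd by rewrite !le_max lexx !orbT.
move=> q a qA aA rel ord0' ordN.
have D0 : (0 < D)%N.
  rewrite lt0n; apply/eqP => D0; move: ordN; rewrite leNgt => /negP; apply.
  rewrite big1 ?coef0 ?normr0 // => e _.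
  have /eqP -> : nat_of_ord e == 0%N by rewrite -leqn0 -D0 -ltnS ltn_ord.
  by rewrite mulr0n.
pose tau : {poly R} := \poly_(j < N.+1) a j.
pose z M : {poly R} := \poly_(i < M.+1) (if i == 0%N then 0 else a (N + i)%N).
have ntau : pnorm 1 tau <= A1.
  rewrite (@pnorm_widen _ N.+1) ?size_poly //.
  apply: le_trans (_ : \sum_(i < N.+1) A <= _).
    by apply: ler_sum => i _; rewrite expr1n mulr1 coef_poly ltn_ord aA // -ltnS.
  by rewrite sumr_const card_ord -mulr_natl.
pose Q k := \sum_(e < D.+1) q e * (tau ^+ (e - k) *+ 'C(e, k)).
have nQ k : pnorm 1 (Q k) <= E.
  apply: le_trans (pnorm_sum _ _ _ ler01) _; rewrite /E.
  apply: le_trans (_ : \sum_(e < D.+1) (A * (2 ^+ D * (1 + A1) ^+ D)) <= _); last first.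
    by rewrite sumr_const card_ord -[X in X <= _]mulr_natl lerDl.
  apply: ler_sum => e _; apply: le_trans (pnormM _ _ ler01) _.
  apply: ler_pM; rewrite ?pnorm_ge0 //.
  rewrite -mulr_natl -polyC_natr pnormCM ger0_norm //.
  apply: ler_pM => //; first by rewrite pnorm_ge0.
    rewrite -natrX ler_nat; apply: leq_trans (_ : 2 ^ e <= _)%N.
      have [ke|ek] := leqP k e; last by rewrite bin_small.
      rewrite -[2%N]/(1 + 1)%N expnDn (bigD1 (Ordinal (ke : (k < e.+1)%N))) //= !exp1n !muln1.
      exact: leq_addr.
    by rewrite leq_exp2l // -ltnS.
  apply: le_trans (pnormX_le _ _ ler01) _.
  apply: le_trans (_ : (1 + A1) ^+ (e - k) <= _).
    by rewrite lerXn2r ?nnegrE ?pnorm_ge0 ?addr_ge0 //; apply: le_trans ntau _; rewrite lerDr.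
  by rewrite ler_weXn2l ?lerDl // (leq_trans (leq_subr _ _)) // -ltnS.
have Q1E : Q 1%N = \sum_e q e * tau ^+ e.-1 *+ e.
  by apply: eq_bigr => e _; rewrite bin1 subn1 mulrnAr.
pose u := \poly_(i < size (Q 1%N)) (Q 1%N)`_(N + i).
have Q1u : Q 1%N = 'X^N * u.
  apply/polyP => i; rewrite coefXnM; case: ltnP => [iN|Ni].
    by rewrite Q1E ord0'.
  rewrite coef_poly subnKC //; case: ltnP => // h; rewrite nth_default //.
  by apply: leq_trans h _; exact: leq_subr.
have u0 : u`_0 = (Q 1%N)`_N.
  rewrite coef_poly addn0; case: ltnP => //; rewrite leqn0 => /eqP h.
  by rewrite nth_default // h.
set del := u`_0 in u0.
have deld : delta <= `|del| by rewrite u0 Q1E.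
pose u' := u - del%:P.
have u'0 : u'`_0 = 0 by rewrite coefB coefC /= subrr.
have nu' : pnorm s u' <= s * E.
  apply: le_trans (_ : s * pnorm 1 (Q 1%N) <= _); last by rewrite ler_pM2l.
  pose n := (size (Q 1%N)).+1.
  have su' : (size u' <= n)%N.
    apply: leq_trans (size_polyD _ _) _; rewrite geq_max size_polyN.
    by rewrite (leq_trans (size_poly _ _)) //= (leq_trans (size_polyC_leq1 _)).
  rewrite (pnorm_widen s su').
  rewrite (@pnorm_widen _ (N + n)); last by rewrite /n; clear; lia.
  rewrite big_split_ord /= mulrDr.
  apply: le_trans (_ : s * (\sum_(i < n) `|(Q 1%N)`_(N + i)| * 1 ^+ (N + i)) <= _); last first.
    rewrite lerDr mulr_ge0 //; apply: sumr_ge0 => i _; by rewrite mulr_ge0 // expr1n.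
  rewrite big_distrr /=; apply: ler_sum => i _.
  rewrite expr1n mulr1 mulrC; case: (posnP i) => [->|ipos].
    by rewrite u'0 normr0 mulr0 mulr_ge0.
  rewrite coefB coefC (gtn_eqF ipos) subr0 coef_poly.
  case: ifP => [_|/negbT]; last first.
    rewrite -leqNgt => h; rewrite normr0 mulr0 mulr_ge0 //.
  apply: ler_pM; rewrite ?exprn_ge0 //.
  by rewrite -[leRHS]expr1 ler_wiXn2l.
pose S k := 'X^(N * (k - 2)) * Q k.
have nS k : pnorm s (S k) <= E.
  apply: le_trans (pnormM _ _ s0') _; rewrite pnormXn.
  apply: le_trans (_ : 1 * pnorm s (Q k) <= _).
    by rewrite ler_wpM2r ?pnorm_ge0 // exprn_ile1.
  by rewrite mul1r; apply: le_trans (pnorm_le _ _ s1) _.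
have zsplit M : \poly_(j < (N + M).+1) a j = tau + 'X^N * z M.
  apply/polyP => i; rewrite coefD coefXnM !coef_poly !ltnS.
  have [iN|Ni] := ltnP i N.
    by rewrite addr0 (ltnW iN) (leq_trans (ltnW iN)) ?leq_addr.
  have -> : (i <= N + M)%N = (i - N <= M)%N by move: Ni; clear; lia.
  have [->|iN] := eqVneq i N; first by rewrite subnn leqnn addr0.
  have -> : (i <= N)%N = false by move: Ni iN; clear; lia.
  have -> : (i - N == 0)%N = false by move: Ni iN; clear; lia.
  by rewrite subnKC // add0r.
have expand M : \sum_e q e * (\poly_(j < (N + M).+1) a j) ^+ e =
    \sum_(k < D.+1) Q k * ('X^(N * k) * z M ^+ k).
  rewrite zsplit.
  transitivity (\sum_(e < D.+1) \sum_(k < D.+1) q e * (tau ^+ (e - k) *+ 'C(e, k)) * ('X^(N * k) * z M ^+ k)).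
    apply: eq_bigr => e _; rewrite exprDn big_distrr /=.
    rewrite (big_ord_widen D.+1 (fun k => q e * (tau ^+ (e - k) * ('X^N * z M) ^+ k *+ 'C(e, k)))) //.
    rewrite big_mkcond; apply: eq_bigr => k _; case: ifP => [_|/negbT].
      by rewrite exprMn -exprM -mulrA; congr (_ * _); rewrite -mulrnAl.
    by rewrite -leqNgt => h; rewrite bin_small // mulr0n mulr0 mul0r.
  by rewrite exchange_big; apply: eq_bigr => k _; rewrite -big_distrl.
have zz M i : (i <= M)%N -> (z M)`_i = if i == 0%N then 0 else a (N + i)%N.
  by move=> iM; rewrite coef_poly ltnS iM.
have z0 M : (z M)`_0 = 0 by rewrite zz.
(* As [z] has no constant term, the coefficients of order at most [M] of a power of exponent at
   least 2 only involve coefficients of [z] of order less than [M]. *)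
have powdiff M M' k : (0 < M)%N -> (M <= M'.+1)%N -> (M.-1 <= M')%N -> (1 < k)%N ->
    forall i, (i <= M)%N -> (z M' ^+ k)`_i = (z M.-1 ^+ k)`_i.
  move=> M0 _ MM' k1 i iM; apply/eqP; rewrite -subr_eq0 -coefB subrXX.
  apply/eqP; apply: (@coefM_low _ _ M) => // [l lM|].
    by rewrite coefB !zz ?subrr //; move: lM MM' M0; clear; lia.
  rewrite coef_sum big1 // => j _; rewrite coefM big_ord1 subnn.
  have [jk|jk] := ltnP j k.-1.
    have -> : (z M' ^+ (k.-1 - j))`_0 = 0; last by rewrite mul0r.
    by rewrite -horner_coef0 horner_exp horner_coef0 z0 expr0n subn_eq0 leqNgt jk.
  have -> : (z M.-1 ^+ j)`_0 = 0; last by rewrite mulr0.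
  rewrite -horner_coef0 horner_exp horner_coef0 z0 expr0n.
  have -> : (nat_of_ord j == 0%N) = false by move: jk k1; clear; lia.
  by [].
have main M : pnorm s (z M) <= eta.
  elim: M => [|M IH].
    rewrite (_ : z 0%N = 0) ?pnorm0 ?ltW //; apply/polyP => i.
    by rewrite coef_poly coef0; case: i.
  set y := z M in IH.
  pose Q0s := \poly_(i < size (Q 0%N)) (if i == 0%N then 0 else (Q 0%N)`_(N + N + i)).
  (* This is the coefficient of order $2N+i$ of the relation, in which [z M.+1] only occurs through
     the leading coefficient [del]. *)
  have eqn i : (0 < i <= M.+1)%N -> del * (z M.+1)`_i =
      - (Q0s`_i + (u' * y)`_i + \sum_(k < D.+1 | (1 < k)%N) (S k * y ^+ k)`_i).
    move=> /andP[i0 iM]; have := rel (N + (N + M.+1))%N (N + N + i)%N ltac:(by rewrite -addnA leq_add2l leq_add2l).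
    rewrite expand coef_sum.
    have zi : (z (N + M.+1)%N)`_i = (z M.+1)`_i by rewrite !zz //; move: iM; clear; lia.
    have h0 : (Q 0%N)`_(N + N + i) = Q0s`_i.
      rewrite coef_poly (gtn_eqF i0); case: ltnP => // h.
      by rewrite nth_default // (leq_trans h) // leq_addl.
    have h1 : ('X^(N + N) * (u * z (N + M.+1)))`_(N + N + i) = del * (z M.+1)`_i + (u' * y)`_i.
      rewrite coefXnM ltnNge leq_addr /= addKn.
      have -> : u * z (N + M.+1) = del%:P * z (N + M.+1) + u' * y + (z (N + M.+1) - y) * u'.
        by rewrite /u'; ring.
      rewrite !coefD coefCM zi [X in _ + X](@coefM_low _ _ M.+1) ?addr0 // => l lM.
      by rewrite coefB !zz ?subrr //; move: lM; clear; lia.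
    have hk (k : nat) : (1 < k)%N -> (Q k * ('X^(N * k) * z (N + M.+1) ^+ k))`_(N + N + i) = (S k * y ^+ k)`_i.
      move=> k1; have -> : Q k * ('X^(N * k) * z (N + M.+1) ^+ k) = 'X^(N + N) * (S k * z (N + M.+1) ^+ k).
        rewrite /S !mulrA -exprD [Q k * _]mulrC; congr (_ * _ * _).
        congr ('X^_); move: k1; clear; nia.
      rewrite coefXnM ltnNge leq_addr /= addKn !coefM.
      apply: eq_bigr => j _; congr (_ * _).
      by rewrite (@powdiff M.+1) //; have := ltn_ord j; move: iM; clear; lia.
    move=> hs; apply/eqP; rewrite -addr_eq0; apply/eqP; rewrite -[RHS]hs.
    rewrite [RHS](bigID (fun k : 'I_D.+1 => (1 < k)%N)) /=.
    rewrite [X in _ = X + _](eq_bigr (fun k : 'I_D.+1 => (S k * y ^+ k)`_i)); last by move=> k /hk.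
    rewrite (sum_le1 (fun k => (Q k * ('X^(N * k) * z (N + M.+1)%N ^+ k))`_(N + N + i)) D0).
    rewrite muln0 !expr0 !mulr1 h0 muln1 expr1 Q1u.
    have -> : 'X^N * u * ('X^N * z (N + M.+1)%N) = 'X^(N + N) * (u * z (N + M.+1)%N).
      by rewrite exprD; ring.
    by rewrite h1; ring.
  have nQ0s : pnorm s Q0s <= s * E.
    apply: le_trans (_ : s * pnorm 1 (Q 0%N) <= _); last by rewrite ler_pM2l.
    rewrite (@pnorm_widen _ (size (Q 0%N))) ?size_poly //.
    rewrite (@pnorm_widen _ (N + N + size (Q 0%N))%N) ?leq_addl //.
    rewrite big_split_ord /= mulrDr.
    apply: le_trans (_ : s * (\sum_(l < size (Q 0%N)) `|(Q 0%N)`_(N + N + l)| * 1 ^+ (N + N + l)) <= _); last first.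
      by rewrite lerDr mulr_ge0 //; apply: sumr_ge0 => l _; rewrite mulr_ge0 // expr1n.
    rewrite big_distrr /=; apply: ler_sum => l _.
    rewrite expr1n mulr1 mulrC coef_poly ltn_ord; case: (posnP l) => [l0|lpos].
      by rewrite normr0 mulr0 mulr_ge0.
    apply: ler_pM; rewrite ?exprn_ge0 //.
    by rewrite -[leRHS]expr1 ler_wiXn2l.
  have y1 : pnorm s y <= 1 by exact: le_trans IH eta1.
  have ny k : (1 < k)%N -> pnorm s (y ^+ k) <= eta ^+ 2.
    move=> k1; apply: le_trans (pnormX_le _ _ s0') _.
    apply: le_trans (_ : eta ^+ k <= _).
      by rewrite lerXn2r ?nnegrE ?pnorm_ge0 // ltW.
    by rewrite ler_wiXn2l // ltW.
  have step : delta * pnorm s (z M.+1) <= pnorm s Q0s + pnorm s (u' * y) +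
      \sum_(k < D.+1 | (1 < k)%N) pnorm s (S k * y ^+ k).
    rewrite (@pnorm_widen _ M.+2 _ (z M.+1)) ?size_poly // big_distrr /=.
    apply: le_trans (_ : \sum_(i < M.+2) (`|Q0s`_i| * s ^+ i + `|(u' * y)`_i| * s ^+ i +
        \sum_(k < D.+1 | (1 < k)%N) `|(S k * y ^+ k)`_i| * s ^+ i) <= _).
      apply: ler_sum => i _; case: (posnP i) => [i0|ipos].
        rewrite i0 z0 normr0 mul0r mulr0 addr_ge0 ?addr_ge0 ?mulr_ge0 ?exprn_ge0 //.
        by apply: sumr_ge0 => k _; rewrite mulr_ge0 ?exprn_ge0.
      rewrite -big_distrl /= -!mulrDl mulrA ler_wpM2r ?exprn_ge0 //.
      apply: le_trans (_ : `|del * (z M.+1)`_i| <= _); first by rewrite normrM ler_wpM2r.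
      rewrite eqn; last by rewrite ipos -ltnS ltn_ord.
      rewrite normrN; apply: le_trans (ler_normD _ _) _; apply: lerD; first exact: ler_normD.
      exact: ler_norm_sum.
    rewrite big_split big_split /=; apply: lerD; first by apply: lerD; apply: sum_coef_le_pnorm.
    by rewrite exchange_big; apply: ler_sum => k _; apply: sum_coef_le_pnorm.
  rewrite -(ler_pM2l d0); apply: le_trans step _.
  have h1 : pnorm s (u' * y) <= s * E.
    apply: le_trans (pnormM _ _ s0') _; rewrite -[leRHS]mulr1.
    by apply: ler_pM; rewrite ?pnorm_ge0.
  have h2 : \sum_(k < D.+1 | (1 < k)%N) pnorm s (S k * y ^+ k) <= D.+1%:R * E * eta ^+ 2.
    apply: le_trans (_ : \sum_(k < D.+1) E * eta ^+ 2 <= _); last first.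
      by rewrite sumr_const card_ord -[X in X <= _]mulr_natl mulrA.
    rewrite big_mkcond; apply: ler_sum => k _; case: ifP => [k1|_]; last first.
      by rewrite mulr_ge0 ?exprn_ge0 // ltW.
    by apply: le_trans (pnormM _ _ s0') _; apply: ler_pM; rewrite ?pnorm_ge0 // ny.
  have h3 : D.+1%:R * E * eta ^+ 2 <= delta / 3 * eta.
    by rewrite expr2 mulrA ler_pM2r.
  have -> : delta * eta = delta * eta / 3 + delta * eta / 3 + delta / 3 * eta by field.
  by apply: lerD; [apply: lerD; [exact: le_trans nQ0s sE|exact: le_trans h1 sE]|exact: le_trans h2 h3].
move=> i; have [iN|Ni] := leqP i N.
  apply: le_trans (aA i iN) _; apply: le_trans BA _.
  by rewrite -{1}[Bd]expr1 ler_weXn2l.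
have := pnorm_coef (z (i - N)%N) (i - N)%N s0'; rewrite zz //.
have -> : (i - N == 0)%N = false by move: Ni; clear => *; lia.
rewrite subnKC ?(ltnW Ni) // => h.
have {}h : `|a i| * s ^+ (i - N) <= 1 by apply: le_trans h _; exact: le_trans (main _) eta1.
apply: le_trans (_ : s^-1 ^+ (i - N) <= _).
  by rewrite exprVn -[leRHS]mul1r ler_pdivlMr ?exprn_gt0.
apply: le_trans (_ : Bd ^+ (i - N) <= _).
  by rewrite lerXn2r ?nnegrE ?invr_ge0 // (le_trans ler01).
by rewrite ler_weXn2l // (leq_trans (leq_subr _ _)).
Qed.

End Hensel.

(** * Polynomial functions *)

(** A predicate on functions instead of a type of polynomials: it is stable under compositions and
    restrictions, and an upper bound for the degree is all that is recorded. *)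
Inductive polyf (R : realType) (n : nat) : nat -> ('rV[R]_n -> R) -> Prop :=
| polyf_cst c : polyf 0 (fun=> c)
| polyf_coord i : polyf 1 (fun x => x 0 i)
| polyfD D f g : polyf D f -> polyf D g -> polyf D (fun x => f x + g x)
| polyfM D E f g : polyf D f -> polyf E g -> polyf (D + E) (fun x => f x * g x)
| polyf_le D E f : (D <= E)%N -> polyf D f -> polyf E f.

Lemma near_all_seq (T : Type) (F : set_system T) {FF : Filter F} (I : eqType) (r : seq I)
    (P : I -> T -> Prop) :
  (forall j, j \in r -> \forall y \near F, P j y) ->
  \forall y \near F, forall j, j \in r -> P j y.
Proof.
elim: r => [|j r IH] H; first exact: filterE.
apply: filterS2 (H j (mem_head _ _)) (IH _) => [y h1 h2 k|k kr]; last first.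
  by apply: H; rewrite inE kr orbT.
by rewrite inE => /orP[/eqP ->|kr] //; exact: h2.
Qed.

Section Polyf.
Variable R : realType.

Lemma polyf_ext n D (f g : 'rV[R]_n -> R) : f =1 g -> polyf D f -> polyf D g.
Proof. by move=> /funext ->. Qed.

Lemma polyfZ n D (c : R) (f : 'rV[R]_n -> R) : polyf D f -> polyf D (fun x => c * f x).
Proof. by move=> pf; rewrite -(add0n D); apply: polyfM => //; apply: polyf_cst. Qed.

Lemma polyfN n D (f : 'rV[R]_n -> R) : polyf D f -> polyf D (fun x => - f x).
Proof. by move=> /(polyfZ (-1)); apply: polyf_ext => x; rewrite mulN1r. Qed.

Lemma polyfB n D (f g : 'rV[R]_n -> R) : polyf D f -> polyf D g -> polyf D (fun x => f x - g x).
Proof. by move=> pf /polyfN; apply: polyfD. Qed.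

Lemma polyf_cst_le n D (c : R) : @polyf R n D (fun=> c).
Proof. by apply: (@polyf_le _ _ 0) => //; apply: polyf_cst. Qed.

Lemma polyf_sum n D (I : Type) (r : seq I) (P : pred I) (f : I -> 'rV[R]_n -> R) :
  (forall i, P i -> polyf D (f i)) -> polyf D (fun x => \sum_(i <- r | P i) f i x).
Proof.
move=> H; elim: r => [|i r IH].
  by under eq_fun do rewrite big_nil; exact: polyf_cst_le.
under eq_fun do rewrite big_cons; case: (boolP (P i)) => // Pi.
by apply: polyfD => //; exact: H.
Qed.

Lemma polyfX n D k (f : 'rV[R]_n -> R) : polyf D f -> polyf (k * D) (fun x => f x ^+ k).
Proof.
move=> pf; elim: k => [|k IH]; first exact: polyf_cst.
by under eq_fun do rewrite exprS; rewrite mulSn; apply: polyfM.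
Qed.

Lemma polyf_prod n D (I : Type) (r : seq I) (f : I -> 'rV[R]_n -> R) :
  (forall i, polyf D (f i)) -> polyf (size r * D) (fun x => \prod_(i <- r) f i x).
Proof.
move=> H; elim: r => [|i r IH].
  by under eq_fun do rewrite big_nil; exact: polyf_cst.
by under eq_fun do rewrite big_cons; rewrite /= mulSn; apply: polyfM.
Qed.

Lemma polyf_comp n m D E (f : 'rV[R]_n -> R) (g : 'rV[R]_m -> 'rV[R]_n) :
  polyf D f -> (forall i, polyf E (fun u => g u 0 i)) -> polyf (D * E) (fun u => f (g u)).
Proof.
move=> pf pg; elim: pf => {D f} [c|i|D f h _ IH1 _ IH2|D D' f h _ IH1 _ IH2|D D' f DD' _ IH].
- exact: polyf_cst_le.
- by rewrite mul1n.
- exact: polyfD.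
- by rewrite mulnDl; apply: polyfM.
- by apply: polyf_le IH; rewrite leq_mul2r DD' orbT.
Qed.

Lemma polyf_mulmx n m (A : 'M[R]_(n, m)) j : polyf 1 (fun u : 'rV[R]_n => (u *m A) 0 j).
Proof.
under eq_fun do rewrite mxE; apply: polyf_sum => i _.
by under eq_fun do rewrite mulrC; apply: polyfZ; apply: polyf_coord.
Qed.

Lemma polyf_continuous n D (f : 'rV[R]_n -> R) : polyf D f -> continuous f.
Proof.
elim => {D f} [c|i|D f h _ IH1 _ IH2|D D' f h _ IH1 _ IH2|//] x.
- exact: cst_continuous.
- exact: coord_continuous.
- by apply: continuousD; [exact: IH1|exact: IH2].
- by apply: continuousM; [exact: IH1|exact: IH2].
Qed.

Lemma polyf_line n D (f : 'rV[R]_n -> R) : polyf D f -> forall x v,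
  exists2 q : {poly R}, (size q <= D.+1)%N & forall t, f (x + t *: v) = q.[t].
Proof.
move=> pf x v; elim: pf => {D f} [c|i|D f h _ IH1 _ IH2|D D' f h _ IH1 _ IH2|D D' f DD' _ IH].
- by exists c%:P => [|t]; rewrite ?hornerC ?size_polyC_leq1.
- exists ((x 0 i)%:P + v 0 i *: 'X) => [|t].
    rewrite (leq_trans (size_polyD _ _)) // geq_max (leq_trans (size_polyC_leq1 _)) //.
    by rewrite (leq_trans (size_scale_leq _ _)) // size_polyX.
  by rewrite !hornerE !mxE mulrC.
- have [q sq qE] := IH1; have [r sr rE] := IH2; exists (q + r) => [|t].
    by rewrite (leq_trans (size_polyD _ _)) // geq_max sq sr.
  by rewrite hornerD qE rE.
- have [q sq qE] := IH1; have [r sr rE] := IH2; exists (q * r) => [|t].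
    rewrite (leq_trans (size_polyMleq _ _)) //; move: sq sr; clear; lia.
  by rewrite hornerM qE rE.
- by have [q sq qE] := IH; exists q => //; apply: leq_trans sq _.
Qed.

Lemma polyf_graded n D (f : 'rV[R]_n -> R) : polyf D f ->
  exists H : nat -> 'rV[R]_n -> R, (forall m, polyf m (H m)) /\
    forall t v, f (t *: v) = \sum_(m < D.+1) H m v * t ^+ m.
Proof.
(* For products the homogeneous parts are convolved. This requires the parts beyond the degree to
   vanish, which is therefore added to the induction. *)
suff S : polyf D f -> exists H : nat -> 'rV[R]_n -> R, [/\ forall m, polyf m (H m),
    forall m v, (D < m)%N -> H m v = 0 & forall t v, f (t *: v) = \sum_(m < D.+1) H m v * t ^+ m].
  by move=> /S[H [? _ ?]]; exists H.
elim => {D f} [c|i|D f h _ IH1 _ IH2|D D' f h _ IH1 _ IH2|D D' f DD' _ IH].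
- exists (fun m => if m == 0%N then fun=> c else fun=> 0); split => [m|[|m] v //|t v].
    by case: ifP => _; apply: polyf_cst_le.
  by rewrite big_ord1 mulr1.
- exists (fun m => if m == 1%N then fun x => x 0 i else fun=> 0); split => [m|[|[|m]] v //|t v].
    by case: eqP => [->|_]; [apply: polyf_coord|apply: polyf_cst_le].
  by rewrite !big_ord_recl big_ord0 /= !mxE; ring.
- have [H1 [p1 z1 e1]] := IH1; have [H2 [p2 z2 e2]] := IH2.
  exists (fun m x => H1 m x + H2 m x); split => [m|m v Dm|t v].
  + exact: polyfD.
  + by rewrite z1 // z2 // addr0.
  + by rewrite e1 e2 -big_split; apply: eq_bigr => m _; rewrite mulrDl.
- have [H1 [p1 z1 e1]] := IH1; have [H2 [p2 z2 e2]] := IH2.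
  exists (fun m x => \sum_(j < m.+1) H1 j x * H2 (m - j)%N x); split => [m|m v Dm|t v].
  + apply: polyf_sum => j _; apply: (@polyf_le _ _ (j + (m - j))); last exact: polyfM.
    by rewrite subnKC // -ltnS.
  + apply: big1 => j _; have [jD|Dj] := leqP j D; last by rewrite z1 // mul0r.
    by rewrite z2 ?mulr0 //; move: Dm jD; clear; lia.
  + have toP N (G : nat -> R) : \sum_(m < N) G m * t ^+ m = (\poly_(m < N) G m).[t].
      by rewrite horner_poly.
    rewrite e1 e2 (toP _ (H1 ^~ v)) (toP _ (H2 ^~ v)) -hornerM.
    rewrite (toP _ (fun m => \sum_(j < m.+1) H1 j v * H2 (m - j)%N v)).
    congr (_.[t]); apply/polyP => m; rewrite coef_poly coefM.
    have S : \sum_(j < m.+1) (\poly_(m < D.+1) H1 m v)`_j * (\poly_(m < D'.+1) H2 m v)`_(m - j) =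
        \sum_(j < m.+1) H1 j v * H2 (m - j)%N v.
      apply: eq_bigr => j _; rewrite !coef_poly.
      case: ltnP => [_|h1]; last by rewrite z1 // !mul0r.
      by case: ltnP => [_|h2] //; rewrite z2 // !mulr0.
    rewrite S; case: ltnP => // DDm; apply: big1 => j _.
    have [jD|Dj] := leqP j D; last by rewrite z1 // mul0r.
    by rewrite z2 ?mulr0 //; move: DDm jD; clear; lia.
- have [H [p z e]] := IH; exists H; split => // [m v Dm|t v].
    by apply: z; apply: leq_ltn_trans Dm.
  rewrite e (big_ord_widen D'.+1 (fun m => H m v * t ^+ m)) // big_mkcond.
  apply: eq_bigr => m _; case: ifP => // /negbT; rewrite -leqNgt => h.
  by rewrite z // mul0r.
Qed.

Lemma poly_eq0_interval (q : {poly R}) (a h : R) : 0 < h ->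
  (forall t, a <= t <= a + h -> q.[t] = 0) -> q = 0.
Proof.
move=> h0 q0; apply: (@pnorm_eq0 _ 1) => //; apply/eqP; rewrite eq_le pnorm_ge0 // andbT.
have := @pnorm_le_of_interval _ (size q).+1 q a h 1 0 isT (leqW (leqnSn _)) h0 ler01.
by rewrite mul0r; apply => t ht; rewrite q0 // normr0.
Qed.

Lemma poly_nonzero_near (q : {poly R}) (h : R) : 0 < h -> q != 0 ->
  exists2 t, 0 <= t <= h & q.[t] != 0.
Proof.
move=> h0 q0; apply: contrapT => H; case/eqP: q0; apply: (@poly_eq0_interval _ 0 h) => // t.
rewrite add0r => th; apply/eqP; apply: contrapT => /negP qt; apply: H; by exists t.
Qed.

(** On the line through [x] and [x0] the restriction is a nonzero polynomial in one variable, hence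
    nonzero at parameters arbitrarily close to 0. *)
Lemma polyf_dense n D (f : 'rV[R]_n -> R) x0 : polyf D f -> f x0 != 0 ->
  forall x e, 0 < e -> exists2 y, `|y - x| < e & f y != 0.
Proof.
move=> pf fx0 x e e0; have [q sq qE] := polyf_line pf x (x0 - x).
have q0 : q != 0.
  apply: contraNneq fx0 => q0; have := qE 1.
  by rewrite q0 horner0 scale1r addrC subrK => ->.
have c0 : 0 < 1 + `|x0 - x| by rewrite ltr_wpDr.
have h0 : 0 < e / 2 / (1 + `|x0 - x|) by rewrite !divr_gt0.
have [t /andP[t0 th] qt] := poly_nonzero_near h0 q0.
exists (x + t *: (x0 - x)); last by rewrite qE.
rewrite addrC addKr normrZ ger0_norm //.
move: th; rewrite ler_pdivlMr // => th.
apply: le_lt_trans (_ : e / 2 < _); last by lra.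
by apply: le_trans th; rewrite ler_wpM2l // lerDr.
Qed.

Lemma near_sg (T : topologicalType) (f : T -> R) (x : T) : {for x, continuous f} -> f x != 0 ->
  \forall y \near x, Num.sg (f y) = Num.sg (f x).
Proof.
move=> fc fx; have fx0 : 0 < `|f x| by rewrite normr_gt0.
have /cvgrPdist_lt /(_ _ fx0) := fc; apply: filterS => y.
have [x0|x0|x0] := ltrgtP 0 (f x); last by rewrite -x0 eqxx in fx.
  by rewrite (gtr0_norm x0) ltr_norml => ?; rewrite !gtr0_sg //; lra.
by rewrite (ltr0_norm x0) ltr_norml => ?; rewrite !ltr0_sg //; lra.
Qed.

(** Nonvanishing of the functions already treated is an open condition, and the points where the
    next one does not vanish are dense. *)
Lemma polyf_prod_neq0 n D (I : eqType) (r : seq I) (f : I -> 'rV[R]_n -> R) :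
  (forall i, i \in r -> polyf D (f i) /\ exists x, f i x != 0) ->
  exists x, forall i, i \in r -> f i x != 0.
Proof.
elim: r => [|i r IH] H; first by exists 0.
have [|x xP] := IH; first by move=> j jr; apply: H; rewrite inE jr orbT.
have nbx : \forall y \near x, forall j, j \in r -> f j y != 0.
  have : forall j, j \in r -> \forall y \near x, f j y != 0.
    move=> j jr; have [pj _] := H j ltac:(by rewrite inE jr orbT).
    have pc : {for x, continuous (f j)} by exact: (polyf_continuous pj).
    have := near_sg pc (xP j jr); apply: filterS => y sy.
    by rewrite -sgr_eq0 sy sgr_eq0 xP.
  exact: (@near_all_seq _ (nbhs x) _ _ r (fun j y => f j y != 0)).
have [pi [xi fi]] := H i (mem_head _ _).
move: nbx => /nbhs_ballP[e /= e0 He].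
have [y yx fy] := polyf_dense pi fi x e0.
exists y => j; rewrite inE => /orP[/eqP -> //|jr]; apply: He => //.
by rewrite -ball_normE /= distrC.
Qed.

End Polyf.

(** * Taylor expansions and charts of submanifolds *)

Section Line.
Variable R : realType.

Lemma is_derive_line n (g : 'rV[R]_n -> R) x v s dg :
  is_derive (x + s *: v) v g dg -> is_derive s 1 (fun s => g (x + s *: v)) dg.
Proof.
move=> [ex val].
have E : (fun h : R => h^-1 *: (((fun s => g (x + s *: v)) \o shift s) (h *: 1) - g (x + s *: v))) =
         (fun h : R => h^-1 *: ((g \o shift (x + s *: v)) (h *: v) - g (x + s *: v))).
  apply/funext => h /=; congr (_ *: (g _ - _)).
  by rewrite scalerDl addrCA /GRing.scale /= mulr1.
by split; rewrite /derivable /derive E.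
Qed.

Lemma mvt_bound (h dh : R -> R) (a b E : R) :
  (forall s, Num.min a b <= s <= Num.max a b -> is_derive s 1 h (dh s)) ->
  (forall s, Num.min a b <= s <= Num.max a b -> `|dh s| <= E) ->
  `|h b - h a| <= E * `|b - a|.
Proof.
suff S (a' b' : R) : a' <= b' -> (forall s : R, a' <= s <= b' -> is_derive s 1 h (dh s)) ->
    (forall s : R, a' <= s <= b' -> `|dh s| <= E) -> `|h b' - h a'| <= E * `|b' - a'|.
  by case: (leP a b) => ab; [|rewrite distrC [`|b - a|]distrC => *]; apply: S => //; exact: ltW.
move=> ab hd hE.
have hc : {within `[a', b'], continuous h}.
  by apply: derivable_within_continuous => s; rewrite in_itv /= => /hd[].
have [|s sab ->] := MVT_segment (df := dh) ab _ hc.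
  by move=> s; rewrite in_itv /= => /andP[s1 s2]; apply: hd; rewrite (ltW s1) (ltW s2).
by rewrite normrM ler_wpM2r // hE // -in_itv.
Qed.

(** The derivative of the remainder is the remainder, of order one less, of the derivative; so each
    induction step is a mean value estimate. *)
Lemma taylor_bound (N : nat) (hs : nat -> R -> R) (r M : R) : 0 <= M ->
  (forall j (s : R), `|s| <= r -> is_derive s 1 (hs j) (hs j.+1 s)) ->
  (forall s : R, `|s| <= r -> `|hs N s| <= M) ->
  forall s : R, `|s| <= r -> `|hs 0%N s - \sum_(j < N) hs j 0 / j`!%:R * s ^+ j| <= M * `|s| ^+ N.
Proof.
move=> M0; elim: N hs => [|N IH] hs hd hM s sr.
  by rewrite big_ord0 subr0 expr0 mulr1 hM.
have r0 : 0 <= r by apply: le_trans sr.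
pose P : {poly R} := \poly_(j < N.+1) (hs j 0 / j`!%:R).
have PE t : \sum_(j < N.+1) hs j 0 / j`!%:R * t ^+ j = P.[t] by rewrite horner_poly.
have dPE t : P^`().[t] = \sum_(j < N) hs j.+1 0 / j`!%:R * t ^+ j.
  rewrite (@horner_coef_wide _ N); last first.
    by apply/leq_sizeP => i Ni; rewrite coef_deriv coef_poly ltnS ltnNge Ni mul0rn.
  apply: eq_bigr => j _; rewrite coef_deriv coef_poly ltnS ltn_ord factS natrM.
  rewrite -mulr_natr; congr (_ * _); field.
  by rewrite nat1r !pnatr_eq0 -lt0n fact_gt0.
rewrite PE; pose G t := hs 0%N t - P.[t]; pose dG t := hs 1%N t - P^`().[t].
have G0 : G 0 = 0.
  by rewrite /G -PE big_ord_recl big1 => [|j _]; rewrite ?expr0 ?fact0 ?expr0n ?mulr0 //=; field.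
have hb t : Num.min 0 s <= t <= Num.max 0 s -> `|t| <= `|s|.
  by case: (leP 0 s) => s0 /andP[h1 h2]; [rewrite !ger0_norm|rewrite !ler0_norm]; lra.
have := @mvt_bound G dG 0 s (M * `|s| ^+ N) _ _; rewrite G0 !subr0 exprS.
rewrite [`|s| * _]mulrC mulrA; apply => t /hb ts.
  by apply: is_deriveB; apply: hd; exact: le_trans ts sr.
rewrite /dG dPE; apply: le_trans (IH (fun j => hs j.+1) (fun j t' ht' => hd j.+1 t' ht') hM t (le_trans ts sr)) _.
by rewrite ler_wpM2l // lerXn2r ?nnegrE.
Qed.

End Line.

Section Jets.
Variables (R : realType) (n : nat).
Implicit Types (U : set 'rV[R]_n) (f : seq 'rV[R]_n -> 'rV[R]_n -> R).

(** Iterated directional derivatives as a family indexed by lists, the head being the direction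
    differentiated last. No total differential and no symmetry of derivatives is built in. *)
Definition jet U f := open U /\ forall vs x, U x ->
  {for x, continuous (f vs)} /\ forall v, is_derive x v (f vs) (f (v :: vs) x).

Lemma smooth_jet U m (F : 'rV[R]_n -> 'rV[R]_m) j : open U -> smooth_on U F ->
  jet U (fun vs x => iter_derive vs F x 0 j).
Proof.
move=> oU sF; split => // vs x Ux; have [Fc Fd] := sF vs x Ux; split.
  exact: (continuous_comp Fc (@coord_continuous _ _ _ 0 j _)).
move=> v; have dF := Fd v; split; first by move/derivable_mxP : dF; apply.
by rewrite /= derive_mx // mxE.
Qed.

Lemma open_norm_ball U x : open U -> U x ->
  exists2 r : R, 0 < r & forall y, `|y| <= r -> U (x + y).
Proof.
move=> oU Ux; have /nbhs_ballP[r /= r0 rU] := open_nbhs_nbhs (conj oU Ux).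
exists (r / 2); first by lra.
by move=> y yr; apply: rU; rewrite -ball_normE /= opprD addrA subrr sub0r normrN; lra.
Qed.

Lemma continuous_ball (g : 'rV[R]_n -> R) x (e : R) : {for x, continuous g} -> 0 < e ->
  exists2 r : R, 0 < r & forall y, `|y| <= r -> `|g (x + y) - g x| <= e.
Proof.
move=> gc e0; have /cvgrPdist_le /(_ _ e0) /nbhs_ballP [r /= r0 H] := gc.
exists (r / 2); first by lra.
move=> y yr; rewrite distrC; apply: H.
by rewrite -ball_normE /= opprD addrA subrr sub0r normrN; lra.
Qed.

(* Going from [y] to [y'] by changing one coordinate at a time. *)
Lemma coord_lipschitz (g : 'rV[R]_n -> R) (dg : 'I_n -> 'rV[R]_n -> R) x (r E : R) :
  (forall i z, `|z| <= r -> is_derive (x + z) (axis R i) g (dg i (x + z))) ->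
  (forall i z, `|z| <= r -> `|dg i (x + z)| <= E) ->
  forall y y', `|y| <= r -> `|y'| <= r -> `|g (x + y) - g (x + y')| <= n%:R * E * `|y - y'|.
Proof.
move=> gd gE y y' yr y'r; have r0 : 0 <= r by apply: le_trans yr.
pose z k : 'rV[R]_n := \row_i (if (i < k)%N then y 0 i else y' 0 i).
have z0 : z 0%N = y' by apply/rowP => i; rewrite mxE.
have zn : z n = y by apply/rowP => i; rewrite mxE ltn_ord.
have step (k : 'I_n) : `|g (x + z k.+1) - g (x + z k)| <= E * `|y - y'|.
  pose w t : 'rV[R]_n := z k + t *: axis R k.
  have w0 : w 0 = z k by rewrite /w scale0r addr0.
  have w1 : w (y 0 k - y' 0 k) = z k.+1.
    apply/rowP => i; rewrite axis_line !mxE ltnS.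
    case: (eqVneq i k) => [->|ik]; first by rewrite ltnn leqnn addrC subrK.
    by rewrite [in RHS]leq_eqVlt (_ : (nat_of_ord i == k) = false) //; apply: negbTE.
  pose a := y 0 k - y' 0 k.
  have wr t : Num.min 0 a <= t <= Num.max 0 a -> `|w t| <= r.
    move=> ta; apply: norm_le_coord => // i; rewrite axis_line !mxE.
    have hy := le_trans (coord_le_norm y i) yr; have hy' := le_trans (coord_le_norm y' i) y'r.
    case: (eqVneq i k) => [ik|_]; last by case: ifP.
    rewrite ltnn; rewrite ik in hy hy'.
    by move: ta hy hy'; rewrite /a !ler_norml; case: (leP 0 (y 0 k - y' 0 k)) => ?; lra.
  have := @mvt_bound _ (fun t => g (x + w t)) (fun t => dg k (x + w t)) 0 a E _ _.
  rewrite w0 w1 subr0 => H; apply: le_trans (H _ _) _.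
  - move=> t /wr tr; rewrite /w.
    have -> : (fun t : R => g (x + (z k + t *: axis R k))) = (fun t => g ((x + z k) + t *: axis R k)).
      by apply/funext => s; rewrite addrA.
    by apply: is_derive_line; rewrite -addrA; apply: gd.
  - by move=> t /wr tr; apply: gE.
  - apply: ler_wpM2l; last exact: coord_diff_le_norm.
    by apply: le_trans (gE k 0 _); rewrite ?normr0.
rewrite -zn -z0 -[x in x <= _]/(`|_|).
have -> : g (x + z n) - g (x + z 0%N) = \sum_(k < n) (g (x + z k.+1) - g (x + z k)).
  by rewrite -(big_mkord xpredT (fun k => g (x + z k.+1) - g (x + z k))) telescope_sumr.
apply: le_trans (ler_norm_sum _ _ _) _; rewrite zn z0.
apply: le_trans (_ : \sum_(k < n) E * `|y - y'| <= _); first exact: ler_sum.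
by rewrite sumr_const card_ord -[X in X <= _]mulr_natl mulrA.
Qed.

(** Polynomial approximation to every order at one point. In this form smoothness passes to implicit
    functions by iterating an equation, without differentiating it. *)
Definition taylorable m (f : 'rV[R]_m -> R) x := forall N, exists D (tau : 'rV[R]_m -> R) (C r : R),
  [/\ polyf D tau, 0 < r & forall v, `|v| <= r -> `|f (x + v) - tau v| <= C * `|v| ^+ N].

(** Induction on the number [j] of coordinates that may vary. Taylor's formula in the new coordinate
    has as coefficients derivatives in that direction, and these are replaced by their Taylor
    polynomials in the earlier coordinates. *)
Lemma jet_taylorable U f x vs : jet U f -> U x -> taylorable (f vs) x.
Proof.
move=> [oU jf] Ux N.
have [r0 r00 r0U] := open_norm_ball oU Ux.
suff S j : (j <= n)%N -> forall vs, exists D (tau : 'rV[R]_n -> R) (C r : R),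
  [/\ polyf D tau, 0 < r & forall v : 'rV[R]_n, `|v| <= r -> (forall i : 'I_n, (j <= i)%N -> v 0 i = 0) ->
     `|f vs (x + v) - tau v| <= C * `|v| ^+ N].
  have [D [tau [C [r [p rr H]]]]] := S n (leqnn n) vs; exists D, tau, C, r; split => // v vr.
  by apply: H => // i; rewrite leqNgt ltn_ord.
elim: j => [_ ws|j IH jn ws].
  exists 0%N, (fun=> f ws x), 0, 1; split => //; first exact: polyf_cst.
  move=> v _ v0; have -> : v = 0 by apply/rowP => i; rewrite v0 // mxE.
  by rewrite addr0 subrr normr0 mul0r.
pose jo := Ordinal jn; pose e := axis R jo.
pose ch i := nseq i e ++ ws.
have /choice [D HD] : forall i, exists D, exists (tau : 'rV[R]_n -> R) (C r : R),
  [/\ polyf D tau, 0 < r & forall v : 'rV[R]_n, `|v| <= r -> (forall i : 'I_n, (j <= i)%N -> v 0 i = 0) ->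
     `|f (ch i) (x + v) - tau v| <= C * `|v| ^+ N].
  by move=> i; apply: (IH (ltnW jn) (ch i)).
have /choice [tau Ht] := HD; have /choice [C HC] := Ht; have /choice [r Hr] := HC.
have [chc _] := jf (ch N) x Ux.
have [r1 r10 Hr1] := continuous_ball chc ltr01.
pose M := `|f (ch N) x| + 1.
pose rr := Num.min (Num.min r0 r1) (\big[Num.min/1]_(i < N) r i).
have rr0 : 0 < rr.
  rewrite !lt_min r00 r10 /=; apply: lt_bigmin => // i _.
  by have [] := Hr i.
pose pr (v : 'rV[R]_n) : 'rV[R]_n := \row_i (if i == jo then 0 else v 0 i).
pose DD := (\max_(i < N) (D i * 1 + i))%N.
exists DD, (fun v => \sum_(i < N) tau i (pr v) / i`!%:R * v 0 jo ^+ i),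
  (M + \sum_(i < N) `|C i|), (Num.min 1 rr); split.
- apply: polyf_sum => i _; apply: (@polyf_le _ _ (D i * 1 + i)).
    exact: (leq_bigmax (F := fun i : 'I_N => (D i * 1 + i)%N)).
  apply: polyfM; last by rewrite -[i in polyf i]muln1; apply: polyfX; apply: polyf_coord.
  apply: (@polyf_ext _ _ _ (fun v => i`!%:R^-1 * tau i (pr v))); first by move=> v; rewrite mulrC.
  apply: polyfZ; apply: polyf_comp; first by have [] := Hr i.
  move=> l; rewrite /pr; under eq_fun do rewrite mxE.
  by case: eqP => _; [apply: polyf_cst_le|apply: polyf_coord].
- by rewrite lt_min ltr01.
move=> v; rewrite le_min => /andP[v1 vr] vj.
have prv : `|pr v| <= `|v|.
  apply: norm_le_coord => // i; rewrite mxE; case: eqP => _; first by rewrite normr0.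
  exact: coord_le_norm.
have prj (i : 'I_n) : (j <= i)%N -> pr v 0 i = 0.
  rewrite mxE leq_eqVlt => /orP[/eqP ji|ji]; last by rewrite vj // if_same.
  by rewrite -val_eqE /= -ji eqxx.
have vE : v = pr v + v 0 jo *: e.
  by apply/rowP => i; rewrite axis_line !mxE; case: eqP => [->|]; rewrite ?eqxx ?add0r.
have ve (s : R) : `|s| <= `|v| -> `|pr v + s *: e| <= `|v|.
  move=> sv; apply: norm_le_coord => // i; rewrite axis_line !mxE.
  by case: eqP => _; rewrite ?eqxx ?add0r // coord_le_norm.
move: vr; rewrite !le_min => /andP[/andP[vr0 vr1] vrr].
have vri (i : 'I_N) : `|v| <= r i.
  apply: le_trans vrr _; exact: bigmin_le_cond.
have T := @taylor_bound R N (fun i s => f (ch i) (x + (pr v + s *: e))) `|v| M _ _ _ (v 0 jo) (coord_le_norm _ _).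
have {}T : `|f ws (x + v) - \sum_(i < N) f (ch i) (x + pr v) / i`!%:R * v 0 jo ^+ i| <= M * `|v| ^+ N.
  apply: le_trans (_ : M * `|v 0 jo| ^+ N <= _); last first.
    by rewrite ler_wpM2l ?addr_ge0 // lerXn2r ?nnegrE // coord_le_norm.
  move: T; rewrite -vE scale0r addr0; apply.
  - by rewrite addr_ge0.
  - move=> i s sv.
    have -> : (fun s : R => f (ch i) (x + (pr v + s *: e))) = (fun s => f (ch i) ((x + pr v) + s *: e)).
      by apply/funext => t; rewrite addrA.
    apply: is_derive_line; rewrite -addrA.
    by apply: (proj2 (jf _ _ _)); apply: r0U; apply: le_trans vr0; exact: ve.
  - move=> s sv; rewrite -[f _ _](subrK (f (ch N) x)); apply: le_trans (ler_normD _ _) _.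
    by rewrite addrC lerD2l; apply: Hr1; apply: le_trans vr1; exact: ve.
set S := (X in `|_ - X|); rewrite -[f ws (x + v)](subrK (\sum_(i < N) f (ch i) (x + pr v) / i`!%:R * v 0 jo ^+ i)).
rewrite -addrA; apply: le_trans (ler_normD _ _) _; rewrite [leRHS]mulrDl; apply: lerD => //.
rewrite /S -sumrB; apply: le_trans (ler_norm_sum _ _ _) _; rewrite big_distrl /=.
apply: ler_sum => i _; rewrite -mulrBl -mulrBl !normrM.
have h1 : `|f (ch i) (x + pr v) - tau i (pr v)| <= `|C i| * `|v| ^+ N.
  have [_ _ /(_ (pr v) _ prj)] := Hr i => /(_ (le_trans prv (vri i))) h.
  apply: le_trans h _; apply: le_trans (_ : `|C i| * `|pr v| ^+ N <= _).
    by rewrite ler_wpM2r ?exprn_ge0 // ler_norm.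
  by rewrite ler_wpM2l // lerXn2r ?nnegrE.
have h2 : `|i`!%:R^-1| <= 1 :> R.
  by rewrite ger0_norm ?invr_ge0 // invf_le1 ?ltr0n ?fact_gt0 // ler1n fact_gt0.
have h3 : `|v 0 jo ^+ i| <= 1.
  by rewrite normrX exprn_ile1 // (le_trans (coord_le_norm _ _)).
apply: le_trans (_ : `|C i| * `|v| ^+ N * 1 * 1 <= _); last by rewrite !mulr1.
by apply: ler_pM => //; apply: ler_pM.
Qed.

End Jets.

(** * Implicit functions *)

Section Implicit.
Variable R : realType.

Lemma mulmx_norm_bound n m (A : 'M[R]_(n, m)) :
  exists2 k : R, 1 <= k & forall u : 'rV[R]_n, `|u *m A| <= k * `|u|.
Proof.
exists (1 + \sum_i \sum_j `|A i j|); first by rewrite lerDl; do 2! apply: sumr_ge0 => ? _.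
have s0 : 0 <= \sum_i \sum_j `|A i j| by do 2! apply: sumr_ge0 => ? _.
move=> u; apply: norm_le_coord => [|j]; first by rewrite mulr_ge0 // addr_ge0.
rewrite mxE; apply: le_trans (ler_norm_sum _ _ _) _.
apply: le_trans (_ : (\sum_i \sum_j `|A i j|) * `|u| <= _); last by rewrite ler_wpM2r // lerDr.
rewrite big_distrl /=; apply: ler_sum => i _; rewrite normrM mulrC.
apply: ler_pM => //; last exact: coord_le_norm.
by rewrite (bigD1 j) //= lerDl sumr_ge0.
Qed.

Lemma lipschitz_within_continuous n (A : set 'rV[R]_n) (f : 'rV[R]_n -> R) (C : R) :
  (forall u v, A u -> A v -> `|f u - f v| <= C * `|u - v|) -> {within A, continuous f}.
Proof.
move=> fL; apply/subspace_continuousP => x Ax; apply/cvgrPdist_le => /= e e0.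
have C0 : 0 < `|C| + 1 by rewrite ltr_wpDl.
apply/nbhs_ballP; exists (e / (`|C| + 1)); first by rewrite /= divr_gt0.
move=> y; rewrite -ball_normE /= => xy Ay; apply: le_trans (fL x y Ax Ay) _.
apply: le_trans (_ : (`|C| + 1) * `|x - y| <= _).
  by rewrite ler_wpM2r // (le_trans (ler_norm _)) // lerDl.
by move: xy; rewrite ltr_pdivlMr // mulrC => /ltW.
Qed.

(* The solution minimizes [`|w + rho (u *m A + w *m B)|] over a closed ball:
   moving [w] to [- rho (u *m A + w *m B)] would divide this norm by [4]. *)
Lemma implicit_function n d m (A : 'M[R]_(d, n)) (B : 'M[R]_(m, n))
    (rho : 'rV[R]_n -> 'rV[R]_m) (del eps k : R) : 0 < del -> 0 < k -> 0 <= eps ->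
  eps * k <= 4^-1 -> rho 0 = 0 ->
  (forall y y' : 'rV_n, `|y| <= del -> `|y'| <= del -> `|rho y - rho y'| <= eps * `|y - y'|) ->
  (forall u : 'rV_d, `|u *m A| <= k * `|u|) -> (forall w : 'rV_m, `|w *m B| <= k * `|w|) ->
  let r := del / (2 * k) in exists psi : 'rV[R]_d -> 'rV[R]_m,
  (forall u : 'rV_d, `|u| <= r -> [/\ `|psi u| <= r, psi u + rho (u *m A + psi u *m B) = 0 &
    forall w : 'rV_m, `|w| <= r -> w + rho (u *m A + w *m B) = 0 -> w = psi u]) /\
  (forall u u' : 'rV_d, `|u| <= r -> `|u'| <= r -> `|psi u - psi u'| <= `|u - u'|).
Proof.
move=> del0 k0 eps0 ek rho0 rhoL kA kB r.
have r0 : 0 < r by rewrite divr_gt0 // mulr_gt0.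
have rE : k * r = del / 2 by rewrite /r; field; rewrite gt_eqF.
have small (u : 'rV_d) (w : 'rV_m) : `|u| <= r -> `|w| <= r -> `|u *m A + w *m B| <= del.
  move=> ur wr; apply: le_trans (ler_normD _ _) _.
  have h1 : `|u *m A| <= k * r by apply: le_trans (kA u) _; rewrite ler_pM2l.
  have h2 : `|w *m B| <= k * r by apply: le_trans (kB w) _; rewrite ler_pM2l.
  lra.
have rhoL4 (u u' : 'rV_d) (w w' : 'rV_m) : `|u| <= r -> `|u'| <= r -> `|w| <= r -> `|w'| <= r ->
    `|rho (u *m A + w *m B) - rho (u' *m A + w' *m B)| <= 4^-1 * (`|u - u'| + `|w - w'|).
  move=> ur u'r wr w'r; apply: le_trans (rhoL _ _ (small _ _ ur wr) (small _ _ u'r w'r)) _.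
  have -> : u *m A + w *m B - (u' *m A + w' *m B) = (u - u') *m A + (w - w') *m B.
    by rewrite !mulmxBl opprD addrACA.
  apply: le_trans (_ : eps * (k * (`|u - u'| + `|w - w'|)) <= _).
    rewrite ler_wpM2l //; apply: le_trans (ler_normD _ _) _; rewrite mulrDr.
    exact: lerD.
  by rewrite mulrA ler_wpM2r // addr_ge0.
have z0r p : `|0 : 'rV[R]_p| <= r by rewrite normr0 ltW.
have sol (u : 'rV[R]_d) : `|u| <= r -> exists2 w : 'rV[R]_m, `|w| <= r & w + rho (u *m A + w *m B) = 0.
  move=> ur; pose f (w : 'rV[R]_m) := `|w + rho (u *m A + w *m B)|.
  pose K := box (const_mx (- r)) (const_mx r : 'rV[R]_m).
  have KP w : K w <-> `|w| <= r.
    split => [Kw|wr i]; first by apply: norm_le_coord => [|i]; [exact: ltW|rewrite ler_norml; have := Kw i; rewrite !mxE].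
    by rewrite !mxE -ler_norml (le_trans (coord_le_norm _ _)).
  have fc : {within K, continuous f}.
    apply: (@lipschitz_within_continuous _ _ _ 2) => w w' /KP wr /KP w'r.
    apply: le_trans (ler_dist_dist _ _) _.
    rewrite opprD addrACA; apply: le_trans (ler_normD _ _) _.
    rewrite mulr_natl mulr2n lerD //; apply: le_trans (rhoL4 u u w w' ur ur wr w'r) _.
    by rewrite subrr normr0 add0r ler_piMl //; lra.
  have [|w] := EVT_min_rV _ (@box_compact _ _ _ _) fc; first by exists 0; apply/KP.
  rewrite inE => /KP wr wmin; exists w => //; apply/eqP; rewrite -normr_eq0 -/(f w).
  have [//|fw] := eqVneq (f w) 0.
  pose w' := - rho (u *m A + w *m B).
  have w'r : `|w'| <= r.
    have := rhoL4 u 0 w 0 ur (z0r _) wr (z0r _).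
    rewrite !mul0mx addr0 rho0 !subr0 /w' normrN; lra.
  have : f w' <= 4^-1 * f w.
    rewrite /f {1}/w' addrC; have := rhoL4 u u w' w ur ur w'r wr.
    by rewrite subrr normr0 add0r /w' -opprD normrN [rho _ + w]addrC.
  have := wmin w'; rewrite inE => /(_ ((KP _).2 w'r)).
  have : 0 < f w by rewrite lt_def fw normr_ge0.
  lra.
have /choice [psi psiP] : forall u : 'rV[R]_d, exists w : 'rV[R]_m, `|u| <= r -> `|w| <= r /\ w + rho (u *m A + w *m B) = 0.
  move=> u; have [ur|ur] := boolP (`|u| <= r); last by exists 0.
  by have [w] := sol u ur; exists w.
have lip (u u' : 'rV[R]_d) (w w' : 'rV[R]_m) : `|u| <= r -> `|u'| <= r -> `|w| <= r -> `|w'| <= r ->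
    w + rho (u *m A + w *m B) = 0 -> w' + rho (u' *m A + w' *m B) = 0 -> `|w - w'| <= `|u - u'|.
  move=> ur u'r wr w'r /eqP; rewrite addr_eq0 => /eqP e1 /eqP; rewrite addr_eq0 => /eqP e2.
  have := rhoL4 u u' w w' ur u'r wr w'r.
  have -> : w - w' = - (rho (u *m A + w *m B) - rho (u' *m A + w' *m B)).
    by rewrite {1}e1 {1}e2 opprB opprK addrC.
  rewrite normrN; have := normr_ge0 (u - u'); lra.
exists psi; split => [u ur|u u' ur u'r].
  have [h1 h2] := psiP u ur; split => // w wr ew.
  apply/eqP; rewrite -subr_eq0 -normr_le0; have := lip u u w (psi u) ur ur wr h1 ew h2.
  by rewrite subrr normr0.
by have [h1 h2] := psiP u ur; have [h3 h4] := psiP u' u'r; apply: lip.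
Qed.

End Implicit.

Section Linearize.
Variables (R : realType) (n : nat).
Implicit Types (U : set 'rV[R]_n) (f : seq 'rV[R]_n -> 'rV[R]_n -> R).

Lemma is_derive_lin (l : 'rV[R]_n -> R) (z v : 'rV[R]_n) :
  (forall h : R, l (h *: v + z) = h * l v + l z) -> is_derive z v l (l v).
Proof.
move=> lin.
have C : (fun h : R => h^-1 *: ((l \o shift z) (h *: v) - l z)) @ 0^' --> l v.
  apply/cvgrPdist_le => /= e e0; near=> h.
  have h0 : h != 0 by near: h; exact: nbhs_dnbhs_neq.
  by rewrite lin addrK /GRing.scale /= mulKf // subrr normr0 ltW.
by split; [apply/cvg_ex; exists (l v)|apply: cvg_lim].
Unshelve. all: by end_near.
Qed.

Definition lin_part f (x y : 'rV[R]_n) := \sum_i y 0 i * f [:: axis R i] x.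

Lemma near_bound (I : finType) (g : I -> 'rV[R]_n -> R) x : (forall i, {for x, continuous (g i)}) ->
  exists M, exists2 r : R, 0 < r & forall i y, `|y| <= r -> `|g i (x + y)| <= M.
Proof.
move=> gc.
have /choice [r rP] : forall i, exists r : R, 0 < r /\ forall y, `|y| <= r -> `|g i (x + y) - g i x| <= 1.
  by move=> i; have [r r0 H] := continuous_ball (gc i) ltr01; exists r.
exists (1 + \sum_i `|g i x|), (\big[Num.min/1]_i r i).
  by apply: lt_bigmin => // i _; have [] := rP i.
move=> i y yr; rewrite -[g i _](subrK (g i x)); apply: le_trans (ler_normD _ _) _.
apply: lerD; first by apply: (proj2 (rP i)); apply: le_trans yr _; exact: bigmin_le_cond.
by rewrite (bigD1 i) //= lerDl sumr_ge0.
Qed.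

(** Two uses of [coord_lipschitz]: the second derivatives are bounded near [x], hence the first
    derivatives of [f] minus its linear part are $O(r)$ on the ball of radius [r]. *)
Lemma jet_linearize U f x : jet U f -> U x -> exists C, exists2 r0 : R, 0 < r0 &
  0 <= C /\ forall (r : R) (y y' : 'rV[R]_n), r <= r0 -> `|y| <= r -> `|y'| <= r ->
   `|(f [::] (x + y) - lin_part f x y) - (f [::] (x + y') - lin_part f x y')| <= C * r * `|y - y'|.
Proof.
move=> [oU jf] Ux.
have [r1 r10 r1U] := open_norm_ball oU Ux.
have [M [r2 r20 HM]] := @near_bound _ (fun ik : 'I_n * 'I_n => f [:: axis R ik.2; axis R ik.1]) x
  (fun ik => (jf _ x Ux).1).
have M0 : 0 <= `|M| by [].
exists (n%:R * (n%:R * `|M|)), (Num.min r1 r2); first by rewrite lt_min r10.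
split; first by rewrite !mulr_ge0.
move=> r y y'; rewrite le_min => /andP[rr1 rr2] yr y'r.
have r0 : 0 <= r by apply: le_trans yr.
pose g z := f [::] z - lin_part f x (z - x).
pose dg i z := f [:: axis R i] z - f [:: axis R i] x.
have gE z : f [::] (x + z) - lin_part f x z = g (x + z) by rewrite /g (addrC x z) addrK.
rewrite !gE (_ : n%:R * (n%:R * `|M|) * r = n%:R * (n%:R * (`|M| * r))); last by ring.
apply: (@coord_lipschitz _ _ g dg x r (n%:R * (`|M| * r))) => // i z zr.
  apply: is_deriveB.
    by apply: (proj2 (jf [::] _ _)); apply: r1U; apply: le_trans rr1.
  have lE u : lin_part f x (u - x) + lin_part f x x = lin_part f x u.
    by rewrite /lin_part -big_split; apply: eq_bigr => k _; rewrite /= !mxE; ring.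
  have lax : lin_part f x (axis R i) = f [:: axis R i] x.
    rewrite /lin_part (bigD1 i) //= big1 => [|k ki]; rewrite !mxE ?eqxx ?addr0 ?mul1r //=.
    by rewrite (negbTE ki) mul0r.
  have H : is_derive (x + z) (axis R i) (lin_part f x) (f [:: axis R i] x).
    rewrite -lax; apply: is_derive_lin => h.
    rewrite /lin_part big_distrr -big_split; apply: eq_bigr => k _.
    by rewrite /= !mxE; ring.
  have -> : (fun z => lin_part f x (z - x)) = lin_part f x - cst (lin_part f x x).
    by apply/funext => u; rewrite -[LHS](addrK (lin_part f x x)) lE.
  by rewrite -[f [:: axis R i] x]subr0; apply: is_deriveB.
have := @coord_lipschitz _ _ (f [:: axis R i]) (fun k => f [:: axis R k; axis R i]) x `|z| `|M| _ _ z 0 _ _.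
rewrite addr0 subr0 /dg => HL; apply: le_trans (HL _ _ _ _) _.
- move=> k u uz; apply: (proj2 (jf _ _ _)); apply: r1U; exact: le_trans uz (le_trans zr rr1).
- move=> k u uz; apply: le_trans (HM (i, k) u _) (ler_norm _).
  exact: le_trans uz (le_trans zr rr2).
- by [].
- by rewrite normr0.
by rewrite -mulrA ler_wpM2l // ler_wpM2l.
Qed.

Lemma derive_unique_quadratic (g : 'rV[R]_n -> R) x v d e C (r : R) : 0 < r -> 0 <= C ->
  is_derive x v g d -> (forall h : R, `|h| <= r -> `|g (x + h *: v) - g x - h * e| <= C * h ^+ 2) -> d = e.
Proof.
move=> r0 C0 [_ <-] H; apply: cvg_lim => //; apply/cvgrPdist_le => /= eps eps0.
near=> h.
have h0 : h != 0 by near: h; exact: nbhs_dnbhs_neq.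
have hr : `|h| <= r.
  near: h; apply: dnbhs0_le => //.
have he : `|h| <= eps / (C + 1).
  by near: h; apply: dnbhs0_le; rewrite divr_gt0 // ltr_wpDl.
have -> : e - h^-1 *: (g (h *: v + x) - g x) = - (h^-1 * (g (x + h *: v) - g x - h * e)).
  by rewrite [h *: v + x]addrC /GRing.scale /=; field.
rewrite normrN normrM normfV ler_pdivrMl ?normr_gt0 //.
apply: le_trans (H h hr) _; rewrite -real_normK ?num_real // expr2 mulrA mulrC ler_pM2l ?normr_gt0 //.
apply: le_trans (_ : (C + 1) * `|h| <= _); first by rewrite ler_wpM2r // lerDl.
by move: he; rewrite ler_pdivlMr ?ltr_wpDl // mulrC.
Unshelve. all: by end_near.
Qed.

(** Linearity in the direction is not part of [jet]. It follows because the error in [jet_linearize]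
    is quadratic, which determines the derivative in every direction. *)
Lemma jet_derive_lin U f x v : jet U f -> U x -> f [:: v] x = lin_part f x v.
Proof.
move=> jf Ux; have [C [r0 r00 [C0 H]]] := jet_linearize jf Ux.
pose k := 1 + `|v|; have k0 : 0 < k by rewrite ltr_wpDr.
apply: (@derive_unique_quadratic (f [::]) x v _ _ (C * k ^+ 2) (r0 / k)).
- by rewrite divr_gt0.
- by rewrite mulr_ge0 // exprn_ge0 // ltW.
- exact: (proj2 (proj2 jf [::] x Ux)).
move=> h hr; have hk : `|h| * k <= r0 by move: hr; rewrite ler_pdivlMr.
have hv : `|h *: v| <= `|h| * k by rewrite normrZ ler_wpM2l // lerDr.
have := H _ (h *: v) 0 hk hv; rewrite normr0 addr0 => /(_ _)/wrap[].
  by rewrite mulr_ge0 // ltW.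
have -> : lin_part f x 0 = 0 by rewrite /lin_part big1 // => i _; rewrite mxE mul0r.
have -> : lin_part f x (h *: v) = h * lin_part f x v.
  by rewrite /lin_part big_distrr; apply: eq_bigr => i _; rewrite /= mxE mulrA.
rewrite !subr0 addrAC => HH; apply: le_trans HH _.
rewrite -mulrA -[C * k ^+ 2 * _]mulrA ler_wpM2l //.
apply: le_trans (_ : `|h| * k * (`|h| * k) <= _).
  by rewrite ler_wpM2l // mulr_ge0 // ltW.
have -> : h ^+ 2 = `|h| ^+ 2 by rewrite real_normK ?num_real.
by rewrite le_eqVlt; apply/orP; left; apply/eqP; ring.
Qed.

End Linearize.

Section VectorTaylor.
Variable R : realType.

Definition vtaylor d m (W : 'rV[R]_d -> 'rV[R]_m) N := exists D (tau : 'rV[R]_d -> 'rV[R]_m) (C r : R),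
  [/\ 0 < r, 0 <= C, forall j, polyf D (fun v => tau v 0 j) &
   forall v, `|v| <= r -> `|W v - tau v| <= C * `|v| ^+ N].

Lemma vtaylorP d m (W : 'rV[R]_d -> 'rV[R]_m) N :
  (forall j, exists D (tau : 'rV[R]_d -> R) (C r : R), [/\ polyf D tau, 0 < r &
     forall v, `|v| <= r -> `|W v 0 j - tau v| <= C * `|v| ^+ N]) -> vtaylor W N.
Proof.
move=> /choice [D /choice [tau /choice [C /choice [r H]]]].
exists (\max_j D j)%N, (fun v => \row_j tau j v), (\sum_j `|C j|), (\big[Num.min/1]_j r j); split.
- by apply: lt_bigmin => // j _; have [] := H j.
- by apply: sumr_ge0.
- move=> j; apply: (@polyf_ext _ _ _ (tau j)) => [v|]; first by rewrite mxE.
  have [p _ _] := H j.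
  by apply: polyf_le p; exact: leq_bigmax.
move=> v vr; apply: norm_le_coord => [|j]; first by rewrite mulr_ge0 ?sumr_ge0 ?exprn_ge0.
rewrite !mxE; have [_ _ /(_ v)] := H j => h; apply: le_trans (h _) _.
  by apply: le_trans vr _; exact: bigmin_le_cond.
rewrite ler_wpM2r ?exprn_ge0 // (le_trans (ler_norm _)) // (bigD1 j) //= lerDl sumr_ge0 //.
Qed.

(* The Taylor polynomials of the implicit function [W] are obtained by iterating
   the fixed point equation, the order of the error increasing by one each time. *)
Lemma implicit_taylor n d m (A : 'M[R]_(d, n)) (B : 'M[R]_(m, n)) (L : 'M[R]_(d, m)) (M : 'M[R]_m)
    (rho : 'rV[R]_n -> 'rV[R]_m) (W : 'rV[R]_d -> 'rV[R]_m) (C0 r0 : R) : 0 < r0 -> 0 <= C0 ->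
  (forall (r : R) (y y' : 'rV_n), r <= r0 -> `|y| <= r -> `|y'| <= r -> `|rho y - rho y'| <= C0 * r * `|y - y'|) ->
  (forall N, vtaylor rho N) ->
  (forall v : 'rV_d, `|v| <= r0 -> `|W v| <= `|v|) ->
  (forall v : 'rV_d, `|v| <= r0 -> W v = (v *m L + rho (v *m A + W v *m B)) *m M) ->
  forall N, vtaylor W N.
Proof.
move=> r00 C00 rhoL rhoT W1 WE.
have [a a1 aP] := mulmx_norm_bound A; have [b b1 bP] := mulmx_norm_bound B.
have [c c1 cP] := mulmx_norm_bound M.
have a0 : 0 <= a by exact: le_trans a1.
have b0 : 0 <= b by exact: le_trans b1.
have c0 : 0 <= c by exact: le_trans c1.
elim=> [|N [D [tau [C [r [r1 CC pt H]]]]]].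
  exists 0%N, (fun=> 0), 1, (Num.min r0 1); split => //; first by rewrite lt_min r00 ltr01.
    by move=> j; under eq_fun do rewrite mxE; exact: polyf_cst.
  move=> v; rewrite le_min => /andP[v1 v2]; rewrite subr0 expr0 mulr1.
  exact: le_trans (W1 v v1) v2.
have W0 : W 0 = 0.
  by apply/eqP; rewrite -normr_le0; have := W1 0; rewrite normr0; apply; exact: ltW.
(* Order 1 comes from the bound on [W], with the zero polynomial. The iteration proper starts there,
   since it needs an approximation [tau] that is $O(|v|)$. *)
case: N => [|N] in D tau C r r1 CC pt H *.
  exists 0%N, (fun=> 0), 1, r0; split => // [j|v v1].
    by under eq_fun do rewrite mxE; exact: polyf_cst.
  by rewrite subr0 expr1 mul1r W1.
have [E [T [C' [r' [r'0 C'0 pT HT]]]]] := rhoT N.+2.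
pose k := a + (1 + C) * b.
have k0 : 0 < k by rewrite ltr_pwDl ?mulr_ge0 ?addr_ge0 // ?(lt_le_trans ltr01) // (le_trans ler01).
pose sig v := (v *m L + T (v *m A + tau v *m B)) *m M.
exists (maxn 1 (E * (maxn 1 D))), sig, (c * (C0 * k * (b * C) + C' * k ^+ N.+2)),
  (Num.min (Num.min 1 r) (Num.min (r0 / k) (Num.min r0 (r' / k)))); split.
- by rewrite !lt_min ltr01 r1 r00 !divr_gt0.
- apply: mulr_ge0 => //; apply: addr_ge0; last by apply: mulr_ge0 => //; rewrite exprn_ge0 ?ltW.
  by apply: mulr_ge0; [rewrite mulr_ge0 // ltW|exact: mulr_ge0].
- move=> j; rewrite /sig; under eq_fun do rewrite mxE; apply: polyf_sum => i _.
  apply: (@polyf_ext _ _ _ (fun v => M i j * (v *m L + T (v *m A + tau v *m B)) 0 i)).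
    by move=> v; rewrite mulrC.
  apply: polyfZ; under eq_fun do rewrite mxE; apply: polyfD.
    by apply: (@polyf_le _ _ 1); [exact: leq_maxl|exact: polyf_mulmx].
  apply: (@polyf_le _ _ (E * maxn 1 D)); first exact: leq_maxr.
  apply: (@polyf_comp _ _ _ _ _ (fun y => T y 0 i) (fun v => v *m A + tau v *m B)) => // l.
  under eq_fun do rewrite mxE; apply: polyfD.
    by apply: (@polyf_le _ _ 1); [exact: leq_maxl|exact: polyf_mulmx].
  under eq_fun do rewrite mxE; apply: polyf_sum => i' _.
  apply: (@polyf_ext _ _ _ (fun v => B i' l * tau v 0 i')); first by move=> v; rewrite mulrC.
  by apply: polyfZ; apply: (@polyf_le _ _ D) => //; exact: leq_maxr.
move=> v; rewrite !le_min => /andP[/andP[v1 vr] /andP[vr0k /andP[vr0 vr'k]]].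
have tauv : `|tau v| <= (1 + C) * `|v|.
  rewrite -[tau v](subrK (W v)); apply: le_trans (ler_normD _ _) _.
  rewrite mulrDl mul1r addrC; apply: lerD; first exact: W1.
  rewrite distrC; apply: le_trans (H v vr) _; rewrite ler_wpM2l // exprS ler_piMr //.
  by rewrite exprn_ile1.
have ky (w : 'rV[R]_m) : `|w| <= (1 + C) * `|v| -> `|v *m A + w *m B| <= k * `|v|.
  move=> wv; apply: le_trans (ler_normD _ _) _; rewrite mulrDl; apply: lerD; first exact: aP.
  by apply: le_trans (bP w) _; rewrite mulrC [_ * b]mulrC -mulrA mulrC ler_wpM2l.
have Wv : `|W v| <= (1 + C) * `|v|.
  by apply: le_trans (W1 v vr0) _; rewrite ler_peMl // lerDl.
have kr0 : k * `|v| <= r0 by move: vr0k; rewrite ler_pdivlMr // mulrC.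
have kr' : k * `|v| <= r' by move: vr'k; rewrite ler_pdivlMr // mulrC.
rewrite {1}WE // -mulmxBl; apply: le_trans (cP _) _; rewrite -mulrA.
apply: ler_wpM2l => //.
have -> : v *m L + rho (v *m A + W v *m B) - (v *m L + T (v *m A + tau v *m B)) =
   (rho (v *m A + W v *m B) - rho (v *m A + tau v *m B)) +
   (rho (v *m A + tau v *m B) - T (v *m A + tau v *m B)).
  by rewrite opprD addrACA subrr add0r addrA subrK.
apply: le_trans (ler_normD _ _) _; rewrite mulrDl; apply: lerD.
  apply: le_trans (rhoL _ _ _ kr0 (ky _ Wv) (ky _ tauv)) _.
  have -> : v *m A + W v *m B - (v *m A + tau v *m B) = (W v - tau v) *m B.
    by rewrite opprD addrACA subrr add0r mulmxBl.
  apply: le_trans (_ : C0 * (k * `|v|) * (b * (C * `|v| ^+ N.+1)) <= _).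
    rewrite ler_wpM2l ?mulr_ge0 ?(ltW k0) //.
    by apply: le_trans (bP _) _; rewrite ler_wpM2l // H.
  by rewrite [in leRHS]exprS le_eqVlt; apply/orP; left; apply/eqP; ring.
apply: le_trans (HT _ (le_trans (ky _ tauv) kr')) _; rewrite -mulrA -exprMn ler_wpM2l //.
by rewrite lerXn2r ?nnegrE ?mulr_ge0 ?(ltW k0) // ky.
Qed.

End VectorTaylor.

(** * Charts with a linear inverse *)

Section Chart.
Variables (R : realType) (n : nat).

(** [X] parametrizes [V] near [c], and its inverse is the restriction of the affine map $y \mapsto
    (y-c)A'$. Being affine, the inverse is Lipschitz everywhere and keeps images of [V] definable.
    Taylor polynomials are asked for at interior points of the parameter ball. *)
Definition is_chart d (V : set 'rV[R]_n) (c : 'rV[R]_n) (A' : 'M[R]_(n, d)) (X : 'rV[R]_d -> 'rV[R]_n)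
    (r rho L : R) :=
  [/\ [/\ 0 < r, 0 < rho & 0 <= L],
    forall u, `|u| <= r -> V (X u) /\ (X u - c) *m A' = u,
    forall u u', `|u| <= r -> `|u'| <= r -> `|X u - X u'| <= L * `|u - u'|,
    forall y, V y -> `|y - c| <= rho -> `|(y - c) *m A'| <= r /\ y = X ((y - c) *m A') &
    forall u, `|u| < r -> forall l, taylorable (fun u => X u 0 l) u].

(** The rows of [A] form a basis of the kernel of [J], and [B] is a section of [J]. The identity
    $A'A + JB = 1$ separates tangential from transverse coordinates. *)
Lemma kernel_split m d (J : 'M[R]_(n, m)) (B : 'M[R]_(m, n)) : B *m J = 1%:M -> n = (d + m)%N ->
  exists (A : 'M[R]_(d, n)) (A' : 'M[R]_(n, d)),
    [/\ A *m J = 0, A *m A' = 1%:M, B *m A' = 0 & A' *m A + J *m B = 1%:M].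
Proof.
move=> BJ nE; have fJ : row_full J by apply/row_fullP; exists B.
have rk : \rank (kermx J) = d by rewrite mxrank_ker (eqP fJ) nE addnK.
have [A [fA eA]] : exists A : 'M[R]_(d, n), row_free A /\ (A :=: kermx J)%MS.
  by move: rk => <-; exists (row_base (kermx J)); split; [exact: row_base_free|exact: eq_row_base].
have AJ : A *m J = 0 by apply/sub_kermxP; rewrite eA.
have /row_freeP [A1 AA1] := fA.
have BP : B *m (1%:M - J *m B) = 0 by rewrite mulmxBr mulmx1 mulmxA BJ mul1mx subrr.
have [Z ZE] : exists Z, 1%:M - J *m B = Z *m A.
  by apply/submxP; rewrite eA; apply/sub_kermxP; rewrite mulmxBl mul1mx -mulmxA BJ mulmx1 subrr.
exists A, ((1%:M - J *m B) *m A1); split => //.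
- by rewrite mulmxA mulmxBr mulmx1 mulmxA AJ mul0mx subr0.
- by rewrite mulmxA BP mul0mx.
- by rewrite ZE -[Z *m A *m A1]mulmxA AA1 mulmx1 -ZE subrK.
Qed.

Variables (m : nat) (U : set 'rV[R]_n) (f : 'I_m -> seq 'rV[R]_n -> 'rV[R]_n -> R).
Hypothesis oU : open U.
Hypothesis jf : forall j, jet U (f j).

Definition jac x : 'M[R]_(n, m) := \matrix_(i, j) f j [:: axis R i] x.
Definition remainder x y : 'rV[R]_m := \row_j f j [::] (x + y) - y *m jac x.

Lemma remainderE x y j : remainder x y 0 j = f j [::] (x + y) - lin_part (f j) x y.
Proof. by rewrite !mxE; congr (_ - _); apply: eq_bigr => i _; rewrite mxE. Qed.

Lemma remainder_lipschitz x : U x -> exists C, exists2 r0 : R, 0 < r0 & 0 <= C /\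
  forall (r : R) (y y' : 'rV_n), r <= r0 -> `|y| <= r -> `|y'| <= r ->
    `|remainder x y - remainder x y'| <= C * r * `|y - y'|.
Proof.
move=> Ux; have /choice [C /choice [r H]] : forall j, exists C, exists r0 : R, [/\ 0 < r0, 0 <= C &
  forall (r : R) (y y' : 'rV[R]_n), r <= r0 -> `|y| <= r -> `|y'| <= r ->
   `|(f j [::] (x + y) - lin_part (f j) x y) - (f j [::] (x + y') - lin_part (f j) x y')| <= C * r * `|y - y'|].
  by move=> j; have [C [r0 h1 [h2 h3]]] := jet_linearize (jf j) Ux; exists C, r0.
exists (\sum_j C j), (\big[Num.min/1]_j r j).
  by apply: lt_bigmin => // j _; have [] := H j.
split; first by apply: sumr_ge0 => j _; have [] := H j.
move=> r' y y' rr yr y'r; have r'0 : 0 <= r' by apply: le_trans yr.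
have C0 : 0 <= \sum_j C j by apply: sumr_ge0 => j _; have [] := H j.
apply: norm_le_coord => [|j]; first by rewrite !mulr_ge0.
have hE (p q : 'rV[R]_m) : (p - q) 0 j = p 0 j - q 0 j by rewrite !mxE.
rewrite hE.
rewrite !remainderE; have [_ Cj0 h] := H j.
apply: le_trans (h r' y y' _ yr y'r) _; first by apply: le_trans rr _; exact: bigmin_le_cond.
rewrite ler_wpM2r // ler_wpM2r // (bigD1 j) //= lerDl sumr_ge0 // => i _.
by have [] := H i.
Qed.

Lemma remainder_taylor x N : U x -> vtaylor (remainder x) N.
Proof.
move=> Ux; apply: vtaylorP => j; have [D [tau [C [r [p r0 H]]]]] := jet_taylorable [::] (jf j) Ux N.
exists (maxn D 1), (fun y => tau y - lin_part (f j) x y), C, r; split => //.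
  apply: polyfB; first by apply: polyf_le p; exact: leq_maxl.
  apply: (@polyf_le _ _ 1); first exact: leq_maxr.
  apply: polyf_sum => i _; apply: (@polyf_ext _ _ _ (fun y => f j [:: axis R i] x * y 0 i)).
    by move=> y; rewrite mulrC.
  by apply: polyfZ; apply: polyf_coord.
move=> v vr; rewrite remainderE.
by rewrite (_ : _ - _ = f j [::] (x + v) - tau v); [exact: H|ring].
Qed.

Lemma remainder_add x y z : remainder x (y + z) - remainder x y =
  remainder (x + y) z - remainder (x + y) 0 + z *m jac (x + y) - z *m jac x.
Proof.
rewrite /remainder mulmxDl mul0mx addr0 addrA subr0.
move: (\row_j f j [::] (x + y + z)) (\row_j f j [::] (x + y)) => a b.
move: (y *m jac x) (z *m jac x) (z *m jac (x + y)) => c d e.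
by apply/rowP => j; rewrite !mxE; ring.
Qed.

(** Coordinates along the kernel of the Jacobian at [c] are the parameters; the transverse
    coordinate [psi u] solves the equation of [implicit_function] for the remainder. For the Taylor
    polynomials at another point [x0] the equation is recentred there, where the transverse Jacobian
    [M0] is still invertible. *)
Lemma implicit_chart (V : set 'rV[R]_n) d c : (n = d + m)%N -> V c -> U c ->
  (forall y, U y -> V y <-> forall j, f j [::] y = 0) ->
  (forall w : 'rV[R]_m, exists v : 'rV[R]_n, \row_j f j [:: v] c = w) ->
  exists A' X r rho L, @is_chart d V c A' X r rho L.
Proof.
move=> nE Vc Uc VU surj.
have VF y : U y -> V y <-> \row_j f j [::] y = 0.
  move=> Uy; rewrite VU //; split => [h|/rowP h j]; first by apply/rowP => j; rewrite !mxE.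
  by have := h j; rewrite !mxE.
set J := jac c.
have /choice [vB vBP] : forall i : 'I_m, exists v : 'rV[R]_n, v *m J = row i 1%:M.
  move=> i; have [v vE] := surj (row i 1%:M); exists v; rewrite -vE; apply/rowP => j.
  by rewrite mxE [RHS]mxE (jet_derive_lin _ (jf j) Uc); apply: eq_bigr => l _; rewrite mxE.
pose B := \matrix_(i < m) vB i.
have BJ : B *m J = 1%:M by apply/row_matrixP => i; rewrite row_mul rowK vBP.
have [A [A' [AJ AA' BA' A'A]]] := kernel_split BJ nE.
have [a a1 aP] := mulmx_norm_bound A; have [b b1 bP] := mulmx_norm_bound B.
have [a' a'1 a'P] := mulmx_norm_bound A'; have [l l1 lP] := mulmx_norm_bound J.
pose k := a + b.
have k0 : 0 < k by rewrite /k; lra.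
have kA (u : 'rV_d) : `|u *m A| <= k * `|u|.
  by apply: le_trans (aP u) _; rewrite ler_wpM2r // /k; lra.
have kB (w : 'rV_m) : `|w *m B| <= k * `|w|.
  by apply: le_trans (bP w) _; rewrite ler_wpM2r // /k; lra.
have [C [r0 r00 [C0 HC]]] := remainder_lipschitz Uc.
have [r1 r10 r1U] := open_norm_ball oU Uc.
pose eps := (4 * k)^-1.
have eps0 : 0 < eps by rewrite invr_gt0 mulr_gt0.
pose del := Num.min (Num.min r0 r1) (eps / (C + 1)).
have del0 : 0 < del by rewrite !lt_min r00 r10 divr_gt0 // ltr_wpDl.
have delr0 : del <= r0 by rewrite !ge_min lexx.
have delr1 : del <= r1 by rewrite !ge_min lexx !orbT.
have delC : C * del <= eps.
  apply: le_trans (_ : (C + 1) * del <= _); first by rewrite ler_wpM2r ?lerDl // ltW.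
  by rewrite mulrC -ler_pdivlMr ?ltr_wpDl // ge_min lexx orbT.
have ek : eps * k <= 4^-1 by rewrite /eps invfM mulfVK // gt_eqF.
have Fc : \row_j f j [::] c = 0 by apply/VF.
have rem0 x : remainder x 0 = \row_j f j [::] x by rewrite /remainder addr0 mul0mx subr0.
have rho0 : remainder c 0 = 0 by rewrite rem0.
have rhoL (y y' : 'rV_n) : `|y| <= del -> `|y'| <= del ->
    `|remainder c y - remainder c y'| <= eps * `|y - y'|.
  by move=> yd y'd; apply: le_trans (HC del _ _ delr0 yd y'd) _; rewrite ler_wpM2r.
have := implicit_function del0 k0 (ltW eps0) ek rho0 rhoL kA kB.
set r := del / (2 * k) => -[psi [psiP psiL]].
have r_gt0 : 0 < r by rewrite divr_gt0 // mulr_gt0.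
have rE : 2 * (k * r) = del by rewrite /r; field; rewrite gt_eqF.
pose Y u := u *m A + psi u *m B.
pose X u := c + Y u.
have YJ u : Y u *m J = psi u by rewrite /Y mulmxDl -!mulmxA AJ BJ mulmx0 mulmx1 add0r.
have YA' u : Y u *m A' = u by rewrite /Y mulmxDl -!mulmxA AA' BA' mulmx0 mulmx1 addr0.
have psi0 : psi 0 = 0.
  have h0 p : `|0 : 'rV[R]_p| <= r by rewrite normr0 ltW.
  have [_ _ h] := psiP 0 (h0 d).
  by symmetry; apply: h; rewrite ?h0 // !mul0mx !add0r rho0.
have psi1 u : `|u| <= r -> `|psi u| <= `|u|.
  by move=> ur; have := psiL u 0 ur; rewrite psi0 !subr0 normr0; apply; exact: ltW.
have Yn u : `|u| <= r -> `|Y u| <= 2 * (k * `|u|).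
  move=> ur; apply: le_trans (ler_normD _ _) _; rewrite mulr_natl mulr2n lerD ?kA //.
  by apply: le_trans (kB _) _; rewrite ler_pM2l // psi1.
have Yd u : `|u| <= r -> `|Y u| <= del.
  by move=> ur; apply: le_trans (Yn u ur) _; rewrite -rE !ler_pM2l.
have FX u : `|u| <= r -> \row_j f j [::] (X u) = 0.
  move=> ur; have [_ h _] := psiP u ur.
  by rewrite -[RHS]h -/(Y u) /remainder YJ addrC subrK.
have UX u : `|u| <= r -> U (X u) by move=> ur; apply: r1U; apply: le_trans (Yd u ur) _.
have VX u : `|u| <= r -> V (X u) by move=> ur; apply/VF; [exact: UX|exact: FX].
pose rho := Num.min del (Num.min (r / a') (r / l)).
have a'0 : 0 < a' by lra.
have l0 : 0 < l by lra.
have rho_gt0 : 0 < rho by rewrite lt_min del0 lt_min (divr_gt0 r_gt0 a'0) (divr_gt0 r_gt0 l0).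
exists A', X, r, rho, (2 * k); split.
- by split => //; rewrite mulr_ge0 // ltW.
- by move=> u ur; split; [exact: VX|rewrite /X addrC addKr YA'].
- move=> u u' ur u'r; rewrite /X opprD addrACA subrr add0r /Y opprD addrACA -!mulmxBl.
  apply: le_trans (ler_normD _ _) _; rewrite -mulrA mulr_natl mulr2n lerD ?kA //.
  by apply: le_trans (kB _) _; rewrite ler_pM2l // psiL.
- move=> y Vy; rewrite le_min => /andP[yd]; rewrite le_min => /andP[ya yl].
  have ur : `|(y - c) *m A'| <= r.
    by apply: le_trans (a'P _) _; rewrite mulrC -ler_pdivlMr.
  have wr : `|(y - c) *m J| <= r.
    by apply: le_trans (lP _) _; rewrite mulrC -ler_pdivlMr.
  have ycE : y - c = (y - c) *m A' *m A + (y - c) *m J *m B.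
    by rewrite -!mulmxA -mulmxDr A'A mulmx1.
  split => //; have [_ _ h] := psiP _ ur.
  rewrite /X /Y -(h _ wr) -?ycE; first by rewrite addrC subrK.
  rewrite /remainder -/J addrC subrK [c + _]addrC subrK; apply/VF => //.
  by rewrite -[y](subrK c) addrC; apply: r1U; apply: le_trans yd _.
move=> u0 u0r; have u0r' := ltW u0r.
set x0 := X u0; have Ux0 := UX u0 u0r'.
have [C1 [r2 r20 [C10 HC1]]] := remainder_lipschitz Ux0.
rewrite -/x0 in HC1.
pose M0 := B *m jac x0.
(* If [w *m M0 = 0], a small move [z *m B] with [z] proportional to [w] changes the equations at
   [x0] to second order only. By [remainder_add] the remainder at [c] then changes by nearly [- z],
   in contradiction with its Lipschitz constant [eps], for which [eps * k] is 1/4. *)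
have M0inj (w : 'rV_m) : w *m M0 = 0 -> w = 0.
  move=> wM; apply/eqP; apply: contrapT => /negP w0.
  have w0' : 0 < `|w| by rewrite normr_gt0.
  pose g := del - `|Y u0|.
  have g0 : 0 < g by rewrite subr_gt0; apply: le_lt_trans (Yn _ u0r') _; rewrite -rE !ltr_pM2l.
  pose t := Num.min (Num.min g r2 / k) (4 * k ^+ 2 * (C1 + 1))^-1.
  have t0 : 0 < t.
    by rewrite lt_min invr_gt0 divr_gt0 ?lt_min ?g0 //= !mulr_gt0 ?exprn_gt0 // ltr_wpDl.
  pose z := (t / `|w|) *: w.
  have zn : `|z| = t by rewrite normrZ gtr0_norm ?divr_gt0 // divfK // gt_eqF.
  have zM : z *m B *m jac x0 = 0 by rewrite -mulmxA -scalemxAl wM scaler0.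
  have zB : `|z *m B| <= k * t by rewrite -zn; exact: kB.
  have ktg : k * t <= Num.min g r2 by rewrite mulrC -ler_pdivlMr // ge_min lexx.
  move: ktg; rewrite le_min => /andP[ktg ktr2].
  have := rhoL (Y u0 + z *m B) (Y u0) _ (Yd _ u0r').
  rewrite (remainder_add c (Y u0) (z *m B)) (_ : c + Y u0 = x0) // -/J -[z *m B *m J]mulmxA BJ mulmx1 zM addr0 [Y u0 + _]addrC addrK.
  move=> /(_ _)/wrap[|h1].
    rewrite addrC; apply: le_trans (ler_normD _ _) _; move: ktg zB; rewrite /g.
    by move: (`|Y u0|) (`|z *m B|) (k * t) => *; lra.
  have h2 := HC1 (k * t) (z *m B) 0 ktr2 zB.
  rewrite normr0 subr0 in h2.
  have {}h2 := h2 (ltW (mulr_gt0 k0 t0)).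
  have h3 : t <= `|remainder x0 (z *m B) - remainder x0 0 - z| + `|remainder x0 (z *m B) - remainder x0 0|.
    have gen (p q : 'rV[R]_m) : `|q| <= `|p - q| + `|p|.
      by rewrite -{1}(subKr p q) [leRHS]addrC; exact: ler_normB.
    by have := gen (remainder x0 (z *m B) - remainder x0 0) z; rewrite zn.
  have h4 : eps * `|z *m B| <= t / 4.
    apply: le_trans (_ : eps * (k * t) <= _); first by rewrite ler_pM2l.
    by rewrite mulrA mulrC ler_pM2l.
  have h5 : C1 * (k * t) * `|z *m B| <= t / 4.
    apply: le_trans (_ : C1 * (k * t) * (k * t) <= _).
      by rewrite ler_wpM2l // !mulr_ge0 // ltW.
    have -> : C1 * (k * t) * (k * t) = t * (k ^+ 2 * C1 * t) by ring.
    rewrite ler_pM2l //.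
    apply: le_trans (_ : k ^+ 2 * (C1 + 1) * t <= _).
      by rewrite ler_wpM2r ?(ltW t0) // ler_wpM2l ?exprn_ge0 ?(ltW k0) // lerDl.
    have hh : t <= (4 * k ^+ 2 * (C1 + 1))^-1 by rewrite ge_min lexx orbT.
    have k2 : 0 < k ^+ 2 * (C1 + 1) by rewrite mulr_gt0 ?exprn_gt0 // ltr_wpDl.
    rewrite mulrC -ler_pdivlMr //; move: hh; rewrite -mulrA invfM.
    by [].
  move: h1 h2 h3 h4 h5; lra.
have M0u : M0 \in unitmx.
  rewrite -row_free_unit -kermx_eq0; apply/rowV0P => v /sub_kermxP; exact: M0inj.
(* [psi] recentred at [u0]. Solving the linear part of the equation at [x0] by the inverse of [M0]
   gives the fixed point form of [implicit_taylor]. *)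
pose W v := psi (u0 + v) - psi u0.
pose rr := Num.min r2 (r - `|u0|).
have rr0 : 0 < rr by rewrite lt_min r20 subr_gt0.
have u0v (v : 'rV_d) : `|v| <= rr -> `|u0 + v| <= r.
  by rewrite le_min => /andP[_ h]; apply: le_trans (ler_normD _ _) _; lra.
have XW v : X (u0 + v) = x0 + (v *m A + W v *m B).
  rewrite /x0 /X /Y /W mulmxDl mulmxBl.
  move: (u0 *m A) (v *m A) (psi (u0 + v) *m B) (psi u0 *m B) => p q s t.
  by apply/rowP => i; rewrite !mxE; ring.
have HT := @implicit_taylor R n d m A B (A *m jac x0) (- invmx M0) (remainder x0) W C1 rr rr0 C10.
have Wtay N : vtaylor W N.
  apply: HT => //.
  - by move=> r' y y' r'r; apply: HC1; apply: le_trans r'r _; rewrite ge_min lexx.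
  - by move=> N'; exact: remainder_taylor.
  - by move=> v vr; apply: le_trans (psiL _ _ (u0v v vr) u0r') _; rewrite addrC addKr.
  move=> v vr; have := FX _ (u0v v vr); rewrite XW.
  set y := v *m A + W v *m B; move=> Fy.
  have : remainder x0 y + y *m jac x0 = 0 by rewrite /remainder subrK.
  rewrite {2}/y mulmxDl -[W v *m B *m _]mulmxA -/M0 -mulmxA => /eqP.
  rewrite addrA addr_eq0 => /eqP E.
  by rewrite mulmxN -mulNmx addrC E opprK mulmxK.
move=> i N; have [D [tau [CC [rt [rt0 CC0 pt Ht]]]]] := Wtay N.
have bk : 0 < b by lra.
exists (maxn 1 D), (fun v => x0 0 i + (v *m A) 0 i + (tau v *m B) 0 i), (b * CC), rt; split => //.
  apply: polyfD; first apply: polyfD.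
  - exact: polyf_cst_le.
  - by apply: (@polyf_le _ _ 1); [exact: leq_maxl|exact: polyf_mulmx].
  apply: (@polyf_le _ _ D); first exact: leq_maxr.
  under eq_fun do rewrite mxE; apply: polyf_sum => j _.
  by apply: (@polyf_ext _ _ _ (fun v => B j i * tau v 0 j)); [move=> v; rewrite mulrC|apply: polyfZ].
move=> v vr; rewrite XW.
have -> : (x0 + (v *m A + W v *m B)) 0 i - (x0 0 i + (v *m A) 0 i + (tau v *m B) 0 i) =
    ((W v - tau v) *m B) 0 i.
  rewrite (mulmxBl (W v) (tau v) B); move: (W v *m B) (v *m A) (tau v *m B) => p q s.
  by rewrite !mxE; ring.
apply: le_trans (coord_le_norm _ _) _; apply: le_trans (bP _) _.
by rewrite -mulrA ler_pM2l // Ht.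
Qed.

End Chart.

Lemma submanifold_chart (R : realType) n d (V : set 'rV[R]_n) c : submanifold d V -> V c ->
  exists A' X r rho L, @is_chart R n d V c A' X r rho L.
Proof.
move=> [dn H] Vc; have [U [F [oU Uc sF surj VU]]] := H c Vc.
have VUP y : U y -> V y <-> F y = 0.
  move=> Uy; split => [Vy|Fy]; first by have : (V `&` U) y by []; rewrite VU => -[].
  by have : (U `&` [set y | F y = 0]) y by []; rewrite -VU => -[].
pose f j vs x := iter_derive vs F x 0 j.
apply: (@implicit_chart R n (n - d) U f oU (fun j => smooth_jet j oU sF) V d c) => //.
- by rewrite subnKC.
- move=> y Uy; rewrite VUP //; split => [Fy j|h]; first by rewrite /f /= Fy mxE.
  by apply/rowP => j; rewrite mxE; exact: h.
- move=> w; have [v vE] := surj c Uc w; exists v; apply/rowP => j.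
  by rewrite mxE /f /= vE.
Qed.

(** * Semialgebraic sets with empty interior *)

HB.instance Definition _ (R : Type) := gen_eqMixin (GRing.term R).

Section Definable.
Variable R : realType.
Implicit Types (P Q : (nat -> R) -> Prop).

(** The environment of a formula is read as an infinite sequence, equal to 0 beyond its length. *)
Definition definable P := exists f : ord.formula R,
  forall e, ord.holds e f <-> P (fun i => e`_i).

Lemma definable_and P Q : definable P -> definable Q -> definable (fun a => P a /\ Q a).
Proof. by move=> [f fP] [g gP]; exists (ord.And f g) => e /=; rewrite fP gP. Qed.

Lemma definable_all (I : eqType) (r : seq I) (P : I -> (nat -> R) -> Prop) :
  (forall i, definable (P i)) -> definable (fun a => forall i, i \in r -> P i a).
Proof.
move=> H; elim: r => [|i r IH]; first by exists (ord.Bool true) => e /=.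
have [f fP] := definable_and (H i) IH; exists f => e; rewrite fP; split => [[h1 h2] j|h].
  by rewrite inE => /orP[/eqP -> //|]; exact: h2.
by split => [|j jr]; apply: h; rewrite inE ?eqxx ?jr ?orbT.
Qed.

Lemma definable_ext P Q : (forall a, P a <-> Q a) -> definable P -> definable Q.
Proof. by move=> PQ [f fP]; exists f => e; rewrite fP PQ. Qed.

Lemma definable_ex k P : definable P ->
  definable (fun a => exists x, P (fun i => if i == k then x else a i)).
Proof.
move=> [f fP]; exists (ord.Exists k f) => e /=; split => -[x].
  rewrite fP => h; exists x; move: h; congr P; apply/funext => i.
  by rewrite nth_set_nth.
move=> h; exists x; rewrite fP; move: h; congr P; apply/funext => i.
by rewrite nth_set_nth.
Qed.

Lemma definable_exn m n P : definable P ->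
  definable (fun a => exists b : nat -> R, P b /\ forall i, ~~ (m <= i < m + n)%N -> b i = a i).
Proof.
move=> dP; elim: n => [|n IH].
  apply: definable_ext dP => a; split => [h|[b [Pb ba]]].
    by exists a; split.
  have -> // : a = b; apply/funext => i; rewrite ba // addn0; lia.
have [f fP] := definable_ex (m + n)%N IH; exists f => e; rewrite fP; split.
  move=> [x [b [Pb ba]]]; exists b; split => // i ib; rewrite ba.
    by case: eqP => // ii; move: ib; rewrite ii; lia.
  by move: ib; lia.
move=> [b [Pb ba]]; exists (b (m + n)%N), b; split => // i ib.
by case: eqP => [-> //|ii]; apply: ba; move: ib ii; lia.
Qed.

Lemma definable_polyf n D (f : 'rV[R]_n -> R) m : polyf D f ->
  exists t : GRing.term R, forall e, GRing.eval e t = f (\row_i e`_(m + i)).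
Proof.
elim => {D f} [c|i|D f h _ [t1 e1] _ [t2 e2]|D D' f h _ [t1 e1] _ [t2 e2]|//].
- by exists (GRing.Const c).
- by exists (GRing.Var _ (m + i)) => e; rewrite mxE.
- by exists (GRing.Add t1 t2) => e /=; rewrite e1 e2.
- by exists (GRing.Mul t1 t2) => e /=; rewrite e1 e2.
Qed.

Lemma definable_eq n D (f : 'rV[R]_n -> R) m : polyf D f ->
  definable (fun a => f (\row_i a (m + i)%N) = 0).
Proof.
by move=> /(@definable_polyf _ _ _ m) [t tP]; exists (ord.Equal t (GRing.NatConst _ 0)) => e /=; rewrite tP.
Qed.

Definition env n (y : 'rV[R]_n) : seq R := [seq y 0 i | i : 'I_n].

Lemma env_nth n (y : 'rV[R]_n) (i : 'I_n) : (env y)`_i = y 0 i.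
Proof. by rewrite (nth_map i) ?size_enum_ord // nth_ord_enum. Qed.

Lemma env_nth_default n (y : 'rV[R]_n) i : (n <= i)%N -> (env y)`_i = 0.
Proof. by move=> ni; rewrite nth_default // size_map size_enum_ord. Qed.

Lemma eval_env_polyf n (t : GRing.term R) : GRing.rterm t ->
  exists D, polyf D (fun y : 'rV[R]_n => GRing.eval (env y) t).
Proof.
elim: t => //=.
- move=> i _; have [ni|ni] := leqP n i.
    exists 0%N; apply: (polyf_ext _ (polyf_cst n 0)) => y; by rewrite env_nth_default.
  exists 1%N; apply: (polyf_ext _ (polyf_coord R (Ordinal ni))) => y.
  by rewrite -[i in RHS]/(nat_of_ord (Ordinal ni)) env_nth.
- by move=> c _; exists 0%N; apply: polyf_cst.
- by move=> c _; exists 0%N; apply: polyf_cst.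
- move=> t1 IH1 t2 IH2 /andP[/IH1[D1 p1] /IH2[D2 p2]]; exists (maxn D1 D2).
  by apply: polyfD; [apply: polyf_le p1; exact: leq_maxl|apply: polyf_le p2; exact: leq_maxr].
- by move=> t IH /IH[D p]; exists D; apply: polyfN.
- move=> t IH k /IH[D p]; exists D; apply: (polyf_ext _ (polyfZ k%:R p)) => y.
  by rewrite mulr_natl.
- by move=> t1 IH1 t2 IH2 /andP[/IH1[D1 p1] /IH2[D2 p2]]; exists (D1 + D2)%N; apply: polyfM.
- by move=> t IH k /IH[D p]; exists (k * D)%N; apply: polyfX.
Qed.

(** Every atom compares two terms, so that its truth only depends on the sign of their
    difference. *)
Lemma qf_form_signs (g : ord.formula R) : ord.qf_form g -> ord.rformula g ->
  exists ts : seq (GRing.term R), all (@GRing.rterm R) ts /\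
   forall e e', (forall t, t \in ts -> Num.sg (GRing.eval e t) = Num.sg (GRing.eval e' t)) ->
     ord.qf_eval e g = ord.qf_eval e' g.
Proof.
elim: g => //=.
- by move=> b; exists [::].
- move=> t1 t2 _ /andP[r1 r2]; exists [:: GRing.Add t1 (GRing.Opp t2)]; split=> /=.
    by rewrite r1 r2.
  move=> e e' /(_ _ (mem_head _ _)) /= h.
  by rewrite -subr_eq0 -sgr_eq0 h sgr_eq0 subr_eq0.
- move=> t1 t2 _ /andP[r1 r2]; exists [:: GRing.Add t1 (GRing.Opp t2)]; split=> /=.
    by rewrite r1 r2.
  move=> e e' /(_ _ (mem_head _ _)) /= h.
  by rewrite -subr_lt0 -sgr_lt0 h sgr_lt0 subr_lt0.
- move=> t1 t2 _ /andP[r1 r2]; exists [:: GRing.Add t1 (GRing.Opp t2)]; split=> /=.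
    by rewrite r1 r2.
  move=> e e' /(_ _ (mem_head _ _)) /= h.
  by rewrite -subr_le0 -sgr_le0 h sgr_le0 subr_le0.
- move=> g1 IH1 g2 IH2 /andP[q1 q2] /andP[r1 r2].
  have [s1 [a1 h1]] := IH1 q1 r1; have [s2 [a2 h2]] := IH2 q2 r2.
  exists (s1 ++ s2); rewrite all_cat a1 a2; split=> // e e' h.
  by rewrite (h1 e e') ?(h2 e e') // => t ts; apply: h; rewrite mem_cat ts ?orbT.
- move=> g1 IH1 g2 IH2 /andP[q1 q2] /andP[r1 r2].
  have [s1 [a1 h1]] := IH1 q1 r1; have [s2 [a2 h2]] := IH2 q2 r2.
  exists (s1 ++ s2); rewrite all_cat a1 a2; split=> // e e' h.
  by rewrite (h1 e e') ?(h2 e e') // => t ts; apply: h; rewrite mem_cat ts ?orbT.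
- move=> g1 IH1 g2 IH2 /andP[q1 q2] /andP[r1 r2].
  have [s1 [a1 h1]] := IH1 q1 r1; have [s2 [a2 h2]] := IH2 q2 r2.
  exists (s1 ++ s2); rewrite all_cat a1 a2; split=> // e e' h.
  by rewrite (h1 e e') ?(h2 e e') // => t ts; apply: h; rewrite mem_cat ts ?orbT.
- by move=> g IH q r; have [s [a h]] := IH q r; exists s; split=> // e e' /h ->.
Qed.

Lemma qelim (f : ord.formula R) : exists g, [/\ ord.qf_form g, ord.rformula g &
  forall e, ord.qf_eval e g <-> ord.holds e f].
Proof.
pose g := ord.quantifier_elim (@wproj R) (ord.to_rform f).
have rf := ord.to_rform_rformula f.
have /andP[qg rg] : ord.qf_form g && ord.rformula g.
  by apply: ord.quantifier_elim_wf rf; exact: wf_QE_wproj.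
exists g; split=> // e.
have P := ord.quantifier_elim_rformP (@wf_QE_wproj R) (@valid_QE_wproj R) e rf.
by rewrite -ord.to_rformP; split => [/P|/P].
Qed.

(* The product of the atoms, after quantifier elimination, that are not
   identically zero vanishes on a definable set with empty interior: where it
   does not vanish, all the atoms have locally constant sign. *)
Lemma definable_thin n (P : (nat -> R) -> Prop) (W : set 'rV[R]_n) :
  definable P -> (forall y, W y <-> P (fun i => (env y)`_i)) ->
  (forall y e, W y -> 0 < e -> exists2 y', `|y' - y| < e & ~ W y') ->
  exists D (G : 'rV[R]_n -> R), [/\ polyf D G, (exists y, G y != 0) & forall y, W y -> G y = 0].
Proof.
move=> [f fP] WP thin; have [g [qg rg gf]] := qelim f.
have [ts [/allP rts tsP]] := qf_form_signs qg rg.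
pose ev t (y : 'rV[R]_n) := GRing.eval (env y) t.
pose ts' := [seq t <- ts | `[< exists y, ev t y != 0 >]].
have WgP y : W y <-> ord.qf_eval (env y) g by rewrite gf fP.
have /choice [Dt DtP] : forall t, exists D, t \in ts -> polyf D (ev t).
  move=> t; case: (boolP (t \in ts)) => [tt|_]; last by exists 0%N.
  by have [D DP] := eval_env_polyf n (rts t tt); exists D.
pose Dm := (\max_(t <- ts') Dt t)%N.
have Dmp t : t \in ts' -> polyf Dm (ev t).
  move=> tt; apply: (@polyf_le _ _ (Dt t)); first by rewrite /Dm leq_bigmax_seq.
  by apply: DtP; move: tt; rewrite mem_filter => /andP[].
have [y0 y0P] : exists y, forall t, t \in ts' -> ev t y != 0.
  apply: (@polyf_prod_neq0 _ _ Dm _ ts' ev) => t tt; split; first exact: Dmp.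
  by move: tt; rewrite mem_filter => /andP[/asboolP].
pose ev' t y := if t \in ts' then ev t y else 1.
exists (size ts' * Dm)%N, (fun y => \prod_(t <- ts') ev' t y); split.
- apply: polyf_prod => t; rewrite /ev'; case: (boolP (t \in ts')) => [/Dmp //|_].
  exact: polyf_cst_le.
- exists y0; rewrite prodf_seq_neq0; apply/allP => t tt /=; by rewrite /ev' tt y0P.
move=> y Wy; apply/eqP; apply: contrapT => /negP.
rewrite prodf_seq_neq0 => /allP Gy.
have near_signs : \forall y' \near y, forall t, t \in ts' -> Num.sg (ev t y') = Num.sg (ev t y).
  have : forall t, t \in ts' -> \forall y' \near y, Num.sg (ev t y') = Num.sg (ev t y).
    move=> t tt; apply: near_sg; first exact: (polyf_continuous (Dmp t tt)).
    by have := Gy t tt; rewrite /= /ev' tt.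
  exact: (@near_all_seq _ (nbhs y) _ _ ts' (fun t y' => Num.sg (ev t y') = Num.sg (ev t y))).
move: near_signs => /nbhs_ballP[e /= e0 He].
have [y' yy' nWy'] := thin y e Wy e0; apply: nWy'.
apply/WgP; rewrite -(tsP (env y)); first by apply/WgP.
move=> t tt; case: (boolP (t \in ts')) => [tt'|].
  symmetry; apply: He tt'; by rewrite -ball_normE /= distrC.
rewrite mem_filter tt andbT => /asboolPn h.
have z x : ev t x = 0 by apply/eqP; apply: contrapT => /negP hx; apply: h; exists x.
by rewrite -!/(ev t _) !z.
Qed.

End Definable.

Section PolynomialMaps.
Variables (R : realType) (n : nat).

(** Monomials as words in the variables: the length of a word is the number of coordinate factors,
    each of which will cost one denominator in [polynomial_relation]. *)
Lemma peval_words k (p : mpoly.mpoly n R) : in_Pkn k p ->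
  exists2 cs : seq (R * seq 'I_n), (forall c, c \in cs -> (size c.2 <= k)%N) &
  forall x, peval p x = \sum_(c <- cs) c.1 * \prod_(i <- c.2) x 0 i.
Proof.
move=> pk; pose w (m : mpoly.multinom n) := flatten [seq nseq (m i) i | i <- enum 'I_n].
exists [seq (mpoly.mcoeff m p, w m) | m <- mpoly.msupp p] => [c /mapP[m mp ->]|x] /=.
  have := leq_trans (@mpoly.mmeasure_mnm_lt _ _ mpoly.mdeg p m mp) pk.
  move=> h; have {h} : (mpoly.mdeg m < k.+1)%N by exact: h.
  rewrite ltnS mpoly.mdegE; apply: leq_trans.
  rewrite /w size_flatten /shape -map_comp sumnE big_map big_enum /=.
  by apply: leq_sum => i _; rewrite size_nseq.
rewrite /peval mpoly.mevalE big_map; apply: eq_bigr => m _; congr (_ * _).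
rewrite /w /= big_flatten big_map big_enum /=; apply: eq_bigr => i _.
by rewrite big_nseq iter_mulr_1.
Qed.

Lemma peval_polyf (q : mpoly.mpoly n R) : exists D, polyf D (peval q).
Proof.
pose k := mpoly.mmeasure mpoly.mdeg q.
have qk : in_Pkn k q by rewrite /in_Pkn leqnSn.
have [cs csk csE] := peval_words qk; exists k.
rewrite (_ : peval q = fun x => \sum_(c <- cs) c.1 * \prod_(i <- c.2) x 0 i); last exact/funext.
elim: cs {csE} csk => [|c cs IH] csk.
  by under eq_fun do rewrite big_nil; exact: polyf_cst_le.
under eq_fun do rewrite big_cons.
apply: polyfD; last by apply: IH => c' cc; apply: csk; rewrite inE cc orbT.
apply: polyfZ; apply: (@polyf_le _ _ (size c.2 * 1)); first by rewrite muln1 csk ?mem_head.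
by apply: polyf_prod => i; apply: polyf_coord.
Qed.

Lemma definable_algebraic (V : set 'rV[R]_n) m : algebraic_set V ->
  definable (fun a : nat -> R => V (\row_i a (m + i)%N)).
Proof.
move=> [s ->]; apply: definable_all => q; have [D pq] := peval_polyf q.
exact: definable_eq pq.
Qed.

(** The image is a projection, hence definable by an existential formula: the variables below [m]
    hold the point of the image, and the next [n] the point of [V]. *)
Lemma algebraic_thin_image (V : set 'rV[R]_n) m (g : 'rV[R]_n -> 'rV[R]_m) D :
  algebraic_set V -> (forall i, polyf D (fun x => g x 0 i)) ->
  (forall y e, (g @` V) y -> 0 < e -> exists2 y', `|y' - y| < e & ~ (g @` V) y') ->
  exists E (G : 'rV[R]_m -> R), [/\ polyf E G, (exists y, G y != 0) & forall x, V x -> G (g x) = 0].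
Proof.
move=> aV pg thin.
pose P (a : nat -> R) := exists b : nat -> R, (V (\row_i b (m + i)%N) /\
  forall i, i \in enum 'I_m -> b i = g (\row_i b (m + i)%N) 0 i) /\
  forall i, ~~ (m <= i < m + n)%N -> b i = a i.
have dP : definable P.
  apply: definable_exn; apply: definable_and; first exact: definable_algebraic.
  apply: definable_all => i; have [t tP] := definable_polyf m (pg i).
  by exists (ord.Equal (GRing.Var _ i) t) => e /=; rewrite tP.
have [|E [G [pG G0 GW]]] := definable_thin dP (W := g @` V) _ thin.
  move=> y; split => [[x Vx xy]|[b [[Vb bg] ba]]].
    pose b i := if (i < m)%N then (env y)`_i else (env x)`_(i - m).
    have xb : \row_i b (m + i)%N = x.
      by apply/rowP => i; rewrite mxE /b ltnNge leq_addr addKn env_nth.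
    exists b; rewrite xb; split; first split => // i _; rewrite ?/b ?ltn_ord ?xy ?env_nth //.
    move=> i h; rewrite /b; case: (ltnP i m) => // mi.
    by rewrite !env_nth_default //; move: h mi; clear; lia.
  exists (\row_i b (m + i)%N) => //; apply/rowP => i.
  rewrite -bg ?mem_enum // ba ?env_nth //.
  by rewrite negb_and -ltnNge ltn_ord.
by exists E, G; split => // x Vx; apply: GW; exists x.
Qed.

End PolynomialMaps.

(** * Smooth algebraic functions are analytic *)

Section EqO.
Variable R : realType.
Implicit Types (f g : R -> R) (p q : {poly R}).

(** The relation $f(t) = g(t) + O(|t|^N)$ as $t \to 0$. *)
Definition eqO (N : nat) f g := exists C d : R, [/\ 0 < d, 0 <= C &
  forall t, `|t| <= d -> `|f t - g t| <= C * `|t| ^+ N].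

Definition bnd f := exists C d : R, [/\ 0 < d, 0 <= C & forall t, `|t| <= d -> `|f t| <= C].

Lemma eqO_refl N f : eqO N f f.
Proof. by exists 0, 1; split => // t _; rewrite subrr normr0 mul0r. Qed.

Lemma eqO_sym N f g : eqO N f g -> eqO N g f.
Proof. by move=> [C [d [? ? H]]]; exists C, d; split => // t /H; rewrite distrC. Qed.

Lemma eqO_trans N g f h : eqO N f g -> eqO N g h -> eqO N f h.
Proof.
move=> [C [d [d0 C0 H]]] [C' [d' [d'0 C'0 H']]]; exists (C + C'), (Num.min d d').
split; [by rewrite lt_min d0|by rewrite addr_ge0|].
move=> t; rewrite le_min => /andP[/H h1 /H' h2].
have -> : f t - h t = (f t - g t) + (g t - h t) by ring.
by apply: le_trans (ler_normD _ _) _; rewrite mulrDl lerD.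
Qed.

Lemma eqO_le N M f g : (M <= N)%N -> eqO N f g -> eqO M f g.
Proof.
move=> MN [C [d [d0 C0 H]]]; exists C, (Num.min d 1).
split => //; first by rewrite lt_min d0 ltr01.
move=> t; rewrite le_min => /andP[/H h t1]; apply: le_trans h _.
by rewrite ler_wpM2l // ler_wiXn2l.
Qed.

Lemma eqOD N f g f' g' : eqO N f g -> eqO N f' g' -> eqO N (fun t => f t + f' t) (fun t => g t + g' t).
Proof.
move=> [C [d [d0 C0 H]]] [C' [d' [d'0 C'0 H']]]; exists (C + C'), (Num.min d d').
split; [by rewrite lt_min d0|by rewrite addr_ge0|].
move=> t; rewrite le_min => /andP[/H h /H' h'].
have -> : f t + f' t - (g t + g' t) = (f t - g t) + (f' t - g' t) by ring.
by apply: le_trans (ler_normD _ _) _; rewrite mulrDl lerD.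
Qed.

Lemma eqOM N f g f' g' : bnd f' -> bnd g -> eqO N f g -> eqO N f' g' ->
  eqO N (fun t => f t * f' t) (fun t => g t * g' t).
Proof.
move=> [A [a [a0 A0 HA]]] [B [b [b0 B0 HB]]] [C [d [d0 C0 H]]] [C' [d' [d'0 C'0 H']]].
exists (C * A + B * C'), (Num.min (Num.min a b) (Num.min d d')).
split; [by rewrite !lt_min a0 b0 d0|by rewrite addr_ge0 ?mulr_ge0|].
move=> t; rewrite !le_min => /andP[/andP[/HA ha /HB hb] /andP[/H h /H' h']].
have -> : f t * f' t - g t * g' t = (f t - g t) * f' t + g t * (f' t - g' t) by ring.
apply: le_trans (ler_normD _ _) _; rewrite !normrM mulrDl; apply: lerD.
  by rewrite mulrAC; apply: ler_pM.
by rewrite -mulrA; apply: ler_pM.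
Qed.

Lemma bnd_horner p : bnd (fun t => p.[t]).
Proof. by exists (pnorm 1 p), 1; split => [//||t t1]; rewrite ?pnorm_ge0 // pnorm_horner_le. Qed.

Lemma bnd_eqO N f g : bnd g -> eqO N f g -> bnd f.
Proof.
move=> [A [a [a0 A0 HA]]] [C [d [d0 C0 H]]]; exists (C + A), (Num.min a (Num.min d 1)).
split; [by rewrite !lt_min a0 d0 ltr01|by rewrite addr_ge0|].
move=> t; rewrite !le_min => /andP[/HA ha /andP[/H h t1]].
rewrite -[f t](subrK (g t)); apply: le_trans (ler_normD _ _) _; apply: lerD => //.
by apply: le_trans h _; rewrite ler_piMr // exprn_ile1.
Qed.

Lemma bndM f g : bnd f -> bnd g -> bnd (fun t => f t * g t).
Proof.
move=> [A [a [a0 A0 HA]]] [B [b [b0 B0 HB]]]; exists (A * B), (Num.min a b).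
split; [by rewrite lt_min a0|by rewrite mulr_ge0|].
by move=> t; rewrite le_min => /andP[/HA ha /HB hb]; rewrite normrM; apply: ler_pM.
Qed.

Lemma bndX f n : bnd f -> bnd (fun t => f t ^+ n).
Proof.
move=> bf; elim: n => [|n IH]; first by exists 1, 1; split => // t _; rewrite expr0 normr1.
by under eq_fun do rewrite exprS; exact: bndM.
Qed.

Lemma eqOX N f g n : bnd f -> bnd g -> eqO N f g -> eqO N (fun t => f t ^+ n) (fun t => g t ^+ n).
Proof.
move=> bf bg fg; elim: n => [|n IH]; first exact: eqO_refl.
under eq_fun do rewrite exprS; under [X in eqO _ _ X]eq_fun do rewrite exprS.
by apply: eqOM => //; exact: bndX.
Qed.

Lemma eqO_sum N (I : Type) (r : seq I) (f g : I -> R -> R) : (forall i, eqO N (f i) (g i)) ->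
  eqO N (fun t => \sum_(i <- r) f i t) (fun t => \sum_(i <- r) g i t).
Proof.
move=> H; elim: r => [|i r IH].
  under eq_fun do rewrite big_nil; under [X in eqO _ _ X]eq_fun do rewrite big_nil.
  exact: eqO_refl.
under eq_fun do rewrite big_cons; under [X in eqO _ _ X]eq_fun do rewrite big_cons.
exact: eqOD.
Qed.

Lemma eqO_ext N f g f' g' : f =1 f' -> g =1 g' -> eqO N f g -> eqO N f' g'.
Proof. by move=> /funext -> /funext ->. Qed.

Lemma eqO_scale N f g c : eqO N f g -> eqO N (fun t => f (t * c)) (fun t => g (t * c)).
Proof.
move=> [C [d [d0 C0 H]]]; exists (C * `|c| ^+ N), (d / (`|c| + 1)).
have c1 : 0 < `|c| + 1 by rewrite ltr_wpDl.
split; [by rewrite divr_gt0|by rewrite mulr_ge0 ?exprn_ge0|].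
move=> t; rewrite ler_pdivlMr // => tc.
apply: le_trans (H _ _) _.
  by rewrite normrM; apply: le_trans tc; rewrite ler_wpM2l // lerDl.
by rewrite normrM exprMn -mulrA [`|t| ^+ N * _]mulrC.
Qed.

Lemma eqO_take N p : eqO N (fun t => p.[t]) (fun t => \sum_(i < N) p`_i * t ^+ i).
Proof.
exists (pnorm 1 p), 1; split => //; first exact: pnorm_ge0.
by move=> t t1; have := horner_tail p N ltr01 t1; rewrite divr1 mulrC.
Qed.

Definition often (P : R -> Prop) := forall d, 0 < d -> exists2 t, 0 < `|t| < d & P t.

Lemma poly_small N C p : often (fun t => `|p.[t]| <= C * `|t| ^+ N) ->
  forall i, (i < N)%N -> p`_i = 0.
Proof.
elim: N p => [//|N IH] p H i iN.
have p0 : p`_0 = 0.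
  apply/eqP; rewrite -normr_le0; apply/ler_addgt0Pl => e e0; rewrite addr0.
  pose K := `|C| + pnorm 1 p + 1.
  have K0 : 0 < K by rewrite ltr_wpDl // addr_ge0 // pnorm_ge0.
  have [|t /andP[t0]] := H (Num.min 1 (e / K)); first by rewrite lt_min ltr01 divr_gt0.
  rewrite lt_min => /andP[t1]; rewrite ltr_pdivlMr // => tK pt.
  have := horner_tail p 1 ltr01 (ltW t1); rewrite big_ord1 expr0 mulr1 divr1 expr1 => h.
  have -> : p`_0 = p.[t] - (p.[t] - p`_0) by ring.
  apply: le_trans (ler_normB _ _) _; apply: le_trans (lerD pt h) _.
  apply: le_trans (_ : `|C| * `|t| + `|t| * pnorm 1 p <= _).
    rewrite lerD2r; apply: le_trans (_ : `|C| * `|t| ^+ N.+1 <= _).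
      by rewrite ler_wpM2r ?exprn_ge0 // ler_norm.
    by rewrite ler_wpM2l // exprS ler_piMr // exprn_ile1 // ltW.
  by apply/ltW; apply: le_lt_trans tK; rewrite /K; nra.
have pE : p = drop_poly 1 p * 'X.
  by rewrite -[LHS](poly_take_drop 1) -[X in X + _](_ : 0 = _) ?add0r ?expr1 //; apply/polyP => j;
     rewrite coef_take_poly coef0; case: j.
case: i iN => [//|i] iN; rewrite pE coefMX /=; apply: IH => // d d0.
have [t /andP[t0 td] pt] := H d d0; exists t; rewrite ?t0 //.
by move: pt; rewrite {1}pE hornerM hornerX normrM exprSr mulrA ler_pM2r.
Qed.

Lemma eqO_coef N p q : eqO N (fun t => p.[t]) (fun t => q.[t]) -> forall i, (i < N)%N -> p`_i = q`_i.
Proof.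
move=> [C [d [d0 C0 H]]] i iN; apply/eqP; rewrite -subr_eq0 -coefB; apply/eqP.
apply: (@poly_small N C) => // d' d'0.
have dd : 0 < Num.min d d' by rewrite lt_min d0.
have tE : `|Num.min d d' / 2| = Num.min d d' / 2 by rewrite gtr0_norm // divr_gt0.
have le1 : Num.min d d' <= d by rewrite ge_min lexx.
have le2 : Num.min d d' <= d' by rewrite ge_min lexx orbT.
exists (Num.min d d' / 2); first by rewrite tE; lra.
by rewrite hornerD hornerN; apply: H; rewrite tE; lra.
Qed.

Lemma cauchy_limit (a : nat -> R) :
  (forall e, 0 < e -> exists N, forall i j, (N <= i)%N -> (N <= j)%N -> `|a i - a j| <= e) ->
  exists l, forall e, 0 < e -> exists N, forall i, (N <= i)%N -> `|a i - l| <= e.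
Proof.
move=> H; have ca : cvg (a @ \oo).
  apply/cauchy_cvgP/cauchy_exP => e e0.
  have e20 : 0 < e / 2 by lra.
  have [N NP] := H _ e20; exists (a N); exists N => // i /= Ni.
  by rewrite -ball_normE /=; have := NP N i (leqnn _) Ni; lra.
exists (lim (a @ \oo)) => e e0.
have /cvgrPdist_le /(_ _ e0) [N _ NP] := ca.
by exists N => i Ni; rewrite distrC; apply: NP.
Qed.

(** The coefficients of [T L] converge, and their limits are the Taylor coefficients of [f]: the
    tails of order [N] are uniformly $O(|t|^N)$ by [horner_tail]. *)
Lemma approximates_eqO T s f N : 0 < s -> approximates T s f ->
  exists q : {poly R}, eqO N f (fun t => q.[t]).
Proof.
move=> s0 Tf; have s0' := ltW s0.
have /choice [c cP] : forall k, exists l, forall e, 0 < e -> exists N, forall i, (N <= i)%N -> `|(T i)`_k - l| <= e.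
  move=> k; apply: cauchy_limit => e e0.
  have [M MP] := (proj1 Tf) (e * s ^+ k) ltac:(by rewrite mulr_gt0 // exprn_gt0).
  exists M => i j Mi Mj; have := MP i j Mi Mj => h.
  have := le_trans (pnorm_coef (T i - T j) k s0') h.
  by rewrite coefB ler_pM2r // exprn_gt0.
have [B B0 [N0 N0P]] := approximates_bounded s0' Tf.
exists (\poly_(i < N) c i), (B / s ^+ N), s; split => //; first by rewrite divr_ge0 ?exprn_ge0 // ltW.
move=> t ts; rewrite horner_poly; apply/ler_addgt0Pl => e e0.
have e40 : 0 < e / 2 by lra.
have [N1 N1P] := approximates_unif s0' Tf e40.
have [N2 N2P] : exists M, forall L, (M <= L)%N -> forall k : 'I_N, `|(T L)`_k * t ^+ k - c k * t ^+ k| <= e / 2 / N.+1%:R.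
  have : forall k : 'I_N, exists M, forall L, (M <= L)%N -> `|(T L)`_k * t ^+ k - c k * t ^+ k| <= e / 2 / N.+1%:R.
    move=> k; pose K := `|t| ^+ k + 1.
    have K0 : 0 < K by rewrite ltr_wpDl // exprn_ge0.
    have [M MP] := cP k (e / 2 / N.+1%:R / K) ltac:(by rewrite !divr_gt0).
    exists M => L /MP; rewrite ler_pdivlMr // => h; rewrite -mulrBl normrM normrX.
    by apply: le_trans h; rewrite ler_wpM2l // lerDl.
  move=> /choice[Nf NfP]; exists (\max_i Nf i) => L LL k; apply: NfP.
  by apply: leq_trans LL; apply: (leq_bigmax k).
pose L := maxn N0 (maxn N1 N2).
have L0 : (N0 <= L)%N by rewrite leq_maxl.
have L1 : (N1 <= L)%N by rewrite /L !leq_max leqnn orbT.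
have L2 : (N2 <= L)%N by rewrite /L !leq_max leqnn !orbT.
have h1 := N1P L L1 t ts; rewrite distrC in h1.
have h2 := horner_tail (T L) N s0 ts.
have h3 : `|\sum_(k < N) (T L)`_k * t ^+ k - \sum_(k < N) c k * t ^+ k| <= e / 2.
  rewrite -sumrB; apply: le_trans (ler_norm_sum _ _ _) _.
  apply: le_trans (_ : \sum_(k < N) e / 2 / N.+1%:R <= _); first by apply: ler_sum => k _; apply: N2P.
  rewrite sumr_const card_ord -[X in X <= _]mulr_natr -mulrA ler_piMr ?(ltW e40) //.
  by rewrite mulrC ler_pdivrMr ?ltr0n // mul1r ler_nat.
have h4 : (`|t| / s) ^+ N * pnorm s (T L) <= B / s ^+ N * `|t| ^+ N.
  have -> : B / s ^+ N * `|t| ^+ N = (`|t| / s) ^+ N * B by rewrite expr_div_n; ring.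
  by rewrite ler_wpM2l ?exprn_ge0 ?divr_ge0 // N0P.
have -> : f t - \sum_(k < N) c k * t ^+ k = (f t - (T L).[t]) + ((T L).[t] - \sum_(k < N) (T L)`_k * t ^+ k)
  + (\sum_(k < N) (T L)`_k * t ^+ k - \sum_(k < N) c k * t ^+ k) by ring.
apply: le_trans (ler_normD _ _) _; apply: le_trans (lerD (ler_normD _ _) (lexx _)) _; lra.
Qed.

(** If the difference of two Taylor polynomials is $O(|t|^N)$ at arbitrarily small parameters, their
    coefficients below order [N] coincide. So it suffices that the functions agree at such
    parameters. *)
Lemma eqO_agree f g : (forall N, exists p : {poly R}, eqO N f (fun t => p.[t])) ->
  (forall N, exists p : {poly R}, eqO N g (fun t => p.[t])) -> often (fun t => f t = g t) ->
  forall N, eqO N f g.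
Proof.
move=> Tf Tg fg N; have [p fp] := Tf N; have [q gq] := Tg N.
have pq i : (i < N)%N -> (p - q)`_i = 0.
  have [C [d [d0 C0 H]]] := fp; have [C' [d' [d'0 C'0 H']]] := gq.
  apply: (@poly_small N (C + C')) => e e0.
  have [|t /andP[t0]] := fg (Num.min e (Num.min d d')); first by rewrite !lt_min e0 d0.
  rewrite !lt_min => /andP[te /andP[td td']] E; exists t; first by rewrite t0.
  have h := H t (ltW td); have h' := H' t (ltW td'); rewrite -E in h'.
  rewrite hornerD hornerN mulrDl.
  have -> : p.[t] - q.[t] = (f t - q.[t]) - (f t - p.[t]) by ring.
  by apply: le_trans (ler_normB _ _) _; rewrite addrC lerD.
apply: eqO_trans fp _; apply: eqO_trans _ (eqO_sym gq).
apply: eqO_trans (eqO_take N p) (eqO_sym _).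
apply: eqO_ext (eqO_take N q) => // t; apply: eq_bigr => i _.
by have /eqP := pq i (ltn_ord i); rewrite coefB subr_eq0 => /eqP ->.
Qed.

End EqO.

Section PolyfCoefs.
Variables (R : realType) (d : nat).

Definition polyfx (f : 'rV[R]_d -> R) := exists D, polyf D f.

Lemma polyfx_of D f : polyf D f -> polyfx f. Proof. by exists D. Qed.

Lemma polyfxD f g : polyfx f -> polyfx g -> polyfx (fun x => f x + g x).
Proof.
move=> [D pf] [E pg]; exists (maxn D E).
by apply: polyfD; [apply: polyf_le pf; exact: leq_maxl|apply: polyf_le pg; exact: leq_maxr].
Qed.

Lemma polyfxM f g : polyfx f -> polyfx g -> polyfx (fun x => f x * g x).
Proof. by move=> [D pf] [E pg]; exists (D + E)%N; apply: polyfM. Qed.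

Lemma polyfx_sum (I : Type) (r : seq I) (f : I -> 'rV[R]_d -> R) :
  (forall i, polyfx (f i)) -> polyfx (fun x => \sum_(i <- r) f i x).
Proof.
move=> H; elim: r => [|i r IH].
  by under eq_fun do rewrite big_nil; exists 0%N; exact: polyf_cst.
by under eq_fun do rewrite big_cons; exact: polyfxD.
Qed.

Definition coefs_polyfx (F : 'rV[R]_d -> {poly R}) := forall i, polyfx (fun x => (F x)`_i).

Lemma coefs_polyfxM F G : coefs_polyfx F -> coefs_polyfx G -> coefs_polyfx (fun x => F x * G x).
Proof.
move=> pF pG i; under eq_fun do rewrite coefM; apply: polyfx_sum => j; exact: polyfxM.
Qed.

Lemma coefs_polyfxX F n : coefs_polyfx F -> coefs_polyfx (fun x => F x ^+ n).
Proof.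
move=> pF; elim: n => [|n IH].
  by move=> i; under eq_fun do rewrite expr0 coef1; exists 0%N; exact: polyf_cst.
by under eq_fun do rewrite exprS; exact: coefs_polyfxM.
Qed.

Lemma coefs_polyfx_sum (I : Type) (r : seq I) (F : I -> 'rV[R]_d -> {poly R}) :
  (forall i, coefs_polyfx (F i)) -> coefs_polyfx (fun x => \sum_(i <- r) F i x).
Proof. by move=> H i; under eq_fun do rewrite coef_sum; apply: polyfx_sum => j; exact: H. Qed.

End PolyfCoefs.

(** * The Taylor series of a smooth algebraic function *)

Section Expansion.
Variables (R : realType) (d : nat) (phi : 'rV[R]_d -> R).
Implicit Types (u v w : 'rV[R]_d).

Lemma taylorable_line w v : taylorable phi w -> forall N,
  exists p : {poly R}, eqO N (fun t => phi (w + t *: v)) (fun t => p.[t]).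
Proof.
move=> tp N; have [D [tau [C [r [pt r0 H]]]]] := tp N.
have [p _ pE] := polyf_line pt 0 v; exists p, (`|C| * `|v| ^+ N), (r / (`|v| + 1)).
have v1 : 0 < `|v| + 1 by rewrite ltr_wpDl.
split; [by rewrite divr_gt0|by rewrite mulr_ge0 ?exprn_ge0|].
move=> t; rewrite ler_pdivlMr // => tv; rewrite -pE add0r.
apply: le_trans (H _ _) _.
  by rewrite normrZ; apply: le_trans tv; rewrite ler_wpM2l // lerDl.
rewrite normrZ exprMn [`|t| ^+ N * _]mulrC mulrA ler_wpM2r ?exprn_ge0 //.
by rewrite ler_wpM2r ?exprn_ge0 // ler_norm.
Qed.

(** The Taylor polynomials of different orders have the same homogeneous parts where they overlap,
    by [eqO_coef]. The part of degree [m] is read off the polynomial with error of order [m.+1], the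
    first one that determines it. *)
Lemma homogeneous_parts : taylorable phi 0 -> exists H : nat -> 'rV[R]_d -> R,
  (forall m, polyf m (H m)) /\
  forall v N, eqO N (fun t => phi (t *: v)) (fun t => (\poly_(m < N) H m v).[t]).
Proof.
move=> tp.
have /choice [HH HHP] : forall N, exists Hn : nat -> 'rV[R]_d -> R, (forall m, polyf m (Hn m)) /\
    forall v, exists p : {poly R}, (forall m, p`_m = Hn m v) /\
      eqO N (fun t => phi (t *: v)) (fun t => p.[t]).
  move=> N; have [D [tau [C [r [pt r0 Ht]]]]] := tp N.
  have [Hn [pH HE]] := polyf_graded pt.
  exists (fun m => if (m < D.+1)%N then Hn m else fun=> 0); split.
    by move=> m; case: ifP => // _; exact: polyf_cst_le.
  move=> v; exists (\poly_(m < D.+1) Hn m v); split.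
    by move=> m; rewrite coef_poly; case: ifP.
  exists (`|C| * `|v| ^+ N), (r / (`|v| + 1)).
  have v1 : 0 < `|v| + 1 by rewrite ltr_wpDl.
  split; [by rewrite divr_gt0|by rewrite mulr_ge0 ?exprn_ge0|].
  move=> t; rewrite ler_pdivlMr // => tv; rewrite horner_poly -HE.
  have := Ht (t *: v); rewrite add0r => h; apply: le_trans (h _) _.
    by rewrite normrZ; apply: le_trans tv; rewrite ler_wpM2l // lerDl.
  rewrite normrZ exprMn -mulrA [`|v| ^+ N * _]mulrC ler_wpM2r ?mulr_ge0 ?exprn_ge0 //.
  exact: ler_norm.
exists (fun m => HH m.+1 m); split=> [m|v N]; first by have [] := HHP m.+1.
have [_ /(_ v) [p [pE pO]]] := HHP N.
apply: (eqO_trans pO); apply: eqO_ext (eqO_take N p) => // t.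
rewrite horner_poly; apply: eq_bigr => m _.
have [_ /(_ v) [p' [p'E p'O]]] := HHP m.+1.
rewrite -p'E; congr (_ * _); apply: (@eqO_coef _ m.+1) => //.
apply: eqO_trans (eqO_sym _) p'O; apply: eqO_le pO; exact: ltn_ord.
Qed.

Variable H : nat -> 'rV[R]_d -> R.
Hypothesis pH : forall m, polyf m (H m).
Hypothesis HE : forall v N, eqO N (fun t => phi (t *: v)) (fun t => (\poly_(m < N) H m v).[t]).

Lemma homogeneous_parts_scale m c v : H m (c *: v) = c ^+ m * H m v.
Proof.
have h1 := HE (c *: v) m.+1; have h2 := eqO_scale c (HE v m.+1).
have : eqO m.+1 (fun t => (\poly_(i < m.+1) H i (c *: v)).[t]) (fun t => (\poly_(i < m.+1) (c ^+ i * H i v)).[t]).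
  apply: eqO_trans (eqO_sym h1) _.
  apply: eqO_ext h2 => t; first by rewrite scalerA.
  by rewrite !horner_poly; apply: eq_bigr => i _; rewrite exprMn; ring.
by move=> /eqO_coef /(_ m (ltnSn m)); rewrite !coef_poly ltnSn.
Qed.

Variables (r0 : R) (D DP : nat) (P : nat -> 'rV[R]_d -> R).
Hypothesis r00 : 0 < r0.
Hypothesis pP : forall e, polyf DP (P e).
Hypothesis rel : forall u, `|u| < r0 -> \sum_(e < D.+1) P e u * phi u ^+ e = 0.
Hypothesis nz : exists e u, (e <= D)%N /\ P e u != 0.

Definition pu u : {poly R} := \poly_(e < D.+1) P e u.
Definition hs k e u := ((pu u)^`N(k))`_e.
(** The divided (Hasse) derivative of order [k] of the relation with respect to the value, taken at
    [T]. With divided derivatives Taylor's formula has no factorials. *)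
Definition ev k u T := ((pu u)^`N(k)).[T].

Lemma hsE k e u : hs k e u = if (k + e < D.+1)%N then P (k + e) u *+ 'C(k + e, k) else 0.
Proof. by rewrite /hs coef_nderivn coef_poly; case: ifP; rewrite ?mul0rn. Qed.

Lemma polyf_hs k e : polyf DP (hs k e).
Proof.
apply: (@polyf_ext _ _ _ (fun u => if (k + e < D.+1)%N then 'C(k + e, k)%:R * P (k + e) u else 0)).
  by move=> u; rewrite hsE; case: ifP => // _; rewrite mulr_natl.
by case: (k + e < D.+1)%N; [apply: polyfZ|apply: polyf_cst_le].
Qed.

Lemma evE k u T : ev k u T = \sum_(e < D.+1) hs k e u * T ^+ e.
Proof.
rewrite /ev (@horner_coef_wide _ D.+1) //; apply/leq_sizeP => j Dj.
by rewrite -/(hs k j u) hsE ltnNge (leq_trans Dj) ?leq_addl.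
Qed.

Lemma ev0E u T : ev 0 u T = \sum_(e < D.+1) P e u * T ^+ e.
Proof. by rewrite evE; apply: eq_bigr => e _; rewrite hsE add0n ltn_ord bin0 mulr1n. Qed.

Lemma ev_taylor u T g : ev 0 u (T + g) = \sum_(k < D.+1) ev k u T * g ^+ k.
Proof.
rewrite /ev nderivn0 (@nderiv_taylor_wide _ D.+1) //; first by rewrite /GRing.comm mulrC.
exact: size_poly.
Qed.

Lemma exists_graded : exists G : nat -> nat -> nat -> 'rV[R]_d -> R,
  (forall k e m, polyf m (G k e m)) /\
  forall k e t v, (\poly_(m < DP.+1) G k e m v).[t] = hs k e (t *: v).
Proof.
have /choice [G GP] : forall ke : nat * nat, exists Gm : nat -> 'rV[R]_d -> R,
   (forall m, polyf m (Gm m)) /\ forall t v, hs ke.1 ke.2 (t *: v) = \sum_(m < DP.+1) Gm m v * t ^+ m.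
  by move=> [k e]; exact: polyf_graded (polyf_hs k e).
exists (fun k e => G (k, e)); split=> [k e m|k e t v]; first by have [] := GP (k, e).
by have [_ /(_ t v) /= ->] := GP (k, e); rewrite horner_poly.
Qed.

Variable G : nat -> nat -> nat -> 'rV[R]_d -> R.
Hypothesis pG : forall k e m, polyf m (G k e m).
Hypothesis GE : forall k e t v, (\poly_(m < DP.+1) G k e m v).[t] = hs k e (t *: v).

Definition qk k e v : {poly R} := \poly_(m < DP.+1) G k e m v.
Definition tau M v : {poly R} := \poly_(m < M) H m v.
(** The divided derivative of order [k] of the relation along the ray of [v], evaluated at the
    truncated Taylor series. Its coefficients of order less than [M] do not depend on the
    truncation, which justifies [kap]; [flat k] means that the Taylor series is formally a root of
    this derivative. *)
Definition Sk k M v := \sum_(e < D.+1) qk k e v * tau M v ^+ e.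
Definition kap k i v := (Sk k i.+1 v)`_i.
Definition flat k := forall i v, kap k i v = 0.

Lemma Sk_eqO f v k M : eqO M f (fun t => (tau M v).[t]) ->
  eqO M (fun t => ev k (t *: v) (f t)) (fun t => (Sk k M v).[t]).
Proof.
move=> fE; have bf := bnd_eqO (bnd_horner (tau M v)) fE.
apply: (@eqO_ext _ _ (fun t => \sum_(e < D.+1) (qk k e v).[t] * f t ^+ e)
   (fun t => \sum_(e < D.+1) (qk k e v).[t] * (tau M v).[t] ^+ e)).
- by move=> t; rewrite evE; apply: eq_bigr => e _; rewrite GE.
- by move=> t; rewrite /Sk horner_sum; apply: eq_bigr => e _; rewrite hornerM horner_exp.
apply: eqO_sum => e; apply: eqOM; [exact: bndX|exact: bnd_horner|exact: eqO_refl|].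
by apply: eqOX => //; exact: bnd_horner.
Qed.

Lemma Sk_coef k M i v : (i < M)%N -> (Sk k M v)`_i = kap k i v.
Proof.
move=> iM; apply: (@eqO_coef _ i.+1) => //.
apply: eqO_trans (eqO_le _ (eqO_sym (Sk_eqO k (HE v M)))) (Sk_eqO k (HE v i.+1)); exact: iM.
Qed.

Lemma coefs_tau M : coefs_polyfx (tau M).
Proof.
move=> i; exists i; apply: (@polyf_ext _ _ _ (fun v => if (i < M)%N then H i v else 0)).
  by move=> v; rewrite coef_poly.
by case: (i < M)%N => //; apply: polyf_cst_le.
Qed.

Lemma coefs_qk k e : coefs_polyfx (qk k e).
Proof.
move=> i; exists i; apply: (@polyf_ext _ _ _ (fun v => if (i < DP.+1)%N then G k e i v else 0)).
  by move=> v; rewrite coef_poly.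
by case: (i < DP.+1)%N => //; apply: polyf_cst_le.
Qed.

Lemma polyfx_kap k i : polyfx (kap k i).
Proof.
apply: coefs_polyfx_sum => e; apply: coefs_polyfxM; first exact: coefs_qk.
by apply: coefs_polyfxX; exact: coefs_tau.
Qed.

Lemma flat0 : flat 0.
Proof.
move=> i v; rewrite /kap -[RHS](coef0 _ i); apply: (@eqO_coef _ i.+1) => //.
apply: eqO_trans (eqO_sym (Sk_eqO 0 (HE v i.+1))) _.
exists 0, (r0 / 2 / (`|v| + 1)).
have v1 : 0 < `|v| + 1 by rewrite ltr_wpDl.
split => //; first by rewrite !divr_gt0.
move=> t; rewrite ler_pdivlMr // => tv; rewrite horner0 subr0 mul0r ev0E rel ?normr0 //.
rewrite normrZ; apply: le_lt_trans (_ : r0 / 2 < _); last by move: r00; lra.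
by apply: le_trans tv; rewrite ler_wpM2l // lerDl.
Qed.

Lemma poly_eq_horner (p q : {poly R}) : (forall t, p.[t] = q.[t]) -> p = q.
Proof.
move=> pq; apply/eqP; rewrite -subr_eq0; apply/eqP; apply: (@poly_eq0_interval _ _ 0 1) => // t _.
by rewrite hornerD hornerN pq subrr.
Qed.

(** If [m] is the highest power of the value with a nonzero coefficient, the divided derivative of
    order [m] is this coefficient [P m] itself. *)
Lemma nonflat : exists k, ~ flat k.
Proof.
have [e [u [eD Pu]]] := nz.
pose A e := `[< exists u, P e u != 0 >].
have exA : exists e, (e <= D)%N && A e by exists e; rewrite eD; apply/asboolP; exists u.
have ubA e' : (e' <= D)%N && A e' -> (e' <= D)%N by case/andP.
case: (ex_maxnP exA ubA) => m /andP[mD /asboolP[v Pv]] mmax.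
exists m => fl; case/eqP: Pv.
have q0 (e' : nat) : (0 < e')%N -> qk m e' v = 0.
  move=> e'0; apply: poly_eq_horner => t; rewrite horner0 GE hsE; case: ltnP => // me.
  have -> : P (m + e')%N (t *: v) = 0; last by rewrite mul0rn.
  apply/eqP; apply: contrapT => /negP h.
  have := mmax (m + e')%N; rewrite -ltnS me /= => /(_ _)/wrap[|]; first by apply/asboolP; exists (t *: v).
  by move: e'0; clear; lia.
have SE M : Sk m M v = qk m 0 v.
  rewrite /Sk big_ord_recl expr0 mulr1 big1 ?addr0 // => i _.
  by rewrite q0 ?mul0r.
have : qk m 0 v = 0.
  by apply/polyP => i; rewrite -(SE i.+1) coef0; exact: fl.
move=> /(congr1 (fun p => p.[1])); rewrite GE horner0 scale1r hsE addn0 ltnS mD.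
by rewrite binn mulr1n.
Qed.

Lemma deriv_link k M v :
  \sum_(e < D.+1) qk k e v * tau M v ^+ e.-1 *+ e = Sk k.+1 M v *+ k.+1.
Proof.
rewrite /Sk big_ord_recl mulr0n add0r big_ord_recr /= mulrnDl.
have -> : qk k.+1 D v = 0.
  apply: poly_eq_horner => t; rewrite horner0 GE hsE ltnNge.
  by rewrite (_ : (D < k.+1 + D)%N) //; clear; lia.
rewrite mul0r mul0rn addr0 -sumrMnl; apply: eq_bigr => e _; rewrite /bump leq0n add1n /=.
rewrite -!mulrnAl; congr (_ * _); apply: poly_eq_horner => t.
rewrite !hornerMn !GE !hsE addnS addSn; case: ifP => _; last by rewrite !mul0rn.
rewrite -!mulrnA; congr (_ *+ _).
by rewrite mulnC [RHS]mulnC mul_bin_left (_ : (k + e).+1 - k = e.+1)%N //; clear; lia.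
Qed.

(** Just before the first derivative that is not flat, the Taylor series is formally a simple root:
    the next derivative has a finite order [N] along it. This is the situation of [hensel_bound]. *)
Lemma min_nonflat : exists k N v, [/\ flat k, (forall j, (j <= k)%N -> flat j),
  kap k.+1 N v != 0 & forall i w, (i < N)%N -> kap k.+1 i w = 0].
Proof.
have exk : exists k, `[< ~ flat k >] by have [k kP] := nonflat; exists k; apply/asboolP.
case: (ex_minnP exk) => -[|k] /asboolP kP kmin; first by case: kP; exact: flat0.
have fl j : (j <= k)%N -> flat j.
  by move=> jk; apply: contrapT => h; have := kmin j ltac:(by apply/asboolP); move: jk; clear; lia.
have exN : exists N, `[< exists v, kap k.+1 N v != 0 >].
  apply: contrapT => h; apply: kP => i v; apply/eqP; apply: contrapT => /negP h'.
  by apply: h; exists i; apply/asboolP; exists v.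
case: (ex_minnP exN) => N /asboolP[v vN] Nmin.
exists k, N, v; split => //; first exact: fl.
move=> i w iN; apply/eqP; apply: contrapT => /negP h.
by have := Nmin i ltac:(by apply/asboolP; exists w); rewrite leqNgt iN.
Qed.

Lemma near_bound_polyf (I : finType) (g : I -> 'rV[R]_d -> R) x : (forall i, polyfx (g i)) ->
  exists2 M, 0 <= M & exists2 r : R, 0 < r & forall i y, `|y - x| <= r -> `|g i y| <= M.
Proof.
move=> pg; have [|M [r r1 H']] := @near_bound _ _ _ g x.
  by move=> i; have [E pE] := pg i; exact: (polyf_continuous pE).
exists `|M| => //; exists r => // i y yr; apply: le_trans (ler_norm _).
by have := H' i (y - x) yr; rewrite addrC subrK.
Qed.

(** [hensel_bound] for the derivative of order [k], uniformly in the directions [v] near [v0]: the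
    data are bounded there, and the leading coefficient of the next derivative keeps half of its
    size at [v0]. *)
Lemma kap_bounds k N v0 : flat k -> kap k.+1 N v0 != 0 -> (forall i w, (i < N)%N -> kap k.+1 i w = 0) ->
  exists2 B, 1 <= B & exists2 r : R, 0 < r & forall v, `|v - v0| <= r -> forall i, `|H i v| <= B ^+ i.+1.
Proof.
move=> fk kN kn.
have [A1 A10 [r1 r10 HA1]] := @near_bound_polyf _ (fun em : 'I_D.+1 * 'I_DP.+1 => G k em.1 em.2) v0
  (fun em => polyfx_of (pG k em.1 em.2)).
have [A2 A20 [r2 r20 HA2]] := @near_bound_polyf _ (fun i : 'I_N.+1 => H i) v0 (fun i => polyfx_of (pH i)).
have [E pE] := polyfx_kap k.+1 N.
pose del := `|kap k.+1 N v0| / 2.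
have del0 : 0 < del by rewrite divr_gt0 // normr_gt0.
have [r3 r30 Hr3] := continuous_ball (@polyf_continuous _ _ _ _ pE v0) del0.
pose A := DP.+1%:R * A1 + A2.
have A0 : 0 <= A by rewrite addr_ge0 ?mulr_ge0.
have [B B1 HB] := hensel_bound D N A0 del0.
exists B => //; exists (Num.min r1 (Num.min r2 r3)); first by rewrite !lt_min r10 r20.
move=> v; rewrite !le_min => /andP[vr1 /andP[vr2 vr3]].
apply: (HB (fun e => qk k e v)).
- move=> e; rewrite (@pnorm_widen _ DP.+1) ?size_poly //.
  apply: le_trans (_ : \sum_(i < DP.+1) A1 <= _).
    apply: ler_sum => i _; rewrite expr1n mulr1 coef_poly ltn_ord.
    exact: (HA1 (e, i)).
  by rewrite sumr_const card_ord -[X in X <= _]mulr_natl lerDl.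
- move=> i iN; apply: le_trans (HA2 (Ordinal (iN : (i < N.+1)%N)) v vr2) _.
  by rewrite lerDr mulr_ge0.
- move=> m i im; have := fk i v; rewrite -(@Sk_coef k m.+1 i v) //.
- move=> i iN; rewrite deriv_link coefMn Sk_coef ?kn ?mul0rn //.
  exact: leq_trans iN (leqnSn _).
rewrite deriv_link coefMn Sk_coef // normrMn.
apply: le_trans (_ : `|kap k.+1 N v| <= _); last by rewrite -[X in X <= _]mulr1n ler_wpMn2l.
have := Hr3 (v - v0) vr3; rewrite [v0 + _]addrC subrK => h.
have := ler_normB (kap k.+1 N v) (kap k.+1 N v - kap k.+1 N v0); rewrite subKr.
by move: h; rewrite /del; lra.
Qed.

(** On lines through [v0] the part [H m] is a polynomial of degree at most [m], so
    [pnorm_le_of_interval] carries the bound from a neighbourhood of [v0] to the unit ball at a cost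
    exponential in [m]. Homogeneity gives the factor $|v|^m$. *)
Lemma kap_bounds_all k N v0 : flat k -> kap k.+1 N v0 != 0 -> (forall i w, (i < N)%N -> kap k.+1 i w = 0) ->
  exists2 C, 1 <= C & forall m v, `|H m v| <= C ^+ m.+1 * `|v| ^+ m.
Proof.
move=> fk kN kn; have [B B1 [r r1 HB]] := kap_bounds fk kN kn.
have B0 : 0 < B by rewrite (lt_le_trans ltr01).
pose h := r / (1 + `|v0|) / 2.
have v01 : 0 < 1 + `|v0| by rewrite ltr_wpDr.
have h0 : 0 < h by rewrite !divr_gt0.
pose C := B * (8 * (1 + `|0 : R| + h) / h).
have c1 : 1 <= 8 * (1 + `|0 : R| + h) / h.
  rewrite normr0 ler_pdivlMr // mul1r; lra.
have C1 : 1 <= C by rewrite -[leLHS]mulr1 ler_pM.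
exists C => // m; suff S v : `|v| <= 1 -> `|H m v| <= C ^+ m.+1.
  move=> v; have [->|v0'] := eqVneq v 0.
    rewrite normr0; case: (posnP m) => [m0|m0].
      by apply: le_trans (S 0 _) _; rewrite ?normr0 // m0 expr0 mulr1.
    have -> : H m 0 = 0.
      by rewrite -(scale0r (0 : 'rV[R]_d)) homogeneous_parts_scale expr0n (gtn_eqF m0) mul0r.
    by rewrite normr0 mulr_ge0 ?exprn_ge0 // (le_trans ler01).
  have nv : 0 < `|v| by rewrite normr_gt0.
  have {1}-> : v = `|v| *: (`|v|^-1 *: v) by rewrite scalerA divff ?scale1r // gt_eqF.
  rewrite homogeneous_parts_scale normrM normrX normr_id mulrC ler_wpM2r ?exprn_ge0 //.
  by apply: S; rewrite normrZ normfV normr_id mulVf // gt_eqF.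
move=> v1; have [q sq qE] := polyf_line (pH m) v0 (v - v0).
have := @pnorm_le_of_interval _ m.+1 q 0 h 1 (B ^+ m.+1) isT (leq_trans sq (leqnSn _)) h0 ler01.
rewrite -exprMn => /(_ _)/wrap[t|hq].
  rewrite add0r => /andP[t0 th]; rewrite -qE; apply: HB; rewrite addrC addKr normrZ ger0_norm //.
  have h1 : `|v - v0| <= 1 + `|v0| by apply: le_trans (ler_normB _ _) _; rewrite lerD2r.
  apply: le_trans (_ : h * (1 + `|v0|) <= _); first exact: ler_pM.
  have -> : h * (1 + `|v0|) = r / 2 by rewrite /h; field; rewrite gt_eqF.
  lra.
have -> : v = v0 + 1 *: (v - v0) by rewrite scale1r addrC subrK.
rewrite qE; apply: le_trans (pnorm_horner_le q _) hq; by rewrite normr1.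
Qed.

Lemma geo_sum (x : R) n : 0 <= x <= 2^-1 -> \sum_(i < n) x ^+ i <= 2.
Proof.
move=> /andP[x0 x1]; suff : \sum_(i < n) x ^+ i <= 2 - 2 * x ^+ n.
  by have := exprn_ge0 n x0; lra.
elim: n => [|n IH]; first by rewrite big_ord0 expr0; lra.
rewrite big_ord_recr exprS /=; have := exprn_ge0 n x0; nra.
Qed.

Lemma pow_half_small (C e : R) : 0 < e -> exists N, forall i, (N <= i)%N -> C * 2^-1 ^+ i <= e.
Proof.
move=> e0; have [N NP] := exists_half_pow `|C| e0; exists N => i Ni.
apply: le_trans (_ : `|C| * 2^-1 ^+ i <= _).
  by rewrite ler_wpM2r ?exprn_ge0 ?invr_ge0 // ler_norm.
apply: le_trans NP; rewrite -exprVn ler_wpM2l // ler_wiXn2l ?invr_ge0 //; lra.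
Qed.

Lemma geo_tail (F : nat -> R) C : 0 <= C -> (forall i, F i <= C * 2^-1 ^+ i) ->
  forall m n, (m <= n)%N -> \sum_(m <= i < n) F i <= 2 * C * 2^-1 ^+ m.
Proof.
move=> C0 FC m n mn; rewrite -{1}[m]add0n big_addn.
apply: le_trans (_ : \sum_(0 <= i < n - m) C * 2^-1 ^+ m * 2^-1 ^+ i <= _).
  by apply: ler_sum => i _; rewrite -mulrA -exprD addnC.
rewrite -big_distrr big_mkord /= [2 * C]mulrC -!mulrA ler_wpM2l // mulrC.
by rewrite ler_wpM2r ?exprn_ge0 ?invr_ge0 // geo_sum // invr_ge0 ler0n lexx.
Qed.

Lemma geo_pnorm (q : nat -> {poly R}) s C : 0 <= s -> 0 <= C -> (forall m, pnorm s (q m) <= C * 2^-1 ^+ m) ->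
  forall e, 0 < e -> exists N, forall i j, (N <= i)%N -> (N <= j)%N ->
    pnorm s (\sum_(m < i) q m - \sum_(m < j) q m) <= e.
Proof.
move=> s0 C0 qC e e0; have [N NP] := pow_half_small (2 * C) e0; exists N.
suff S i j : (N <= i)%N -> (i <= j)%N -> pnorm s (\sum_(m < j) q m - \sum_(m < i) q m) <= e.
  move=> i j Ni Nj; case: (leqP i j) => [ij|/ltnW ij]; last exact: S.
  by rewrite -opprB pnormN; exact: S.
move=> Ni ij; rewrite -(big_mkord xpredT q) -(big_mkord xpredT q) (big_cat_nat (leq0n i) ij) /=.
rewrite addrAC subrr add0r; apply: le_trans (NP i Ni); apply: le_trans (pnorm_sum _ _ _ s0) _.
exact: geo_tail.
Qed.

Variable C1 : R.
Hypothesis C11 : 1 <= C1.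
Hypothesis HC1 : forall m v, `|H m v| <= C1 ^+ m.+1 * `|v| ^+ m.

(** Where $|u| \le 2\,$[rad], the part [H m] is at most $C_1^{m+1}(2\,$[rad]$)^m$; passing from
    values on an interval of length [rad] to the norm of radius [4 * rad] costs 40 per degree. The
    160 makes the resulting ratio $80\,C_1$[rad] at most 1/2, and [r0 / 10] keeps [5 * rad] below
    [r0]. *)
Definition rad := Num.min 1 (Num.min (r0 / 10) (160 * C1)^-1).

Lemma rad_facts : [/\ 0 < rad, rad <= 1, 5 * rad < r0 & 160 * (C1 * rad) <= 1].
Proof.
have C10 : 0 < C1 by move: C11; lra.
have h1 : rad <= r0 / 10 by rewrite /rad !ge_min lexx orbT.
have h2 : rad <= (160 * C1)^-1 by rewrite /rad !ge_min lexx !orbT.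
have C160 : 0 < 160 * C1 by rewrite mulr_gt0.
split.
- by rewrite /rad !lt_min ltr01 divr_gt0 // invr_gt0.
- by rewrite /rad ge_min lexx.
- by apply: le_lt_trans (_ : 5 * (r0 / 10) < _); [rewrite ler_pM2l|move: r00; lra].
by move: h2; rewrite mulrA -ler_pdivlMl // mulr1.
Qed.

Lemma H_small m u : `|u| <= 5 * rad -> `|H m u| <= C1 * 2^-1 ^+ m.
Proof.
have [rd0 rd1 rdr rdC] := rad_facts; have C10 : 0 < C1 by move: C11; lra.
move=> ur; apply: le_trans (HC1 m u) _; rewrite exprS -mulrA ler_pM2l // -exprMn.
rewrite lerXn2r ?nnegrE ?mulr_ge0 ?invr_ge0 ?(ltW C10) //.
by apply: le_trans (_ : C1 * (5 * rad) <= _); [rewrite ler_pM2l|lra].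
Qed.

Lemma exists_sum : exists phit : 'rV[R]_d -> R, forall u, `|u| <= 5 * rad -> forall e, 0 < e ->
  exists N, forall M, (N <= M)%N -> `|\sum_(m < M) H m u - phit u| <= e.
Proof.
have C10 : 0 <= C1 by move: C11; lra.
suff : forall u, exists l, `|u| <= 5 * rad -> forall e, 0 < e ->
    exists N, forall M, (N <= M)%N -> `|\sum_(m < M) H m u - l| <= e.
  by move=> /choice[f fP]; exists f.
move=> u; have [ur|ur] := boolP (`|u| <= 5 * rad); last by exists 0.
have [|l lP] := @cauchy_limit R (fun M => \sum_(m < M) H m u); last by exists l.
move=> e e0; have [|N NP] := @geo_pnorm (fun m => (H m u)%:P) 0 C1 (lexx _) C10 _ e e0.
  by move=> m; rewrite pnormC; exact: H_small.
exists N => i j Ni Nj; have := NP i j Ni Nj.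
by rewrite -!rmorph_sum -polyCB pnormC.
Qed.

Variable phit : 'rV[R]_d -> R.
Hypothesis phitP : forall u, `|u| <= 5 * rad -> forall e, 0 < e ->
  exists N, forall M, (N <= M)%N -> `|\sum_(m < M) H m u - phit u| <= e.

Lemma line_in u v t : `|u| <= rad -> `|v| <= 1 -> `|t| <= 4 * rad -> `|u + t *: v| <= 5 * rad.
Proof.
have [rd0 _ _ _] := rad_facts.
move=> ur v1 tr; apply: le_trans (ler_normD _ _) _; rewrite normrZ.
have : `|t| * `|v| <= 4 * rad * 1 by apply: ler_pM.
lra.
Qed.

Lemma phit_line u v : `|u| <= rad -> `|v| <= 1 ->
  exists T, approximates T (4 * rad) (fun t => phit (u + t *: v)).
Proof.
move=> ur v1; have [rd0 rd1 rdr rdC] := rad_facts; have C10 : 0 < C1 by move: C11; lra.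
have /choice [q qP] : forall m, exists q : {poly R}, (size q <= m.+1)%N /\ forall t, H m (u + t *: v) = q.[t].
  by move=> m; have [q sq qE] := polyf_line (pH m) u v; exists q.
exists (fun M => \sum_(m < M) q m); split.
  apply: (@geo_pnorm _ _ (40 * C1)); [by rewrite mulr_ge0 // ltW|by rewrite mulr_ge0 // ltW|].
  move=> m; have [sq qE] := qP m.
  have := @pnorm_le_of_interval _ m.+1 (q m) 0 rad (4 * rad) (C1 ^+ m.+1 * (2 * rad) ^+ m) isT (leq_trans sq (leqnSn _)) rd0.
  rewrite normr0 addr0 => /(_ _ _)/wrap[||h].
  - by rewrite mulr_ge0 // ltW.
  - move=> t; rewrite add0r => /andP[t0 tr]; rewrite -qE; apply: le_trans (HC1 _ _) _.
    rewrite ler_wpM2l ?exprn_ge0 ?(ltW C10) // lerXn2r ?nnegrE //; first by rewrite mulr_ge0 // ltW.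
    apply: le_trans (ler_normD _ _) _; rewrite normrZ ger0_norm //.
    have : t * `|v| <= rad * 1 by apply: ler_pM.
    lra.
  apply: le_trans h _.
  have -> : 8 * (4 * rad + rad) / rad = 40 by field; rewrite gt_eqF.
  have -> : C1 ^+ m.+1 * (2 * rad) ^+ m * 40 ^+ m.+1 = 40 * C1 * (80 * (C1 * rad)) ^+ m.
    by rewrite !exprS !exprMn (_ : 80 = 2 * 40) ?exprMn; ring.
  rewrite ler_pM2l ?mulr_gt0 // lerXn2r ?nnegrE ?invr_ge0 //; last by lra.
  by rewrite !mulr_ge0 // ltW.
move=> t tr e e0; have [N NP] := phitP (line_in ur v1 tr) e0.
exists N => M /NP; rewrite horner_sum; under eq_bigr do rewrite (qP _).2; exact.
Qed.

Lemma phit_ray v N : eqO N (fun t => phit (t *: v)) (fun t => (tau N v).[t]).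
Proof.
have [rd0 rd1 rdr rdC] := rad_facts; have C10 : 0 < C1 by move: C11; lra.
have v1 : 0 < `|v| + 1 by rewrite ltr_wpDl.
exists (2 * C1 * (C1 * (`|v| + 1)) ^+ N), (rad / (`|v| + 1)); split.
- by rewrite divr_gt0.
- by rewrite !mulr_ge0 ?exprn_ge0 ?mulr_ge0 ?(ltW C10) // ltW.
move=> t; rewrite ler_pdivlMr // => tv; apply/ler_addgt0Pl => e e0.
have tvr : `|t *: v| <= rad.
  by rewrite normrZ; apply: le_trans tv; rewrite ler_wpM2l // lerDl.
have tvr5 : `|t *: v| <= 5 * rad by lra.
have [M0 M0P] := phitP tvr5 e0.
pose M := maxn N M0; have NM : (N <= M)%N by exact: leq_maxl.
have := M0P M (leq_maxr _ _); rewrite distrC => h.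
have -> : phit (t *: v) - (tau N v).[t] =
    (phit (t *: v) - \sum_(m < M) H m (t *: v)) + (\sum_(m < M) H m (t *: v) - (tau N v).[t]) by ring.
apply: le_trans (ler_normD _ _) _; apply: lerD => //.
have -> : \sum_(m < M) H m (t *: v) - (tau N v).[t] = \sum_(N <= m < M) t ^+ m * H m v.
  rewrite /tau horner_poly -(big_mkord xpredT (fun m => H m (t *: v))).
  rewrite -(big_mkord xpredT (fun m => H m v * t ^+ m)) (big_cat_nat (leq0n N) NM) /= addrAC.
  rewrite [X in X - _](eq_bigr (fun m => H m v * t ^+ m)) ?subrr ?add0r => [|m _].
    by apply: eq_bigr => m _; rewrite homogeneous_parts_scale.
  by rewrite homogeneous_parts_scale mulrC.
pose y := C1 * (`|v| * `|t|).
have y0 : 0 <= y by rewrite !mulr_ge0 // ltW.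
have ye : y <= C1 * rad.
  rewrite ler_pM2l //; apply: le_trans tv; rewrite mulrC ler_wpM2l // lerDl //.
apply: le_trans (ler_norm_sum _ _ _) _.
apply: le_trans (_ : \sum_(N <= m < M) C1 * y ^+ m <= _).
  apply: ler_sum => m _; rewrite normrM normrX mulrC.
  apply: le_trans (_ : C1 ^+ m.+1 * `|v| ^+ m * `|t| ^+ m <= _); first by rewrite ler_wpM2r ?exprn_ge0.
  by rewrite /y !exprMn exprS -!mulrA.
rewrite -{1}[N]add0n big_addn big_mkord.
apply: le_trans (_ : C1 * y ^+ N * \sum_(i < M - N) y ^+ i <= _).
  by rewrite big_distrr; apply: ler_sum => i _; rewrite /= -mulrA -exprD addnC.
apply: le_trans (_ : C1 * y ^+ N * 2 <= _).
  by rewrite ler_wpM2l ?mulr_ge0 ?exprn_ge0 ?(ltW C10) // geo_sum // y0 /=; lra.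
rewrite mulrAC [C1 * 2]mulrC -!mulrA ler_pM2l // ler_pM2l // -exprMn.
rewrite lerXn2r ?nnegrE ?mulr_ge0 ?(ltW C10) ?(ltW v1) //.
by rewrite /y mulrA ler_wpM2r // ler_pM2l // lerDl.
Qed.

Hypothesis tay : forall u, `|u| < r0 -> taylorable phi u.

Definition ht j u := ev j u (phit u).

Lemma rad_lt u : `|u| <= 5 * rad -> `|u| < r0.
Proof. by have [_ _ h _] := rad_facts; move=> /le_lt_trans; apply. Qed.

Lemma ht_line j u v : `|u| <= rad -> `|v| <= 1 ->
  exists T, approximates T (4 * rad) (fun t => ht j (u + t *: v)).
Proof.
have [rd0 _ _ _] := rad_facts; have s0 : 0 <= 4 * rad by rewrite mulr_ge0 // ltW.
move=> ur v1; have [T TP] := phit_line ur v1.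
have /choice [q qP] : forall e, exists q : {poly R}, forall t, hs j e (u + t *: v) = q.[t].
  by move=> e; have [q _ qE] := polyf_line (polyf_hs j e) u v; exists q.
exists (fun L => \sum_(e < D.+1) q e * T L ^+ e).
apply: (@approximates_ext _ _ _ (fun t => \sum_(e < D.+1) (q e).[t] * phit (u + t *: v) ^+ e)).
  by move=> t _; rewrite /ht evE; apply: eq_bigr => e _; rewrite qP.
apply: approximates_sum => // e; apply: approximatesM => //; first exact: approximates_horner.
exact: approximatesX.
Qed.

Lemma ht_eqO j u v N : `|u| <= rad -> `|v| <= 1 -> exists q : {poly R}, eqO N (fun t => ht j (u + t *: v)) (fun t => q.[t]).
Proof.
have [rd0 _ _ _] := rad_facts; move=> ur v1; have [T TP] := ht_line j ur v1.
by apply: approximates_eqO TP; rewrite mulr_gt0.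
Qed.

(** Along a ray [ht j] is a limit of polynomials, and it is flat at 0 since [phit] has the formal
    series as its Taylor series; so [approximates_flat] applies. *)
Lemma ht_flat j : flat j -> forall x, `|x| <= rad -> ht j x = 0.
Proof.
have [rd0 _ _ _] := rad_facts; have s0 : 0 < 4 * rad by rewrite mulr_gt0.
move=> fj x xr; pose v := rad^-1 *: x.
have v1 : `|v| <= 1 by rewrite normrZ gtr0_norm ?invr_gt0 // ler_pdivrMl // mulr1.
have z0 : `|0 : 'rV[R]_d| <= rad by rewrite normr0 ltW.
have [T TP] := ht_line j z0 v1.
have [|_ h] := approximates_flat s0 TP; last first.
  have -> : x = 0 + rad *: v by rewrite add0r scalerA divff ?scale1r // gt_eqF.
  by apply: h; rewrite gtr0_norm //; move: rd0; lra.
move=> n; have := Sk_eqO j (phit_ray v n).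
have -> : Sk j n v = \poly_(i < size (Sk j n v)) (if (i < n)%N then 0 else (Sk j n v)`_i).
  apply/polyP => i; rewrite coef_poly; case: ltnP => [_|h]; last by rewrite nth_default.
  by case: ifP => // im; rewrite Sk_coef // fj.
set q := \poly_(i < _) _ => hE.
have : eqO n (fun t => ht j (0 + t *: v)) (fun=> 0).
  apply: (@eqO_trans _ _ (fun t => q.[t])); first by apply: eqO_ext hE => // t; rewrite add0r.
  apply: eqO_trans (eqO_take n q) _; apply: eqO_ext (eqO_refl n (fun=> 0)) => // t.
  rewrite big1 // => i _; rewrite coef_poly; case: ifP => _; last by rewrite mul0r.
  by rewrite ltn_ord mul0r.
move=> [C [e [e0 C0 hC]]]; exists C => eta eta0.
have me : 0 < Num.min e eta by rewrite lt_min e0.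
exists (Num.min e eta / 2).
  rewrite gtr0_norm ?divr_gt0 //= ltr_pdivrMr // (@le_lt_trans _ _ eta) ?ge_min ?lexx ?orbT //.
  by rewrite ltr_pMr // ltr1n.
have := hC (Num.min e eta / 2); rewrite subr0; apply.
rewrite gtr0_norm ?divr_gt0 //= ler_pdivrMr //; apply: (@le_trans _ _ e); first by rewrite ge_min lexx.
by rewrite ler_pMr // ler1n.
Qed.

Lemma ht_nonzero k : ~ flat k -> exists2 x, `|x| <= rad & ht k x != 0.
Proof.
have [rd0 _ _ _] := rad_facts.
move=> nf; apply: contrapT => h; apply: nf => i v.
rewrite /kap -[RHS](coef0 _ i); apply: (@eqO_coef _ i.+1) => //.
apply: eqO_trans (eqO_sym (Sk_eqO k (phit_ray v i.+1))) _.
have v1 : 0 < `|v| + 1 by rewrite ltr_wpDl.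
exists 0, (rad / (`|v| + 1)); split => //; first by rewrite divr_gt0.
move=> t; rewrite ler_pdivlMr // => tv.
have -> : ev k (t *: v) (phit (t *: v)) = 0.
  apply/eqP; apply: contrapT => /negP hx; apply: h; exists (t *: v) => //.
  by rewrite normrZ; apply: le_trans tv; rewrite ler_wpM2l // lerDl.
by rewrite horner0 subr0 normr0 mul0r.
Qed.

(* Where [phi] differs from the sum [phit] of its Taylor series, the first
   non-flat derivative is controlled by the difference. *)
Lemma ht_le_diff k w v : flat k -> (forall j, (j <= k)%N -> flat j) -> `|w| < rad -> `|v| <= 1 ->
  (exists q : {poly R}, eqO 1 (fun t => phi (w + t *: v)) (fun t => q.[t])) ->
  exists C e : R, [/\ 0 < e, 0 <= C & forall t, `|t| <= e -> phi (w + t *: v) != phit (w + t *: v) ->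
    `|ht k.+1 (w + t *: v)| <= C * `|phi (w + t *: v) - phit (w + t *: v)|].
Proof.
have [rd0 _ _ _] := rad_facts.
move=> fk fl wr v1 [q qE].
have [T TP] := phit_line (ltW wr) v1.
have [q' q'E] := approximates_eqO 1 (mulr_gt0 (ltr0n R 4 : _) rd0) TP.
pose g t := phi (w + t *: v) - phit (w + t *: v).
have bg : bnd g.
  apply: (@bnd_eqO _ 1 _ (fun t => (q - q').[t])); first exact: bnd_horner.
  apply: (@eqO_ext _ _ (fun t => phi (w + t *: v) + (-1) * phit (w + t *: v)) (fun t => q.[t] + (-1) * q'.[t])).
  - by move=> t; rewrite mulN1r.
  - by move=> t; rewrite hornerD hornerN mulN1r.
  apply: eqOD => //; apply: eqOM => //; last exact: eqO_refl.
    by apply: bnd_eqO q'E; exact: bnd_horner.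
  by exists 1, 1; split => // t _; rewrite normrN normr1.
have bh j : bnd (fun t => ht j (w + t *: v)).
  by have [p pE] := ht_eqO j 1 (ltW wr) v1; apply: bnd_eqO pE; exact: bnd_horner.
have [A [a [a0 A0 HA]]] : bnd (fun t => \sum_(j < D) ht (k.+2 + j) (w + t *: v) * g t ^+ j).
  have : forall (r : seq 'I_D), bnd (fun t => \sum_(j <- r) ht (k.+2 + j) (w + t *: v) * g t ^+ j).
    elim => [|j r [B [b [b0 B0 HB]]]].
      by exists 0, 1; split => // t _; rewrite big_nil normr0.
    have [B' [b' [b'0 B'0 HB']]] := bndM (bh (k.+2 + j)%N) (bndX j bg).
    exists (B' + B), (Num.min b' b); split; [by rewrite lt_min b'0|by rewrite addr_ge0|].
    move=> t; rewrite le_min => /andP[/HB' h1 /HB h2]; rewrite big_cons.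
    by apply: le_trans (ler_normD _ _) _; apply: lerD.
  exact.
pose e := Num.min a (Num.min ((rad - `|w|) / 2) (4 * rad)).
have e0 : 0 < e by rewrite !lt_min a0 divr_gt0 ?subr_gt0 // mulr_gt0.
exists A, e; split => // t; rewrite !le_min => /andP[ta /andP[tr t4]] neq.
set x := w + t *: v.
have xr : `|x| <= rad.
  apply: le_trans (ler_normD _ _) _; rewrite normrZ.
  have : `|t| * `|v| <= (rad - `|w|) / 2 * 1 by apply: ler_pM.
  by move: wr; lra.
have xr5 : `|x| <= 5 * rad by move: xr rd0; lra.
have g0 : g t != 0 by rewrite subr_eq0.
have E : ev 0 x (phit x + g t) = 0 by rewrite /g addrC subrK ev0E rel // rad_lt.
(* In the Taylor expansion of the relation around [phit x], the terms of order at most [k] vanish by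
   flatness. What remains is divisible by the nonzero factor [g t ^+ k.+1], and the quotient is
   [ht k.+1] plus a multiple of [g t]. *)
move: E; rewrite ev_taylor.
have htz j : (D < j)%N -> ht j x = 0.
  move=> Dj; rewrite /ht evE big1 // => i _; rewrite hsE ltnNge (leq_trans Dj) ?leq_addr //.
  by rewrite mul0r.
rewrite (big_ord_widen (k.+2 + D)%N (fun j => ev j x (phit x) * g t ^+ j)); last by clear; lia.
rewrite big_mkcond (eq_bigr (fun j : 'I_(k.+2 + D) => ht j x * g t ^+ j)); last first.
  move=> j _; case: ifP => // /negbT; rewrite -leqNgt => Dj; by rewrite htz // mul0r.
rewrite big_split_ord /= big_ord_recr big1 /= ?add0r; last first.
  by move=> j _; rewrite (ht_flat (fl j _) xr) ?mul0r // -ltnS.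
under eq_bigr do rewrite [_ ^+ (k.+2 + _)]exprD mulrCA.
rewrite -big_distrr /= [g t ^+ k.+2]exprSr [_ * g t ^+ k.+1]mulrC -mulrA -mulrDr => /eqP.
rewrite mulf_eq0 expf_eq0 (negbTE g0) andbF /= addr_eq0 => /eqP ->.
by rewrite normrN normrM mulrC ler_wpM2r // HA.
Qed.

Lemma phi_line w v N : `|w| <= rad -> exists q : {poly R}, eqO N (fun t => phi (w + t *: v)) (fun t => q.[t]).
Proof.
have [rd0 _ _ _] := rad_facts.
by move=> wr; apply: taylorable_line; apply: tay; apply: rad_lt; apply: le_trans wr _; lra.
Qed.

Lemma phit_eqO w v N : `|w| <= rad -> `|v| <= 1 -> exists q : {poly R}, eqO N (fun t => phit (w + t *: v)) (fun t => q.[t]).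
Proof.
have [rd0 _ _ _] := rad_facts; move=> wr v1; have [T TP] := phit_line wr v1.
by apply: approximates_eqO TP; rewrite mulr_gt0.
Qed.

Lemma eqO_at0 (f g : R -> R) : eqO 1 f g -> f 0 = g 0.
Proof.
move=> [C [e [e0 _ h]]]; apply/eqP; rewrite -subr_eq0 -normr_le0.
by have := h 0; rewrite normr0 expr1 mulr0; apply; exact: ltW.
Qed.

(* On the segment from [0] to [x], at the first point where [phi] leaves [phit]
   the difference is flat, hence so is [ht k.+1], which is analytic. *)
Lemma phi_phit_nonzero k x : flat k -> (forall j, (j <= k)%N -> flat j) -> `|x| < rad ->
  ht k.+1 x != 0 -> phi x = phit x.
Proof.
have [rd0 rd1 rdr rdC] := rad_facts.
move=> fk fl xr hx; apply/eqP; apply: contrapT => /negP neqx.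
pose v := rad^-1 *: x.
have v1 : `|v| <= 1 by rewrite normrZ gtr0_norm ?invr_gt0 // ler_pdivrMl // mulr1 ltW.
have vx t : (t * rad) *: v = t *: x by rewrite scalerA mulfK ?gt_eqF.
pose E := [set t : R | 0 <= t <= 1 /\ phi (t *: x) != phit (t *: x)].
have E1 : E 1 by rewrite /E /= ler01 lexx scale1r.
have hE : has_inf E by split; [exists 1|exists 0 => t [/andP[]]].
pose t1 := inf E.
have t1le t : E t -> t1 <= t by move=> Et; apply: ge_inf => //; case: hE.
have t10 : 0 <= t1 by apply: lb_le_inf; [exists 1|move=> t [/andP[]]].
have t11 : t1 <= 1 by apply: t1le.
pose w := t1 *: x.
have wr : `|w| < rad.
  by rewrite normrZ ger0_norm //; apply: le_lt_trans xr; rewrite ler_piMl.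
have wE s : w + s *: v = (t1 + s / rad) *: x.
  by rewrite /w /v scalerA scalerDl.
have wr' := ltW wr.
have flatg N : eqO N (fun s => phi (w + s *: v)) (fun s => phit (w + s *: v)).
  (* At the origin both functions have the formal series as Taylor series. Otherwise they agree at
     the points just before [t1], by definition of the infimum, and [eqO_agree] applies. *)
  have [t1z|t1p] := eqVneq t1 0.
    have -> : w = 0 by rewrite /w t1z scale0r.
    apply: (@eqO_trans _ _ (fun s => (tau N v).[s])).
      by apply: eqO_ext (HE v N) => // s; rewrite add0r.
    by apply: eqO_sym; apply: eqO_ext (phit_ray v N) => // s; rewrite add0r.
  apply: eqO_agree => [M|M|e e0]; [exact: phi_line|exact: phit_eqO|].
  have t1p' : 0 < t1 by rewrite lt_def t1p.
  pose s := Num.min (e / 2) (t1 * rad).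
  have s0 : 0 < s by rewrite lt_min divr_gt0 // mulr_gt0.
  exists (- s); first by rewrite normrN gtr0_norm // s0 /= gt_min; apply/orP; left; lra.
  apply/eqP; apply: contrapT => /negP; rewrite wE => neq.
  have : t1 <= t1 - s / rad.
    apply: t1le; split; last by move: neq; rewrite mulNr.
    rewrite subr_ge0 ler_pdivrMr // ge_min lexx orbT /=.
    by rewrite lerBlDr (le_trans t11) // lerDl divr_ge0 // ltW.
  by have : 0 < s / rad by [rewrite divr_gt0]; lra.
have [C [e [e0 C0 hC]]] := ht_le_diff fk fl wr v1 (phi_line v 1 wr').
have [T TP] := ht_line k.+1 wr' v1.
have [||_ h] := @approximates_flat _ _ _ _ _ TP.
- by rewrite mulr_gt0.
- move=> N; have [C' [e' [e'0 C'0 hC']]] := flatg N; exists (C * C') => eta eta0.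
  pose z := Num.min e (Num.min e' eta) / 2.
  have m0 : 0 < Num.min e (Num.min e' eta) by rewrite !lt_min e0 e'0.
  have z0 : 0 < z by rewrite divr_gt0.
  have [s [s0 sz neq]] : exists s, [/\ 0 < s, s <= z & phi (w + s *: v) != phit (w + s *: v)].
    have zr : 0 < z / rad by rewrite divr_gt0.
    have [t Et tlt] := inf_adherent zr hE; rewrite -/t1 in tlt.
    have tt1 : t != t1.
      apply/eqP => tE; case: Et => _; rewrite tE => /eqP; apply.
      by have := eqO_at0 (flatg 1%N); rewrite scale0r addr0.
    have t1t : t1 < t by rewrite lt_def tt1 t1le.
    exists ((t - t1) * rad); split.
    + by rewrite mulr_gt0 // subr_gt0.
    + by rewrite -ler_pdivlMr //; lra.
    + have -> : w + ((t - t1) * rad) *: v = t *: x by rewrite wE mulfK ?gt_eqF // addrC subrK.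
      by case: Et.
  have ze : z <= e by apply: (@le_trans _ _ (Num.min e (Num.min e' eta))); [rewrite /z; lra|rewrite ge_min lexx].
  have ze' : z <= e' by apply: (@le_trans _ _ (Num.min e (Num.min e' eta))); [rewrite /z; lra|rewrite !ge_min lexx !orbT].
  have zeta : z < eta.
    by apply: (@lt_le_trans _ _ (Num.min e (Num.min e' eta))); [rewrite /z; lra|rewrite !ge_min lexx !orbT].
  exists s; first by rewrite gtr0_norm // s0 (le_lt_trans sz).
  have sn : `|s| = s by rewrite gtr0_norm.
  apply: le_trans (hC s _ neq) _; first by rewrite sn (le_trans sz).
  by rewrite -mulrA ler_wpM2l // hC' // sn (le_trans sz).
case/eqP: hx; have := h ((1 - t1) * rad).
have -> : w + ((1 - t1) * rad) *: v = x by rewrite wE mulfK ?gt_eqF // addrC subrK scale1r.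
apply.
rewrite ger0_norm ?mulr_ge0 ?subr_ge0 ?(ltW rd0) // ler_pM2r //; lra.
Qed.

(** [ht k.+1] is nonzero at some [y]. On the segment from [x] towards [y] it is therefore nonzero at
    points arbitrarily close to [x], by the identity principle; there [phi] and [phit] agree by
    [phi_phit_nonzero], and the agreement passes to [x]. *)
Lemma phi_phit x : `|x| < rad -> phi x = phit x.
Proof.
have [rd0 rd1 rdr rdC] := rad_facts.
have [k [N [v0 [fk fl kN kn]]]] := min_nonflat.
have nf : ~ flat k.+1 by move=> h; have := kN; rewrite h eqxx.
have [y yr hy] := ht_nonzero nf.
move=> xr; pose v := (2 * rad)^-1 *: (y - x).
have r2 : 0 < 2 * rad by rewrite mulr_gt0.
have v1 : `|v| <= 1.
  rewrite normrZ gtr0_norm ?invr_gt0 // ler_pdivrMl // mulr1.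
  by apply: le_trans (ler_normB _ _) _; move: xr yr; lra.
have xr' := ltW xr.
have := @eqO_agree _ (fun t => phi (x + t *: v)) (fun t => phit (x + t *: v))
  (fun M => phi_line v M xr') (fun M => phit_eqO M xr' v1).
move=> /(_ _ 1%N)/wrap[|/eqO_at0]; last by rewrite scale0r addr0.
apply: contrapT => nof.
have [e e0 he] : exists2 e, 0 < e & forall t, 0 < t < e -> phi (x + t *: v) <> phit (x + t *: v).
  apply: contrapT => h; apply: nof => e e0; apply: contrapT => h'; apply: h; exists e => // t /andP[t0 te] E.
  by apply: h'; exists t => //; rewrite gtr0_norm // t0.
have [T TP] := ht_line k.+1 xr' v1.
have [||_ h] := @approximates_flat _ _ _ _ _ TP.
- by rewrite mulr_gt0.
- move=> M; exists 0 => eta eta0; pose t := Num.min e (Num.min eta (rad - `|x|)) / 2.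
  have m0 : 0 < Num.min e (Num.min eta (rad - `|x|)) by rewrite !lt_min e0 eta0 subr_gt0.
  have t0 : 0 < t by rewrite divr_gt0.
  have m1 : Num.min e (Num.min eta (rad - `|x|)) <= e by rewrite ge_min lexx.
  have m2 : Num.min e (Num.min eta (rad - `|x|)) <= eta by rewrite !ge_min lexx orbT.
  have m3 : Num.min e (Num.min eta (rad - `|x|)) <= rad - `|x| by rewrite !ge_min lexx !orbT.
  exists t; first by rewrite gtr0_norm // t0 /t; lra.
  rewrite mul0r normr_le0; apply/eqP; apply: contrapT => /eqP hne.
  apply: (he t); first by rewrite t0 /t; lra.
  apply: (phi_phit_nonzero fk fl _ hne); apply: le_lt_trans (ler_normD _ _) _.
  rewrite normrZ gtr0_norm //.
  have : t * `|v| <= t * 1 by rewrite ler_pM2l.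
  rewrite /t; lra.
case/eqP: hy; have := h (2 * rad); rewrite scalerA divff ?gt_eqF // scale1r addrC subrK; apply.
by rewrite gtr0_norm //; lra.
Qed.

End Expansion.

Lemma approximates_le (R : realType) T (s s' : R) f : 0 <= s' <= s -> approximates T s f -> approximates T s' f.
Proof.
move=> /andP[s'0 ss'] [TC Tf]; split=> [e /TC[N NP]|t ts]; last by apply: Tf; apply: le_trans ss'.
by exists N => i j Ni Nj; apply: le_trans (NP i j Ni Nj); exact: pnorm_le.
Qed.

Lemma algebraic_taylorable_analytic (R : realType) d (phi : 'rV[R]_d -> R) (r0 : R) D DP
    (P : nat -> 'rV[R]_d -> R) : 0 < r0 -> (forall u, `|u| < r0 -> taylorable phi u) ->
  (forall e, polyf DP (P e)) -> (forall u, `|u| < r0 -> \sum_(e < D.+1) P e u * phi u ^+ e = 0) ->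
  (exists e u, (e <= D)%N /\ P e u != 0) ->
  exists2 r : R, 0 < r < r0 & forall r' u v, 0 < r' <= r -> `|u| <= r' -> `|v| <= 1 -> analytic_on (4 * r') (fun t => phi (u + t *: v)).
Proof.
move=> r00 tay pP rel nz.
have t0 : taylorable phi 0 by apply: tay; rewrite normr0.
have [H [pH HE]] := homogeneous_parts t0.
have [G [pG GE]] := @exists_graded _ _ D DP P pP.
have [k [N [v0 [fk fl kN kn]]]] := min_nonflat HE r00 rel nz GE.
have [C1 C11 HC1] := kap_bounds_all pH HE pG GE fk kN kn.
have [phit phitP] := exists_sum r00 C11 HC1.
have [rd0 rd1 rdr rdC] := rad_facts r00 C11.
set rr := rad r0 C1 in rd0 rd1 rdr rdC phitP *.
(* For $|u| \le r'$ and $|t| \le 4r'$ the line stays in the ball of radius $5r'$, strictly inside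
   that of radius [rr]. *)
exists (rr / 6); first by rewrite divr_gt0 //=; move: rd0 rdr; lra.
move=> r' u v /andP[r'0 r'r] ur v1.
have [|T TP] := phit_line pH r00 C11 HC1 phitP _ v1 (u := u).
  by apply: le_trans ur _; rewrite -/rr; lra.
exists T; apply: (@approximates_ext _ _ _ (fun t => phit (u + t *: v))); last first.
  by apply: approximates_le TP; rewrite mulr_ge0 ?(ltW r'0) //= ler_pM2l // -/rr; lra.
move=> t tr; symmetry; apply: (@phi_phit _ _ phi H pH HE r0 D DP P r00 pP rel nz G GE C1 C11 HC1 phit phitP tay).
rewrite -/rr; apply: le_lt_trans (ler_normD _ _) _; rewrite normrZ.
have : `|t| * `|v| <= 4 * r' * 1 by apply: ler_pM.
lra.
Qed.

(** * Polynomial relations along lines *)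

Section BiDegree.
Variable R : realType.

Lemma size_mul_leq (p q : {poly R}) a b : (size p <= a.+1)%N -> (size q <= b.+1)%N ->
  (size (p * q)%R <= (a + b).+1)%N.
Proof.
move=> hp hq; apply: leq_trans (size_polyMleq _ _) _.
by move: (size p) (size q) hp hq => s1 s2; clear; lia.
Qed.

(** The outer variable stands for the value of the function, the inner one for the parameter on the
    line; only the degree in the parameter is bounded. *)
Definition coefs_size (w : nat) (p : {poly {poly R}}) := forall j, (size (p`_j)%R <= w.+1)%N.

Lemma size_sum_leq (I : Type) (r : seq I) (P : pred I) (F : I -> {poly R}) w :
  (forall i, P i -> (size (F i) <= w)%N) -> (size (\sum_(i <- r | P i) F i)%R <= w)%N.
Proof.
move=> h; elim/big_ind: _ => // [|p q hp hq]; first by rewrite size_poly0.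
by rewrite (leq_trans (size_polyD _ _)) // geq_max hp.
Qed.

Lemma coefs_sizeM w w' p q : coefs_size w p -> coefs_size w' q -> coefs_size (w + w') (p * q).
Proof.
move=> hp hq j; rewrite coefM; apply: size_sum_leq => i _.
exact: size_mul_leq.
Qed.

Lemma coefs_size_det N J (A : 'M[{poly {poly R}}]_J) :
  (forall i j, coefs_size N (A i j)) -> coefs_size (J * N) (\det A).
Proof.
move=> hA k; rewrite /determinant coef_sum; apply: size_sum_leq => s _.
have h (f : 'I_J -> 'I_J) : coefs_size (J * N) (\prod_i A i (f i)).
  suff h r : coefs_size (size r * N) (\prod_(i <- r) A i (f i)).
    by have := h (enum 'I_J); rewrite size_enum_ord big_enum.
  elim: r => [|i r IH] /=.
    by rewrite big_nil => j; rewrite coef1; case: (j == 0%N); rewrite ?size_poly1 ?size_poly0.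
  by rewrite big_cons mulSn; apply: coefs_sizeM.
by case: (perm.odd_perm s); rewrite ?expr1 ?expr0 ?mulN1r ?mul1r ?coefN ?size_polyN; apply: h.
Qed.

Lemma coefs_size_char_poly N J (A : 'M[{poly R}]_J) :
  (forall i j, (size (A i j) <= N.+1)%N) -> coefs_size (J * N) (char_poly A).
Proof.
move=> hA; apply: coefs_size_det => i j k; rewrite !mxE coefB coefC.
apply: leq_trans (size_polyD _ _) _; rewrite geq_max size_polyN; apply/andP; split.
  rewrite coefMn coefX; apply: leq_trans (_ : 1 <= _)%N => //.
  by case: (k == 1%N); case: (i == j); rewrite ?mulr0n ?mulr1n ?size_poly1 ?size_poly0.
by case: ifP => _; rewrite ?size_poly0 ?hA.
Qed.

End BiDegree.

Section Representable.
Variables (R : realType) (n D0 : nat) (x : 'I_n -> R -> R) (I : R -> Prop).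
Let B := {ffun 'I_n -> 'I_D0.+1}.

Definition monom (b : B) t := \prod_l x l t ^+ b l.

(* Multiplication by [g] on the span of the monomials [monom b] is given by a
   matrix of polynomials of degree at most [N]. *)
Definition representable N (g : R -> R) := exists m : B -> B -> {poly R},
  (forall b b', (size (m b b') <= N.+1)%N) /\
  forall t, I t -> forall b, \sum_b' (m b b').[t] * monom b' t = g t * monom b t.

Lemma representable_le N N' g : (N <= N')%N -> representable N g -> representable N' g.
Proof.
by move=> NN [m [sm mE]]; exists m; split => // b b'; apply: leq_trans (sm b b') _.
Qed.

Lemma representable_ext N g g' : (forall t, g t = g' t) -> representable N g -> representable N g'.
Proof. by move=> /funext ->. Qed.

Lemma representable_poly N (c : {poly R}) : (size c <= N.+1)%N -> representable N (fun t => c.[t]).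
Proof.
move=> sc; exists (fun b b' => if b' == b then c else 0); split=> [b b'|t _ b].
  by case: ifP; rewrite ?size_poly0.
rewrite (bigD1 b) //= eqxx big1 ?addr0 // => b' /negbTE ->; by rewrite horner0 mul0r.
Qed.

Lemma representableD N g g' : representable N g -> representable N g' -> representable N (fun t => g t + g' t).
Proof.
move=> [m [sm mE]] [m' [sm' mE']]; exists (fun b b' => m b b' + m' b b'); split=> [b b'|t It b].
  by rewrite (leq_trans (size_polyD _ _)) // geq_max sm sm'.
rewrite mulrDl -mE // -mE' // -big_split; apply: eq_bigr => b' _; by rewrite /= hornerD mulrDl.
Qed.

Lemma representableM N N' g g' : representable N g -> representable N' g' ->
  representable (N + N') (fun t => g t * g' t).
Proof.
move=> [m [sm mE]] [m' [sm' mE']]; exists (fun b b' => \sum_c m' b c * m c b'); split=> [b b'|t It b].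
  apply: size_sum_leq => c _; rewrite addnC; exact: size_mul_leq.
rewrite -mulrA -mE' // big_distrr /=.
under eq_bigr do rewrite horner_sum big_distrl /=.
rewrite exchange_big /=; apply: eq_bigr => c _.
rewrite mulrCA -mE // big_distrr /=; apply: eq_bigr => b' _.
by rewrite hornerM mulrA.
Qed.

Lemma representable_prod N (T : Type) (r : seq T) (g : T -> R -> R) :
  (forall i, representable N (g i)) -> representable (size r * N) (fun t => \prod_(i <- r) g i t).
Proof.
move=> H; elim: r => [|i r IH].
  apply: (@representable_ext _ (fun t => (1 : {poly R}).[t])) => [t|]; first by rewrite big_nil hornerC.
  by apply: representable_poly; rewrite size_poly1.
by under eq_fun do rewrite big_cons; rewrite /= mulSn; exact: representableM.
Qed.

(** Multiplication by [x l] raises an exponent by one. At the top exponent [D0] the relation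
    replaces the leading coefficient times $x_l^{D_0+1}$ by lower powers, so carrying that
    coefficient along avoids any division. *)
Lemma representable_coord N l (a : nat -> {poly R}) : (forall e, (e <= D0.+1)%N -> (size (a e) <= N.+1)%N) ->
  (forall t, I t -> \sum_(e < D0.+2) (a e).[t] * x l t ^+ e = 0) ->
  representable N (fun t => (a D0.+1).[t] * x l t).
Proof.
move=> sa rel.
pose up (b : B) (e : 'I_D0.+1) : B := [ffun i => if i == l then e else b i].
pose c (b : B) (e : 'I_D0.+1) : {poly R} :=
  if ((b l).+1 < D0.+1)%N then (if nat_of_ord e == (b l).+1 then a D0.+1 else 0) else - a e.
have sc b e : (size (c b e) <= N.+1)%N.
  rewrite /c; case: ifP => _; last by rewrite size_polyN sa // ltnW.
  by case: ifP => _; rewrite ?size_poly0 ?sa.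
exists (fun b b' => \sum_e (if b' == up b e then c b e else 0)); split=> [b b'|t It b].
  by apply: size_sum_leq => e _; case: ifP; rewrite ?size_poly0.
under eq_bigr do rewrite horner_sum big_distrl /=.
rewrite exchange_big /=.
pose Z := \prod_(i | i != l) x i t ^+ b i.
have mu e : monom (up b e) t = x l t ^+ e * Z.
  rewrite /monom (bigD1 l) //= ffunE eqxx; congr (_ * _); apply: eq_bigr => i il.
  by rewrite ffunE (negbTE il).
have mb : monom b t = x l t ^+ b l * Z by rewrite /monom (bigD1 l).
have -> : \sum_(e < D0.+1) \sum_b' (if b' == up b e then c b e else 0).[t] * monom b' t =
    (\sum_(e < D0.+1) (c b e).[t] * x l t ^+ e) * Z.
  rewrite big_distrl /=; apply: eq_bigr => e _; rewrite (bigD1 (up b e)) //= eqxx big1 ?addr0.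
    by rewrite mu mulrA.
  by move=> b' /negbTE ->; rewrite horner0 mul0r.
rewrite mb !mulrA; congr (_ * _); rewrite -mulrA -exprS.
rewrite /c; case: ltnP => h.
  rewrite (bigD1 (Ordinal h)) //= eqxx big1 ?addr0 // => e eh.
  have -> : (nat_of_ord e == (b l).+1) = false by apply: negbTE; apply: contraNneq eh => eh; apply/eqP/val_inj.
  by rewrite horner0 mul0r.
have bD : nat_of_ord (b l) = D0 by have := ltn_ord (b l); move: h; clear; lia.
have := rel t It; rewrite big_ord_recr /= bD => /eqP; rewrite addrC addr_eq0 => /eqP ->.
rewrite -sumrN; apply: eq_bigr => e _; by rewrite hornerN mulNr.
Qed.

(** For each [t] the vector of monomials is an eigenvector of the matrix for the eigenvalue [g t];
    it is not zero because the monomial with zero exponents is 1. The characteristic polynomial is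
    thus a monic relation, of degree the number of monomials. *)
Lemma representable_relation N g : representable N g ->
  exists c : nat -> {poly R}, [/\ forall j, (size (c j) <= (#|B| * N).+1)%N, c #|B| = 1 &
    forall t, I t -> \sum_(j < #|B|.+1) (c j).[t] * g t ^+ j = 0].
Proof.
move=> [m [sm mE]].
pose A : 'M[{poly R}]_(#|B|) := \matrix_(i, j) m (enum_val j) (enum_val i).
have sA : size (char_poly A) = #|B|.+1 by rewrite size_char_poly.
exists (fun j => (char_poly A)`_j); split.
- by apply: coefs_size_char_poly => i j; rewrite mxE.
- by have /monicP := char_poly_monic A; rewrite lead_coefE sA.
move=> t It; pose At := map_mx (horner_eval t) A.
pose v : 'rV[R]_(#|B|) := \row_i monom (enum_val i) t.
have v0 : v != 0.
  apply/eqP => /rowP /(_ (enum_rank [ffun=> ord0])); rewrite !mxE enum_rankK /monom.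
  rewrite big1 => [/eqP|i _]; first by rewrite oner_eq0.
  by rewrite ffunE expr0.
have vA : v *m At = g t *: v.
  apply/rowP => j; rewrite !mxE -mE // (reindex (@enum_val _ B)) /=; last first.
    by apply: onW_bij; exact: enum_val_bij.
  by apply: eq_bigr => i _; rewrite !mxE mulrC.
have : root (char_poly At) (g t) by rewrite -eigenvalue_root_char; apply/eigenvalueP; exists v.
rewrite -map_char_poly => /eqP; rewrite (@horner_coef_wide _ #|B|.+1); last first.
  by apply: leq_trans (size_poly _ _) _; rewrite sA.
move=> E; rewrite -[RHS]E; apply: eq_bigr => j _; by rewrite coef_map.
Qed.

End Representable.

Section LineRelation.
Variables (R : realType) (n D0 N : nat).

Definition reldeg := (#|{ffun 'I_n -> 'I_D0.+1}|).
Definition relsize := (reldeg * (n * N + N) + reldeg * (n * N)).+1.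

(** With [A] the product of the leading coefficients of all coordinates, [A ^+ k] clears the
    denominators of words of length at most [k], so that $A^k$ times the function is representable
    with size $O(k)$. Its monic relation, rewritten for the function itself, keeps a degree that
    does not involve [k]. *)
Lemma polynomial_relation (x : 'I_n -> R -> R) (I : R -> Prop) (a : 'I_n -> nat -> {poly R}) k
    (cs : seq (R * seq 'I_n)) : (0 < k)%N ->
  (forall l e, (e <= D0.+1)%N -> (size (a l e) <= N.+1)%N) -> (forall l, a l D0.+1 != 0) ->
  (forall l t, I t -> \sum_(e < D0.+2) (a l e).[t] * x l t ^+ e = 0) ->
  (forall c, c \in cs -> (size c.2 <= k)%N) ->
  exists b : 'I_reldeg.+1 -> {poly R}, [/\ forall j, (size (b j) <= (k * relsize).+1)%N,
    exists j, b j != 0 &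
    forall t, I t -> \sum_j (b j).[t] * (\sum_(c <- cs) c.1 * \prod_(i <- c.2) x i t) ^+ j = 0].
Proof.
move=> k0 sa a0 rel csk.
pose A := \prod_l a l D0.+1.
have sprod (r : seq 'I_n) : (size (\prod_(l <- r) a l D0.+1)%R <= (size r * N).+1)%N.
  elim: r => [|l r IH]; first by rewrite big_nil size_poly1.
  by rewrite big_cons /= mulSn; apply: size_mul_leq => //; exact: sa.
have sA : (size A <= (n * N).+1)%N.
  by rewrite /A -big_enum; apply: leq_trans (sprod _) _; rewrite size_enum_ord.
have A0 : A != 0 by apply/prodf_neq0 => l _; exact: a0.
have RA := @representable_poly R n D0 x I _ _ sA.
pose N1 := (n * N + N)%N.
have Rx l : representable D0 x I N1 (fun t => A.[t] * x l t).
  apply: (@representable_ext _ _ _ _ _ _ (fun t => (\prod_(i <- rem l (enum 'I_n)) a i D0.+1).[t] * ((a l D0.+1).[t] * x l t))).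
    move=> t; rewrite mulrA -hornerM; congr (_.[t] * _).
    by rewrite /A -big_enum [RHS](big_rem l) ?mem_enum //= mulrC.
  apply: representableM; last by apply: representable_coord; [exact: sa|exact: rel].
  apply: representable_poly; apply: leq_trans (sprod _) _.
  rewrite ltnS leq_mul2r size_rem ?mem_enum // size_enum_ord leq_pred orbT //.
have RAk j : representable D0 x I (j * (n * N)) (fun t => A.[t] ^+ j).
  elim: j => [|j IH].
    apply: (@representable_ext _ _ _ _ _ _ (fun t => (1 : {poly R}).[t])) => [t|]; first by rewrite hornerC.
    by apply: representable_poly; rewrite size_poly1.
  by under eq_fun do rewrite exprS; rewrite mulSn; exact: representableM.
pose g t := A.[t] ^+ k * \sum_(c <- cs) c.1 * \prod_(i <- c.2) x i t.
have Rg : representable D0 x I (k * N1) g.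
  rewrite /g; elim: (cs) csk => [|c cs' IH] csk.
    apply: (@representable_ext _ _ _ _ _ _ (fun t => (0 : {poly R}).[t])) => [t|]; first by rewrite big_nil mulr0 horner0.
    by apply: representable_poly; rewrite size_poly0.
  under eq_fun do rewrite big_cons mulrDr.
  apply: representableD; last by apply: IH => c' cc; apply: csk; rewrite inE cc orbT.
  have sc := csk c (mem_head _ _).
  apply: (@representable_ext _ _ _ _ _ _ (fun t => (c.1%:P).[t] * (A.[t] ^+ (k - size c.2) * \prod_(i <- c.2) (A.[t] * x i t)))).
    move=> t; rewrite hornerC big_split /= big_const_seq count_predT -Monoid.iteropE /=.
    by rewrite [RHS]mulrCA; congr (_ * _); rewrite mulrA -exprD subnK.
  rewrite -[(k * N1)%N]add0n; apply: representableM.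
    by apply: representable_poly; rewrite size_polyC_leq1.
  apply: (@representable_le _ _ _ _ _ ((k - size c.2) * (n * N) + size c.2 * N1)).
    rewrite -{2}(subnK sc) mulnDl leq_add2r leq_mul2l leq_addr orbT //.
  by apply: representableM => //; exact: representable_prod.
have [c [sc cJ cE]] := representable_relation Rg.
exists (fun j => c j * A ^+ (k * j)); split.
- move=> j; have h2 : (size (A ^+ (k * j))%R <= (k * j * (n * N)).+1)%N.
    elim: (k * j)%N => [|i IH]; first by rewrite size_poly1.
    by rewrite exprS mulSn; exact: size_mul_leq.
  have jl : (j <= reldeg)%N by rewrite -ltnS ltn_ord.
  have h3 : (k * j * (n * N) <= k * (reldeg * (n * N)))%N by rewrite -mulnA leq_mul2l leq_mul2r jl !orbT.
  apply: leq_trans (size_mul_leq (sc j) h2) _; rewrite ltnS /relsize -/reldeg mulnS.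
  apply: leq_trans (leq_addl _ _); rewrite mulnDr mulnCA leq_add2l //.
- exists ord_max; rewrite /= -/reldeg cJ mul1r expf_neq0 //.
move=> t It; have := cE t It; rewrite /g => E; rewrite -[RHS]E; apply: eq_bigr => j _.
by rewrite hornerM horner_exp exprMn exprM mulrA.
Qed.

End LineRelation.

(** * Bernstein and Remez inequalities along lines *)

Section Dilation.
Variable R : realType.
Implicit Types (p q : {poly R}) (h s t : R).

Definition dil h p : {poly R} := \poly_(i < size p) (p`_i * h ^+ i).

Lemma coef_dil h p i : (dil h p)`_i = p`_i * h ^+ i.
Proof. by rewrite coef_poly; case: ltnP => // sp; rewrite nth_default // mul0r. Qed.

Lemma horner_dil h p t : (dil h p).[t] = p.[h * t].
Proof.
rewrite horner_poly horner_coef; apply: eq_bigr => i _; by rewrite exprMn mulrA.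
Qed.

Lemma size_dil h p : (size (dil h p) <= size p)%N.
Proof. exact: size_poly. Qed.

Lemma pnorm_dil s h p : pnorm s (dil h p) = pnorm (s * `|h|) p.
Proof.
rewrite (@pnorm_widen _ (size p)) ?size_dil // (@pnorm_widen _ (size p) _ p) //.
by apply: eq_bigr => i _; rewrite coef_dil normrM normrX exprMn -mulrA [`|h| ^+ i * _]mulrC.
Qed.

Lemma dil_eq0 h p : h != 0 -> dil h p = 0 -> p = 0.
Proof.
move=> h0 /polyP pE; apply/polyP => i; have := pE i.
rewrite coef_dil !coef0 => /eqP; rewrite mulf_eq0 expf_eq0 (negbTE h0) andbF orbF.
by move/eqP.
Qed.

Lemma approximates_dil T s h f : h != 0 -> approximates T (`|h| * s) f ->
  approximates (fun L => dil h (T L)) s (fun t => f (h * t)).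
Proof.
move=> h0 [TC Tf]; split=> [e /TC[N NP]|t ts e e0].
  exists N => i j Ni Nj; rewrite (_ : _ - _ = dil h (T i - T j)); last first.
    by apply/polyP => l; rewrite coefB !coef_dil coefB mulrBl.
  by rewrite pnorm_dil mulrC; exact: NP.
have [|N NP] := Tf (h * t) _ e e0; first by rewrite normrM ler_pM2l ?normr_gt0.
by exists N => i /NP; rewrite horner_dil.
Qed.

End Dilation.

Section Tame.
Variables (R : realType) (J Cdeg : nat).
Hypothesis Cdeg0 : (0 < Cdeg)%N.
Implicit Types (F : R -> R) (s h t M : R).

(** What is retained of a polynomial of degree [k] restricted to a line in a chart: [J] and [Cdeg]
    do not depend on it. *)
Definition tame k s F := exists2 T, approximates T s F & exists b : 'I_J.+1 -> {poly R},
  [/\ forall j, (size (b j) <= (k * Cdeg).+1)%N, exists j, b j != 0 &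
    forall t, `|t| <= s -> \sum_j (b j).[t] * F t ^+ j = 0].

Lemma tame_opp k s F : tame k s F -> tame k s (fun t => F (- t)).
Proof.
move=> [T TF [b [sb [j bj] rel]]].
exists (fun L => dil (-1) (T L)).
  have := @approximates_dil R T s (-1) F; rewrite normrN normr1 mul1r oppr_eq0 oner_eq0 => /(_ isT TF).
  by congr approximates; apply/funext => t; rewrite mulN1r.
exists (fun j => dil (-1) (b j)); split=> [i||t ts].
- exact: leq_trans (size_dil _ _) (sb i).
- by exists j; apply: contra_neq bj; apply: dil_eq0; rewrite oppr_eq0 oner_eq0.
- have := rel (- t); rewrite normrN => /(_ ts) h; rewrite -[RHS]h.
  by apply: eq_bigr => i _; rewrite horner_dil mulN1r.
Qed.

Definition Econst : R := 1 + `|Wconst R J| ^+ Cdeg.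

Lemma Econst_ge1 : 1 <= Econst. Proof. by rewrite lerDl exprn_ge0. Qed.

(** [bernstein_algebraic] after the dilation by [h]. Its hypothesis on residuals follows from
    [approximates_flat]: evaluated at [T L], the relation converges to a function that is
    identically 0. *)
Lemma tame_growth k s F h M : (0 < k)%N -> tame k s F -> 0 < h -> 2 * h <= s -> 0 < M ->
  (forall t, - (2 * h) <= t <= - h -> `|F t| <= M) ->
  exists2 T, approximates T s F & exists N, forall L, (N <= L)%N -> forall i,
    `|(T L)`_i| * (5 / 4 * h) ^+ i <= M * Econst ^+ k.
Proof.
move=> k0 [T TF [b [sb [j bj] rel]]] h0 hs M0 FM.
have hn : `|h| = h by rewrite gtr0_norm.
have hne : h != 0 by rewrite gt_eqF.
have TF2 : approximates T (`|h| * 2) F.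
  by apply: approximates_le TF; rewrite hn mulr_ge0 ?(ltW h0) //= mulrC.
have DF := approximates_dil hne TF2.
exists T => //.
have := @bernstein_algebraic R J (k * Cdeg) (fun L => dil h (T L)) (fun j => dil h (b j)) M.
move=> /(_ _ _ _ _ _ _)/wrap[|||||| [N _ NP]].
- by rewrite muln_gt0 k0.
- by move=> i; exact: leq_trans (size_dil _ _) (sb i).
- by exists j; apply: contra_neq bj; exact: dil_eq0.
- by [].
- move=> e e0.
  have A : approximates (fun L => \sum_j dil h (b j) * dil h (T L) ^+ j) 2
      (fun t => \sum_j (dil h (b j)).[t] * F (h * t) ^+ j).
    apply: approximates_sum => // i; apply: approximatesM => //; first exact: approximates_horner.
    exact: approximatesX.
  have Z t : `|t| <= 2 -> \sum_j (dil h (b j)).[t] * F (h * t) ^+ j = 0.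
    move=> t2; have E : `|h * t| <= s.
      by rewrite normrM hn; apply: le_trans hs; rewrite mulrC ler_pM2r.
    by rewrite -[RHS](rel _ E); apply: eq_bigr => i _; rewrite horner_dil.
  have [|H _] := approximates_flat (ltr0n R 2 : 0 < 2) A.
    move=> n; exists 0 => eta eta0; exists (Num.min 1 (eta / 2)).
      rewrite gtr0_norm ?lt_min ?ltr01 ?divr_gt0 //= gt_min; apply/orP; right; lra.
    rewrite Z ?normr0 ?mul0r // gtr0_norm ?lt_min ?ltr01 ?divr_gt0 //.
    by apply: (@le_trans _ _ 1); [rewrite ge_min lexx|lra].
  by have [N NP] := H e e0; exists N.
- have [N NP] := approximates_unif (ltW (ltr0n R 2 : 0 < 2)) DF M0.
  exists N => // L NL t /andP[t1 t2].
  have tn : `|t| <= 2 by rewrite ler_norml; lra.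
  have h1 := NP L NL t tn.
  have h2 : `|F (h * t)| <= M by apply: FM; apply/andP; split; nra.
  have -> : (dil h (T L)).[t] = ((dil h (T L)).[t] - F (h * t)) + F (h * t) by ring.
  apply: le_trans (ler_normD _ _) _; lra.
exists N => L NL i; have := NP L NL i; rewrite coef_dil normrM normrX hn => hh.
rewrite exprMn mulrA mulrAC; apply: le_trans hh _; rewrite ler_pM2l //.
rewrite mulnC exprM; apply: le_trans (ler_norm _) _; rewrite normrX normrX.
by rewrite lerXn2r ?nnegrE ?exprn_ge0 ?addr_ge0 // lerDr.
Qed.

Lemma sum45 n : \sum_(i < n) (4 / 5 : R) ^+ i <= 5.
Proof.
suff : \sum_(i < n) (4 / 5 : R) ^+ i <= 5 - 5 * (4 / 5) ^+ n.
  by have p0 : 0 <= (4 / 5 : R) ^+ n by [apply: exprn_ge0; lra]; lra.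
elim: n => [|n IH]; first by rewrite big_ord0 expr0; lra.
by rewrite big_ord_recr exprS /=; lra.
Qed.

Lemma pnorm_of_growth (p : {poly R}) h M : 0 < h ->
  (forall i, `|p`_i| * (5 / 4 * h) ^+ i <= M) -> pnorm h p <= 5 * M.
Proof.
move=> h0 H; have M0 : 0 <= M by apply: le_trans (H 0%N); rewrite mulr_ge0.
rewrite /pnorm /pnormby; apply: le_trans (_ : \sum_(i < size p) M * (4 / 5) ^+ i <= _).
  apply: ler_sum => i _; have -> : h ^+ i = (5 / 4 * h) ^+ i * (4 / 5) ^+ i.
    by rewrite -exprMn; congr (_ ^+ _); field.
  by rewrite mulrA ler_wpM2r // exprn_ge0 //; lra.
by rewrite -big_distrr /= mulrC ler_wpM2r // sum45.
Qed.

(** The coefficient bounds of [tame_growth] are summed as a geometric series of ratio 4/5, hence the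
    5. That lemma requires a positive bound, hence the perturbation of [M] by [e']. *)
Lemma tame_double k s F h M : (0 < k)%N -> tame k s F -> 0 < h -> 2 * h <= s -> 0 <= M ->
  (forall t, - (2 * h) <= t <= - h -> `|F t| <= M) ->
  forall t, `|t| <= h -> `|F t| <= 5 * Econst ^+ k * M.
Proof.
move=> k0 tF h0 hs M0 FM t th; have E0 : 0 < Econst ^+ k.
  by rewrite exprn_gt0 // (lt_le_trans ltr01) // Econst_ge1.
apply/ler_addgt0Pl => e e0; pose e' := e / (5 * Econst ^+ k + 1).
have c0 : 0 < 5 * Econst ^+ k + 1 by rewrite ltr_wpDl // mulr_ge0 // ltW.
have e'0 : 0 < e' by rewrite divr_gt0.
have M'0 : 0 < M + e' by rewrite ltr_wpDl.
have [|T TF [N NP]] := tame_growth k0 tF h0 hs M'0.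
  by move=> t' /FM h'; rewrite (le_trans h') // lerDl ltW.
have ts : `|t| <= s by move: th h0 hs; lra.
have [N' N'P] := (proj2 TF) t ts e' e'0.
pose L := maxn N N'.
have h1 := pnorm_of_growth h0 (NP L (leq_maxl _ _)).
have h2 := N'P L (leq_maxr _ _).
have h3 := pnorm_horner_le (T L) th.
have -> : F t = (T L).[t] - ((T L).[t] - F t) by ring.
apply: le_trans (ler_normB _ _) _; apply: le_trans (lerD (le_trans h3 h1) h2) _.
have -> : e = e' * (5 * Econst ^+ k + 1) by rewrite /e' divfK // gt_eqF.
by rewrite le_eqVlt; apply/orP; left; apply/eqP; ring.
Qed.

Lemma tame_bounded k s F : 0 <= s -> tame k s F -> exists B, forall t, `|t| <= s -> `|F t| <= B.
Proof.
move=> s0 [T TF _]; have [B B0 [N NP]] := approximates_bounded s0 TF.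
have [N' N'P] := approximates_unif s0 TF ltr01.
exists (B + 1) => t ts; pose L := maxn N N'.
have h1 := NP L (leq_maxl _ _); have h2 := N'P L (leq_maxr _ _) t ts.
have h3 := pnorm_horner_le (T L) ts.
have -> : F t = (T L).[t] - ((T L).[t] - F t) by ring.
by apply: le_trans (ler_normB _ _) _; lra.
Qed.

Section Segment.
Variables (F : R -> R) (k : nat) (h : R).
Hypotheses (k0 : (0 < k)%N) (h0 : 0 < h).
Hypothesis tF : forall w, `|w| <= 12 * h -> tame k (4 * h) (fun t => F (w + t)).

Let G := 5 * Econst ^+ k.

(** [tame_double] around $c + 3l/2$ extends the bound to the right of the interval, and a reflection
    extends it to the left; the length is multiplied by 5. *)
Lemma expand1 c l M : 0 < l <= 2 * h -> `|c| <= 4 * h -> 0 <= M ->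
  (forall t, `|t - c| <= l / 2 -> `|F t| <= M) -> forall t, `|t - c| <= 5 * l / 2 -> `|F t| <= G * M.
Proof.
move=> /andP[l0 lh] ch M0 FM t; move=> tcl.
have /andP[c1 c2] : - (4 * h) <= c <= 4 * h by rewrite -ler_norml.
have /andP[t1 t2] : - (5 * l / 2) <= t - c <= 5 * l / 2 by rewrite -ler_norml.
have G1 : 1 <= G.
  by have := exprn_ege1 k Econst_ge1; rewrite /G; lra.
have [tin|] := boolP (`|t - c| <= l / 2).
  by apply: le_trans (FM t tin) _; rewrite ler_peMl.
rewrite -ltNge => tout; case: (leP c t) => tc.
  have w1 : `|c + 3 * l / 2| <= 12 * h by rewrite ler_norml; lra.
  have := @tame_double k (4 * h) _ l M k0 (tF w1) l0 _ M0 _ (t - (c + 3 * l / 2)).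
  rewrite [c + 3 * l / 2 + _]addrC subrK; apply; first by lra.
    by move=> u /andP[u1 u2]; apply: FM; rewrite ler_norml; lra.
  by move: tout; rewrite ger0_norm ?subr_ge0 // ler_norml => ?; lra.
have w1 : `|c - 3 * l / 2| <= 12 * h by rewrite ler_norml; lra.
have := @tame_double k (4 * h) _ l M k0 (tame_opp (tF w1)) l0 _ M0 _ (- (t - (c - 3 * l / 2))).
rewrite opprK [c - 3 * l / 2 + _]addrC subrK; apply; first by lra.
  by move=> u /andP[u1 u2]; apply: FM; rewrite ler_norml; lra.
rewrite normrN; move: tout; rewrite ltr0_norm ?subr_lt0 // ler_norml => ?; lra.
Qed.

Lemma expand_iter j c l M : 0 < l -> 5 ^+ j * l <= 10 * h -> `|c| <= 4 * h -> 0 <= M ->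
  (forall t, `|t - c| <= l / 2 -> `|F t| <= M) ->
  forall t, `|t - c| <= 5 ^+ j * l / 2 -> `|F t| <= G ^+ j * M.
Proof.
have G0 : 0 <= G by rewrite mulr_ge0 // exprn_ge0 // (le_trans ler01) // Econst_ge1.
move=> l0 + ch M0 FM; elim: j => [|j IH] jl.
  by move=> t; rewrite !expr0 !mul1r; exact: FM.
rewrite exprS -mulrA in jl.
have jl2 : 5 ^+ j * l <= 2 * h by lra.
move=> t; rewrite exprS -!mulrA mulrA => tc; rewrite exprS -mulrA.
apply: (@expand1 c (5 ^+ j * l)) => //.
- by rewrite jl2 mulr_gt0 // exprn_gt0.
- by rewrite mulr_ge0 // exprn_ge0.
- by apply: IH; move: jl2 h0; lra.
- by move: tc; rewrite !mulrA.
Qed.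

End Segment.

Lemma block_pigeonhole N Q N' (S : {set 'I_N}) : (0 < N')%N -> (N <= Q * N')%N -> (0 < #|S|)%N ->
  exists b (S' : {set 'I_N'}), [/\ (#|S| <= Q * #|S'|)%N, (0 < #|S'|)%N &
    forall i', i' \in S' -> exists2 i, i \in S & nat_of_ord i = (b * N' + i')%N].
Proof.
move=> N'0 NQ S0.
pose Sb (b : 'I_Q) := [set i in S | (i %/ N' == b)%N]%SET.
have bl (i : 'I_N) : (i %/ N' < Q)%N by rewrite ltn_divLR // (leq_trans (ltn_ord i)).
have cS : #|S| = (\sum_b #|Sb b|)%N.
  rewrite -sum1_card (partition_big (fun i => Ordinal (bl i)) xpredT) //=.
  apply: eq_bigr => b _; rewrite -sum1_card; apply: eq_bigl => i.
  by rewrite inE -val_eqE.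
have [b bP] : exists b : 'I_Q, (#|S| <= Q * #|Sb b|)%N.
  apply: contrapT => h.
  have {}h (b : 'I_Q) : (Q * #|Sb b| < #|S|)%N.
    by rewrite ltnNge; apply/negP => h'; apply: h; exists b.
  have Q0 : (0 < Q)%N.
    have /card_gt0P[i _] := S0; have := leq_trans (ltn_ord i) NQ.
    by case: (Q).
  have : (Q * #|S| + Q <= Q * #|S|)%N.
    have {2}-> : (Q * #|S| = \sum_(b < Q) #|S|)%N by rewrite sum_nat_const card_ord.
    have -> : (Q * #|S| + Q = \sum_(b < Q) (Q * #|Sb b|).+1)%N.
      under eq_bigr => b _ do rewrite -addn1.
      by rewrite big_split /= -big_distrr /= -cS sum_nat_const card_ord muln1.
    by apply: leq_sum => b _; exact: h.
  by rewrite -{2}[(Q * _)%N]addn0 leq_add2l leqNgt Q0.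
pose f (i : 'I_N) : 'I_N' := Ordinal (ltn_pmod i N'0).
exists b, (f @: Sb b)%SET.
have inj : {in Sb b &, injective f}.
  move=> i j; rewrite !inE => /andP[_ /eqP ib] /andP[_ /eqP jb] /(congr1 val) /= E.
  by apply: val_inj; rewrite /= (divn_eq i N') (divn_eq j N') ib jb E.
rewrite card_in_imset //; split => //.
  by rewrite lt0n; apply: contraTneq S0 => E; rewrite -leqNgt; move: bP; rewrite E muln0.
move=> i' /imsetP[i1]; rewrite !inE => /andP[iS /eqP ib] ->; exists i1 => //.
by rewrite /= -ib; exact: divn_eq.
Qed.

(** * A discrete Remez inequality for functions with a relation *)

Section Remez.
Variable dd : nat.
Hypothesis dd0 : (0 < dd)%N.

(** The constants are tied by the absorption that ends [tame_remez]. A block of relative length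
    about $5^{-q}$, $q$ being [rz_q], expands to the whole segment in $q+1$ steps. On it, Taylor
    truncation at degree $m$ gains $(2/Q)^m$ with $Q$ = [rz_Q], against the cost [rz_G ^+ m] of
    [discrete_remez]; as $Q$ is at least 4 times [rz_G], the product is at most $2^{-m}$. With $m$
    equal to [k] times [rz_C] this beats the cost of the expansion. *)
Definition rz_q := (512 * dd)%N.
Definition rz_Q := (5 ^ rz_q)%N.
Definition rz_G : R := (128 * dd)%:R.
Definition rz_C := (Num.truncn (40 * 5 ^+ rz_q.+2 * Econst ^+ rz_q.+3)%R).+1.
Definition Kremez : R := 2 * (5 * Econst) ^+ rz_q.+1 * rz_G ^+ rz_C + 2.

Lemma rz_Q_ge : (4 * (128 * dd) <= rz_Q)%N.
Proof. by rewrite mulnA -/rz_q; apply/ltnW/ltn_expl. Qed.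

Lemma rz_C_pow : 40 * 5 ^+ rz_q.+2 * Econst ^+ rz_q.+3 <= 2 ^+ rz_C.
Proof.
apply: le_trans (_ : rz_C%:R <= _).
  by apply/ltW; rewrite /rz_C; apply: truncnS_gt.
by rewrite -natrX ler_nat ltnW // ltn_expl.
Qed.

Lemma Kremez_ge2 : 2 <= Kremez.
Proof.
rewrite /Kremez lerDr !mulr_ge0 ?exprn_ge0 ?mulr_ge0 //.
by apply: le_trans Econst_ge1.
Qed.

(** The inequality for polynomials is applied on one short block rich in points of [S], to a Taylor
    truncation of [F]. The truncation error is a small multiple of the supremum [M0] over the whole
    segment, which in turn is bounded by the supremum [Mb] over the block through repeated
    expansion; so the error can be absorbed into [Mb]. *)
Lemma tame_remez k F h eps N (S : {set 'I_N}) : (0 < k)%N -> 0 < h ->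
  (forall w, `|w| <= 12 * h -> tame k (4 * h) (fun t => F (w + t))) ->
  (rz_Q * (rz_Q + 4 * dd * (k * rz_C)) <= N)%N -> (N < 2 * dd * #|S|)%N ->
  (forall i, i \in S -> `|F (h * (i%:R / N%:R))| <= eps) ->
  forall t, 0 <= t <= h -> `|F t| <= Kremez ^+ k * eps.
Proof.
move=> k0 h0 tF Nbig cS Feps.
have Q0 : (0 < rz_Q)%N by rewrite expn_gt0.
have E1 := Econst_ge1; have E0 : 0 < Econst by exact: lt_le_trans ltr01 E1.
pose m := (k * rz_C)%N.
have m0 : (0 < m)%N.
  rewrite muln_gt0 k0 /= lt0n; apply/eqP => C0; have := rz_C_pow; rewrite C0 expr0.
  have : 1 <= Econst ^+ rz_q.+3 by exact: exprn_ege1.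
  have : 1 <= (5 : R) ^+ rz_q.+2 by apply: exprn_ege1; lra.
  by nra.
have NQ1 : (rz_Q <= N)%N.
  apply: leq_trans Nbig; rewrite -{1}[rz_Q]muln1 leq_mul2l; apply/orP; right.
  by apply: leq_trans Q0 _; exact: leq_addr.
have N0 : (0 < N)%N by exact: leq_trans Q0 NQ1.
have N0' : 0 < N%:R :> R by rewrite ltr0n.
have S0 : (0 < #|S|)%N.
  by rewrite lt0n; apply: contraTneq cS => ->; rewrite muln0.
pose N' := (N %/ rz_Q).+1.
have NQN' : (N <= rz_Q * N')%N by rewrite mulnC; apply/ltnW; exact: ltn_ceil.
have QN'2 : (rz_Q * N' <= 2 * N)%N.
  rewrite /N' mulnS mulnC; have := leq_trunc_div N rz_Q.
  by move: NQ1; clear; lia.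
have [b [S' [cS' S'0 S'P]]] := block_pigeonhole (ltn0Sn _) NQN' S0.
have N'0' : 0 < N'%:R :> R by rewrite ltr0n.
pose L := h * (N'%:R / N%:R).
pose a := h * ((b * N')%:R / N%:R).
have L0 : 0 < L by rewrite mulr_gt0 // divr_gt0.
have QL : rz_Q%:R * L <= 2 * h.
  rewrite /L mulrCA mulrC ler_pM2r // mulrA ler_pdivrMr // -!natrM ler_nat //.
have Lh : L <= 2 * h.
  by apply: le_trans QL; rewrite ler_peMl ?(ltW L0) // ler1n.
have hL : h <= rz_Q%:R * L.
  by rewrite /L mulrCA ler_peMr ?(ltW h0) // mulrA ler_pdivlMr // mul1r -natrM ler_nat.
have ah : 0 <= a <= h.
  rewrite mulr_ge0 ?(ltW h0) ?divr_ge0 //= ler_piMr ?(ltW h0) // ler_pdivrMr // mul1r ler_nat.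
  move: S'0 => /card_gt0P[i' /S'P[i _ iE]]; have := ltn_ord i; rewrite iE => /ltnW.
  by apply: leq_trans; exact: leq_addr.
case/andP: ah => a0 ah.
have hn0 : `|0 : R| <= 12 * h by rewrite normr0 mulr_ge0 // ltW.
have s0 : 0 <= 4 * h by rewrite mulr_ge0 // ltW.
have [B BP] := tame_bounded s0 (tF _ hn0).
have {}BP t : `|t| <= 4 * h -> `|F t| <= B by move=> /BP; rewrite add0r.
pose M0 := sup [set `|F t| | t in [set t | 0 <= t <= h]].
have M0P t : 0 <= t <= h -> `|F t| <= M0.
  move=> th; apply: ub_le_sup; last by exists t.
  by exists B => _ [u /andP[u0 uh] <-]; apply: BP; rewrite ger0_norm //; move: uh h0; clear -Cdeg0 dd0; lra.
pose Mb := sup [set `|F t| | t in [set t | a <= t <= a + L]].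
have MbP t : a <= t <= a + L -> `|F t| <= Mb.
  move=> th; apply: ub_le_sup; last by exists t.
  by exists B => _ [u /andP[u0 uh] <-]; apply: BP; rewrite ger0_norm; move: u0 uh h0 a0 ah Lh; clear -Cdeg0 dd0; lra.
have Mb0 : 0 <= Mb by apply: le_trans (MbP a _); rewrite // lexx /= lerDl ltW.
have M00 : 0 <= M0 by apply: le_trans (M0P 0 _); rewrite // lexx /= ltW.
pose G : R := 5 * Econst ^+ k.
have Ek1 : 1 <= Econst ^+ k by exact: exprn_ege1.
have G1 : 1 <= G by rewrite /G; lra.
have G0 : 0 < G by lra.
have M0Mb : M0 <= G ^+ rz_q.+1 * Mb.
  apply: ge_sup => [|_ [t /andP[t0 th] <-]]; first by exists `|F 0|, 0; rewrite //= lexx ltW.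
  have QE : 5 ^+ rz_q = rz_Q%:R :> R by rewrite natrX.
  apply: (@expand_iter F k h k0 h0 tF rz_q.+1 (a + L / 2) L Mb) => //.
  - by rewrite exprS -mulrA QE; move: QL; clear -Cdeg0 dd0; lra.
  - by rewrite ger0_norm; move: a0 ah L0 Lh h0; clear -Cdeg0 dd0; lra.
  - by move=> u; rewrite ler_norml => hu; apply: MbP; move: hu; clear -Cdeg0 dd0; lra.
  - by rewrite exprS -mulrA QE ler_norml; move: t0 th hL L0 Lh ah a0; clear -Cdeg0 dd0; lra.
move=> t th; apply: le_trans (M0P t th) _; apply: (le_trans M0Mb).
have eps0 : 0 <= eps by have /card_gt0P[i /Feps] := S0; exact: le_trans.
suff MbE : Mb <= 2 * eps * rz_G ^+ m.
  apply: le_trans (_ : G ^+ rz_q.+1 * (2 * eps * rz_G ^+ m) <= _).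
    by rewrite ler_pM2l // exprn_gt0.
  have -> : G ^+ rz_q.+1 * (2 * eps * rz_G ^+ m) = 2 * (G ^+ rz_q.+1 * rz_G ^+ m) * eps by ring.
  rewrite ler_wpM2r //.
  apply: le_trans (_ : (2 * (5 * Econst) ^+ rz_q.+1 * rz_G ^+ rz_C) ^+ k <= _); last first.
    rewrite lerXn2r ?nnegrE ?lerDl ?addr_ge0 ?mulr_ge0 ?exprn_ge0 ?mulr_ge0 ?(ltW E0) //.
  have -> : rz_G ^+ m = (rz_G ^+ rz_C) ^+ k by rewrite -exprM mulnC.
  rewrite [leRHS]exprMn mulrA ler_wpM2r ?exprn_ge0 //.
  rewrite [leRHS]exprMn; apply: ler_pM; rewrite ?exprn_ge0 ?(ltW G0) //.
    by rewrite -[leLHS]expr1 ler_weXn2l //; lra.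
  rewrite exprAC lerXn2r ?nnegrE ?(ltW G0) ?exprn_ge0 ?mulr_ge0 ?(ltW E0) //.
  rewrite /G [leRHS]exprMn ler_wpM2r ?exprn_ge0 ?(ltW E0) // -[leLHS]expr1 ler_weXn2l //; lra.
(* [tame_growth] needs a positive bound. If [M0] is 0, one expansion step shows that [F] vanishes on
   the block too, which may extend beyond the segment. *)
have [M0z|M0nz] := eqVneq M0 0.
  apply: le_trans (_ : 0 <= _); last by rewrite mulr_ge0 ?exprn_ge0 // mulr_ge0.
  apply: ge_sup => [|_ [u /andP[u0 uh] <-]]; first by exists `|F a|, a; rewrite //= lexx lerDl ltW.
  have := @expand_iter F k h k0 h0 tF 1 (h / 2) h M0 h0; rewrite expr1 M0z mulr0; apply => //.
  - by move: h0; clear -Cdeg0 dd0; lra.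
  - by rewrite ger0_norm; move: h0; clear -Cdeg0 dd0; lra.
  - by move=> v; rewrite -M0z ler_norml => hv; apply: M0P; move: hv; clear -Cdeg0 dd0; lra.
  - by rewrite ler_norml; move: u0 uh h0 a0 ah Lh; clear -Cdeg0 dd0; lra.
have M0p : 0 < M0 by rewrite lt_def M0nz.
have GM0 : 0 < G * M0 by rewrite mulr_gt0.
have wa : `|a| <= 12 * h by rewrite ger0_norm //; move: ah h0; clear -Cdeg0 dd0; lra.
have [||T TF [N1 N1P]] := tame_growth k0 (tF a wa) h0 _ GM0.
- by move: h0; clear -Cdeg0 dd0; lra.
- move=> u /andP[u1 u2].
  have := @expand_iter F k h k0 h0 tF 1 (h / 2) h M0 h0; rewrite !expr1; apply => //.
  + by move: h0; clear -Cdeg0 dd0; lra.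
  + by rewrite ger0_norm; move: h0; clear -Cdeg0 dd0; lra.
  + by move=> v; rewrite ler_norml => hv; apply: M0P; move: hv; clear -Cdeg0 dd0; lra.
  + by rewrite ler_norml; move: u1 u2 h0 a0 ah Lh; clear -Cdeg0 dd0; lra.
pose tl := 5 * (G * M0 * Econst ^+ k) * (2 / rz_Q%:R) ^+ m.
have Q0' : 0 < rz_Q%:R :> R by rewrite ltr0n.
have tl0 : 0 < tl.
  by rewrite !mulr_gt0 ?exprn_gt0 ?divr_gt0.
have [N2 N2P] := approximates_unif s0 TF tl0.
pose n := maxn N1 N2.
have pn := pnorm_of_growth h0 (N1P n (leq_maxl _ _)).
pose q := take_poly m.+1 (T n).
have qF u : 0 <= u <= L -> `|F (a + u) - q.[u]| <= 2 * tl.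
  move=> /andP[u0 uL]; have un : `|u| = u by rewrite ger0_norm.
  have uh : `|u| <= 4 * h by rewrite un; move: uL Lh h0; clear -Cdeg0 dd0; lra.
  have h1 := N2P n (leq_maxr _ _) u uh.
  have uh2 : u / h <= 2 / rz_Q%:R.
    rewrite ler_pdivrMr // mulrAC ler_pdivlMr //; apply: le_trans QL; rewrite mulrC.
    by rewrite ler_pM2l.
  have qE : q.[u] = \sum_(i < m.+1) (T n)`_i * u ^+ i.
    rewrite /q (@horner_coef_wide _ m.+1) ?size_take_poly //.
    by apply: eq_bigr => i _; rewrite coef_take_poly ltn_ord.
  have Q2 : 2 / rz_Q%:R <= 1 :> R.
    by rewrite ler_pdivrMr // mul1r ler_nat; apply: leq_trans rz_Q_ge; move: dd0; clear; lia.
  have h2 : `|(T n).[u] - q.[u]| <= tl.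
    rewrite qE. 
    have [uh'|uh'] := leP u h; last first.
      have : rz_Q%:R * L <= 2 * h by [].
      have : 4 * L <= rz_Q%:R * L.
        by rewrite ler_pM2r // ler_nat; apply: leq_trans rz_Q_ge; move: dd0; clear; lia.
      by move: uh' uL h0; clear -Cdeg0 dd0; lra.
    have hu : `|u| <= h by rewrite un.
    apply: le_trans (horner_tail (T n) m.+1 h0 hu) _; rewrite un mulrC /tl.
    apply: ler_pM; rewrite ?pnorm_ge0 ?exprn_ge0 ?divr_ge0 ?(ltW h0) //.
    apply: le_trans (_ : (2 / rz_Q%:R) ^+ m.+1 <= _).
      by rewrite lerXn2r ?nnegrE ?divr_ge0 // ltW.
    by rewrite ler_wiXn2l ?divr_ge0.
  have -> : F (a + u) - q.[u] = - ((T n).[u] - F (a + u)) + ((T n).[u] - q.[u]) by ring.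
  by apply: le_trans (ler_normD _ _) _; rewrite normrN [2 * tl]mulr_natl mulr2n; exact: lerD.
(* The spacing for [discrete_remez]: [S'] has more than $N'/(4\,dd)$ elements, hence more than
   [m * g]. *)
pose g := (N' %/ (4 * dd * m))%N.
have dm0 : (0 < 4 * dd * m)%N by rewrite muln_gt0 m0 andbT muln_gt0 dd0.
have N'big : (4 * dd * m <= N')%N.
  rewrite /N' leqW // leq_divRL //; apply: leq_trans Nbig.
  by rewrite mulnC leq_mul2l leq_addl orbT.
have g0 : (0 < g)%N by rewrite divn_gt0.
have mg : (m * g < #|S'|)%N.
  have h1 : (4 * dd * (m * g) <= N')%N by rewrite mulnA mulnC; exact: leq_trunc_div.
  have h2 : (N' < 4 * dd * #|S'|)%N.
    rewrite -(ltn_pmul2l Q0); apply: leq_ltn_trans QN'2 _.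
    have : (2 * dd * #|S| <= 2 * dd * (rz_Q * #|S'|))%N by rewrite leq_mul2l cS' orbT.
    by move: cS; clear; nia.
  have := leq_ltn_trans h1 h2; rewrite ltn_pmul2l //.
  by rewrite muln_gt0.
have N'g : N'%:R / g%:R <= (8 * dd * m)%:R :> R.
  rewrite ler_pdivrMr ?ltr0n // -natrM ler_nat.
  have := ltn_ceil N' dm0; rewrite -/g; move: g0; clear; nia.
have pq : pnorm L q <= (eps + 2 * tl) * rz_G ^+ m.
  have := @discrete_remez R m g N' S' q 0 L L (eps + 2 * tl) g0 (size_take_poly _ _) L0 (ltW L0) mg.
  move=> /(_ _)/wrap[i' i'S|].
    have [i iS iE] := S'P i' i'S.
    have hu : 0 <= L * (i'%:R / N'%:R) <= L.
      rewrite mulr_ge0 ?(ltW L0) ?divr_ge0 //= ler_piMr ?(ltW L0) // ler_pdivrMr // mul1r ler_nat.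
      by rewrite ltnW.
    have hq := qF _ hu.
    have aE : a + L * (i'%:R / N'%:R) = h * (i%:R / N%:R).
      have gen (x y z w : R) : x != 0 -> y != 0 -> h * (z / y) + h * (x / y) * (w / x) = h * ((z + w) / y).
        by move=> xn yn; field; rewrite xn yn.
      by rewrite /a /L iE natrD gen ?gt_eqF.
    have := Feps i iS; rewrite -aE => hF; rewrite add0r.
    have -> : q.[L * (i'%:R / N'%:R)] = F (a + L * (i'%:R / N'%:R)) - (F (a + L * (i'%:R / N'%:R)) - q.[L * (i'%:R / N'%:R)]) by ring.
    by apply: le_trans (ler_normB _ _) _; apply: lerD.
  move=> hp; apply: le_trans hp _; rewrite -mulrA ler_wpM2l //; first by move: (tl) tl0 eps0 => x; clear -Cdeg0 dd0; lra.
  have gen (x : R) : x != 0 -> 2 * (x + `|0 : R| + x) / x = 2 * 2.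
    by move=> xn; rewrite normr0; field; rewrite xn.
  rewrite gen ?gt_eqF //.
  rewrite ler_pdivrMr ?ltr0n ?fact_gt0 //.
  apply: le_trans (_ : (2 * 2 * (8 * dd * m)%:R) ^+ m <= _).
    by rewrite lerXn2r ?nnegrE ?mulr_ge0 ?divr_ge0 // ler_wpM2l // mulr_ge0.
  have -> : 2 * 2 * (8 * dd * m)%:R = ((32 * dd)%:R * m%:R : R) by rewrite -!natrM; congr (_%:R); clear; lia.
  rewrite exprMn /rz_G (_ : (128 * dd)%N = (32 * dd * 4)%N); last by clear; lia.
  rewrite [((32 * dd * 4)%:R)]natrM exprMn -mulrA ler_wpM2l ?exprn_ge0 //.
  by rewrite -!natrX -natrM ler_nat expnn_le_fact.
have G1' : 1 <= rz_G ^+ m by apply: exprn_ege1; rewrite ler1n muln_gt0.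
have MbX : Mb <= eps * rz_G ^+ m + 4 * (tl * rz_G ^+ m).
  apply: ge_sup => [|_ [u /andP[u0 uh] <-]]; first by exists `|F a|, a; rewrite //= lexx lerDl ltW.
  have hu : 0 <= u - a <= L by rewrite subr_ge0 u0 lerBlDl.
  have := qF _ hu; rewrite [a + _]addrC subrK => h1.
  have uL : `|u - a| <= L by case/andP: hu => h2 h3; rewrite ger0_norm.
  have h2 := le_trans (pnorm_horner_le q uL) pq.
  have -> : F u = q.[u - a] + (F u - q.[u - a]) by ring.
  apply: le_trans (ler_normD _ _) _; apply: le_trans (lerD h2 h1) _.
  have : tl <= tl * rz_G ^+ m by rewrite ler_peMr // ltW.
  by rewrite mulrDl; move: (tl) (rz_G ^+ m) => x y; clear -Cdeg0 dd0; lra.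
(* What remains is the absorption of the error by half of [Mb], for which [rz_Q] and [rz_C] were
   chosen. *)
suff tlM : 4 * (tl * rz_G ^+ m) <= Mb / 2 by move: MbX tlM; move: (tl) (rz_G ^+ m) (Mb) => x y z; clear -Cdeg0 dd0; lra.
have h1 : (2 / rz_Q%:R) ^+ m * rz_G ^+ m <= 2^-1 ^+ m.
  rewrite -exprMn lerXn2r ?nnegrE ?mulr_ge0 ?divr_ge0 ?invr_ge0 //.
  rewrite mulrAC ler_pdivrMr // [leRHS]mulrC ler_pdivlMr // /rz_G -!natrM ler_nat.
  by apply: leq_trans rz_Q_ge; clear; lia.
have X0 : 0 <= 5 * (G * M0 * Econst ^+ k) by rewrite !mulr_ge0 ?exprn_ge0 ?(ltW G0) ?(ltW E0).
apply: le_trans (_ : 4 * (5 * (G * M0 * Econst ^+ k) * 2^-1 ^+ m) <= _).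
  by rewrite ler_pM2l // /tl -mulrA ler_wpM2l.
apply: le_trans (_ : 4 * (5 * (G * (G ^+ rz_q.+1 * Mb) * Econst ^+ k) * 2^-1 ^+ m) <= _).
  rewrite ler_pM2l // ler_wpM2r ?exprn_ge0 ?invr_ge0 // ler_pM2l // ler_wpM2r ?exprn_ge0 ?(ltW E0) //.
  by rewrite (ler_pM2l G0).
have -> : 4 * (5 * (G * (G ^+ rz_q.+1 * Mb) * Econst ^+ k) * 2^-1 ^+ m) =
   (40 * G ^+ rz_q.+2 * Econst ^+ k * 2^-1 ^+ m) * (Mb / 2).
  have gen (g' P y e z : R) : 4 * (5 * (g' * (P * y) * e) * z) = (40 * (g' * P) * e * z) * (y / 2) by field.
  by rewrite [G ^+ rz_q.+2]exprS gen.
rewrite -[leRHS]mul1r ler_wpM2r ?divr_ge0 //.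
rewrite exprVn ler_pdivrMr ?exprn_gt0 // mul1r.
apply: le_trans (_ : (40 * 5 ^+ rz_q.+2 * Econst ^+ rz_q.+3) ^+ k <= _); last first.
  have X1 : 0 <= 40 * 5 ^+ rz_q.+2 * Econst ^+ rz_q.+3.
    by apply: mulr_ge0; [apply: mulr_ge0 => //; exact: exprn_ge0|exact: exprn_ge0 (ltW E0)].
  by rewrite /m mulnC exprM lerXn2r ?nnegrE ?exprn_ge0 // rz_C_pow.
have -> : 40 * G ^+ rz_q.+2 * Econst ^+ k = (40 * 5 ^+ rz_q.+2) * (Econst ^+ k) ^+ rz_q.+3.
  by rewrite [G ^+ _]exprMn [_ ^+ rz_q.+3]exprSr !mulrA.
rewrite [leRHS]exprMn [(Econst ^+ rz_q.+3) ^+ k]exprAC.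
apply: ler_wpM2r; first by apply: exprn_ge0; exact: exprn_ge0 (ltW E0).
have h5 : 1 <= 40 * 5 ^+ rz_q.+2 :> R.
  rewrite -[leLHS]mulr1; apply: ler_pM; rewrite ?ler1n //.
  by apply: exprn_ege1; rewrite ler1n.
by rewrite -{1}[40 * _]expr1 ler_weXn2l.
Qed.

End Remez.

End Tame.

(** * Box counting and relations in charts *)

Section BoxCounting.
Variable R : realType.

Lemma grid_cover d N : (0 < N)%N -> exists s : seq 'rV[R]_d,
  [/\ size s = ((2 * N) ^ d)%N, forall c, c \in s -> `|c| <= 1 &
    forall u, `|u| <= 1 -> exists2 c, c \in s & `|u - c| <= N%:R^-1].
Proof.
move=> N0; have N0' : 0 < N%:R :> R by rewrite ltr0n.
pose pt (k : {ffun 'I_d -> 'I_(2 * N)}) : 'rV[R]_d := \row_i ((k i)%:R / N%:R - 1).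
exists [seq pt k | k : {ffun 'I_d -> 'I_(2 * N)}]; split.
- by rewrite size_map -cardE card_ffun !card_ord.
- move=> _ /mapP[k _ ->]; apply: norm_le_coord => // i; rewrite mxE.
  have h0 : 0 <= (k i)%:R / N%:R :> R by rewrite divr_ge0.
  have h2 : (k i)%:R / N%:R <= 2 :> R by rewrite ler_pdivrMr // -natrM ler_nat; exact/ltnW/ltn_ord.
  by rewrite ler_norml; lra.
move=> u u1.
have ui i : -1 <= u 0 i <= 1 by rewrite -ler_norml (le_trans (coord_le_norm u i)).
have tlt i : (minn (Num.truncn ((u 0 i + 1) * N%:R)%R) (2 * N).-1 < 2 * N)%N.
  by rewrite gtn_min; apply/orP; right; rewrite ltn_predL muln_gt0.
exists (pt [ffun i => Ordinal (tlt i)]); first by apply: map_f; rewrite mem_enum.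
apply: norm_le_coord => [|i]; first by rewrite invr_ge0 ltW.
rewrite !mxE ffunE /=; have /andP[u0 u2] := ui i.
set y := (u 0 i + 1) * N%:R; have y0 : 0 <= y by apply: mulr_ge0 (ltW N0'); lra.
have y2 : y <= 2 * N%:R by apply: ler_wpM2r (ltW N0') _ _ _; lra.
have -> : u 0 i - ((minn (Num.truncn y) (2 * N).-1)%:R / N%:R - 1) =
   (y - (minn (Num.truncn y) (2 * N).-1)%:R) / N%:R.
  by rewrite /y; field; rewrite gt_eqF.
rewrite normrM [`|_^-1|]ger0_norm ?invr_ge0 ?(ltW N0') // ler_piMl ?invr_ge0 ?(ltW N0') //.
have /andP[t1 t2] := truncn_itv y0.
have [h|h] := leqP (Num.truncn y) (2 * N).-1.
  by rewrite ler_norml; rewrite -natr1 in t2; lra.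
have h2 : (2 * N <= Num.truncn y)%N by move: h N0; clear; lia.
have h3 : (2 * N)%:R <= y by apply: le_trans t1; rewrite ler_nat.
have h4 : y = (2 * N)%:R by apply/eqP; rewrite eq_le h3 andbT natrM.
have -> : y = (2 * N).-1%:R + 1 by rewrite natr1 prednK ?muln_gt0.
by rewrite addrC addKr normr1.
Qed.

Lemma chart_cover n d (V : set 'rV[R]_n) c (A' : 'M[R]_(n, d)) X (r rho L : R) N :
  is_chart V c A' X r rho L -> (0 < N)%N -> exists2 s : seq 'rV[R]_n, size s = ((2 * N) ^ d)%N &
    forall x, V x -> `|x - c| <= rho -> exists2 y, y \in s & `|x - y| <= L * r / N%:R.
Proof.
move=> [[r0 rho0 L0] _ XL Vch _] N0; have [s [sz s1 sP]] := grid_cover d N0.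
exists [seq X (r *: u) | u <- s]; first by rewrite size_map.
move=> x Vx xc; have [ur ->] := Vch x Vx xc; set u := (_ *m _) in ur *.
have [|w ws uw] := sP (r^-1 *: u).
  by rewrite normrZ gtr0_norm ?invr_gt0 // mulrC ler_pdivrMr // mul1r.
exists (X (r *: w)); first exact: map_f.
apply: le_trans (XL _ _ _ _) _ => //.
  by rewrite normrZ gtr0_norm // -[leRHS]mulr1 ler_pM2l // s1.
have -> : u - r *: w = r *: (r^-1 *: u - w) by rewrite scalerBr scalerA divff ?gt_eqF // scale1r.
by rewrite normrZ gtr0_norm // -mulrA ler_wpM2l // ler_pM2l.
Qed.

Lemma compact_balls n (V : set 'rV[R]_n) (rho : 'rV[R]_n -> R) : compact V ->
  (forall c, V c -> 0 < rho c) -> exists2 s : seq 'rV[R]_n, (forall c, c \in s -> V c) &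
    forall x, V x -> exists2 c, c \in s & `|x - c| < rho c.
Proof.
move=> cV rho0; move: (cV); rewrite compact_cover => /(_ 'rV[R]_n V (fun c => ball c (rho c))) [||D DV Dcov].
- by move=> c Vc; exact: ball_open.
- by move=> x Vx; exists x => //; apply: ballxx; exact: rho0.
exists (finmap.enum_fset D) => [c cD|x /Dcov[c cD]].
  by apply/set_mem/DV.
by rewrite -ball_normE /= distrC => ?; exists c.
Qed.

Definition box_dim n (V : set 'rV[R]_n) d := exists A : nat, exists2 C : R, 0 <= C &
  forall N, (0 < N)%N -> exists2 s : seq 'rV[R]_n, (size s <= A * N ^ d)%N &
    forall x, V x -> exists2 y, y \in s & `|x - y| <= C / N%:R.

Lemma submanifold_box_dim n d (V : set 'rV[R]_n) : compact V -> submanifold d V -> box_dim V d.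
Proof.
move=> cV mV.
have ch c : exists x : 'M[R]_(n, d) * ('rV[R]_d -> 'rV[R]_n) * (R * R * R),
    V c -> is_chart V c x.1.1 x.1.2 x.2.1.1 x.2.1.2 x.2.2.
  have [Vc|nV] := pselect (V c); last by exists (0, (fun=> 0), (0, 0, 0)).
  have [A' [X [r [rho [L ch]]]]] := submanifold_chart mV Vc.
  by exists (A', X, (r, rho, L)).
have {ch}[f fP] := choice ch.
have [|s sV sP] := @compact_balls n V (fun c => (f c).2.1.2) cV; first by move=> c /fP[[]].
exists (size s * 2 ^ d)%N, (\sum_(c <- s) `|(f c).2.2 * (f c).2.1.1|); first by apply: sumr_ge0.
move=> N N0.
have cov c : exists t : seq 'rV[R]_n, V c -> size t = ((2 * N) ^ d)%N /\
    forall x, V x -> `|x - c| <= (f c).2.1.2 -> exists2 y, y \in t &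
      `|x - y| <= (f c).2.2 * (f c).2.1.1 / N%:R.
  have [Vc|nV] := pselect (V c); last by exists nil.
  by have [t t1 t2] := chart_cover (fP c Vc) N0; exists t.
have [t tP] := choice cov.
exists (flatten [seq t c | c <- s]).
  rewrite size_flatten /shape -map_comp -mulnA -expnMn.
  elim: s sV {sP} => [|c s IH] sV //=; rewrite mulSn leq_add //.
    by have [-> _] := tP c (sV c (mem_head _ _)).
  by apply: IH => c' c's; apply: sV; rewrite inE c's orbT.
move=> x Vx; have [c cs xc] := sP x Vx.
have [_ /(_ x Vx (ltW xc))[y yt xy]] := tP c (sV c cs).
exists y; first by apply/flattenP; exists (t c) => //; exact: map_f.
apply: le_trans xy _; rewrite ler_wpM2r ?invr_ge0 //.
by rewrite (big_rem c) //=; apply: le_trans (ler_norm _) _; rewrite lerDl sumr_ge0.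
Qed.

(** If the image contained a ball of radius [e], the $M^{d+1}$ points of a grid in it, at distances
    at least $e/(2M)$, would require distinct members of a cover with at most $A(BM)^d$ members.
    This is impossible as soon as $M > AB^d$. *)
Lemma box_dim_thin n d (V : set 'rV[R]_n) (g : 'rV[R]_n -> 'rV[R]_d.+1) (G : R) :
  box_dim V d -> (forall x y, `|g x - g y| <= G * `|x - y|) ->
  forall (y : 'rV[R]_d.+1) (e : R), 0 < e -> exists2 y', `|y' - y| < e & ~ (g @` V) y'.
Proof.
move=> [A [C C0 cov]] gL y e e0; apply: contrapT => H.
have full y' : `|y' - y| < e -> exists2 x, V x & g x = y'.
  move=> ye; apply: contrapT => h; apply: H; exists y' => // -[x Vx xy]; apply: h; by exists x.
have G0 : 0 <= `|G| by [].
pose B := (Num.truncn (8 * `|G| * C / e)).+1.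
have BP : 8 * `|G| * C < B%:R * e by rewrite -ltr_pdivrMr // truncnS_gt.
pose M := (A * B ^ d).+1.
have M0 : 0 < M%:R :> R by rewrite ltr0n.
pose pt (k : {ffun 'I_d.+1 -> 'I_M}) : 'rV[R]_d.+1 := \row_i (e / 2 * ((k i)%:R / M%:R)).
have ptn k : `|y + pt k - y| < e.
  rewrite addrC addKr; apply: le_lt_trans (_ : e / 2 < _); last by lra.
  apply: norm_le_coord => [|i]; first by lra.
  rewrite mxE ger0_norm; last by rewrite mulr_ge0 ?divr_ge0 //; lra.
  rewrite ler_piMr ?divr_ge0 ?(ltW e0) // ler_pdivrMr // mul1r ler_nat; exact/ltnW/ltn_ord.
have /choice[x xP] : forall k, exists x, V x /\ g x = y + pt k.
  by move=> k; have [x Vx gx] := full _ (ptn k); exists x.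
have [s sz sP] := cov (B * M)%N ltac:(by rewrite muln_gt0).
have /choice[c cP] : forall k, exists c, c \in s /\ `|x k - c| <= C / (B * M)%:R.
  by move=> k; have [Vx _] := xP k; have [c cs xc] := sP _ Vx; exists c.
have cinj : injective c.
  move=> k k' E; apply/ffunP => i; apply/val_inj.
  have xx : `|x k - x k'| <= 2 * (C / (B * M)%:R).
    have -> : x k - x k' = (x k - c k) - (x k' - c k') by rewrite E opprB addrA subrK.
    apply: le_trans (ler_normB _ _) _.
    by have [_ h1] := cP k; have [_ h2] := cP k'; lra.
  have := gL (x k) (x k'); rewrite (xP k).2 (xP k').2 => h.
  have {h} h : `|(y + pt k) 0 i - (y + pt k') 0 i| <= `|G| * (2 * (C / (B * M)%:R)).
    apply: le_trans (coord_diff_le_norm _ _ _) _; apply: le_trans h _.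
    apply: le_trans (_ : `|G| * `|x k - x k'| <= _); first by rewrite ler_wpM2r // ler_norm.
    by rewrite ler_wpM2l.
  rewrite !mxE in h.
  have E2 : y 0 i + e / 2 * ((k i)%:R / M%:R) - (y 0 i + e / 2 * ((k' i)%:R / M%:R)) =
     e / (2 * M%:R) * ((k i)%:R - (k' i)%:R) by field; rewrite gt_eqF.
  rewrite E2 normrM gtr0_norm in h; last by rewrite divr_gt0 // mulr_gt0.
  apply/eqP; apply: contraTT h => kk; rewrite -ltNge.
  have k1 : 1 <= `|(k i)%:R - (k' i)%:R : R|.
    case: (ltngtP (k i) (k' i)) kk => // kk _; rewrite ler_normr.
      by have : (k i)%:R + 1 <= (k' i)%:R :> R; [rewrite natr1 ler_nat|lra].
    by have : (k' i)%:R + 1 <= (k i)%:R :> R; [rewrite natr1 ler_nat|lra].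
  apply: lt_le_trans (_ : e / (2 * M%:R) * 1 <= _); last by rewrite ler_pM2l // divr_gt0 // mulr_gt0.
  have B0 : 0 < B%:R :> R by rewrite ltr0n.
  rewrite natrM (_ : `|G| * _ = 4 * `|G| * C / B%:R / (2 * M%:R)); last by field; rewrite !gt_eqF.
  rewrite mulr1 ltr_pM2r ?invr_gt0 ?mulr_gt0 // ltr_pdivrMr //.
  have : 0 <= `|G| * C by rewrite mulr_ge0.
  by move: BP; lra.
have : (size [seq c k | k : {ffun 'I_d.+1 -> 'I_M}] <= size s)%N.
  apply: uniq_leq_size; first by rewrite map_inj_uniq ?enum_uniq.
  by move=> _ /mapP[k _ ->]; exact: (cP k).1.
rewrite size_map -cardE card_ffun !card_ord => /leq_trans/(_ sz).
by rewrite expnMn mulnA expnS leq_pmul2r ?expn_gt0 // /M ltnn.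
Qed.

End BoxCounting.

Section ChartRelations.
Variable R : realType.

Definition extend d (u : 'rV[R]_d) (T : R) : 'rV[R]_d.+1 := \row_i oapp (fun j => u 0 j) T (unlift ord0 i).

Lemma extend_line d (u : 'rV[R]_d) T : extend u T = extend u 0 + T *: axis R ord0.
Proof.
apply/rowP => i; rewrite axis_line !mxE; case: unliftP => [j ->|->] //=.
  by rewrite !unlift_none /= add0r.
Qed.

(** By [coef_interp] the coefficients in the distinguished variable are linear combinations of the
    functions obtained by fixing this variable to integers, hence polynomial functions. *)
Lemma polynomial_family d E (G : 'rV[R]_d.+1 -> R) : polyf E G -> (exists y, G y != 0) ->
  exists P : nat -> 'rV[R]_d -> R, [/\ forall e, polyf E (P e),
    forall u T, G (extend u T) = \sum_(e < E.+1) P e u * T ^+ e & exists e u, (e <= E)%N /\ P e u != 0].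
Proof.
move=> pG [y Gy]; have [w wP] := coef_interp R E.
pose P e u := \sum_k w e k * G (extend u k%:R).
have PE u : exists2 q : {poly R}, (size q <= E.+1)%N & (forall T, G (extend u T) = q.[T]) /\ forall e, P e u = q`_e.
  have [q sq qE] := polyf_line pG (extend u 0) (axis R ord0); exists q => //; split=> [T|e].
    by rewrite extend_line qE.
  by rewrite wP //; apply: eq_bigr => k _; rewrite extend_line qE.
exists P; split.
- move=> e; apply: polyf_sum => k _; apply: polyfZ.
  have := @polyf_comp R d.+1 d E 1 G (fun u => extend u k%:R); rewrite muln1; apply => // i.
  have [j ->|->] := unliftP ord0 i.
    apply: polyf_ext (polyf_coord _ j) => u; by rewrite mxE liftK.
  apply: polyf_ext (polyf_cst_le _ _ k%:R) => u; by rewrite mxE unlift_none.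
- move=> u T; have [q sq [-> qP]] := PE u; rewrite (horner_coef_wide _ sq).
  by apply: eq_bigr => e _; rewrite qP.
pose u : 'rV[R]_d := \row_j y 0 (lift ord0 j).
have [q sq [qE qP]] := PE u.
have yE : y = extend u (y 0 ord0).
  by apply/rowP => i; rewrite mxE; case: unliftP => [j ->|->] //=; rewrite mxE.
have q0 : q != 0 by apply: contraNneq Gy => q0; rewrite yE qE q0 horner0.
exists (size q).-1, u; rewrite qP -lead_coefE lead_coef_eq0 q0; split=> //.
by move: sq; clear; lia.
Qed.

Lemma chart_relation n d (V : set 'rV[R]_n) c (A' : 'M[R]_(n, d)) X (r rho L : R) (l : 'I_n) :
  compact V -> algebraic_set V -> submanifold d V -> is_chart V c A' X r rho L ->
  exists E (P : nat -> 'rV[R]_d -> R), [/\ forall e, polyf E (P e),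
    forall u, `|u| <= r -> \sum_(e < E.+1) P e u * X u 0 l ^+ e = 0 &
    exists e u, (e <= E)%N /\ P e u != 0].
Proof.
move=> cV aV mV [_ Xu _ _ _].
pose g (x : 'rV[R]_n) := extend ((x - c) *m A') (x 0 l).
have pg i : polyf 1 (fun x => g x 0 i).
  have [j ->|->] := unliftP ord0 i; last first.
    by apply: polyf_ext (polyf_coord _ l) => x; rewrite mxE unlift_none.
  apply: polyf_ext (polyfB (polyf_mulmx A' j) (polyf_cst_le _ _ ((c *m A') 0 j))) => x.
  by rewrite /g /extend [RHS]mxE liftK /= mulmxBl [RHS]mxE [X in _ = _ + X]mxE.
have [k k1 kP] := mulmx_norm_bound A'.
have gL x y : `|g x - g y| <= k * `|x - y|.
  have k0 : 0 <= k by lra.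
  apply: norm_le_coord => [|i]; first by rewrite mulr_ge0.
  rewrite !mxE; case: unliftP => [j _|_] /=; last first.
    by apply: le_trans (coord_diff_le_norm _ _ _) _; rewrite ler_peMl.
  apply: le_trans (coord_diff_le_norm _ _ _) _; rewrite -mulmxBl.
  by rewrite [X in X *m _](_ : _ = x - y) // opprB addrA subrK.
have thin := box_dim_thin (submanifold_box_dim cV mV) gL.
have [|E [G [pG Gy GV]]] := algebraic_thin_image aV pg; first by move=> y e _; exact: thin.
have [P [pP PE nz]] := polynomial_family pG Gy; exists E, P; split=> // u /Xu[VX Xu'].
by rewrite -PE -[u in extend u _]Xu'; exact: GV.
Qed.

Lemma chart_relations n d (V : set 'rV[R]_n) c (A' : 'M[R]_(n, d)) X (r rho L : R) :
  compact V -> algebraic_set V -> submanifold d V -> is_chart V c A' X r rho L ->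
  exists E (P : 'I_n -> nat -> 'rV[R]_d -> R), [/\ forall l e, polyf E (P l e),
    forall l u, `|u| <= r -> \sum_(e < E.+1) P l e u * X u 0 l ^+ e = 0 &
    forall l, exists e u, (e <= E)%N /\ P l e u != 0].
Proof.
move=> cV aV mV ch.
have /choice[f fP] : forall l : 'I_n, exists f : nat * (nat -> 'rV[R]_d -> R), [/\ forall e, polyf f.1 (f.2 e),
    forall u, `|u| <= r -> \sum_(e < f.1.+1) f.2 e u * X u 0 l ^+ e = 0 &
    exists e u, (e <= f.1)%N /\ f.2 e u != 0].
  by move=> l; have [E [P h]] := chart_relation l cV aV mV ch; exists (E, P).
pose E := (\max_l (f l).1)%N.
have lE l : ((f l).1 <= E)%N by exact: leq_bigmax.
exists E, (fun l e u => if (e <= (f l).1)%N then (f l).2 e u else 0); split.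
- move=> l e; case: (e <= (f l).1)%N; last exact: polyf_cst_le.
  by apply: polyf_le (lE l) _; have [h _ _] := fP l.
- move=> l u ur; have [_ h _] := fP l; rewrite -[RHS](h u ur).
  rewrite (big_ord_widen E.+1 (fun e => (f l).2 e u * X u 0 l ^+ e)) ?ltnS // [RHS]big_mkcond /=.
  by apply: eq_bigr => e _; rewrite ltnS; case: ifP => // _; rewrite mul0r.
move=> l; have [_ _ [e [u [el nz]]]] := fP l; exists e, u; rewrite el; split => //.
exact: leq_trans el (lE l).
Qed.

Lemma approximates_prod (I : Type) (r : seq I) (T : I -> nat -> {poly R}) s (f : I -> R -> R) :
  0 <= s -> (forall i, approximates (T i) s (f i)) ->
  approximates (fun L => \prod_(i <- r) T i L) s (fun t => \prod_(i <- r) f i t).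
Proof.
move=> s0 H; elim: r => [|i r IH].
  have := @approximates_cst R s 1; congr approximates; apply/funext => t; by rewrite big_nil ?polyC1.
have := approximatesM s0 (H i) IH; congr approximates; apply/funext => t; by rewrite big_cons.
Qed.

(** At a point of [nd] each coordinate has a relation with a nonzero coefficient, so that no
    relation vanishes identically on a line through it. The parameter [tau] lets the segment be
    centred away from this point. *)
Lemma chart_tame n d (V : set 'rV[R]_n) c (A' : 'M[R]_(n, d)) X (r rho L : R) :
  compact V -> algebraic_set V -> submanifold d V -> is_chart V c A' X r rho L ->
  exists J Cdeg (r1 : R) (nd : set 'rV[R]_d), [/\ (0 < Cdeg)%N, 0 < r1, 5 * r1 <= r,
    forall u e, 0 < e -> exists2 w, `|w - u| < e & nd w &
    forall k p w v tau, (0 < k)%N -> in_Pkn k p -> nd w -> `|v| <= 1 -> `|w + tau *: v| <= r1 ->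
      tame J Cdeg k (4 * r1) (fun t => peval p (X (w + (tau + t) *: v)))].
Proof.
move=> cV aV mV ch; have [[r0 _ _] _ _ _ tayX] := ch.
have [E [P [pP rel nz]]] := chart_relations cV aV mV ch.
have /choice[ra raP] : forall l : 'I_n, exists ra, 0 < ra < r /\ forall r' u v, 0 < r' <= ra ->
    `|u| <= r' -> `|v| <= 1 -> analytic_on (4 * r') (fun t => X (u + t *: v) 0 l).
  move=> l; have [||ra h1 h2] := @algebraic_taylorable_analytic R d (fun u => X u 0 l) r E E (P l) r0 _ (pP l) _ (nz l).
  - by move=> u ur; exact: tayX.
  - by move=> u /ltW; exact: rel.
  by exists ra.
have [r1 r10 [r1r r1a]] : exists2 r1, 0 < r1 & 5 * r1 <= r /\ forall l, r1 <= ra l.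
  have [r1 r1P] : exists r1, 0 < r1 /\ forall l, l \in enum 'I_n -> r1 <= ra l.
    elim: (enum 'I_n) => [|l s [r1 [r10 IH]]]; first by exists 1.
    have [/andP[ra0 _] _] := raP l; exists (Num.min r1 (ra l)); rewrite lt_min r10 ra0; split=> // l'.
    rewrite inE => /orP[/eqP->|/IH]; first by rewrite ge_min lexx orbT.
    by rewrite ge_min => ->.
  case: r1P => r10 r1a; exists (Num.min r1 (r / 5)).
    by rewrite lt_min r10 divr_gt0.
  split; first by rewrite mulrC -ler_pdivlMr // ge_min lexx orbT.
  by move=> l; rewrite ge_min r1a ?mem_enum.
pose nd (w : 'rV[R]_d) := forall l, exists e, (e <= E)%N /\ P l e w != 0.
exists (reldeg n E), (relsize n E E), r1, nd; split => //.
- move=> u e e0.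
  have /choice[el elP] := nz.
  have pprod : polyf (size (enum 'I_n) * E) (fun w => \prod_(l <- enum 'I_n) P l (el l) w).
    by apply: polyf_prod => l; exact: pP.
  have [x xP] : exists x, forall l, l \in enum 'I_n -> P l (el l) x != 0.
    apply: (@polyf_prod_neq0 R d E) => l _; split; first exact: pP.
    by have [x [_ h]] := elP l; exists x.
  have [|w wu wP] := @polyf_dense R d _ _ x pprod _ u e e0; last first.
    exists w => // l; have [? [h _]] := elP l; exists (el l); split=> //.
    apply: contraNneq wP => h0; rewrite (bigD1_seq l) ?mem_enum ?enum_uniq //= h0 mul0r //.
  by rewrite prodf_seq_neq0; apply/allP => l ls /=; exact: xP.
move=> k p w v tau k0 pk ndw v1 wr.
have s0 : 0 <= 4 * r1 by rewrite mulr_ge0 // ltW.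
have lineE t : w + (tau + t) *: v = (w + tau *: v) + t *: v by rewrite scalerDl addrA.
have [cs csk csE] := peval_words pk.
pose x (l : 'I_n) t := X (w + (tau + t) *: v) 0 l.
have FE t : peval p (X (w + (tau + t) *: v)) = \sum_(c <- cs) c.1 * \prod_(i <- c.2) x i t by rewrite csE.
have inr t : `|t| <= 4 * r1 -> `|w + (tau + t) *: v| <= r.
  move=> tr; apply: le_trans r1r; rewrite lineE; apply: le_trans (ler_normD _ _) _.
  have -> : 5 * r1 = r1 + 4 * r1 by ring.
  by apply: lerD => //; rewrite normrZ -[leRHS]mulr1; apply: ler_pM.
have /choice[T TP] : forall l, exists T, approximates T (4 * r1) (x l).
  move=> l; have [_ h] := raP l.
  have [T TP] := h r1 (w + tau *: v) v (introT andP (conj r10 (r1a l))) wr v1.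
  exists T; apply: approximates_ext TP => t _; by rewrite /x lineE.
exists (fun L => \sum_(c <- cs) c.1%:P * \prod_(i <- c.2) T i L).
  have := @approximates_sum R _ cs (fun c L => c.1%:P * \prod_(i <- c.2) T i L) (4 * r1)
    (fun c t => c.1 * \prod_(i <- c.2) x i t) s0.
  move=> /(_ (fun c => approximatesM s0 (approximates_cst _ _) (approximates_prod c.2 s0 TP))).
  by apply: approximates_ext => t _; rewrite FE.
have /choice[q qP] : forall le : 'I_n * nat, exists q : {poly R}, (size q <= E.+1)%N /\
    forall t, P le.1 le.2 (w + (tau + t) *: v) = q.[t].
  move=> [l e]; have [q sq qE] := polyf_line (pP l e) (w + tau *: v) v.
  by exists q; split=> // t; rewrite lineE qE.
have qnz l : exists e, (e <= E)%N && (q (l, e) != 0).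
  have [e [eE nz']] := ndw l; exists e; rewrite eE /=.
  apply: contraNneq nz' => q0; have := (qP (l, e)).2 (- tau).
  by rewrite subrr scale0r addr0 q0 horner0 /= => ->.
have /choice[top topP] : forall l, exists top, [/\ (top <= E)%N, q (l, top) != 0 &
    forall e, (top < e)%N -> (e <= E)%N -> q (l, e) = 0].
  move=> l; have [|top /andP[t1 t2] tmax] := @ex_maxnP (fun e => (e <= E)%N && (q (l, e) != 0)) E (qnz l).
    by move=> e /andP[].
  exists top; split=> // e te eE; apply/eqP; apply: contraLR te => qe; rewrite -leqNgt.
  by apply: tmax; rewrite eE.
(* Along the line the relation of a coordinate may have a lower degree [top l]. Multiplying it by a
   power of the coordinate moves its leading coefficient to the index [E.+1], common to all
   coordinates. *)
pose a l e := if (E.+1 - top l <= e)%N then q (l, (e - (E.+1 - top l))%N) else 0.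
have [|||b [sb bnz brel]] := @polynomial_relation R n E E x (fun t => `|t| <= 4 * r1) a k cs k0 _ _ _ csk; last first.
  exists b; split=> // t tr; rewrite -[RHS](brel t tr); apply: eq_bigr => j _; by rewrite FE.
- move=> l t tr; have [t1 _ t3] := topP l.
have tE : (top l <= E.+1)%N by exact: leqW.
pose sh := (E.+1 - top l)%N.
have -> : \sum_(e < E.+2) (a l e).[t] * x l t ^+ e =
    x l t ^+ sh * \sum_(e < (top l).+1) (q (l, nat_of_ord e)).[t] * x l t ^+ e.
  rewrite -(big_mkord xpredT (fun e => (a l e).[t] * x l t ^+ e)).
  rewrite (@big_cat_nat _ _ _ sh) //=; last by rewrite leqW // leq_subr.
  rewrite [X in X + _]big_nat big1 ?add0r => [|e /andP[_ es]]; last first.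
    by rewrite /a leqNgt -/sh es /= horner0 mul0r.
  rewrite -{1}[sh]add0n big_addn.
  have -> : (E.+2 - sh = (top l).+1)%N by rewrite /sh; move: tE; clear; lia.
  rewrite big_mkord big_distrr /=; apply: eq_bigr => e _.
  rewrite /a -/sh leq_addl addnK exprD; ring.
have := rel l _ (inr t tr).
rewrite -(big_mkord xpredT (fun e => P l e (w + (tau + t) *: v) * X (w + (tau + t) *: v) 0 l ^+ e)).
rewrite (@big_cat_nat _ _ _ (top l).+1) //= big_mkord [X in _ + X]big_nat [X in _ + X]big1 => [|e /andP[te eE]]; last first.
  by have -> := (qP (l, e)).2 t; rewrite t3 // horner0 mul0r.
rewrite addr0 => h; rewrite (_ : \sum_(e < (top l).+1) _ = 0) ?mulr0 // -[RHS]h.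
by apply: eq_bigr => e _; rewrite -(qP (l, nat_of_ord e)).2.
- by move=> l; have [t1 t2 _] := topP l; rewrite /a leq_subr subKn // leqW.
- by move=> l e _; rewrite /a; case: (_ <= e)%N; rewrite ?size_poly0 //; exact: (qP (_, _)).1.
Qed.

End ChartRelations.

(** * Estimates in charts *)

Section LineLimits.
Variables (R : realType) (d J Cdeg k : nat) (F : 'rV[R]_d -> R) (r r1 : R) (nd : set 'rV[R]_d).
Hypotheses (Cdeg0 : (0 < Cdeg)%N) (k0 : (0 < k)%N) (r10 : 0 < r1) (r1r : 5 * r1 <= r).
Hypothesis Fuc : forall e : R, 0 < e -> exists2 dl : R, 0 < dl &
  forall u v : 'rV[R]_d, `|u| <= r -> `|v| <= r -> `|u - v| <= dl -> `|F u - F v| <= e.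
Hypothesis nd_dense : forall (u : 'rV[R]_d) (e : R), 0 < e -> exists2 w, `|w - u| < e & nd w.
Hypothesis nd_tame : forall (w v : 'rV[R]_d) (tau : R), nd w -> `|v| <= 1 -> `|w + tau *: v| <= r1 ->
  tame J Cdeg k (4 * r1) (fun t => F (w + (tau + t) *: v)).

(* The estimates for lines along which all the relations degenerate are obtained as limits of those
   for nearby lines. *)
Lemma nondegenerate_approx (u v : 'rV[R]_d) (e b : R) : 0 < e -> `|u| + b < r1 -> 0 <= b -> `|v| <= 1 -> exists2 w, nd w &
  (forall tau : R, `|tau| <= b -> `|w + tau *: v| <= r1) /\
  forall t : R, `|t| <= 4 * r1 -> `|u + t *: v| <= r -> `|F (w + t *: v) - F (u + t *: v)| <= e.
Proof.
move=> e0 ub b0 v1; have [dl dl0 dlP] := Fuc e0.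
have m0 : 0 < Num.min dl (r1 - (`|u| + b)) by rewrite lt_min dl0 subr_gt0.
have [w wu ndw] := nd_dense u m0; exists w => //.
move: wu; rewrite lt_min => /andP[wu1 wu2].
have wn : `|w| <= r1 - b.
  have -> : w = u + (w - u) by rewrite addrC subrK.
  by apply: le_trans (ler_normD _ _) _; lra.
have tv (t s : R) : `|t| <= s -> `|t *: v| <= s.
  by move=> ts; rewrite normrZ -[leRHS]mulr1; apply: ler_pM.
split=> [tau taub|t tr ur].
  by apply: le_trans (ler_normD _ _) _; move: (tv _ _ taub) r10; lra.
apply: dlP => //; last by rewrite opprD addrACA subrr addr0 ltW.
by apply: le_trans (ler_normD _ _) _; move: (tv _ _ tr) r1r; lra.
Qed.

Lemma line_double (u v : 'rV[R]_d) (h M : R) : `|u| < r1 -> `|v| <= 1 -> 0 < h -> 2 * h <= 4 * r1 -> 0 <= M ->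
  (forall t : R, - (2 * h) <= t <= - h -> `|F (u + t *: v)| <= M) ->
  forall t : R, `|t| <= h -> `|F (u + t *: v)| <= 5 * Econst R J Cdeg ^+ k * M.
Proof.
move=> ur v1 h0 hr M0 FM t th; set D := 5 * _.
have D0 : 0 <= D by rewrite mulr_ge0 // exprn_ge0 // (le_trans ler01) // Econst_ge1.
apply/ler_addgt0Pr => e e0; pose e' := e / (D + 1).
have e'0 : 0 < e' by rewrite divr_gt0 // ltr_wpDl.
have uv (s : R) : `|s| <= 4 * r1 -> `|u + s *: v| <= r.
  move=> sr; apply: le_trans (ler_normD _ _) _; have : `|s *: v| <= 4 * r1.
    by rewrite normrZ -[leRHS]mulr1; apply: ler_pM.
  by move: ur r1r; lra.
have [|w ndw [wr wP]] := @nondegenerate_approx u v e' 0 e'0 _ (lexx 0) v1; first by rewrite addr0.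
have w0 : `|w + 0 *: v| <= r1 by apply: wr; rewrite normr0.
have tm := nd_tame ndw v1 w0.
have Me : 0 <= M + e' by lra.
have := tame_double Cdeg0 k0 tm h0 hr Me _ th; rewrite add0r => /(_ _)/wrap[s /andP[s1 s2]|].
  rewrite add0r; have sr : `|s| <= 4 * r1 by rewrite ler_norml; lra.
  have := wP s sr (uv s sr); have := FM s; rewrite s1 s2 => /(_ isT) h1 h2.
  have -> : F (w + s *: v) = F (u + s *: v) + (F (w + s *: v) - F (u + s *: v)) by ring.
  by apply: le_trans (ler_normD _ _) _; exact: lerD.
move=> h1; have tr : `|t| <= 4 * r1 by lra.
have h2 := wP t tr (uv t tr).
have -> : F (u + t *: v) = F (w + t *: v) - (F (w + t *: v) - F (u + t *: v)) by ring.
apply: le_trans (ler_normB _ _) _; apply: le_trans (lerD h1 h2) _.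
rewrite -/D mulrDr -addrA lerD2l.
have -> : e = (D + 1) * e' by rewrite /e' mulrC divfK // gt_eqF // ltr_wpDl.
by rewrite mulrDl mul1r.
Qed.

Lemma line_remez (dd : nat) (u v : 'rV[R]_d) (h eps : R) N (S : {set 'I_N}) : (0 < dd)%N ->
  0 < h -> `|u| + 12 * h < r1 -> `|v| <= 1 ->
  (rz_Q dd * (rz_Q dd + 4 * dd * (k * rz_C R J Cdeg dd)) <= N)%N -> (N < 2 * dd * #|S|)%N ->
  (forall i, i \in S -> `|F (u + (h * (i%:R / N%:R)) *: v)| <= eps) ->
  forall t : R, 0 <= t <= h -> `|F (u + t *: v)| <= Kremez R J Cdeg dd ^+ k * eps.
Proof.
move=> dd0 h0 ur v1 Nb cS Feps t th; set D := _ ^+ k.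
have D0 : 0 <= D by rewrite exprn_ge0 // (le_trans _ (Kremez_ge2 _ _ _ _)).
apply/ler_addgt0Pr => e e0; pose e' := e / (D + 1).
have e'0 : 0 < e' by rewrite divr_gt0 // ltr_wpDl.
have un0 : 0 <= `|u| by [].
have uv (s : R) : 0 <= s <= h -> `|s| <= 4 * r1 /\ `|u + s *: v| <= r.
  move=> /andP[s0 sh]; have sr : `|s| <= 4 * r1 by rewrite ger0_norm; lra.
  split=> //; apply: le_trans (ler_normD _ _) _; have : `|s *: v| <= 4 * r1.
    by rewrite normrZ -[leRHS]mulr1; apply: ler_pM.
  by move: h0 ur r1r; lra.
have b0 : 0 <= 12 * h by lra.
have [w ndw [wr wP]] := nondegenerate_approx e'0 ur b0 v1.
have tm (tau : R) : `|tau| <= 12 * h -> tame J Cdeg k (4 * h) (fun t => F (w + (tau + t) *: v)).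
  move=> /wr /(nd_tame ndw v1)[T TF [b [b1 b2 b3]]]; exists T.
    by apply: approximates_le TF; lra.
  by exists b; split=> // s sh; apply: b3; lra.
have := @tame_remez R J Cdeg Cdeg0 dd dd0 k (fun t => F (w + t *: v)) h (eps + e') N S k0 h0 tm Nb cS.
move=> /(_ _ t th)/wrap[i iS|h1].
  set s := h * _; have /uv[s1 s2] : 0 <= s <= h.
    have N0 : 0 < N%:R :> R by rewrite ltr0n; exact: leq_ltn_trans (ltn_ord i).
    rewrite mulr_ge0 ?(ltW h0) ?divr_ge0 //= ler_piMr ?(ltW h0) // ler_pdivrMr // mul1r ler_nat.
    exact/ltnW/ltn_ord.
  have := wP s s1 s2; have := Feps i iS => h1 h2.
  have -> : F (w + s *: v) = F (u + s *: v) + (F (w + s *: v) - F (u + s *: v)) by ring.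
  by apply: le_trans (ler_normD _ _) _; exact: lerD.
have [t1 t2] := uv t th; have h2 := wP t t1 t2.
have -> : F (u + t *: v) = F (w + t *: v) - (F (w + t *: v) - F (u + t *: v)) by ring.
apply: le_trans (ler_normB _ _) _; apply: le_trans (lerD h1 h2) _.
rewrite -/D mulrDr -addrA lerD2l.
have -> : e = (D + 1) * e' by rewrite /e' mulrC divfK // gt_eqF // ltr_wpDl.
by rewrite mulrDl mul1r.
Qed.

Definition om (h1 : R) : set 'rV[R]_d := [set u : 'rV[R]_d | `|u| <= h1].
(** The first summand pays for the [d] doublings of [cube_double], the second for the Remez
    inequality; the 1 makes the latter strict. *)
Definition Kchart : R := (5 * Econst R J Cdeg) ^+ d + Kremez R J Cdeg d + 1.

Lemma Kchart_ge2 : 2 <= Kchart.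
Proof.
have h1 := Kremez_ge2 R J Cdeg d; have h2 := Econst_ge1 R J Cdeg.
have : 0 <= (5 * Econst R J Cdeg) ^+ d by rewrite exprn_ge0 // mulr_ge0 // (le_trans ler01).
by rewrite /Kchart; lra.
Qed.

Lemma axis_norm (i : 'I_d) (s : R) : `|s| = 1 -> `|s *: axis R i| <= 1.
Proof.
move=> s1; apply: norm_le_coord => // j; have := axis_line (0 : 'rV[R]_d) i s j.
by rewrite add0r => ->; rewrite !mxE add0r; case: ifP; rewrite ?mxE ?add0r ?normr0 ?s1 ?ler01.
Qed.

Variable h1 : R.
Hypotheses (h10 : 0 < h1) (h1r : 26 * h1 <= r1).

Let Fuc' : forall e : R, 0 < e -> exists2 dl : R, 0 < dl & forall u v : 'rV[R]_d, om h1 u -> om h1 v ->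
  (forall i, `|u 0 i - v 0 i| <= dl) -> `|F u - F v| <= e.
Proof.
move=> e /Fuc[dl dl0 H]; exists dl => // u v ou ov uv; apply: H; [| |].
- by rewrite /om /= in ou; move: h1r r1r r10; lra.
- by rewrite /om /= in ov; move: h1r r1r r10; lra.
- by apply: norm_le_coord => [|i]; [rewrite ltW|rewrite !mxE].
Qed.

(** A child and its parent differ by one halving in each coordinate; these are undone one at a time
    by [line_double] along the axes. *)
Lemma cube_double (a : 'rV[R]_d) (h : R) e : 0 < h -> cube a h `<=` om h1 ->
  boxsup F a (a + const_mx h) <= Kchart ^+ k * boxsup F (corner a h e) (corner a h e + const_mx (h / 2)).
Proof.
move=> h0 sub; have E1 := Econst_ge1 R J Cdeg; have E0 : 0 < Econst R J Cdeg by lra.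
have h20 : 0 <= h / 2 by lra.
have csub : cube (corner a h e) (h / 2) `<=` om h1 by apply: subset_trans sub; apply: corner_sub; rewrite ltW.
have [[c0 c0P _] cP] := cubesup_max Fuc' h20 csub; set S := boxsup F (corner a h e) _ in cP *.
have S0 : 0 <= S by apply: le_trans (cP _ c0P).
set D := 5 * Econst R J Cdeg ^+ k.
have D1 : 1 <= D by have := exprn_ege1 k E1; rewrite /D; lra.
have D0 : 0 <= D by lra.
suff H m x : (m <= d)%N -> cube a h x ->
    (forall j : 'I_d, (m <= j)%N -> corner a h e 0 j <= x 0 j <= corner a h e 0 j + h / 2) -> `|F x| <= D ^+ m * S.
  have [[x xc <-] _] := cubesup_max Fuc' (ltW h0) sub.
  apply: le_trans (H d x (leqnn d) xc _) _; first by move=> j; rewrite leqNgt ltn_ord.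
  apply: ler_wpM2r => //.
  apply: le_trans (_ : ((5 * Econst R J Cdeg) ^+ d) ^+ k <= _); last first.
    rewrite lerXn2r ?nnegrE ?exprn_ge0 ?mulr_ge0 ?(ltW E0) //.
      by have := Kchart_ge2; lra.
    by have := Kremez_ge2 R J Cdeg d; rewrite /Kchart; lra.
  rewrite exprAC lerXn2r ?nnegrE ?exprn_ge0 ?mulr_ge0 ?exprn_ge0 ?(ltW E0) //.
  rewrite [leRHS]exprMn ler_wpM2r ?exprn_ge0 ?(ltW E0) // -[leLHS]expr1 ler_weXn2l //; lra.
elim: m x => [|m IH] x md xc xh.
  by rewrite expr0 mul1r; apply: cP; apply/cubeP => j; exact: xh.
pose i : 'I_d := Ordinal md.
have xi : a 0 i <= x 0 i <= a 0 i + h by move/cubeP: xc.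
have cE : corner a h e 0 i = a 0 i + h / 2 * (e i)%:R by rewrite !mxE.
(* [b] is the endpoint of the [i]-th side away from the half selected by [e], [sg] the direction
   from that half towards [b]. *)
pose sg : R := if e i then -1 else 1; pose b : R := if e i then a 0 i else a 0 i + h.
pose u := x + (b - x 0 i) *: axis R i.
have ucoord (t : R) j : (u + t *: (sg *: axis R i)) 0 j = if j == i then b + t * sg else x 0 j.
  by rewrite scalerA axis_line /u !axis_line eqxx; case: eqP => // _; rewrite [x 0 i + _]addrC subrK.
have half (t : R) : - h <= t <= - (h / 2) -> cube a h (u + t *: (sg *: axis R i)) /\
    corner a h e 0 i <= b + t * sg <= corner a h e 0 i + h / 2.
  move=> /andP[t1 t2].
  have hb : corner a h e 0 i <= b + t * sg <= corner a h e 0 i + h / 2.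
    by rewrite cE /b /sg; case: (e i) => /=; rewrite ?mulr1 ?mulr0; lra.
  split=> //; apply/cubeP => j; rewrite ucoord; case: eqP => [->|_]; last by move/cubeP: xc.
  by move: hb; rewrite cE /b /sg; case: (e i) => /=; rewrite ?mulr1 ?mulr0; lra.
have uo : `|u| <= h1.
  apply: sub; apply/cubeP => j; have := ucoord 0 j; rewrite scale0r addr0 mul0r addr0 => ->.
  by case: eqP => [->|_]; [rewrite /b; case: (e i); lra|move/cubeP: xc].
have hh1 : h <= 2 * h1.
  have o1 : om h1 a by apply: sub; apply/cubeP => j; lra.
  have o2 : om h1 (a + const_mx h) by apply: sub; apply/cubeP => j; rewrite !mxE; lra.
  have := le_trans (coord_le_norm _ i) o2; have := le_trans (coord_le_norm _ i) o1.
  by rewrite !mxE !ler_norml; lra.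
have DS0 : 0 <= D ^+ m * S by rewrite mulr_ge0 // exprn_ge0.
have sg1 : `|sg *: axis R i| <= 1 by apply: axis_norm; rewrite /sg; case: (e i); rewrite ?normrN ?normr1.
have h2h : 0 < h / 2 by lra.
have := @line_double u (sg *: axis R i) (h / 2) (D ^+ m * S) _ sg1 h2h _ DS0.
move=> /(_ _ _ _)/wrap[||t /andP[t1 t2]|]; [move: h1r h10; lra|move: h1r h10; lra| |].
  have [|hc1 hc2] := half t; first by lra.
  apply: IH => //; first exact: ltnW.
  move=> j mj; rewrite ucoord; case: eqP => [->//|/eqP ji]; apply: xh.
  by rewrite ltn_neqAle mj andbT eq_sym.
move=> H; rewrite exprS -mulrA.
have [hx1|hx1] := boolP (corner a h e 0 i <= x 0 i <= corner a h e 0 i + h / 2).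
  apply: le_trans (_ : D ^+ m * S <= _); last by rewrite ler_peMl.
  apply: IH => // [|j mj]; first exact: ltnW.
  by have [->//|ji] := eqVneq j i; apply: xh; rewrite ltn_neqAle mj andbT eq_sym.
have -> : x = u + (sg * (x 0 i - b)) *: (sg *: axis R i).
  apply/rowP => j; rewrite ucoord; case: eqP => [->|//].
  by rewrite mulrAC /sg; case: (e i); ring.
apply: H; move: hx1; rewrite cE /sg /b; case: (e i) => /=; rewrite ?mulr1 ?mulr0 ?addr0 ler_norml.
  by move=> hx1; have {hx1} : x 0 i < a 0 i + h / 2; [rewrite ltNge; apply: contra hx1 => ?; lra|lra].
by move=> hx1; have {hx1} : a 0 i + h / 2 < x 0 i; [rewrite ltNge; apply: contra hx1 => ?; lra|lra].
Qed.

Lemma segment_remez (u : 'rV[R]_d) (i : 'I_d) (h M : R) : 0 < h -> 0 < M ->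
  (forall t : R, 0 <= t <= h -> om h1 (u + t *: axis R i)) ->
  (exists2 t : R, 0 <= t <= h & M <= `|F (u + t *: axis R i)|) ->
  forall N, (rz_Q d * (rz_Q d + 4 * d * (k * rz_C R J Cdeg d)) <= N)%N ->
  (2 * d * #|[set l : 'I_N | (`|F (u + (h * (l%:R / N%:R)) *: axis R i)| < (Kchart ^+ k)^-1 * M)%R]%SET| <= N)%N.
Proof.
move=> h0 M0 uo [t th Mt] N Nb; rewrite leqNgt; apply/negP => cS.
have d0 : (0 < d)%N by apply: leq_ltn_trans (ltn_ord i).
have K2 := Kchart_ge2; have Kk0 : 0 < Kchart ^+ k by rewrite exprn_gt0 //; lra.
have o1 : om h1 u by have := uo 0; rewrite scale0r addr0; apply; rewrite lexx ltW.
have o2 : om h1 (u + h *: axis R i) by apply: uo; rewrite lexx ltW.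
have hh1 : h <= 2 * h1.
  have := le_trans (coord_le_norm _ i) o2; have := le_trans (coord_le_norm _ i) o1.
  by rewrite axis_line eqxx !ler_norml; lra.
(* A segment inside the cube has length at most [2 * h1], so $|u| + 12h \le 25\,h_1 < r_1$. This is
   where the 26 comes from. *)
have ur : `|u| + 12 * h < r1 by rewrite /om /= in o1; move: h1r h10; lra.
have ax1 : `|axis R i| <= 1 by rewrite -[axis R i]scale1r; apply: axis_norm; rewrite normr1.
have := line_remez d0 h0 ur ax1 Nb cS (eps := (Kchart ^+ k)^-1 * M).
move=> /(_ _ t th)/wrap[l|]; first by rewrite inE => /ltW.
apply/negP; rewrite -ltNge; apply: lt_le_trans Mt.
rewrite mulrA -[ltRHS]mul1r ltr_pM2r // ltr_pdivrMr // mul1r.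
have := Kremez_ge2 R J Cdeg d => Kr2.
have h5 : 0 <= (5 * Econst R J Cdeg) ^+ d by rewrite exprn_ge0 // mulr_ge0 // (le_trans ler01) // Econst_ge1.
by rewrite ltrXn2r; [rewrite -lt0n|move: Kr2; lra|rewrite /Kchart; lra].
Qed.

End LineLimits.

(** * Hausdorff measure *)

Section Hausdorff.
Variables (R : realType) (n : nat).
Implicit Types (x y : 'rV[R]_n) (S T A : set 'rV[R]_n).

Lemma norm_le_eucl x : `|x| <= eucl x.
Proof.
apply: norm_le_coord => [|i]; first exact: sqrtr_ge0.
by rewrite /eucl -sqrtr_sqr ler_wsqrtr // (bigD1 i) //= lerDl sumr_ge0 // => j _; exact: sqr_ge0.
Qed.

Lemma eucl_le_norm x : eucl x <= n%:R * `|x|.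
Proof.
have h0 : 0 <= n%:R * `|x| by rewrite mulr_ge0.
rewrite -(ger0_norm h0) -sqrtr_sqr /eucl ler_wsqrtr //.
apply: le_trans (_ : \sum_(i < n) `|x| ^+ 2 <= _).
  by apply: ler_sum => i _; rewrite -[leLHS]real_normK ?num_real // lerXn2r ?nnegrE ?coord_le_norm.
rewrite sumr_const card_ord -[leLHS]mulr_natl exprMn ler_wpM2r ?sqr_ge0 // -natrX ler_nat.
by case: (n) => // m; rewrite expnS leq_pmulr.
Qed.

Lemma ediam_ge0 A x : A x -> (0 <= ediam A)%E.
Proof.
move=> Ax; apply: le_ereal_sup_tmp; exists (eucl (x - x))%:E; last by rewrite lee_fin sqrtr_ge0.
by exists x => //; exists x.
Qed.

Lemma hterm_ge0 d A : (0 <= hterm d A)%E.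
Proof.
rewrite /hterm; case: pselect => // A0; rewrite lee_fin exprn_ge0 // fine_ge0 //.
by have /set0P[x /ediam_ge0] : A != set0 by apply/eqP.
Qed.

Lemma hterm_le d A (D : R) : 0 <= D -> (ediam A <= D%:E)%E -> (hterm d A <= (D ^+ d)%:E)%E.
Proof.
move=> D0 AD; rewrite /hterm; case: pselect => A0; first by rewrite lee_fin exprn_ge0.
have /set0P[x /ediam_ge0] : A != set0 by apply/eqP.
case: (ediam A) AD => [r| |] //; rewrite !lee_fin => rD r0.
by rewrite lerXn2r ?nnegrE.
Qed.

Lemma ediam_ball c (r : R) : 0 <= r -> (ediam [set x : 'rV[R]_n | (`|x - c| <= r)%R] <= (2 * n%:R * r)%:E)%E.
Proof.
move=> r0; apply: ge_ereal_sup => _ [x /= xc [y /= yc <-]]; rewrite lee_fin.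
apply: le_trans (eucl_le_norm _) _; rewrite mulrAC [leRHS]mulrC ler_wpM2l //.
have -> : x - y = (x - c) - (y - c) by rewrite opprB addrA subrK.
by apply: le_trans (ler_normB _ _) _; lra.
Qed.

Lemma hausdorff_le d S (B : R) : (forall delta : R, 0 < delta -> exists eta : R, [/\ 0 < eta, eta <= delta &
    exists2 s : seq 'rV[R]_n, (size s)%:R * (2 * n%:R * eta) ^+ d <= B &
    forall x, S x -> exists2 c, c \in s & `|x - c| <= eta]) -> (hausdorff d S <= B%:E)%E.
Proof.
move=> H; apply: ge_ereal_sup => _ [delta /= d0 <-].
have n1 : 0 < 2 * n%:R + 1 :> R by rewrite ltr_wpDl // mulr_ge0.
have [|eta [eta0 ed [s sB sP]]] := H (delta / (2 * n%:R + 1)); first by rewrite divr_gt0.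
have nd : 2 * n%:R * eta <= delta.
  move: ed; rewrite ler_pdivlMr // mulrDr mulr1 mulrC => h.
  by apply: le_trans h; rewrite lerDl ltW.
have ne0 : 0 <= 2 * n%:R * eta by rewrite !mulr_ge0 // ltW.
pose G j : set 'rV[R]_n := if (j < size s)%N then [set x | `|x - nth 0 s j| <= eta] else set0.
have Gd j : (ediam (G j) <= (2 * n%:R * eta)%:E)%E.
  rewrite /G; case: ifP => _; first exact: ediam_ball (ltW eta0).
  by apply: ge_ereal_sup => z [x []].
apply: (@le_trans _ _ (\sum_(0 <= j <oo) hterm d (G j))%E).
  apply: ereal_inf_lbound; exists G => //; split=> [x /sP[c cs xc]|j]; last first.
    by apply: le_trans (Gd j) _; rewrite lee_fin.
  by exists (index c s) => //; rewrite /G index_mem cs /= nth_index.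
rewrite (@nneseries_split _ _ 0 (size s)); last by move=> *; exact: hterm_ge0.
rewrite eseries0 ?adde0 => [|i si _]; last first.
  by rewrite /G ltnNge -[size s]add0n si /hterm; case: pselect.
apply: le_trans (_ : (((size s)%:R * (2 * n%:R * eta) ^+ d)%:E <= _)%E); last by rewrite lee_fin.
rewrite mulr_natl -[in leRHS](card_ord (size s)) -sumr_const -sumEFin big_mkord.
by apply: lee_sum => i _; exact: hterm_le.
Qed.

Lemma exprn_right_continuous d (D e : R) : 0 < e -> exists2 dl : R, 0 < dl & (D + dl) ^+ d <= D ^+ d + e.
Proof.
move=> e0; have /cvgrPdist_le /(_ e e0) := @exprn_continuous R d D.
move=> /nbhs_ballP[dl /= dl0 H]; exists (dl / 2); first by rewrite divr_gt0.
have := H (D + dl / 2); rewrite /ball /= opprD addrA subrr sub0r normrN gtr0_norm ?divr_gt0 // => /(_ _)/wrap[|].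
  by lra.
by rewrite ler_norml; lra.
Qed.

Lemma geometric_sum_le (e : R) N : 0 <= e -> \sum_(j < N) e / 2 ^+ j.+1 <= e.
Proof.
move=> e0; have -> : \sum_(j < N) e / 2 ^+ j.+1 = e - e / 2 ^+ N.
  elim: N => [|N IH]; first by rewrite big_ord0 expr0 divr1 subrr.
  by rewrite big_ord_recr /= IH exprS; field.
by rewrite gerBl divr_ge0 // exprn_ge0.
Qed.

Lemma card_spread d M (q : nat) (P : {set {ffun 'I_d -> 'I_M}}) :
  (forall k k', k \in P -> k' \in P -> forall i, (k i <= k' i + q)%N) -> (#|P| <= (2 * q).+1 ^ d)%N.
Proof.
move=> H; have [->|[k0 k0P]] := set_0Vmem P; first by rewrite cards0.
have lt k : k \in P -> forall i, (k i + q - k0 i < (2 * q).+1)%N.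
  by move=> kP i; have := H k k0 kP k0P i; clear; lia.
pose f (k : {ffun 'I_d -> 'I_M}) : {ffun 'I_d -> 'I_(2 * q).+1} := [ffun i => inord (k i + q - k0 i)].
have finj : {in P &, injective f}.
  move=> k k' kP k'P E; apply/ffunP => i; apply: val_inj.
  have /(congr1 (fun g : {ffun _ -> _} => val (g i))) := E; rewrite !ffunE /= !inordK ?lt //.
  by have := H k0 k k0P kP i; have := H k0 k' k0P k'P i => /=; clear; lia.
rewrite -(card_in_imset finj); apply: leq_trans (max_card _) _.
by rewrite card_ffun !card_ord.
Qed.

(** A mass distribution argument with grid points in place of a measure. The sets of a cover are
    thickened to open sets, finitely many of which suffice by compactness. A thickened set of size
    [W j] contains preimages of at most $(3\kappa M W_j/\rho)^d$ of the $M^d$ points of a grid in a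
    cube of side [rho], and these numbers add up to at least $M^d$. *)
Lemma hausdorff_ge d S T (phi : 'rV[R]_n -> 'rV[R]_d) (u0 : 'rV[R]_d) (kappa rho B : R) :
  compact S -> S `<=` T -> 0 < kappa -> 0 < rho -> (forall x y, `|phi x - phi y| <= kappa * `|x - y|) ->
  (forall u, `|u - u0| <= rho -> exists2 x, S x & phi x = u) -> (hausdorff d T <= B%:E)%E ->
  rho ^+ d <= (3 * kappa) ^+ d * B.
Proof.
move=> cS ST kappa0 rho0 phiL phiS TB; apply/ler_addgt0Pr => e0 e00.
have K0 : 0 < (3 * kappa) ^+ d by rewrite exprn_gt0 // mulr_gt0.
pose e := e0 / (3 * kappa) ^+ d / 2.
have e_gt0 : 0 < e by rewrite !divr_gt0.
suff H : rho ^+ d <= (3 * kappa) ^+ d * (B + e + e).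
  apply: le_trans H _; rewrite -addrA mulrDr lerD2l.
  have -> : e + e = e0 / (3 * kappa) ^+ d by rewrite /e; lra.
  by rewrite mulrC divfK // gt_eqF.
have : (hausdorff_delta d 1 T < (B + e)%:E)%E.
  apply: le_lt_trans (_ : (B%:E < _)%E); last by rewrite lte_fin ltrDl.
  by apply: le_trans TB; apply: ereal_sup_ubound; exists 1 => //=.
move=> /ereal_inf_lt[_ [G [TG G1] <-] GB].
(* The thickening of the set of index [j] may cost $e/2^{j+1}$, so that all of them together cost at
   most [e]. *)
have /choice[dl dlP] : forall j, exists dl : R, 0 < dl /\
    (fine (ediam (G j)) + 2 * dl) ^+ d <= (fine (ediam (G j))) ^+ d + e / 2 ^+ j.+1.
  move=> j; have [|dl dl0 h] := @exprn_right_continuous d (fine (ediam (G j))) (e / 2 ^+ j.+1).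
    by rewrite divr_gt0 // exprn_gt0.
  by exists (dl / 2); rewrite divr_gt0 // mulrCA divff // mulr1.
pose O j : set 'rV[R]_n := \bigcup_(y in G j) ball y (dl j).
have oO j : open (O j) by apply: bigcup_open => y _; exact: ball_open.
move: cS; rewrite compact_cover => /(_ nat setT O) [||D _ Dcov].
- by move=> j _; exact: oO.
- move=> x /ST /TG[j _ Gj]; exists j => //; exists x => //; apply: ballxx; exact: (dlP j).1.
have [N NP] : exists N, forall x, S x -> exists2 j, (j < N)%N & O j x.
  exists (\max_(j <- finmap.enum_fset D) j).+1 => x /Dcov[j jD Oj]; exists j => //.
  by rewrite ltnS; apply: (@leq_bigmax_seq _ _ xpredT (fun j : nat => j)).
pose W j := fine (ediam (G j)) + 2 * dl j.
have Gfin j y : G j y -> 0 <= fine (ediam (G j)) /\ (ediam (G j) = (fine (ediam (G j)))%:E)%E.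
  move=> /ediam_ge0; have := G1 j; case: (ediam (G j)) => [r| |] //.
have OW j x x' : O j x -> O j x' -> 0 < W j /\ `|x - x'| <= W j.
  move=> [y Gy yx] [y' Gy' yx']; have [g0 gE] := Gfin j y Gy; have d0 := (dlP j).1.
  split; first by rewrite /W; lra.
  have yy : `|y - y'| <= fine (ediam (G j)).
    apply: le_trans (norm_le_eucl _) _; rewrite -lee_fin -gE; apply: ereal_sup_ubound.
    by exists y => //; exists y'.
  move: yx yx'; rewrite -!ball_normE /= => h1 h2.
  have -> : x - x' = - (y - x) + (y - y') + (y' - x') by apply/rowP => i; rewrite !mxE; ring.
  apply: le_trans (ler_normD _ _) _; apply: le_trans (lerD (ler_normD _ _) (lexx _)) _.
  by rewrite normrN /W; lra.
(* The mesh is at most [kappa * W j] for every nonempty set among the finitely many; the rounding in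
   the count then costs at most the factor 3. *)
pose M := (\sum_(j < N) (Num.truncn (rho / (kappa * W j))).+1).+1.
have M0 : 0 < M%:R :> R by rewrite ltr0n.
have MW j : (j < N)%N -> 0 < W j -> 1 <= kappa * W j * M%:R / rho.
  move=> jN W0; rewrite ler_pdivlMr // mul1r mulrC -ler_pdivrMr ?mulr_gt0 //.
  apply: le_trans (_ : (Num.truncn (rho / (kappa * W j))).+1%:R <= _); first exact/ltW/truncnS_gt.
  rewrite ler_nat /M leqW // (bigD1 (Ordinal jN)) //=; exact: leq_addr.
pose pt (k : {ffun 'I_d -> 'I_M}) : 'rV[R]_d := u0 + \row_i (rho * ((k i)%:R / M%:R)).
have ptu k : `|pt k - u0| <= rho.
  rewrite addrC addKr; apply: norm_le_coord => [|i]; first exact: ltW.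
  rewrite mxE ger0_norm ?mulr_ge0 ?divr_ge0 ?(ltW rho0) //.
  rewrite ler_piMr ?(ltW rho0) // ler_pdivrMr // mul1r ler_nat; exact/ltnW/ltn_ord.
have /choice[x xP] : forall k, exists x, S x /\ phi x = pt k.
  by move=> k; have [x Sx px] := phiS _ (ptu k); exists x.
have /choice[J JP] : forall k, exists j : 'I_N, O j (x k).
  by move=> k; have [j jN Oj] := NP _ (xP k).1; exists (Ordinal jN).
pose P (j : 'I_N) := [set k | J k == j]%SET.
have cP : (M ^ d)%N = (\sum_j #|P j|)%N.
  have -> : (M ^ d)%N = #|{: {ffun 'I_d -> 'I_M}}| by rewrite card_ffun !card_ord.
  rewrite -sum1_card (partition_big J xpredT) //=; apply: eq_bigr => j _.
  by rewrite -sum1_card; apply: eq_bigl => k; rewrite inE.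
pose t (j : 'I_N) : R := fine (hterm d (G j)) + e / 2 ^+ j.+1.
have hfin j : hterm d (G j) = (fine (hterm d (G j)))%:E by rewrite /hterm; case: pselect.
have t0 j : 0 <= t j.
  apply: addr_ge0; first exact: fine_ge0 (hterm_ge0 _ _).
  by apply: divr_ge0; [exact: ltW|exact: exprn_ge0].
have Pt j : #|P j|%:R <= (3 * kappa * M%:R / rho) ^+ d * t j.
  have [->|[k0 k0P]] := set_0Vmem (P j).
    by rewrite cards0 mulr_ge0 // exprn_ge0 // divr_ge0 ?mulr_ge0 ?(ltW kappa0) ?(ltW rho0).
  have Oj k : k \in P j -> O j (x k) by rewrite inE => /eqP <-.
  have [W0 _] := OW j _ _ (Oj _ k0P) (Oj _ k0P).
  have [y Gy _] := Oj _ k0P; have [g0 gE] := Gfin _ _ Gy.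
  set w := kappa * W j * M%:R / rho.
  have w1 : 1 <= w by exact: MW.
  have w0 : 0 <= w by lra.
  pose q := Num.truncn w.
  have qw : q%:R <= w by have /andP[] := truncn_itv w0.
  have cq : (#|P j| <= (2 * q).+1 ^ d)%N.
    apply: card_spread => k k' kP k'P i; have [_ h] := OW j _ _ (Oj _ kP) (Oj _ k'P).
    have h2 : `|pt k 0 i - pt k' 0 i| <= kappa * W j.
      apply: le_trans (coord_diff_le_norm _ _ _) _; rewrite -(xP k).2 -(xP k').2.
      by apply: le_trans (phiL _ _) _; rewrite ler_pM2l.
    rewrite leqNgt; apply/negP => kk.
    have h3 : (k' i)%:R + w < (k i)%:R.
      apply: lt_le_trans (_ : (k' i + q).+1%:R <= _); last by rewrite ler_nat.
      by rewrite -natr1 natrD -addrA ltrD2l natr1 truncnS_gt.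
    move: h2; rewrite !mxE => h2.
    have E2 : u0 0 i + rho * ((k i)%:R / M%:R) - (u0 0 i + rho * ((k' i)%:R / M%:R)) =
      ((k i)%:R - (k' i)%:R) * (rho / M%:R) by field; rewrite gt_eqF.
    move: h2; rewrite E2 ler_norml => /andP[_].
    rewrite -ler_pdivlMr ?divr_gt0 // (_ : kappa * W j / (rho / M%:R) = w); first by lra.
    by rewrite /w; field; rewrite !gt_eqF.
  apply: le_trans (_ : ((2 * q).+1 ^ d)%:R <= _); first by rewrite ler_nat.
  rewrite natrX; apply: le_trans (_ : (3 * w) ^+ d <= _).
    have qE : (2 * q).+1%:R = 2 * q%:R + 1 :> R by rewrite -natr1 natrM.
    by rewrite lerXn2r ?nnegrE ?qE //; move: qw w1 w0; lra.
  rewrite (_ : 3 * w = (3 * kappa * M%:R / rho) * W j); last by rewrite /w; field; rewrite gt_eqF.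
  rewrite exprMn ler_wpM2l ?exprn_ge0 ?divr_ge0 ?mulr_ge0 ?(ltW kappa0) ?(ltW rho0) //.
  rewrite /t /hterm; case: pselect => [G0|_ /=]; first by rewrite G0 in Gy.
  exact: (dlP j).2.
have tB : \sum_j t j <= B + e + e.
  rewrite big_split /=; apply: lerD; last exact: geometric_sum_le (ltW e_gt0).
  rewrite -lee_fin -sumEFin; apply: le_trans (ltW GB).
  apply: le_trans (nneseries_lim_ge N _); last by move=> *; exact: hterm_ge0.
  by rewrite big_mkord; apply: lee_sum => j _; rewrite -hfin.
have : (M ^ d)%:R <= (3 * kappa * M%:R / rho) ^+ d * \sum_j t j.
  by rewrite cP natr_sum big_distrr /=; apply: ler_sum => j _; exact: Pt.
rewrite (_ : 3 * kappa * M%:R / rho = (3 * kappa) * (M%:R / rho)); last by rewrite mulrA.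
have gen (a K T' p : R) : 0 < a -> 0 < p -> a <= K * (a / p) * T' -> p <= K * T'.
  move=> a0 p0 h; rewrite -(ler_pM2l a0) -ler_pdivlMr //.
  by apply: le_trans h _; rewrite le_eqVlt; apply/orP; left; apply/eqP; field; rewrite gt_eqF.
rewrite exprMn expr_div_n natrX => h.
have h2 := gen _ _ _ _ (exprn_gt0 d M0) (exprn_gt0 d rho0) h.
by apply: le_trans h2 _; rewrite ler_pM2l.
Qed.

End Hausdorff.

(** * Sublevel sets in charts *)

Section Regular.
Variable R : realType.

Lemma polyf_lipschitz n D (f : 'rV[R]_n -> R) : polyf D f -> forall B : R, 0 <= B -> exists2 C : R, 0 <= C &
  forall x y : 'rV[R]_n, `|x| <= B -> `|y| <= B -> `|f x - f y| <= C * `|x - y|.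
Proof.
move=> pf B B0; elim: pf => {D f} [c|i|D f g _ [C C0 CP] _ [C' C'0 C'P]|D E f g _ [C C0 CP] _ [C' C'0 C'P]|D E f _ _ IH] //.
- by exists 0 => // x y _ _; rewrite subrr normr0 mul0r.
- by exists 1 => // x y _ _; rewrite mul1r coord_diff_le_norm.
- exists (C + C'); first exact: addr_ge0.
  move=> x y xB yB; have -> : f x + g x - (f y + g y) = (f x - f y) + (g x - g y) by ring.
  by rewrite mulrDl; apply: le_trans (ler_normD _ _) _; apply: lerD; [exact: CP|exact: C'P].
have bd (h : 'rV[R]_n -> R) c : 0 <= c -> (forall x y : 'rV[R]_n, `|x| <= B -> `|y| <= B -> `|h x - h y| <= c * `|x - y|) ->
    forall x : 'rV[R]_n, `|x| <= B -> `|h x| <= `|h 0| + c * B.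
  move=> c0 hP x xB; have -> : h x = h 0 + (h x - h 0) by ring.
  apply: le_trans (ler_normD _ _) _; rewrite lerD2l; apply: le_trans (hP x 0 xB _) _; rewrite ?normr0 //.
  by rewrite subr0 ler_wpM2l.
exists ((`|f 0| + C * B) * C' + (`|g 0| + C' * B) * C).
  by rewrite addr_ge0 // mulr_ge0 // addr_ge0 // mulr_ge0.
move=> x y xB yB; have -> : f x * g x - f y * g y = f x * (g x - g y) + g y * (f x - f y) by ring.
rewrite mulrDl; apply: le_trans (ler_normD _ _) _; rewrite !normrM -!mulrA.
apply: lerD; apply: ler_pM => //; [exact: bd|exact: C'P|exact: bd|exact: CP].
Qed.

(* The hypotheses under which sublevel sets of [F] on cubes inside [Om] decay geometrically. *)
Definition regular d (F : 'rV[R]_d -> R) (Om : set 'rV[R]_d) (K : R) (N0 : nat) :=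
  [/\ 2 <= K,
    forall e : R, 0 < e -> exists2 dl : R, 0 < dl & forall u v : 'rV[R]_d, Om u -> Om v ->
      (forall i, `|u 0 i - v 0 i| <= dl) -> `|F u - F v| <= e,
    forall (a : 'rV[R]_d) (h : R) e, 0 < h -> cube a h `<=` Om ->
      boxsup F a (a + const_mx h) <= K * boxsup F (corner a h e) (corner a h e + const_mx (h / 2)) &
    forall (u : 'rV[R]_d) (i : 'I_d) (h M : R), 0 < h -> 0 < M ->
      (forall t : R, 0 <= t <= h -> Om (u + t *: axis R i)) ->
      (exists2 t : R, 0 <= t <= h & M <= `|F (u + t *: axis R i)|) ->
      forall N, (N0 <= N)%N ->
      (2 * d * #|[set l : 'I_N | (`|F (u + (h * (l%:R / N%:R)) *: axis R i)| < K^-1 * M)%R]%SET| <= N)%N].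

Lemma chart_regular n d (V : set 'rV[R]_n) c (A' : 'M[R]_(n, d)) X (r rho L : R) :
  compact V -> algebraic_set V -> submanifold d V -> is_chart V c A' X r rho L ->
  exists h1 K1 : R, [/\ 0 < h1, h1 <= r, 2 <= K1 & forall k p, (0 < k)%N -> in_Pkn k p ->
    exists N0, regular (fun u => peval p (X u)) (@om R d h1) (K1 ^+ k) N0].
Proof.
move=> cV aV mV ch; have [[r0 rho0 L0] _ XL _ _] := ch.
have [J [Cdeg [r1 [nd [Cdeg0 r10 r1r nd_dense nd_tame]]]]] := chart_tame cV aV mV ch.
have K2 := Kchart_ge2 R d J Cdeg.
have h10 : 0 < r1 / 26 by rewrite divr_gt0.
have h1r : 26 * (r1 / 26) <= r1 by lra.
exists (r1 / 26), (Kchart R d J Cdeg); split=> // [|k p k0 pk]; first by lra.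
have [D pD] := peval_polyf p.
have B0 : 0 <= `|X 0| + L * r by rewrite addr_ge0 // mulr_ge0 // ltW.
have XB (u : 'rV[R]_d) : `|u| <= r -> `|X u| <= `|X 0| + L * r.
  move=> ur; have -> : X u = X 0 + (X u - X 0) by rewrite addrC subrK.
  apply: le_trans (ler_normD _ _) _; rewrite lerD2l.
  by apply: le_trans (XL _ _ ur _) _; rewrite ?normr0 ?subr0 ?(ltW r0) // ler_wpM2l.
have [C C0 CP] := polyf_lipschitz pD B0.
have Fuc (e : R) : 0 < e -> exists2 dl : R, 0 < dl &
  forall u v : 'rV[R]_d, `|u| <= r -> `|v| <= r -> `|u - v| <= dl -> `|peval p (X u) - peval p (X v)| <= e.
  move=> e0; have CL : 0 <= C * L by rewrite mulr_ge0.
  exists (e / (C * L + 1)); first by rewrite divr_gt0 // ltr_wpDl.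
  move=> u v ur vr; rewrite ler_pdivlMr ?ltr_wpDl // => uv.
  apply: le_trans (CP _ _ (XB _ ur) (XB _ vr)) _; apply: le_trans (ler_wpM2l C0 (XL _ _ ur vr)) _.
  apply: le_trans uv; rewrite mulrA [leLHS]mulrC ler_wpM2l // lerDl //.
pose F (u : 'rV[R]_d) := peval p (X u).
have tm w v tau := nd_tame k p w v tau k0 pk.
exists (rz_Q d * (rz_Q d + 4 * d * (k * rz_C R J Cdeg d)))%N; split.
- by rewrite (le_trans K2) // -[leLHS]expr1 ler_weXn2l //; lra.
- move=> e /Fuc[dl dl0 H]; exists dl => // u v ou ov uv; rewrite /om /= in ou ov.
  by apply: H; [lra|lra|apply: norm_le_coord => [|i]; [rewrite ltW|rewrite !mxE]].
- exact: (cube_double Cdeg0 k0 r10 r1r Fuc nd_dense tm h10 h1r).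
- exact: (segment_remez Cdeg0 k0 r10 r1r Fuc nd_dense tm h10 h1r).
Qed.

(** Doubling is iterated along a chain of dyadic cubes containing [u], each a child of the preceding
    one. *)
Lemma regular_descent d (F : 'rV[R]_d -> R) Om K N0 a (h : R) u N : regular F Om K N0 -> 0 < h ->
  cube a h `<=` Om -> cube a h u -> exists b, [/\ cube b (h / 2 ^+ N) u, cube b (h / 2 ^+ N) `<=` cube a h &
    boxsup F a (a + const_mx h) <= K ^+ N * boxsup F b (b + const_mx (h / 2 ^+ N))].
Proof.
move=> [K2 _ dbl _] h0 sub; have K0 : 0 <= K by lra.
elim: N => [|N IH] au; first by exists a; rewrite !expr0 divr1 mul1r; split.
have [b [bu bs bK]] := IH au; have hN0 : 0 < h / 2 ^+ N by rewrite divr_gt0 // exprn_gt0.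
have [e eu] := corner_cover bu; exists (corner b (h / 2 ^+ N) e).
rewrite exprSr invfM mulrA; split=> //.
  by apply: subset_trans bs; apply: corner_sub; exact: ltW.
apply: le_trans bK _; rewrite exprSr -mulrA ler_wpM2l ?exprn_ge0 //.
by apply: dbl => //; apply: subset_trans sub.
Qed.

Lemma omE d (h : R) : 0 <= h -> cube (const_mx (- h)) (2 * h) = @om R d h.
Proof.
move=> h0; apply/seteqP; split=> u; rewrite /om /=.
  move=> /cubeP H; apply: norm_le_coord => // i; have := H i; rewrite mxE ler_norml; lra.
move=> uh; apply/cubeP => i; have := le_trans (coord_le_norm u i) uh; rewrite mxE ler_norml; lra.
Qed.

Lemma half_pow_lt (h e : R) N0 : 0 < h -> 0 < e -> exists2 N, (N0 <= N)%N & h / 2 ^+ N <= e.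
Proof.
move=> h0 e0; have [N NP] := exists_half_pow h e0; exists (maxn N0 N); first exact: leq_maxl.
apply: le_trans NP; rewrite ler_pM2l // lef_pV2 ?posrE ?exprn_gt0 // ler_weXn2l ?leq_maxr //; lra.
Qed.

Lemma cube_diff d a (h : R) (u v : 'rV[R]_d) : 0 <= h -> cube a h u -> cube a h v -> `|u - v| <= h.
Proof.
move=> h0 /cubeP hu /cubeP hv; apply: norm_le_coord => // i; rewrite !mxE ler_norml.
by have := hu i; have := hv i; lra.
Qed.

Section Chart.
Variables (n d : nat) (V : set 'rV[R]_n) (c : 'rV[R]_n) (A' : 'M[R]_(n, d)) (X : 'rV[R]_d -> 'rV[R]_n) (r rho L : R).
Hypothesis ch : is_chart V c A' X r rho L.

(** The Lipschitz map [X] carries the small cubes of [tail_cover] to sets of comparable size in [V].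
    The constant [L + 1] instead of [L] keeps the radii positive. *)
Lemma chart_sublevel (q : 'rV[R]_n -> R) K N0 (h1 h : R) a j (S : set 'rV[R]_n) :
  regular (fun u => q (X u)) (@om R d h1) K N0 -> h1 <= r -> 0 < h -> cube a h `<=` @om R d h1 ->
  0 < boxsup (fun u => q (X u)) a (a + const_mx h) ->
  (forall z, S z -> [/\ V z, `|z - c| <= rho, cube a h ((z - c) *m A') &
    `|q z| <= K ^- (d.+1 * j) * boxsup (fun u => q (X u)) a (a + const_mx h)]) ->
  (hausdorff d S <= (2 ^- j * (2 * n%:R * (L + 1) * h) ^+ d)%:E)%E.
Proof.
move: ch => [[r0 rho0 L0] _ XL Vch _] [K2 Fuc dbl rem] h1r h0 sub b0 SP.
have L1 : 0 < L + 1 by rewrite ltr_wpDl.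
have [N NP] := tail_cover K2 Fuc dbl rem j h0 sub b0.
apply: hausdorff_le => delta d0.
have [N' NN' N'P] := half_pow_lt N (mulr_gt0 L1 h0) d0.
have [s sz sP] := NP N' NN'.
have N'0 : 0 < (2 : R) ^+ N' by rewrite exprn_gt0.
exists ((L + 1) * h / 2 ^+ N'); split=> //; first by rewrite divr_gt0 // mulr_gt0.
have hN : 0 <= h / 2 ^+ N' by rewrite divr_ge0 // ltW.
have /choice[y yP] : forall b : 'rV[R]_d, exists y : 'rV[R]_n, forall v, cube a h v -> cube b (h / 2 ^+ N') v ->
    `|X v - y| <= L * (h / 2 ^+ N').
  move=> b; have [[u [ua ub]]|nu] := pselect (exists u, cube a h u /\ cube b (h / 2 ^+ N') u); last first.
    by exists 0 => v va vb; case: nu; exists v.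
  exists (X u) => v va vb; apply: le_trans (XL _ _ _ _) _.
  - by apply: le_trans h1r; apply: sub.
  - by apply: le_trans h1r; apply: sub.
  - by rewrite ler_wpM2l //; exact: cube_diff hN vb ub.
exists [seq y b | b <- s]; last first.
  move=> z /SP[Vz zc za qz]; have [zr zE] := Vch z Vz zc.
  rewrite zE in qz; have [b bs bz] := sP _ za qz.
  exists (y b); first exact: map_f.
  rewrite {1}zE; apply: le_trans (yP b _ za bz) _; rewrite -mulrA ler_wpM2r // lerDl; exact: ler01.
rewrite size_map.
have -> : 2 * n%:R * ((L + 1) * h / 2 ^+ N') = (2 * n%:R * (L + 1) * h) * (2 ^+ N')^-1 by rewrite !mulrA.
rewrite exprMn mulrCA [leRHS]mulrC ler_wpM2l ?exprn_ge0 ?mulr_ge0 ?(ltW L1) ?(ltW h0) //.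
rewrite exprVn ler_pdivrMr ?exprn_gt0 // ler_pdivlMl ?exprn_gt0 //.
by rewrite -exprM -!natrX -natrM ler_nat.
Qed.

Lemma chart_image_continuous (a : 'rV[R]_d) (h : R) : cube a h `<=` @om R d r -> compact (X @` cube a h).
Proof.
move: ch => [[r0 rho0 L0] _ XL Vch _] sub.
apply: continuous_compact; last exact: box_compact.
apply/subspace_continuousP => u ua; apply/cvgrPdist_le => e e0.
have L1 : 0 < L + 1 by rewrite ltr_wpDl.
have e1 : 0 < e / (L + 1) by rewrite divr_gt0.
rewrite /within /=; apply/nbhs_ballP; exists (e / (L + 1)) => //= v uv va.
apply: le_trans (XL _ _ (sub _ ua) (sub _ va)) _.
move: uv; rewrite -ball_normE /= ltr_pdivlMr // mulrC => /ltW; apply: le_trans.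
by rewrite ler_wpM2r // lerDl.
Qed.

End Chart.

Section Local.
Variables (n d : nat) (V : set 'rV[R]_n).
Hypotheses (cV : compact V) (aV : algebraic_set V) (mV : submanifold d V).

Lemma chart_coordinates c : V c -> exists (A' : 'M[R]_(n, d)) X (r rho L : R),
  is_chart V c A' X r rho L /\ exists h1 K1 kappa eta : R, [/\ 0 < h1 <= r, 2 <= K1, 1 <= kappa,
    forall k p, (0 < k)%N -> in_Pkn k p -> exists N0, regular (fun u => peval p (X u)) (@om R d h1) (K1 ^+ k) N0 &
    [/\ 0 < eta, eta <= rho, kappa * (3 * eta) <= h1 & forall x : 'rV[R]_n, `|x *m A'| <= kappa * `|x|]].
Proof.
move=> Vc; have [A' [X [r [rho [L ch]]]]] := submanifold_chart mV Vc.
exists A', X, r, rho, L; split=> //; have [[r0 rho0 L0] _ _ _ _] := ch.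
have [h1 [K1 [h10 h1r K12 reg]]] := chart_regular cV aV mV ch.
have [kappa k1 kP] := mulmx_norm_bound A'.
have k0 : 0 < kappa by lra.
exists h1, K1, kappa, (Num.min rho (h1 / (3 * kappa))); split=> //; first by rewrite h10.
split=> //.
- by rewrite lt_min rho0 divr_gt0 // mulr_gt0.
- by rewrite ge_min lexx.
have : Num.min rho (h1 / (3 * kappa)) <= h1 / (3 * kappa) by rewrite ge_min lexx orbT.
by rewrite ler_pdivlMr ?mulr_gt0 //; move: (Num.min _ _) => m; lra.
Qed.

(** The cube of the chart is halved around the parameter of [w] until the image lies in the ball of
    radius [e]. The number of halvings depends on the chart and on [e], not on the polynomial. *)
Lemma chart_propagate c : V c -> exists2 eta : R, 0 < eta & forall w (e : R), V w -> `|w - c| < eta -> 0 < e ->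
  exists2 C : R, 1 <= C & forall k p (M : R), (0 < k)%N -> in_Pkn k p ->
    (forall z, V z -> `|z - w| < e -> `|peval p z| <= M) ->
    forall z, V z -> `|z - c| < eta -> `|peval p z| <= C ^+ k * M.
Proof.
move=> Vc; have [A' [X [r [rho [L [ch [h1 [K1 [kappa [eta [/andP[h10 h1r] K12 k1 reg [eta0 er eh kP]]]]]]]]]]]] := chart_coordinates Vc.
have [[r0 rho0 L0] Xu XL Vch _] := ch.
exists eta => // w e Vw wc e0.
have inQ z : V z -> `|z - c| < eta -> om h1 ((z - c) *m A') /\ z = X ((z - c) *m A').
  move=> Vz zc; have zr : `|z - c| <= rho by apply: le_trans er; exact: ltW.
  have [_ zE] := Vch z Vz zr; split=> //; rewrite /om /=.
  apply: le_trans (kP _) _; apply: le_trans eh; rewrite ler_pM2l; lra.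
have L1 : 0 < L + 1 by rewrite ltr_wpDl.
have h20 : 0 < 2 * h1 by lra.
have e1 : 0 < e / 2 / (L + 1) by rewrite !divr_gt0.
have [N _ NP] := half_pow_lt 0 h20 e1.
have K11 : 1 <= K1 by lra.
exists (K1 ^+ N); first exact: exprn_ege1.
move=> k p M k0 pk pM z Vz zc.
have [N0 rg] := reg k p k0 pk.
have [wQ wE] := inQ w Vw wc; have [zQ zE] := inQ z Vz zc.
have Qsub : cube (const_mx (- h1)) (2 * h1) `<=` @om R d h1 by rewrite omE // ltW.
have wQ' : cube (const_mx (- h1)) (2 * h1) ((w - c) *m A') by rewrite omE // ltW.
have zQ' : cube (const_mx (- h1)) (2 * h1) ((z - c) *m A') by rewrite omE // ltW.
have [b [bw bs bK]] := regular_descent N rg h20 Qsub wQ'.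
have [K2 Fuc _ _] := rg.
have hN : 0 < 2 * h1 / 2 ^+ N by rewrite divr_gt0 // exprn_gt0.
have [_ /(_ _ zQ') zM] := cubesup_max Fuc (ltW h20) Qsub.
rewrite -zE in zM; apply: le_trans zM _; apply: le_trans bK _.
rewrite exprAC ler_wpM2l ?exprn_ge0 //; first by lra.
have [[v vb <-] _] := cubesup_max Fuc (ltW hN) (subset_trans bs Qsub).
have vr : `|v| <= r by apply: le_trans h1r; apply: Qsub; exact: bs.
have wr : `|(w - c) *m A'| <= r by apply: le_trans h1r.
apply: pM; first exact: (Xu v vr).1.
rewrite wE; apply: le_lt_trans (XL _ _ vr wr) _.
apply: le_lt_trans (_ : e / 2 < _); last by lra.
apply: le_trans (_ : (L + 1) * (2 * h1 / 2 ^+ N) <= _); last by rewrite mulrC -ler_pdivlMr.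
by apply: ler_pM; rewrite ?lerDl //; exact: cube_diff (ltW hN) vb bw.
Qed.

(** Quantifying over all subsets [S] of the sublevel set makes it unnecessary to invoke monotonicity
    of [hausdorff]. *)
Definition sublevel_decay (B : set 'rV[R]_n) (K : R) k (p : mpoly.mpoly n R) (M m : R) :=
  forall j (S : set 'rV[R]_n), (forall z, S z -> [/\ V z, B z & `|peval p z| <= K ^- (k * j) * M]) ->
  (hausdorff d S <= (2 ^- j * m)%:E)%E.

Lemma chart_local c : V c -> exists (eta K m : R), [/\ 0 < eta, 2 <= K, 0 <= m & forall k p, (0 < k)%N -> in_Pkn k p ->
  (exists z, [/\ V z, `|z - c| < eta & peval p z != 0]) -> exists M : R, [/\ 0 < M, exists2 z, V z & `|peval p z| = M,
    forall z, V z -> `|z - c| < eta -> `|peval p z| <= M &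
    sublevel_decay [set z | `|z - c| < eta] K k p M m]].
Proof.
move=> Vc; have [A' [X [r [rho [L [ch [h1 [K1 [kappa [eta [/andP[h10 h1r] K12 k1 reg [eta0 er eh kP]]]]]]]]]]]] := chart_coordinates Vc.
have [[r0 rho0 L0] Xu XL Vch _] := ch.
have K11 : 1 <= K1 by lra.
have inQ z : V z -> `|z - c| < eta -> cube (const_mx (- h1)) (2 * h1) ((z - c) *m A') /\ z = X ((z - c) *m A').
  move=> Vz zc; have zr : `|z - c| <= rho by apply: le_trans er; exact: ltW.
  have [_ zE] := Vch z Vz zr; split=> //; rewrite omE ?(ltW h10) // /om /=.
  apply: le_trans (kP _) _; apply: le_trans eh; rewrite ler_pM2l; lra.
have h20 : 0 < 2 * h1 by lra.
have Qsub : cube (const_mx (- h1)) (2 * h1) `<=` @om R d h1 by rewrite omE // ltW.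
exists eta, (K1 ^+ d.+1), ((2 * n%:R * (L + 1) * (2 * h1)) ^+ d); split=> //.
- by rewrite (le_trans K12) // -[leLHS]expr1 ler_weXn2l.
- by rewrite exprn_ge0 // !mulr_ge0 // ?addr_ge0 // ltW.
move=> k p k0 pk [z0 [Vz0 z0c pz0]]; have [N0 rg] := reg k p k0 pk.
have [K2 Fuc _ _] := rg.
have [[v vQ vM] bM] := cubesup_max Fuc (ltW h20) Qsub.
set M := boxsup _ _ _ in vM bM *.
have pM z : V z -> `|z - c| < eta -> `|peval p z| <= M.
  by move=> Vz zc; have [zQ zE] := inQ z Vz zc; rewrite zE; exact: bM.
have M0 : 0 < M by apply: lt_le_trans (pM _ Vz0 z0c); rewrite normr_gt0.
exists M; split=> //.
  exists (X v) => //; apply: (Xu v _).1; apply: le_trans h1r; exact: Qsub.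
move=> j S SP; apply: (chart_sublevel ch rg h1r h20 Qsub) => // z /SP[Vz /= zc pz].
have [zQ zE] := inQ z Vz zc; split=> //.
  by apply: le_trans er; exact: ltW.
by apply: le_trans pz _; rewrite -!exprM mulnCA.
Qed.

Lemma chart_balls c : V c -> exists (eta K m : R), [/\ 0 < eta, 2 <= K, 0 < m & forall x (s : R), V x -> `|x - c| < eta ->
  0 < s -> s < eta ->
  (forall B : R, (hausdorff d (Vball V x s) <= B%:E)%E -> s ^+ d <= m * B) /\
  forall k p, (0 < k)%N -> in_Pkn k p -> (exists2 z, Vball V x s z & peval p z != 0) -> exists M : R, [/\ 0 < M,
    forall z, Vball V x s z -> `|peval p z| <= M & sublevel_decay (Vball V x s) K k p M (m * s ^+ d)]].
Proof.
move=> Vc; have [A' [X [r [rho [L [ch [h1 [K1 [kappa [eta [/andP[h10 h1r] K12 k1 reg [eta0 er eh kP]]]]]]]]]]]] := chart_coordinates Vc.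
have [[r0 rho0 L0] Xu XL Vch _] := ch.
have K11 : 1 <= K1 by lra.
have k0' : 0 < kappa by lra.
have nL : 0 < 2 * n%:R * (L + 1) + 1 by rewrite ltr_wpDl // !mulr_ge0 // addr_ge0.
(* [m1] comes from the cube of side [2 * (kappa * s)] containing the parameters of the ball, [m2]
   from the inner cube used for the lower bound. *)
set m1 := (2 * n%:R * (L + 1) * (2 * kappa)) ^+ d.
have m10 : 0 <= m1 by rewrite exprn_ge0 // !mulr_ge0 ?addr_ge0 // ltW.
set m2 := (3 * kappa) ^+ d * (2 * n%:R * (L + 1) + 1) ^+ d.
have m20 : 0 < m2 by rewrite mulr_gt0 // exprn_gt0 // mulr_gt0.
exists (eta / 2), (K1 ^+ d.+1), (m1 + m2); split=> //.
- by rewrite divr_gt0.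
- by rewrite (le_trans K12) // -[leLHS]expr1 ler_weXn2l.
- by rewrite ltr_wpDl.
move=> x s Vx xc s0 se; pose u0 := (x - c) *m A'.
have eta2 : eta / 2 < eta by lra.
have xc' : `|x - c| <= rho by lra.
have [_ xE] := Vch x Vx xc'.
have u0n : `|u0| <= kappa * (eta / 2).
  by apply: le_trans (kP _) _; rewrite ler_pM2l // ltW.
have ks : kappa * s <= kappa * eta by rewrite ler_pM2l //; lra.
have keta : kappa * (eta / 2) = kappa * eta / 2 by rewrite mulrA.
have ke0 : 0 < kappa * eta by rewrite mulr_gt0.
have ke3 : 3 * (kappa * eta) <= h1 by rewrite mulrCA.
have ke2 : kappa * s <= kappa * eta / 2 by rewrite -mulrA ler_pM2l //; lra.
have ks0 : 0 < kappa * s by rewrite mulr_gt0.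
split.
  move=> B hB; pose s' := s / (2 * n%:R * (L + 1) + 1).
  have s'0 : 0 < s' by rewrite divr_gt0.
  have s's : s' <= s.
    by rewrite ler_pdivrMr // ler_peMr ?(ltW s0) // lerDr !mulr_ge0 // addr_ge0.
  pose Q := cube (u0 - const_mx s') (2 * s').
  have Qr : Q `<=` @om R d r.
    move=> u uQ; have uu0 : `|u - u0| <= s'.
      apply: norm_le_coord => [|i]; first exact: ltW.
      by move/cubeP: uQ => /(_ i); rewrite !mxE ler_norml; lra.
    have -> : u = u0 + (u - u0) by rewrite addrC subrK.
    rewrite /om /=; apply: le_trans (ler_normD _ _) _.
    have : s <= kappa * s by rewrite ler_peMl // ltW.
    lra.
  have := @hausdorff_ge R n d (X @` Q) (Vball V x s) (fun y => (y - c) *m A') u0 kappa s' B.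
  move=> /(_ _ _ k0' s'0 _ _ hB)/wrap[||y z|u us'|hs].
  - exact: (chart_image_continuous ch (a := u0 - const_mx s') (h := 2 * s') Qr).
  - move=> _ [u uQ <-]; have ur := Qr _ uQ; rewrite /Vball /=; split; first exact: (Xu u ur).1.
    apply: le_lt_trans (eucl_le_norm _) _.
    have u0r : `|u0| <= r by lra.
    have uu0 : `|u - u0| <= s'.
      apply: norm_le_coord => [|i]; first exact: ltW.
      by move/cubeP: uQ => /(_ i); rewrite !mxE ler_norml; lra.
    rewrite {1}xE; apply: le_lt_trans (_ : n%:R * (L * s') < _).
      by rewrite ler_wpM2l //; apply: le_trans (XL _ _ ur u0r) _; rewrite ler_wpM2l.
    have -> : s = (2 * n%:R * (L + 1) + 1) * s' by rewrite /s' mulrC divfK // gt_eqF.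
    rewrite mulrA ltr_pM2r //.
    have : 0 <= n%:R * L by rewrite mulr_ge0.
    have : 0 <= n%:R :> R by [].
    by move=> n0 nL0; lra.
  - by rewrite -mulmxBl opprB addrA subrK; apply: kP.
  - have ur : `|u| <= r.
      apply: Qr; apply/cubeP => i; have := le_trans (coord_le_norm _ i) us'.
      by rewrite !mxE ler_norml; lra.
    exists (X u); last exact: (Xu u ur).2.
    exists u => //; apply/cubeP => i; have := le_trans (coord_le_norm _ i) us'.
    by rewrite !mxE ler_norml; lra.
  have B0 : 0 <= B.
    rewrite -(pmulr_rge0 _ (exprn_gt0 d (mulr_gt0 (ltr0n R 3) k0'))).
    by apply: le_trans hs; rewrite exprn_ge0 // ltW.
  apply: le_trans (_ : m2 * B <= _); last by rewrite ler_wpM2r // lerDr.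
  have -> : s ^+ d = (2 * n%:R * (L + 1) + 1) ^+ d * s' ^+ d.
    by rewrite -exprMn /s' mulrC divfK // gt_eqF.
  have -> : m2 * B = (2 * n%:R * (L + 1) + 1) ^+ d * ((3 * kappa) ^+ d * B) by rewrite /m2; ring.
  by apply: ler_wpM2l hs; exact: exprn_ge0 (ltW nL).
move=> k p k0 pk [z0 z0B pz0]; have [N0 rg] := reg k p k0 pk.
have [K2 Fuc _ _] := rg.
pose a := u0 - const_mx (kappa * s); pose h := 2 * (kappa * s).
have h0 : 0 < h by rewrite mulr_gt0.
have Qsub : cube a h `<=` @om R d h1.
  move=> u uQ; have uu0 : `|u - u0| <= kappa * s.
    apply: norm_le_coord => [|i]; first exact: ltW.
    by move/cubeP: uQ => /(_ i); rewrite /h !mxE ler_norml; lra.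
  have -> : u = u0 + (u - u0) by rewrite addrC subrK.
  rewrite /om /=; apply: le_trans (ler_normD _ _) _; lra.
have inQ z : Vball V x s z -> [/\ V z, `|z - c| <= rho, cube a h ((z - c) *m A') & z = X ((z - c) *m A')].
  move=> [Vz zx]; have zx' : `|z - x| < s by apply: le_lt_trans (norm_le_eucl _) zx.
  have zc : `|z - c| <= rho.
    have -> : z - c = (z - x) + (x - c) by rewrite addrA subrK.
    by apply: le_trans (ler_normD _ _) _; lra.
  have [_ zE] := Vch z Vz zc; split=> //; apply/cubeP => i.
  have : `|(z - c) *m A' - u0| <= kappa * s.
    rewrite -mulmxBl opprB addrA subrK; apply: le_trans (kP _) _; rewrite ler_pM2l //; exact: ltW.
  move: (_ *m A') => w /(le_trans (coord_le_norm _ i)); rewrite /h /a; move: (u0) => u.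
  by rewrite !mxE ler_norml; lra.
have [[v vQ vM] bM] := cubesup_max Fuc (ltW h0) Qsub.
set M := boxsup _ _ _ in vM bM *.
have pM z : Vball V x s z -> `|peval p z| <= M.
  by move=> /inQ[_ _ zQ zE]; rewrite zE; exact: bM.
have M0 : 0 < M by apply: lt_le_trans (pM _ z0B); rewrite normr_gt0.
exists M; split=> //.
move=> j S SP.
have := @chart_sublevel n d V c A' X r rho L ch (peval p) _ N0 h1 h a j S rg h1r h0 Qsub M0.
move=> /(_ _)/wrap[z /SP[Vz /inQ[_ zc zQ zE] pz]|hS].
  split=> //; by apply: le_trans pz _; rewrite -!exprM mulnCA.
apply: le_trans hS _; rewrite lee_fin ler_wpM2l ?invr_ge0 ?exprn_ge0 //.
rewrite (_ : 2 * n%:R * (L + 1) * h = (2 * n%:R * (L + 1) * (2 * kappa)) * s); last by rewrite /h !mulrA.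
by rewrite exprMn -/m1 ler_wpM2r ?exprn_ge0 ?(ltW s0) // lerDl ltW.
Qed.

End Local.

End Regular.

(** * Propagation along the submanifold *)

Section Compactness.
Variables (R : realType) (n : nat).

Lemma compact_uniform (V : set 'rV[R]_n) (P : 'rV[R]_n -> R -> Prop) : compact V ->
  (forall x C C', P x C -> C <= C' -> P x C') ->
  (forall c, V c -> exists (eta C : R), 0 < eta /\ forall x, V x -> `|x - c| < eta -> P x C) ->
  exists C, forall x, V x -> P x C.
Proof.
move=> cV mono loc.
have /choice[f fP] : forall c, exists f : R * R, V c -> 0 < f.1 /\ forall x, V x -> `|x - c| < f.1 -> P x f.2.
  move=> c; have [Vc|nV] := pselect (V c); last by exists (0, 0).
  by have [eta [C h]] := loc c Vc; exists (eta, C).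
have [|s sV sP] := @compact_balls R n V (fun c => (f c).1) cV; first by move=> c /fP[].
exists (\sum_(c <- s) `|(f c).2|) => x Vx; have [c cs xc] := sP x Vx.
apply: mono ((fP c (sV c cs)).2 x Vx xc) _.
by rewrite (big_rem c) //=; apply: le_trans (ler_norm _) _; rewrite lerDl sumr_ge0.
Qed.

Lemma argmax_seq (s : seq 'rV[R]_n) (M : 'rV[R]_n -> R) : s != [::] ->
  exists2 c, c \in s & forall c', c' \in s -> M c' <= M c.
Proof.
elim: s => [//|c s IH] _; have [->|/IH[c1 c1s c1M]] := eqVneq s [::].
  by exists c => [|c']; rewrite ?inE // => /eqP ->.
have [h|h] := leP (M c1) (M c).
  exists c; first by rewrite mem_head.
  by move=> c'; rewrite inE => /orP[/eqP->|/c1M /le_trans->].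
exists c1; first by rewrite inE c1s orbT.
by move=> c'; rewrite inE => /orP[/eqP->|/c1M //]; exact: ltW.
Qed.

End Compactness.

Section Global.
Variables (R : realType) (n d : nat) (V : set 'rV[R]_n).
Hypotheses (cV : compact V) (coV : connected V) (aV : algebraic_set V) (mV : submanifold d V).

Definition dominated (C : R) c0 e0 y e := 1 <= C /\ forall k p (M : R), (0 < k)%N -> in_Pkn k p ->
  (forall z : 'rV[R]_n, V z -> `|z - c0| < e0 -> `|peval p z| <= M) ->
  forall z : 'rV[R]_n, V z -> `|z - y| < e -> `|peval p z| <= C ^+ k * M.

(** The points with a neighbourhood on which such a bound holds form a subset of [V] that is open
    and also closed: in a chart around a limit point, [chart_propagate] extends the bound from a
    neighbourhood of a nearby point of the set. *)
Lemma locally_dominated c0 (e0 : R) : V c0 -> 0 < e0 -> forall y, V y -> exists C e, 0 < e /\ dominated C c0 e0 y e.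
Proof.
move=> Vc0 e00; pose W y := V y /\ exists C e, 0 < e /\ dominated C c0 e0 y e.
suff -> : V = W by move=> y [].
apply/esym/coV.
- exists c0; split=> //; exists 1, e0; split=> //; split=> // k p M _ _ pM z Vz zc.
  by rewrite expr1n mul1r; exact: pM.
- pose I := [set q : 'rV[R]_n * R | V q.1 /\ exists C, 0 < q.2 /\ dominated C c0 e0 q.1 q.2].
  exists (\bigcup_(q in I) ball q.1 q.2).
    by apply: bigcup_open => -[y e] [_ [C [h _]]]; exact: ball_open.
  apply/seteqP; split=> y [Vy].
    by move=> [C [e [h dom]]]; split=> //; exists (y, e); [split=> //; exists C|exact: ballxx].
  move=> [[y0 e] [/= Vy0 [C [h [C1 dom]]]]]; rewrite -ball_normE /= => yy0; split=> //.
  exists C, (e - `|y0 - y|); rewrite subr_gt0; split=> //; split=> // k p M k0 pk pM z Vz zy.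
  apply: (dom k p M k0 pk pM z Vz).
  have -> : z - y0 = (z - y) - (y0 - y) by rewrite opprB addrA subrK.
  by apply: le_lt_trans (ler_normB _ _) _; lra.
exists (closure W); first exact: closed_closure.
apply/seteqP; split=> y; first by move=> Wy; split; [case: Wy|exact: subset_closure].
move=> [Vy clW]; split=> //.
have [eta eta0 etaP] := chart_propagate cV aV mV Vy.
have [w [[Vw [Cw [ew [ew0 [Cw1 Cwdom]]]]] wy]] := clW _ (nbhsx_ballx y eta eta0).
have wy' : `|w - y| < eta by move: wy; rewrite -ball_normE /= distrC.
have [C C1 CP] := etaP w ew Vw wy' ew0.
exists (C * Cw), eta; split=> //; split; first by rewrite -[leLHS]mulr1 ler_pM.
move=> k p M k0 pk pM z Vz zy; rewrite exprMn -mulrA.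
by apply: (CP k p (Cw ^+ k * M) k0 pk _ z Vz zy); exact: Cwdom.
Qed.

Lemma globally_dominated c0 (e0 : R) : V c0 -> 0 < e0 -> exists2 C : R, 1 <= C & forall k p (M : R), (0 < k)%N -> in_Pkn k p ->
  (forall z, V z -> `|z - c0| < e0 -> `|peval p z| <= M) -> forall z, V z -> `|peval p z| <= C ^+ k * M.
Proof.
move=> Vc0 e00.
pose P x (C : R) := 1 <= C /\ forall k p (M : R), (0 < k)%N -> in_Pkn k p ->
  (forall z, V z -> `|z - c0| < e0 -> `|peval p z| <= M) -> `|peval p x| <= C ^+ k * M.
have [||C CP] := @compact_uniform R n V P cV.
- move=> x C C' [C1 xC] CC'; split; first exact: le_trans CC'.
  move=> k p M k0 pk pM; apply: le_trans (xC k p M k0 pk pM) _.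
  apply: ler_wpM2r; first by apply: le_trans (pM _ Vc0 _); rewrite ?subrr ?normr0.
  by rewrite lerXn2r ?nnegrE ?(le_trans ler01) // (le_trans C1).
- move=> c Vc; have [C [e [e1 [C1 dom]]]] := locally_dominated Vc0 e00 Vc.
  exists e, C; split=> // x Vx xc; split=> // k p M k0 pk pM; exact: (dom k p M k0 pk pM x Vx xc).
exists C; first exact: (CP c0 Vc0).1.
by move=> k p M k0 pk pM z Vz; exact: (CP z Vz).2.
Qed.

(** [globally_dominated] with [M = 0]: a polynomial vanishing on a ball of [V] would vanish on all
    of [V]. *)
Lemma nonvanishing k (p : mpoly.mpoly n R) : (0 < k)%N -> in_Pkn k p -> (exists x, V x /\ peval p x != 0) ->
  forall x (s : R), V x -> 0 < s -> exists2 z, Vball V x s z & peval p z != 0.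
Proof.
move=> k0 pk [y [Vy py]] x s Vx s0; apply: contrapT => H.
have s1 : 0 < s / (n%:R + 1) by rewrite divr_gt0 // ltr_wpDl.
have [C C1 CP] := globally_dominated Vx s1.
have := CP k p 0 k0 pk _ y Vy; rewrite mulr0 normr_le0 (negPf py) => /(_ _)/wrap[z Vz zx|//].
rewrite normr_le0; apply: contrapT => /negP pz; apply: H; exists z => //; split=> //.
apply: le_lt_trans (eucl_le_norm _) _.
move: zx; rewrite ltr_pdivlMr ?ltr_wpDl // => zx.
by apply: le_lt_trans zx; rewrite mulrC ler_wpM2l // lerDl.
Qed.

Lemma sublevel_decay_le B (K K' : R) k (p : mpoly.mpoly n R) M m m' : 1 <= K -> K <= K' -> m <= m' -> 0 <= M ->
  sublevel_decay d V B K k p M m -> sublevel_decay d V B K' k p M m'.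
Proof.
move=> K1 KK' mm' M0 H j S SP; apply: le_trans (H j S _) _; last first.
  by rewrite lee_fin ler_wpM2l // invr_ge0 exprn_ge0.
move=> z /SP[Vz Bz pz]; split=> //; apply: le_trans pz _; rewrite ler_wpM2r //.
rewrite lef_pV2 ?posrE ?exprn_gt0 ?(lt_le_trans ltr01) // ?(le_trans K1) //.
by rewrite lerXn2r ?nnegrE ?(le_trans ler01) // (le_trans K1).
Qed.

(** The condition [s * C < 1] makes the whole statement monotone in [C], so that the bound on the
    radius and the other constants become uniform together through [compact_uniform]. *)
Lemma uniform_balls : exists2 C : R, 2 <= C & forall x (s : R), V x -> 0 < s -> s * C < 1 ->
  (forall B : R, (hausdorff d (Vball V x s) <= B%:E)%E -> s ^+ d <= C * B) /\
  forall k p, (0 < k)%N -> in_Pkn k p -> (exists x, V x /\ peval p x != 0) -> exists M : R, [/\ 0 < M,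
    forall z, Vball V x s z -> `|peval p z| <= M & sublevel_decay d V (Vball V x s) C k p M (C * s ^+ d)].
Proof.
pose P x (C : R) := 2 <= C /\ forall (s : R), 0 < s -> s * C < 1 ->
  (forall B : R, (hausdorff d (Vball V x s) <= B%:E)%E -> s ^+ d <= C * B) /\
  forall k p, (0 < k)%N -> in_Pkn k p -> (exists x, V x /\ peval p x != 0) -> exists M : R, [/\ 0 < M,
    forall z, Vball V x s z -> `|peval p z| <= M & sublevel_decay d V (Vball V x s) C k p M (C * s ^+ d)].
suff [C CP] : exists C, forall x, V x -> P x C.
  have [[x0 Vx0]|nV] := pselect (exists x, V x); last first.
    by exists 2 => // x s Vx; case: nV; exists x.
  exists C; first exact: (CP x0 Vx0).1.
  by move=> x s Vx; exact: (CP x Vx).2.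
apply: compact_uniform => //.
  move=> x C C' [C2 xC] CC'; split; first exact: le_trans CC'.
  have C0 : 0 < C by lra.
  move=> s s0 sC'; have sC : s * C < 1 by apply: le_lt_trans sC'; rewrite ler_pM2l.
  have [h1 h2] := xC s s0 sC; split=> [B hB|k p k0 pk nz].
    have hs := h1 B hB; apply: (le_trans hs); rewrite ler_wpM2r // -(pmulr_rge0 _ C0).
    by apply: le_trans hs; rewrite exprn_ge0 // ltW.
  have [M [M0 pM dec]] := h2 k p k0 pk nz; exists M; split=> //.
  apply: sublevel_decay_le dec => //; [lra|by rewrite ler_wpM2r // exprn_ge0 // ltW|exact: ltW].
move=> c Vc; have [eta [K [m [eta0 K2 m0 H]]]] := chart_balls cV aV mV Vc.
exists eta, (K + m + eta^-1); split=> // x Vx xc; have ei : 0 < eta^-1 by rewrite invr_gt0.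
split; first lra.
move=> s s0 sC.
have se : s < eta.
  rewrite -[ltRHS]invrK -[ltRHS]mul1r ltr_pdivlMr ?invr_gt0 //.
  by apply: le_lt_trans sC; rewrite ler_pM2l //; lra.
have [h1 h2] := H x s Vx xc s0 se; split=> [B hB|k p k0 pk nz].
  have hs := h1 B hB; apply: (le_trans hs); rewrite ler_wpM2r; [by []| |lra].
  by rewrite -(pmulr_rge0 _ m0); apply: le_trans hs; rewrite exprn_ge0 // ltW.
have [M [M0 pM dec]] := h2 k p k0 pk (nonvanishing k0 pk nz Vx s0); exists M; split=> //.
apply: sublevel_decay_le dec => //; [lra|lra|by rewrite ler_wpM2r ?exprn_ge0 ?(ltW s0) //; lra|exact: ltW].
Qed.

(** The charts of a finite cover have different maxima, but the largest one is at most a factor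
    [C ^+ k] above any other. Enlarging [K] by the factor [C] compensates for this in [K ^- (k * j)]
    as soon as [j] is positive. *)
Lemma global_sublevels : (exists x, V x) -> exists (s : seq ('rV[R]_n * R)) (K m : R), [/\ 2 <= K, 0 <= m,
  forall x, V x -> exists2 c, c \in s & `|x - c.1| < c.2 &
  forall k p, (0 < k)%N -> in_Pkn k p -> (exists x, V x /\ peval p x != 0) -> exists M : R, [/\ 0 < M,
    forall z, V z -> `|peval p z| <= M & forall c, c \in s -> forall j, (0 < j)%N -> forall S : set 'rV[R]_n,
      (forall z, S z -> [/\ V z, `|z - c.1| < c.2 & `|peval p z| <= K ^- (k * j) * M]) ->
      (hausdorff d S <= (2 ^- j * m)%:E)%E]].
Proof.
move=> [x0 Vx0].
have /choice[f fP] : forall c, exists f : R * R * R * R, V c -> [/\ 0 < f.1.1.1, 2 <= f.1.1.2, 0 <= f.1.2, 1 <= f.2 &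
    (forall k p (M : R), (0 < k)%N -> in_Pkn k p -> (forall z, V z -> `|z - c| < f.1.1.1 -> `|peval p z| <= M) ->
       forall z, V z -> `|peval p z| <= f.2 ^+ k * M) /\
    forall k p, (0 < k)%N -> in_Pkn k p -> (exists z, [/\ V z, `|z - c| < f.1.1.1 & peval p z != 0]) ->
    exists M : R, [/\ 0 < M, exists2 z, V z & `|peval p z| = M,
    forall z, V z -> `|z - c| < f.1.1.1 -> `|peval p z| <= M &
    sublevel_decay d V [set z | `|z - c| < f.1.1.1] f.1.1.2 k p M f.1.2]].
  move=> c; have [Vc|nV] := pselect (V c); last by exists (0, 0, 0, 0).
  have [eta [K [m [eta0 K2 m0 H]]]] := chart_local cV aV mV Vc.
  have [C C1 CP] := globally_dominated Vc eta0.
  by exists (eta, K, m, C).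
have [|s sV sP] := @compact_balls R n V (fun c => (f c).1.1.1) cV; first by move=> c /fP[].
pose K := 2 + \sum_(c <- s) `|(f c).1.1.2 * (f c).2|; pose m := \sum_(c <- s) `|(f c).1.2|.
have Kc c : c \in s -> (f c).1.1.2 * (f c).2 <= K.
  move=> cs; rewrite /K (big_rem c) //=; apply: le_trans (ler_norm _) _.
  by rewrite addrCA lerDl addr_ge0 // sumr_ge0.
have mc c : c \in s -> (f c).1.2 <= m.
  by move=> cs; rewrite /m (big_rem c) //=; apply: le_trans (ler_norm _) _; rewrite lerDl sumr_ge0.
exists [seq (c, (f c).1.1.1) | c <- s], K, m; split.
- by rewrite lerDl sumr_ge0.
- by rewrite sumr_ge0.
- by move=> x /sP[c cs xc]; exists (c, (f c).1.1.1) => //; apply: map_f.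
move=> k p k0 pk nz.
have /choice[M MP] : forall c, exists M : R, c \in s -> [/\ 0 < M, exists2 z, V z & `|peval p z| = M,
    forall z, V z -> `|z - c| < (f c).1.1.1 -> `|peval p z| <= M &
    sublevel_decay d V [set z | `|z - c| < (f c).1.1.1] (f c).1.1.2 k p M (f c).1.2].
  move=> c; have [cs|nc] := boolP (c \in s); last by exists 0.
  have [eta0 _ _ _ [_ H]] := fP c (sV c cs).
  have [|M h] := H k p k0 pk; last by exists M.
  have [z [Vz zc] pz] := nonvanishing k0 pk nz (sV c cs) eta0.
  by exists z; split=> //; exact: le_lt_trans (norm_le_eucl _) zc.
have [|c1 c1s c1M] := @argmax_seq R n s M.
  by have [c cs _] := sP _ Vx0; apply: contraTneq cs => ->.
have [M0 [z1 Vz1 pz1] _ _] := MP c1 c1s.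
exists (M c1); split=> //.
  move=> z Vz; have [c cs zc] := sP z Vz; have [_ _ h _] := MP c cs.
  exact: le_trans (h z Vz zc) (c1M c cs).
move=> _ /mapP[c cs ->] j j0 S /= SP.
have [eta0 K2 m0 C1 [dom _]] := fP c (sV c cs).
have [Mc0 _ pMc dec] := MP c cs.
have MM : M c1 <= (f c).2 ^+ k * M c by rewrite -pz1; exact: dom.
apply: le_trans (dec j S _) _; last by rewrite lee_fin ler_wpM2l ?mc // invr_ge0 exprn_ge0.
move=> z /SP[Vz zc pz]; split=> //; apply: le_trans pz _.
have C0 : 0 < (f c).2 by lra.
have Kc0 : 0 < (f c).1.1.2 by lra.
have K0 : 0 < K by apply: lt_le_trans (Kc c cs); exact: mulr_gt0.
apply: le_trans (_ : ((f c).1.1.2 * (f c).2) ^- (k * j) * ((f c).2 ^+ k * M c) <= _).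
  apply: ler_pM; rewrite ?invr_ge0 ?exprn_ge0 ?(ltW K0) ?(ltW M0) //.
  by rewrite lef_pV2 ?posrE ?exprn_gt0 ?mulr_gt0 // lerXn2r ?nnegrE ?mulr_ge0 ?(ltW C0) ?(ltW Kc0) ?(ltW K0) // Kc.
rewrite exprMn invfM -mulrA ler_wpM2l ?invr_ge0 ?exprn_ge0 ?(ltW Kc0) //.
rewrite mulrA ler_piMl ?(ltW Mc0) // ler_pdivrMl ?exprn_gt0 // mulr1.
by rewrite ler_weXn2l // leq_pmulr.
Qed.

End Global.

(** * Mean oscillation *)

Section Borel.
Variables (R : realType) (n : nat).

Lemma open_measurable_Rn (A : set 'rV[R]_n) : open A -> measurable (A : set (Rn R n)).
Proof. by move=> oA; apply: sub_sigma_algebra. Qed.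

Lemma measurable_polyf D (f : 'rV[R]_n -> R) : polyf D f -> measurable_fun setT (f : Rn R n -> R).
Proof.
move=> pf; apply: (measurability _ (measurable_realfun.RGenOpens.measurableE R)).
move=> _ [_ [a [b ->] <-]]; rewrite setTI; apply: open_measurable_Rn.
by move/continuousP: (polyf_continuous pf); apply; exact: interval_open.
Qed.

Lemma measurable_compact (V : set 'rV[R]_n) : compact V -> measurable (V : set (Rn R n)).
Proof.
move=> cV; rewrite -[X in measurable X]setCK; apply: measurableC; apply: open_measurable_Rn.
by apply: closed_openC; apply: compact_closed => //; exact: norm_hausdorff.
Qed.

Lemma measurable_Vball (V : set 'rV[R]_n) c (s : R) : compact V -> 0 < s -> measurable (Vball V c s).
Proof.
move=> cV s0; pose f (y : 'rV[R]_n) := \sum_(i <- enum 'I_n) (y 0 i - c 0 i) * (y 0 i - c 0 i).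
have pf : polyf (1 + 1) f.
  by apply: polyf_sum => i _; apply: polyfM; apply: polyfB (polyf_coord _ i) (polyf_cst_le _ _ _).
rewrite (_ : Vball V c s = V `&` [set y : 'rV[R]_n | f y < s ^+ 2]).
  apply: measurableI; first exact: measurable_compact.
  apply: open_measurable_Rn; have := polyf_continuous pf => /continuousP /(_ [set t | t < s ^+ 2]).
  by apply; exact: open_lt.
have E y : (eucl (y - c) < s) = (f y < s ^+ 2).
  have -> : eucl (y - c) = Num.sqrt (f y).
    by congr Num.sqrt; rewrite /f -big_enum; apply: eq_bigr => i _; rewrite !mxE expr2.
  by rewrite -{1}[s]ger0_norm ?(ltW s0) // -sqrtr_sqr ltr_sqrt // exprn_gt0.
by apply/seteqP; split=> y [Vy yc]; split=> //; move: yc; rewrite /= E.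
Qed.

End Borel.

Lemma measurable_abs dsp (T : measurableType dsp) (R : realType) (D : set T) (g : T -> R) :
  measurable_fun D g -> measurable_fun D (fun z => `|g z|).
Proof. by move=> mg; apply: (@measurableT_comp _ _ _ _ _ _ (@Num.Def.normr _ R) D g) => //; exact: normr_measurable. Qed.

Lemma measurable_shift dsp (T : measurableType dsp) (R : realType) (D : set T) (g : T -> R) (l : R) :
  measurable_fun D g -> measurable_fun D (fun z => g z - l).
Proof. by move=> mg; apply: (@measurable_funB _ _ _ D g (cst l)) => //; exact: measurable_cst. Qed.

(** * From decay of sublevel sets to mean oscillation *)

Section Oscillation.
Variables (R : realType) (n : nat) (mu : {measure set (Rn R n) -> \bar R}) (B : set (Rn R n)) (q : Rn R n -> R).
Variables (K M m b : R) (k : nat).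
Hypotheses (mB : measurable B) (mq : measurable_fun setT q) (M0 : 0 < M) (qM : forall z, B z -> `|q z| <= M).
Hypotheses (K2 : 2 <= K) (k0 : (0 < k)%N) (muB : mu B = b%:E) (b0 : 0 < b) (m0 : 0 <= m).
Hypothesis decay : forall j, (mu (B `&` [set z | (`|q z| <= K ^- (k * j) * M)%R]) <= (2 ^- j * m)%:E)%E.

Let f (z : Rn R n) := ln `|q z|.
Let Lam := k%:R * ln K.
Let E j := B `&` [set z | `|q z| <= K ^- (k * j) * M].

Let K0 : 0 < K. Proof. by move: K2; lra. Qed.
Let lnK0 : 0 < ln K. Proof. by rewrite ln_gt0 //; move: K2; lra. Qed.
Let Lam0 : 0 < Lam. Proof. by rewrite mulr_gt0 // ltr0n. Qed.

Let mf : measurable_fun B f.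
Proof.
apply: (@measurable_funS _ _ _ _ setT) => //.
by apply: (@measurableT_comp _ _ _ _ _ _ (@ln R) setT (fun z => `|q z|)); [exact: measurable_ln|exact: measurable_abs].
Qed.

Let mE j : measurable (E j).
Proof.
apply: measurableI => //.
have mg : measurable_fun setT (fun z : Rn R n => `|q z|) by exact: measurable_abs.
have := mg measurableT `]-oo, (K ^- (k * j) * M)]%classic (measurable_itv _); rewrite setTI.
by congr measurable; apply/seteqP; split=> z /=; rewrite in_itv.
Qed.

(* The number of sublevel sets [E j] containing [z] is at least [|ln |q z| - ln M| / Lam]; at the zeros
   of [q] it is infinite, which also takes care of the convention [ln 0 = 0]. *)
Let pointwise z : B z -> ((`|f z - ln M|)%:E <= \sum_(0 <= j <oo) (Lam%:E * (\1_(E j) z)%:E))%E.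
Proof.
move=> Bz; have := normr_ge0 (f z - ln M); set g := `|f z - ln M| => g0.
pose N := (Num.truncn (g / Lam)).+1.
have gN : g <= N%:R * Lam by rewrite -ler_pdivrMr // ltW // truncnS_gt.
have zE j : (j < N)%N -> E j z.
  move=> jN; split=> //=.
  have [->|qz] := eqVneq (q z) 0.
    by rewrite normr0 mulr_ge0 ?(ltW M0) // invr_ge0 exprn_ge0 // ltW.
  have qz0 : 0 < `|q z| by rewrite normr_gt0.
  have gE : g = ln M - ln `|q z|.
    by rewrite /g /f distrC ger0_norm // subr_ge0 ler_ln ?posrE // qM.
  have jg : j%:R * Lam <= g.
    rewrite -ler_pdivlMr //; have /andP[h _] := truncn_itv (divr_ge0 g0 (ltW Lam0)).
    by apply: le_trans h; rewrite ler_nat -ltnS.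
  rewrite -ler_ln ?posrE ?mulr_gt0 ?invr_gt0 ?exprn_gt0 //.
  rewrite lnM ?posrE ?invr_gt0 ?exprn_gt0 // lnV ?posrE ?exprn_gt0 // lnXn //.
  have -> : ln K *+ (k * j) = j%:R * Lam by rewrite -[LHS]mulr_natl natrM /Lam; ring.
  by move: jg; rewrite gE; lra.
apply: le_trans (_ : ((N%:R * Lam)%:E <= _)%E); first by rewrite lee_fin.
apply: le_trans (nneseries_lim_ge N _); last first.
  by move=> j _ _; rewrite -EFinM lee_fin mulr_ge0 ?(ltW Lam0).
rewrite big_mkord mulrC mulr_natr -[in leLHS](card_ord N) -sumr_const -sumEFin.
apply: lee_sum => i _; rewrite -EFinM lee_fin indicE mem_set ?mulr1 //; exact: zE.
Qed.

(** The series of [pointwise] is integrated term by term; by [decay] the integrals form a geometric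
    series. *)
Lemma log_distance : (\int[mu]_(z in B) (`|f z - ln M|)%:E <= (2 * Lam * m)%:E)%E.
Proof.
have mu0 j : measurable_fun B (fun z => Lam%:E * (\1_(E j) z)%:E)%E.
  by apply: measurable_funeM; apply/measurable_EFinP; apply: measurable_indic; exact: mE.
have mu1 j (z : Rn R n) : (0 <= Lam%:E * (\1_(E j) z)%:E)%E.
  by rewrite -EFinM lee_fin mulr_ge0 // ltW.
apply: le_trans (_ : (\int[mu]_(z in B) (\sum_(0 <= j <oo) (Lam%:E * (\1_(E j) z)%:E)) <= _)%E).
  apply: ge0_le_integral => //.
  - by apply/measurable_EFinP; apply: measurable_abs; exact: measurable_shift.
  - by apply: (@ge0_emeasurable_sum _ _ _ B (fun j z => (Lam%:E * (\1_(E j) z)%:E)%E) predT) => //.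
rewrite integral_nneseries //.
apply: lime_le; first by apply: is_cvg_nneseries => j _ _; apply: integral_ge0.
near=> N.
apply: le_trans (_ : (\sum_(0 <= j < N) ((2 * Lam * m) / 2 ^+ j.+1)%:E <= _)%E); last first.
  rewrite sumEFin lee_fin big_mkord; apply: geometric_sum_le; rewrite !mulr_ge0 // ltW //.
apply: lee_sum => j _; rewrite ge0_integralZl_EFin //; last 2 first.
  by apply/measurable_EFinP; exact: measurable_indic.
  exact: ltW.
rewrite integral_indic //.
apply: le_trans (_ : (Lam%:E * (2 ^- j * m)%:E <= _)%E).
  apply: lee_wpmul2l; first by rewrite lee_fin ltW.
  apply: le_trans (decay j); rewrite le_measure ?inE //; [exact: measurableI|exact: mE].
rewrite -EFinM lee_fin exprS invfM le_eqVlt; apply/orP; left; apply/eqP; field.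
by rewrite expf_neq0.
Unshelve. all: by end_near. Qed.

Lemma measurable_distance (l : R) : measurable_fun B (fun z => (`|f z - l|)%:E).
Proof.
by apply/measurable_EFinP; apply: measurable_abs; exact: measurable_shift.
Qed.

Lemma integrable_cst_finite (l : R) : mu.-integrable B (cst l%:E).
Proof.
apply/integrableP; split; first exact: measurable_cst.
rewrite [X in (X < _)%E](_ : _ = (\int[mu]_(z in B) (cst `|l|%:E) z)%E) //.
by rewrite integral_cst // muB -EFinM ltry.
Qed.

Lemma integrable_difference : mu.-integrable B (fun z => (f z - ln M)%:E).
Proof.
apply/integrableP; split.
  by apply/measurable_EFinP; exact: measurable_shift.
exact: le_lt_trans log_distance (ltry _).
Qed.

Lemma integrable_log : mu.-integrable B (fun z => (f z)%:E).
Proof.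
have := integrableD mB integrable_difference (integrable_cst_finite (ln M)).
apply: eq_integrable => // z _ /=; by rewrite -EFinD subrK.
Qed.

(** Replacing [ln M] by the mean at most doubles the mean distance, hence 4 where [log_distance] has
    2. *)
Lemma mean_osc_le : (mean_osc mu B f <= (4 * Lam * m / b)%:E)%E.
Proof.
have hd := log_distance; set c := 2 * Lam * m in hd.
have c0 : 0 <= c by rewrite !mulr_ge0 // ltW.
have If := integrable_fin_num mB integrable_log.
have IE : (\int[mu]_(z in B) (f z)%:E = (fine (\int[mu]_(z in B) (f z)%:E))%:E)%E by rewrite fineK.
set I := fine _ in IE.
have hI : `|I - ln M * b| <= c.
  rewrite -lee_fin; apply: le_trans hd.
  have -> : ((`|I - ln M * b|)%:E = `|\int[mu]_(z in B) (f z - ln M)%:E|)%E.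
    under eq_integral do rewrite EFinB.
    rewrite integralB_EFin //; [|exact: integrable_log|exact: integrable_cst_finite].
    by rewrite IE (integral_cst mu mB) muB -EFinM -EFinB.
  apply: le_trans (le_abse_integral _ mB _) _ => //.
  by apply/measurable_EFinP; exact: measurable_shift.
have mE' : mean mu B f = I / b by rewrite /mean muB.
have hmean : `|ln M - mean mu B f| <= c / b.
  rewrite ler_pdivlMr // mE' -[X in _ * X <= _](gtr0_norm b0) -normrM mulrBl divfK ?gt_eqF //.
  by rewrite distrC.
rewrite /mean_osc muB /=.
apply: le_trans (_ : ((b^-1)%:E * (c + c)%:E <= _)%E); last first.
  rewrite -EFinM lee_fin le_eqVlt; apply/orP; left; apply/eqP; rewrite /c; field; by rewrite gt_eqF.
apply: lee_wpmul2l; first by rewrite lee_fin invr_ge0 ltW.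
apply: le_trans (_ : (\int[mu]_(z in B) ((`|f z - ln M|)%:E + (cst (c / b)%:E) z) <= _)%E).
  apply: ge0_le_integral => //.
  - exact: measurable_distance.
  - by apply: emeasurable_funD; [exact: measurable_distance|exact: measurable_cst].
  - move=> z Bz; rewrite -EFinD lee_fin.
    have -> : f z - mean mu B f = (f z - ln M) + (ln M - mean mu B f) by rewrite addrA subrK.
    by apply: le_trans (ler_normD _ _) _; rewrite lerD2l.
rewrite ge0_integralD //; try exact: measurable_distance; try exact: measurable_cst; last first.
  by move=> z _; rewrite lee_fin divr_ge0 // ltW.
rewrite (integral_cst mu mB) muB -EFinM divfK ?gt_eqF // EFinD.
exact: leeD.
Qed.

End Oscillation.

(** This serves the degree 0, where the bound is 0 and the oscillation has to vanish exactly. *)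
Lemma mean_osc_cst (R : realType) n (mu : {measure set (Rn R n) -> \bar R}) (B : set (Rn R n)) (f : Rn R n -> R) (l b : R) :
  measurable B -> mu B = b%:E -> 0 < b -> (forall z, f z = l) ->
  mean_osc mu B f = 0%E /\ mu.-integrable B (fun z => (f z)%:E).
Proof.
move=> mB muB b0 fl; have -> : f = cst l by apply/funext => z; rewrite fl.
split; last exact: (integrable_cst_finite mB muB l).
have -> : mean_osc mu B (cst l) = ((b^-1)%:E * \int[mu]_(z in B) (cst 0%E z))%E.
  rewrite /mean_osc muB /=; congr (_ * _)%E; apply: eq_integral => z _.
  rewrite /mean muB (integral_cst mu mB l%:E) muB /= mulfK ?gt_eqF // subrr normr0 //.
by rewrite integral_cst // mul0e mule0.
Qed.

(** * Constants uniform over all balls *)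

Section Main.
Variables (R : realType) (n d : nat) (V : set 'rV[R]_n) (mu : {measure set (Rn R n) -> \bar R}).
Hypotheses (cV : compact V) (coV : connected V) (aV : algebraic_set V) (mV : submanifold d V).
Hypothesis muE : forall A : set (Rn R n), measurable A -> mu A = hausdorff d (A `&` V).

Lemma measure_finite : exists b : R, forall A : set (Rn R n), measurable A -> (mu A <= b%:E)%E.
Proof.
have [A [C C0 cov]] := submanifold_box_dim cV mV.
have C1 : 0 < C + 1 by lra.
exists (A%:R * (2 * n%:R * (C + 1)) ^+ d) => S mS; rewrite muE //.
apply: hausdorff_le => delta d0; pose N := (Num.truncn ((C + 1) / delta)).+1.
have N0 : 0 < N%:R :> R by rewrite ltr0n.
exists ((C + 1) / N%:R); split; first by rewrite divr_gt0.
  by rewrite ler_pdivrMr // mulrC -ler_pdivrMr // ltW // truncnS_gt.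
have [s sz sP] := cov N (ltn0Sn _); exists s.
  apply: le_trans (_ : (A * N ^ d)%:R * (2 * n%:R * ((C + 1) / N%:R)) ^+ d <= _).
    by rewrite ler_wpM2r ?ler_nat // exprn_ge0 // !mulr_ge0 // ?invr_ge0 ltW.
  rewrite natrM natrX -mulrA -exprMn le_eqVlt; apply/orP; left; apply/eqP; congr (_ * _ ^+ _).
  by field; rewrite gt_eqF.
move=> x [_ /sP[y ys xy]]; exists y => //; apply: le_trans xy _.
by rewrite ler_pM2r ?invr_gt0 // lerDl.
Qed.

Lemma mu_Vball x (s : R) : 0 < s -> mu (Vball V x s) = hausdorff d (Vball V x s).
Proof.
move=> s0; rewrite muE; last exact: measurable_Vball.
by congr hausdorff; apply/seteqP; split=> [y []|y [Vy ys]].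
Qed.

Lemma measure_real (A : set (Rn R n)) : measurable A -> mu A = (fine (mu A))%:E /\ 0 <= fine (mu A).
Proof.
move=> mA; have [b bP] := measure_finite.
have fn : mu A \is a fin_num by rewrite ge0_fin_numE ?measure_ge0 // (le_lt_trans (bP A mA)) // ltry.
by split; [rewrite fineK|exact: fine_ge0 (measure_ge0 mu A)].
Qed.

Lemma degree0_constant (p : mpoly.mpoly n R) : in_Pkn 0 p -> exists l, forall x, peval p x = l.
Proof.
move=> /peval_words[cs cs0 csE]; exists (\sum_(c <- cs) c.1) => x; rewrite csE.
apply: eq_big_seq => c /cs0; rewrite leqn0 size_eq0 => /eqP ->.
by rewrite big_nil mulr1.
Qed.

Lemma uniform_mean_osc : (exists x, V x) -> exists C : R, forall k p, in_Pkn k p -> (exists x, V x /\ peval p x != 0) ->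
  mu.-integrable V (fun x => (ln `|peval p x|)%:E) /\
  forall x (s : R), V x -> 0 < s -> (mean_osc mu (Vball V x s) (fun x => (ln `|peval p x|)%R) <= (C * k%:R)%:E)%E.
Proof.
move=> [x0 Vx0].
have [C1 C12 ball] := uniform_balls cV coV aV mV.
have [s [K [m [K2 m0 sP glob]]]] := global_sublevels cV coV aV mV (ex_intro _ x0 Vx0).
have [bV bVP] := measure_finite.
have C10 : 0 < C1 by lra.
have K0 : 0 < K by lra.
have bV0 : 0 <= bV by have := le_trans (measure_ge0 mu V) (bVP V (measurable_compact cV)); rewrite lee_fin.
(* A radius within the range of [uniform_balls]. A ball beyond that range contains the concentric
   ball of radius [s0], so its measure is at least [s0 ^+ d / C1]. *)
pose s0 := (2 * C1)^-1.
have s00 : 0 < s0 by rewrite invr_gt0 mulr_gt0.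
have s0C : s0 * C1 < 1 by rewrite /s0 invfM mulfVK ?gt_eqF // invf_lt1 //; lra.
(* The summand [bV] takes care of [j = 0], which [global_sublevels] excludes. *)
pose m1 := bV + (size s)%:R * m.
have m10 : 0 <= m1 by rewrite addr_ge0 // mulr_ge0.
pose D1 := 4 * ln C1 * C1 ^+ 2; pose D2 := 4 * ln K * m1 * (C1 / s0 ^+ d).
have lnC : 0 <= ln C1 by rewrite ln_ge0 //; lra.
have lnK : 0 <= ln K by rewrite ln_ge0 //; lra.
have D10 : 0 <= D1 by rewrite /D1; apply: mulr_ge0; [exact: mulr_ge0|exact: exprn_ge0 (ltW C10)].
have D20 : 0 <= D2.
  rewrite /D2; apply: mulr_ge0; first by apply: mulr_ge0 => //; exact: mulr_ge0.
  by apply: divr_ge0; [exact: ltW|exact: exprn_ge0 (ltW s00)].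
have lower x t : V x -> 0 < t -> t * C1 < 1 -> t ^+ d / C1 <= fine (mu (Vball V x t)).
  move=> Vx t0 tC; rewrite ler_pdivrMr // mulrC; apply: (ball x t Vx t0 tC).1.
  rewrite -mu_Vball //; have [h _] := measure_real (measurable_Vball x cV t0); by rewrite -h.
have mq (p : mpoly.mpoly n R) : measurable_fun setT (peval p : Rn R n -> R).
  by have [D pD] := peval_polyf p; exact: measurable_polyf pD.
(* For sets of measure bounded from below, such as large balls and [V] itself, the maximum over all
   of [V] serves as [M], and the sublevel sets are cut along the finite cover of
   [global_sublevels]. *)
have large (B : set (Rn R n)) k p : measurable B -> B `<=` V -> s0 ^+ d / C1 <= fine (mu B) -> (0 < k)%N -> in_Pkn k p ->
    (exists x, V x /\ peval p x != 0) -> mu.-integrable B (fun x => (ln `|peval p x|)%:E) /\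
    (mean_osc mu B (fun x => (ln `|peval p x|)%R) <= (D2 * k%:R)%:E)%E.
  move=> mB BV Bb k0 pk nz; have [muB _] := measure_real mB.
  have lo : 0 < s0 ^+ d / C1 by rewrite divr_gt0 // exprn_gt0.
  have b0 : 0 < fine (mu B) by exact: lt_le_trans Bb.
  have [M [M0 pM dec]] := glob k p k0 pk nz.
  have decay j : (mu (B `&` [set z | (`|peval p z| <= K ^- (k * j) * M)%R]) <= (2 ^- j * m1)%:E)%E.
    have mabs : measurable_fun setT (fun z : Rn R n => `|peval p z|) by exact: measurable_abs.
    have mS : measurable (B `&` [set z : Rn R n | `|peval p z| <= K ^- (k * j) * M]).
      apply: measurableI => //; have := mabs measurableT `]-oo, (K ^- (k * j) * M)]%classic (measurable_itv _); rewrite setTI.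
      by congr measurable; apply/seteqP; split=> z /=; rewrite in_itv.
    case: j mS => [|j] mS.
      apply: le_trans (bVP _ mS) _; rewrite lee_fin expr0 invr1 mul1r lerDl mulr_ge0 //.
    set S := _ `&` _ in mS *.
    pose Ball (c : 'rV[R]_n * R) : set (Rn R n) := S `&` [set z | `|z - c.1| < c.2].
    have mBall c : measurable (Ball c).
      apply: measurableI => //; apply: open_measurable_Rn.
      rewrite (_ : [set z | `|z - c.1| < c.2] = ball_ Num.norm c.1 c.2); last first.
        by apply/seteqP; split=> z /=; rewrite distrC.
      by have := ball_open c.1 c.2; rewrite -ball_normE.
    have sub : S `<=` \bigcup_(i in [set i | (i < size s)%N]) Ball (nth (0, 0) s i).
      move=> z Sz; have Vz : V z by apply: BV; exact: Sz.1.
      have [c cs zc] := sP z Vz; exists (index c s); first by rewrite /= index_mem.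
      by rewrite nth_index.
    apply: le_trans (_ : (mu (\big[setU/set0]_(i < size s) Ball (nth (0, 0)%R s i)) <= _)%E).
      rewrite le_measure ?inE //; first by apply: bigsetU_measurable => i _; exact: mBall.
      by rewrite -(@bigcup_mkord _ (size s) (fun i => Ball (nth (0, 0) s i))).
    have Boole := @Boole_inequality _ _ _ mu (fun i => Ball (nth (0, 0) s i)) (size s) (fun i _ => mBall _).
    apply: (le_trans Boole).
    apply: le_trans (_ : (\sum_(i < size s) (2 ^- j.+1 * m)%:E <= _)%E); last first.
      rewrite sumEFin sumr_const card_ord lee_fin -[leLHS]mulr_natl mulrCA ler_wpM2l ?invr_ge0 ?exprn_ge0 //.
      by rewrite lerDr.
    apply: lee_sum => i _.
    have h : (mu (Ball (nth (0, 0)%R s i)) <= (2 ^- j.+1 * m)%:E)%E.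
      rewrite muE //; apply: (dec (nth (0, 0) s i) _ j.+1 isT); first by rewrite mem_nth.
      by move=> z [[[_ zp] zc] Vz]; split.
    exact: h.
  split; first exact: (integrable_log (K := K) (k := k) mB (mq p) M0 (fun z Bz => pM z (BV z Bz)) K2 k0 muB m10 decay).
  apply: le_trans (mean_osc_le mB (mq p) M0 (fun z Bz => pM z (BV z Bz)) K2 k0 muB b0 m10 decay) _.
  rewrite lee_fin ler_pdivrMr //.
  apply: le_trans (_ : D2 * k%:R * (s0 ^+ d / C1) <= _); last by rewrite ler_wpM2l // mulr_ge0.
  rewrite le_eqVlt; apply/orP; left; apply/eqP; rewrite /D2; field.
  by rewrite expf_neq0 ?gt_eqF.
exists (D1 + D2) => k p pk nz.
have VV : measurable (V : set (Rn R n)) by exact: measurable_compact.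
have Vb : s0 ^+ d / C1 <= fine (mu V).
  apply: le_trans (lower x0 s0 Vx0 s00 s0C) _; have mb := measurable_Vball x0 cV s00.
  rewrite -lee_fin -(measure_real mb).1 -(measure_real VV).1 le_measure ?inE //.
  by move=> z [].
have lo : 0 < s0 ^+ d / C1 by rewrite divr_gt0 // exprn_gt0.
have [k0|k0] := posnP k.
  have [|l lP] := @degree0_constant p; first by rewrite -k0.
  split.
    exact: (mean_osc_cst VV (measure_real VV).1 (lt_le_trans lo Vb) (fun z => congr1 (fun y => ln `|y|) (lP z))).2.
  move=> x t Vx t0; have mb := measurable_Vball x cV t0.
  have [h|h] := ltP (t * C1) 1.
    have b0 : 0 < fine (mu (Vball V x t)) by apply: lt_le_trans (lower x t Vx t0 h); rewrite divr_gt0 // exprn_gt0.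
    rewrite (mean_osc_cst mb (measure_real mb).1 b0 (fun z => congr1 (fun y => ln `|y|) (lP z))).1.
    by rewrite lee_fin mulr_ge0 // addr_ge0.
  have b0 : 0 < fine (mu (Vball V x t)).
    apply: lt_le_trans lo _; apply: le_trans (lower x s0 Vx s00 s0C) _; have mb0 := measurable_Vball x cV s00.
    rewrite -lee_fin -(measure_real mb0).1 -(measure_real mb).1 le_measure ?inE //.
    move=> z [Vz zs]; split=> //; apply: lt_le_trans zs _; apply: ltW.
    by rewrite -(ltr_pM2r C10); exact: lt_le_trans s0C h.
  rewrite (mean_osc_cst mb (measure_real mb).1 b0 (fun z => congr1 (fun y => ln `|y|) (lP z))).1.
  by rewrite lee_fin mulr_ge0 // addr_ge0.
split; first exact: (large V k p VV (fun z h => h) Vb k0 pk nz).1.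
move=> x t Vx t0; have mb := measurable_Vball x cV t0.
have k0' : 0 <= k%:R :> R by [].
have [h|h] := ltP (t * C1) 1; last first.
  have sub : Vball V x t `<=` V by move=> z [].
  have hb : s0 ^+ d / C1 <= fine (mu (Vball V x t)).
    apply: le_trans (lower x s0 Vx s00 s0C) _; have mb0 := measurable_Vball x cV s00.
    rewrite -lee_fin -(measure_real mb0).1 -(measure_real mb).1 le_measure ?inE //.
    move=> z [Vz zs]; split=> //; apply: lt_le_trans zs _; apply: ltW.
    by rewrite -(ltr_pM2r C10); exact: lt_le_trans s0C h.
  have [_ hl] := large (Vball V x t) k p mb sub hb k0 pk nz.
  by apply: le_trans hl _; rewrite lee_fin ler_wpM2r // lerDr.
have [_ bl] := ball x t Vx t0 h.
have [M [M0 pM dec]] := bl k p k0 pk nz.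
have hb := lower x t Vx t0 h.
have tl : 0 < t ^+ d / C1 by rewrite divr_gt0 // exprn_gt0.
have b0 : 0 < fine (mu (Vball V x t)) by exact: lt_le_trans hb.
have mt0 : 0 <= C1 * t ^+ d by rewrite mulr_ge0 ?exprn_ge0 // ltW.
have decay j : (mu (Vball V x t `&` [set z | (`|peval p z| <= C1 ^- (k * j) * M)%R]) <= (2 ^- j * (C1 * t ^+ d))%:E)%E.
  have mabs : measurable_fun setT (fun z : Rn R n => `|peval p z|) by exact: measurable_abs.
  have mS : measurable (Vball V x t `&` [set z : Rn R n | `|peval p z| <= C1 ^- (k * j) * M]).
    apply: measurableI => //; have := mabs measurableT `]-oo, (C1 ^- (k * j) * M)]%classic (measurable_itv _); rewrite setTI.
    by congr measurable; apply/seteqP; split=> z /=; rewrite in_itv.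
  rewrite muE //; apply: dec => z [[zB zp] Vz]; split=> //.
apply: le_trans (mean_osc_le mb (mq p) M0 pM C12 k0 (measure_real mb).1 b0 mt0 decay) _.
rewrite lee_fin ler_pdivrMr //.
apply: le_trans (_ : D1 * k%:R * (t ^+ d / C1) <= _).
  rewrite le_eqVlt; apply/orP; left; apply/eqP; rewrite /D1; field; by rewrite gt_eqF.
apply: ler_pM => //; first exact: mulr_ge0.
  exact: ltW.
by rewrite ler_wpM2r // lerDl.
Qed.

End Main.

Unset Implicit Arguments.

Theorem theorem1p5 (R : realType) (n : nat) (V : set 'rV[R]_n) (d : nat)
    (mu : {measure set (Rn R n) -> \bar R}) :
  compact V -> connected V -> algebraic_set V -> submanifold d V ->
  (* mu is the measure lambda_V induced on V: the d-dimensional Hausdorff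
     measure of R^n restricted to V, on Borel sets *)
  (forall A : set (Rn R n), measurable A -> mu A = hausdorff d (A `&` V)) ->
  exists C : R, forall (k : nat) (p : mpoly.mpoly n R),
    in_Pkn k p -> (exists x, V x /\ peval p x != 0) ->
    mu.-integrable V (fun x => (ln `|peval p x|)%:E) /\
    (bmo_norm V mu (fun x => ln `|peval p x|) <= (C * k%:R)%:E)%E.
Proof.
move=> cV coV aV mV muE.
have [nV|nV] := pselect (exists x, V x); last first.
  by exists 0 => k p _ [x [Vx _]]; case: nV; exists x.
have [C CP] := uniform_mean_osc cV coV aV mV muE nV.
exists C => k p pk nz; have [int osc] := CP k p pk nz; split=> //.
apply: ge_ereal_sup => _ [B [x [s [Vx [s0 ->]]]] <-]; exact: osc.
Qed.
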